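(* Let $n\geq 2$ be an integer, let $\Phi\in\mathbb{S}^{n}$ and let $d$ be the geodesic distance from $\Phi$ on $\mathbb{S}^{n}$. Let $\gamma_{n}:=\frac{n-1}{n}$, and let $U_n,\widetilde U_n,V_n,\widetilde V_n,H_n,Q_n$ be the functionals on $W^{1,n}(\mathbb{S}^{n})$ defined in the context. All suprema below are over real-valued $u\in W^{1,n}(\mathbb{S}^{n})\setminus\{0\}$ for which the denominator of the displayed quotient is nonzero. Then $$\sup_{u}\frac{\gamma_{n}^{n}U_{n}(u)}{Q_{n}(u)+n\gamma_{n}^{n-1}\widetilde{U}_{n}(u)}=1,\qquad \sup_{u}\frac{\gamma_{n}U_{n}(u)-n\widetilde{U}_{n}(u)}{Q_{n}(u)}=\gamma_{n}^{1-n},$$ and $$\sup_{u}\frac{\gamma_{n}^{n}V_{n}(u)}{H_{n}(u)+(n-1)\gamma_{n}^{n-1}\widetilde{V}_{n}(u)}=1,\qquad \sup_{u}\frac{\gamma_{n}V_{n}(u)-(n-1)\widetilde{V}_{n}(u)}{H_{n}(u)}=\gamma_{n}^{1-n},$$ $$\sup_{u}\frac{\gamma_{n}^{n}V_{n}(u)-H_{n}(u)}{\widetilde{V}_{n}(u)}=(n-1)\,\gamma_{n}^{n-1}.$$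
   Context: $\mathbb{S}^{n}$ is the unit sphere in $\mathbb{R}^{n+1}$ with surface measure $\sigma_{n}$ and the Riemannian metric induced from $\mathbb{R}^{n+1}$. For a fixed point $\Phi\in\mathbb{S}^{n}$, the geodesic distance from $\Phi$ is $d(\Theta)=d(\Theta,\Phi):=\arccos(\Theta\cdot\Phi)\in[0,\pi]$, $\Theta\in\mathbb{S}^{n}$. $\nabla_{\mathbb{S}^{n}}$ is the (weak) surface gradient: for $f\in L^1(\mathbb{S}^{n})$ it is the tangential $L^1$ vector field $\Psi_f$, if it exists, with $\int_{\mathbb{S}^{n}}\Psi_f\cdot V\,d\sigma_{n}=-\int_{\mathbb{S}^{n}}f\,\nabla\cdot V\,d\sigma_{n}$ for all smooth tangent vector fields $V$. The Sobolev space is $W^{1,n}(\mathbb{S}^{n}):=\{f\in L^n(\mathbb{S}^{n}): |\Psi_f|\in L^n(\mathbb{S}^{n})\}$, equivalently the completion of $C^\infty(\mathbb{S}^{n})$ in the usual Sobolev norm; functions are real-valued. $\log$ is the natural logarithm and $e$ its base. The functionals are $$U_{n}(u):=\int_{\mathbb{S}^{n}}\frac{|u|^{n}}{\sin^{n}d\left(\log\frac{e}{\sin d}\right)^{n}}\,d\sigma_{n},\qquad \widetilde U_{n}(u):=\int_{\mathbb{S}^{n}}\frac{|u|^{n}}{\sin^{n-2}d\left(\log\frac{e}{\sin d}\right)^{n-1}}\,d\sigma_{n},$$ $$V_{n}(u):=\int_{\mathbb{S}^{n}}\frac{|u|^{n}}{|\tan d|^{n}\left(\log\frac{e}{\sin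 d}\right)^{n}}\,d\sigma_{n},\qquad \widetilde V_{n}(u):=\int_{\mathbb{S}^{n}}\frac{|u|^{n}}{|\tan d|^{n-2}\left(\log\frac{e}{\sin d}\right)^{n-1}}\,d\sigma_{n},$$ $$H_{n}(u):=\int_{\mathbb{S}^{n}}|\nabla_{\mathbb{S}^{n}}u|^{n}\,d\sigma_{n},\qquad Q_{n}(u):=\int_{\mathbb{S}^{n}}|\nabla_{\mathbb{S}^{n}}u|^{n}\,|\cos d|^{n}\,d\sigma_{n},$$ where $1/|\tan d|=|\cos d|/\sin d$. *)

(* Defs.v *)
From HB Require Import structures.
From mathcomp Require Import all_boot all_order all_algebra.
From mathcomp Require Import all_classical all_reals all_analysis.
From mathcomp Require Import measurable_realfun.

Set Implicit Arguments.
Unset Strict Implicit.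
Unset Printing Implicit Defensive.

Import Order.TTheory GRing.Theory Num.Theory.
Import numFieldNormedType.Exports.

Local Open Scope classical_set_scope.
Local Open Scope ring_scope.

Section measurable_rV.
Context {d : measure_display} {T : measurableType d} (n : nat).

Let coors : 'I_n -> 'rV[T]_n -> T := fun i x => x ord0 i.

Let rV_set0 : g_sigma_preimage coors set0.
Proof. exact: sigma_algebra0. Qed.

Let rV_setC A : g_sigma_preimage coors A -> g_sigma_preimage coors (~` A).
Proof. exact: sigma_algebraC. Qed.

Let rV_bigcup (F : _^nat) : (forall i, g_sigma_preimage coors (F i)) ->
  g_sigma_preimage coors (\bigcup_i (F i)).
Proof. exact: sigma_algebra_bigcup. Qed.

HB.instance Definition _ := @isMeasurable.Build (measure_tuple_display d)
  'rV[T]_n (g_sigma_preimage coors) rV_set0 rV_setC rV_bigcup.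

Lemma measurable_coord (i : 'I_n) :
  measurable_fun [set: 'rV[T]_n] (fun x : 'rV[T]_n => x ord0 i).
Proof.
move=> _ Y mY; rewrite setTI; apply: sub_sigma_algebra => /=.
rewrite -bigcup_seq/=; exists i => /=; first by rewrite mem_index_enum.
by exists Y => //; rewrite setTI.
Qed.

Lemma measurable_fun_rV {d' : measure_display} {T' : measurableType d'}
    (f : T' -> 'rV[T]_n) :
  (forall i, measurable_fun [set: T'] (fun t => f t ord0 i)) ->
  measurable_fun [set: T'] f.
Proof.
move=> mf; apply: (@measurability _ _ _ _ setT f
  (\big[setU/set0]_(i < n) preimage_set_system setT (coors i) measurable)) => //.
move=> _ [A + <-]; rewrite -bigcup_seq => -[i _ [B mB <-]].
by rewrite setTI; have := mf i measurableT B mB; rewrite !setTI.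
Qed.

End measurable_rV.


Section image_measure.
Context {d d' : measure_display} {T : measurableType d} {T' : measurableType d'}.
Context {R : realType}.
Variables (mu : {measure set T -> \bar R}) (f : {mfun T >-> T'}).

Definition image_measure : set T' -> \bar R := pushforward mu f.

Let image_measure0 : image_measure set0 = 0%E.
Proof. exact: measure0. Qed.

Let image_measure_ge0 A : (0 <= image_measure A)%E.
Proof. exact: measure_ge0. Qed.

Let image_measure_additive : semi_sigma_additive image_measure.
Proof. exact: measure_semi_sigma_additive. Qed.

HB.instance Definition _ := isMeasure.Build _ _ _ image_measure
  image_measure0 image_measure_ge0 image_measure_additive.

End image_measure.

Section lebesgue_rV.
Context {R : realType}.

Definition cons_rV n (p : measurableTypeR R * 'rV[R]_n) : 'rV[R]_n.+1 :=
  \row_i if unlift ord0 i is Some j then p.2 ord0 j else p.1.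

Lemma cons_rV0 n p : @cons_rV n p ord0 ord0 = p.1.
Proof. by rewrite mxE unlift_none. Qed.

Lemma cons_rVS n p i : @cons_rV n p ord0 (lift ord0 i) = p.2 ord0 i.
Proof. by rewrite mxE liftK. Qed.

Lemma measurable_cons_rV n : measurable_fun setT (@cons_rV n).
Proof.
apply: measurable_fun_rV => i; case: (unliftP ord0 i) => [j|] ->.
  under eq_fun do rewrite cons_rVS.
  by apply: (measurableT_comp (measurable_coord j)); exact: measurable_snd.
by under eq_fun do rewrite cons_rV0; exact: measurable_fst.
Qed.

HB.instance Definition _ n :=
  isMeasurableFun.Build _ _ _ _ (@cons_rV n) (@measurable_cons_rV n).

Definition uncons_rV n (x : 'rV[R]_n.+1) : measurableTypeR R * 'rV[R]_n :=
  (x ord0 ord0, \row_i x ord0 (lift ord0 i)).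

Lemma cons_rVK n : cancel (@cons_rV n) (@uncons_rV n).
Proof.
move=> [a y]; rewrite /uncons_rV cons_rV0; congr pair.
by apply/rowP => i; rewrite mxE cons_rVS.
Qed.

Lemma measurable_uncons_rV n : measurable_fun setT (@uncons_rV n).
Proof.
apply/measurable_fun_pairP; split => /=; first exact: measurable_coord.
apply: measurable_fun_rV => i; under eq_fun do rewrite /= mxE.
exact: measurable_coord.
Qed.

Section cons_measure.
Context n (mu : {sigma_finite_measure set 'rV[R]_n -> \bar R}).

Definition cons_measure : set 'rV[R]_n.+1 -> \bar R :=
  image_measure (@lebesgue_measure R \x mu)%E (@cons_rV n).

HB.instance Definition _ := Measure.on cons_measure.

Let cons_measure_sigma_finite : sigma_finite setT cons_measure.
Proof.
have /sigma_finiteP[F [TF ndF Foo]] := sigma_finiteT (@lebesgue_measure R).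
have /sigma_finiteP[G [TG ndG Goo]] := sigma_finiteT mu.
exists (fun k => @uncons_rV n @^-1` (F k `*` G k)).
  rewrite predeqE => x; split => // _.
  have [k _ Fk] : (\bigcup_k F k) (uncons_rV x).1 by rewrite -TF.
  have [l _ Gl] : (\bigcup_k G k) (uncons_rV x).2 by rewrite -TG.
  exists (maxn k l) => //; split.
    by move: Fk; apply/subsetPset/ndF; rewrite leq_maxl.
  by move: Gl; apply/subsetPset/ndG; rewrite leq_maxr.
move=> k; have [mF Fk] := Foo k; have [mG Gk] := Goo k; split.
  rewrite -[X in measurable X]setTI.
  exact: measurable_uncons_rV (measurableX mF mG).
rewrite /cons_measure /image_measure /pushforward -comp_preimage.
rewrite (_ : _ \o _ = id) ?preimage_id; last exact/funext/cons_rVK.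
by rewrite /= product_measure1E// lte_mul_pinfty// ge0_fin_numE.
Qed.

HB.instance Definition _ := Measure_isSigmaFinite.Build _ _ _ cons_measure
  cons_measure_sigma_finite.

End cons_measure.

Fixpoint lebesgue_rV n : {sigma_finite_measure set 'rV[R]_n -> \bar R} :=
  match n with
  | 0 => \d_(0 : 'rV[R]_0)
  | m.+1 => cons_measure (lebesgue_rV m)
  end.

End lebesgue_rV.

Section sphere.
Context {R : realType}.

Definition dotv m (x y : 'rV[R]_m) : R := \sum_(i < m) x ord0 i * y ord0 i.

(* The norm `|x| provided by the library on 'rV[R]_m is the sup norm. *)
Definition enorm m (x : 'rV[R]_m) : R := Num.sqrt (dotv x x).

Definition sphere n : set 'rV[R]_n.+1 := [set x | enorm x = 1].

Arguments sphere n : clear implicits.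

Definition unit_dir m (x : 'rV[R]_m) : 'rV[R]_m := (enorm x)^-1 *: x.

Definition punctured_ball m : set 'rV[R]_m := [set x | 0 < enorm x <= 1].
Arguments punctured_ball m : clear implicits.

Lemma measurable_enorm m : measurable_fun setT (@enorm m).
Proof.
rewrite (_ : @enorm m = (fun r => r `^ 2^-1) \o (fun x => dotv x x)); last first.
  apply/funext => x; rewrite /= powR12_sqrt// sumr_ge0// => i _.
  by rewrite -expr2 sqr_ge0.
apply: measurableT_comp; first exact: measurable_powR.
apply: measurable_sum => i.
by apply: measurable_funM; exact: measurable_coord.
Qed.

Lemma measurable_unit_dir m : measurable_fun setT (@unit_dir m).
Proof.
apply: measurable_fun_rV => i; under eq_fun do rewrite mxE.
apply: measurable_funM; last exact: measurable_coord.
rewrite (_ : (fun _ => _) = (fun r => r `^ (-1)) \o @enorm m); last first.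
  by apply/funext => x; rewrite /= powR_inv1// sqrtr_ge0.
apply: measurableT_comp; [exact: measurable_powR|exact: measurable_enorm].
Qed.

HB.instance Definition _ m :=
  isMeasurableFun.Build _ _ _ _ (@unit_dir m) (@measurable_unit_dir m).

Lemma measurable_punctured_ball m : measurable (punctured_ball m).
Proof.
rewrite (_ : punctured_ball m = @enorm m @^-1` `]0, 1]).
  by rewrite -[X in measurable X]setTI; exact: measurable_enorm.
by apply/seteqP; split=> x; rewrite /= in_itv.
Qed.

(* Surface measure as the cone measure: n + 1 times the (n + 1)-dimensional
   volume of the cone over A with apex 0. It is concentrated on sphere n. *)
Definition surface_measure n (A : set 'rV[R]_n.+1) : \bar R :=
  ((n.+1)%:R%:E * lebesgue_rV n.+1 (@unit_dir n.+1 @^-1` A `&` punctured_ball n.+1))%E.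

Arguments surface_measure n A : clear implicits.

Section surface_measure_measure.
Variable n : nat.

Let surface_measureE : surface_measure n =
  mscale (n.+1)%:R%:nng
    (image_measure (mrestr (lebesgue_rV n.+1) (@measurable_punctured_ball n.+1))
       (@unit_dir n.+1)).
Proof. by []. Qed.

Let surface_measure0 : surface_measure n set0 = 0%E.
Proof. by rewrite surface_measureE; exact: measure0. Qed.

Let surface_measure_ge0 A : (0 <= surface_measure n A)%E.
Proof. by rewrite surface_measureE; exact: measure_ge0. Qed.

Let surface_measure_additive : semi_sigma_additive (surface_measure n).
Proof. by rewrite surface_measureE; exact: measure_semi_sigma_additive. Qed.

HB.instance Definition _ := isMeasure.Build _ _ _ (surface_measure n)
  surface_measure0 surface_measure_ge0 surface_measure_additive.

End surface_measure_measure.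

Definition geodist n (Phi x : 'rV[R]_n.+1) : R := acos (dotv x Phi).

Definition partial m (i : 'I_m) (f : 'rV[R]_m -> R) : 'rV[R]_m -> R :=
  fun x => 'D_(delta_mx ord0 i) f x.

(* All iterated partial derivatives exist and are continuous. *)
Definition smooth m (f : 'rV[R]_m -> R) : Prop :=
  forall s : seq 'I_m, let g := foldr (@partial m) f s in
    continuous g /\ forall i x, derivable g x (delta_mx ord0 i).

(* Functions and vector fields on the sphere are represented by functions on
   the ambient space, of which only the values on the sphere matter. A smooth
   tangent field on the sphere always extends to a smooth ambient field. *)
Definition smooth_tangent_field n (V : 'rV[R]_n.+1 -> 'rV[R]_n.+1) : Prop :=
  (forall i, smooth (fun x => V x ord0 i)) /\
  (forall x, sphere n x -> dotv (V x) x = 0).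

(* Riemannian divergence of a tangent field at a point x of the sphere: the
   trace of P_x DV(x), where P_x = 1 - x^T x is the tangential projection; it
   does not depend on the extension of V off the sphere. *)
Definition surface_div n (V : 'rV[R]_n.+1 -> 'rV[R]_n.+1) (x : 'rV[R]_n.+1) : R :=
  \sum_(i < n.+1) partial i (fun y => V y ord0 i) x
  - \sum_(i < n.+1) \sum_(j < n.+1)
      x ord0 i * x ord0 j * partial j (fun y => V y ord0 i) x.

Definition weak_surface_gradient n (u : 'rV[R]_n.+1 -> R)
    (Psi : 'rV[R]_n.+1 -> 'rV[R]_n.+1) : Prop :=
  [/\ forall x, sphere n x -> dotv (Psi x) x = 0,
      forall i, (fun x => Psi x ord0 i) \in Lfun (surface_measure n) 1%:E &
      forall V, smooth_tangent_field V ->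
        \int[surface_measure n]_(x in sphere n) dotv (Psi x) (V x) =
        - \int[surface_measure n]_(x in sphere n) (u x * surface_div V x)].

(* The weak gradient, unique almost everywhere, when it exists. *)
Definition surface_grad n (u : 'rV[R]_n.+1 -> R) : 'rV[R]_n.+1 -> 'rV[R]_n.+1 :=
  xget (fun=> 0) [set Psi | weak_surface_gradient u Psi].

(* Functions in Lfun are Borel measurable on the ambient space; every class in
   L^n(S^n) has such a representative. *)
Definition sobolev n (u : 'rV[R]_n.+1 -> R) : Prop :=
  u \in Lfun (surface_measure n) n%:R%:E /\
  exists2 Psi, weak_surface_gradient u Psi &
    (fun x => enorm (Psi x)) \in Lfun (surface_measure n) n%:R%:E.

Section functionals.
Variables (n : nat) (Phi : 'rV[R]_n.+1).
Implicit Type u : 'rV[R]_n.+1 -> R.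

Let d := geodist Phi.
Let L x := ln (expR 1 / sin (d x)).
(* 1 / |tan d| *)
Let cotd x := `|cos (d x)| / sin (d x).

(* The functionals are [0, +oo]-valued integrals, so that their finiteness is
   not presupposed. At the null set where sin (d x) = 0 the integrands take
   irrelevant values, as division by 0 yields 0. *)
Definition functional_U u : \bar R :=
  \int[surface_measure n]_(x in sphere n)
    (`|u x| ^+ n / (sin (d x) ^+ n * L x ^+ n))%:E.

Definition functional_Utilde u : \bar R :=
  \int[surface_measure n]_(x in sphere n)
    (`|u x| ^+ n / (sin (d x) ^+ (n - 2) * L x ^+ (n - 1)))%:E.

Definition functional_V u : \bar R :=
  \int[surface_measure n]_(x in sphere n)
    (`|u x| ^+ n * cotd x ^+ n / L x ^+ n)%:E.

Definition functional_Vtilde u : \bar R :=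
  \int[surface_measure n]_(x in sphere n)
    (`|u x| ^+ n * cotd x ^+ (n - 2) / L x ^+ (n - 1))%:E.

Definition functional_H u : \bar R :=
  \int[surface_measure n]_(x in sphere n) (enorm (surface_grad u x) ^+ n)%:E.

Definition functional_Q u : \bar R :=
  \int[surface_measure n]_(x in sphere n)
    (enorm (surface_grad u x) ^+ n * `|cos (d x)| ^+ n)%:E.

End functionals.

(* u is nonzero as an element of W^{1,n}, i.e., modulo null sets. *)
Definition sup_quotient n (N D : ('rV[R]_n.+1 -> R) -> \bar R) : \bar R :=
  ereal_sup [set (N u / D u)%E | u in
    [set u | [/\ sobolev u,
                 ~ {ae surface_measure n, forall x, u x = 0} & D u != 0%E]]].

Definition gamma n : R := (n%:R - 1) / n%:R.

End sphere.

Arguments sphere {R} n _.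
Arguments punctured_ball {R} m _.
Arguments surface_measure {R} n A.
Arguments functional_H {R n} u.

(* Main.v *)
Require Import Defs.
From mathcomp Require Import all_boot all_order all_algebra.
From mathcomp Require Import all_classical all_reals all_analysis.
From mathcomp Require Import measurable_realfun ring lra.
From HB Require Import structures.

Set Implicit Arguments.
Unset Strict Implicit.
Unset Printing Implicit Defensive.
Import Order.TTheory GRing.Theory Num.Theory.
Import numFieldNormedType.Exports.
Local Open Scope classical_set_scope.
Local Open Scope ring_scope.

(* Write t = Theta . Phi = cos d, s = sin d, L = log(e/s), g = (n-1)/n.

   Upper bounds. Let X be the gradient of t^2/2, i.e. t times the meridian field,
   and let w = |t|^k s^p / (s^2 L)^(n-1) with p = n-2 and k = 0 or k = p. Then
   -div(w X) dominates (n-1) times the weight of U_n (resp. V_n) minus n (resp.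
   n-1) times the weight of the corresponding U~_n (resp. V~_n), so integrating
   |u|^n div(w X) by parts and applying Young's inequality to
   n |u|^(n-1) |grad u| w |X| gives
     g U <= n U~ + g^(1-n) Q   and   g V <= (n-1) V~ + g^(1-n) H.
   The chain rule for |u|^n with u only weakly differentiable is avoided by
   replacing the derivative along X by difference quotients along the explicit
   flow of X: the weak gradient controls the increment of u along almost every
   orbit (by Fubini and the uniqueness of weak densities), and Fatou's lemma
   recovers the derivative of the (regularised) weight.

   Sharpness. Take u = L^b with 0 < b < g, and b -> g. The divergence theorem for
   radial fields |t|^k t s^(-n) chi(L) grad t gives U~ <= n (g - b) U,
   (n-1) V~ <= n (g - b) V and the finiteness of U, whereas H = b^n V and
   Q <= b^n U; so every quotient at u is at least an explicit function of b that
   tends to the stated value. *)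

(** * Lebesgue measure on row vectors and surface measure *)

(** The gradient of t^2/2 is preferred to that of t because it vanishes on the equator and points
    towards the nearer pole: one field serves both singularities, and its length |t| s supplies the
    factors |t| of V_n and Q_n. Its flow multiplies a ratio of coordinates by a constant, so that
    flow and Jacobian are explicit functions of t.

    The obstacle is that neither the finiteness of U_n(u) and V_n(u) nor the integrability of the
    unregularised weight against |u|^n is known beforehand, so integrals cannot be subtracted
    freely. With a constant delta > 0 added to s^2 L everything is finite; delta tends to 0 only in
    the final inequality, where all terms are nonnegative.

    The constant comes from Young's inequality with parameter 1/g: it returns (n-1) g of the n-1
    copies of the main term, and (n-1)(1-g) = g remain.

    For u = L^b put c = n (g - b). The integrand of U_n is then s^(-n) L^(-c-1), whose integral
    grows like 1/c, whereas the additional factor s^2 L in U~_n keeps that integral bounded. This is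
    why the ratios of U~_n to U_n and of V~_n to V_n are of order c. *)

Section rV_borel.
Context {R : realType}.

Lemma measurable_forall_coord m (A : 'I_m -> set R) :
  (forall j, measurable (A j)) ->
  measurable [set y : 'rV[R]_m | forall j, A j (y ord0 j)].
Proof.
move=> mA.
rewrite (_ : mkset _ =
    \bigcap_(j in [set: 'I_m]) [set y : 'rV[R]_m | A j (y ord0 j)]).
  apply: fin_bigcap_measurable => // j _.
  by have := @measurable_coord _ R m j measurableT _ (mA j); rewrite setTI.
by apply/seteqP; split => [y Ay j _|y Ay j]; exact: Ay.
Qed.

(** The measurable sets are generated by the coordinates, not by the topology. An open set is
    recovered as the countable union of those boxes with rational centre and radius 1/(k+1) that it
    contains. *)
Lemma open_measurable_rV m (U : set 'rV[R]_m) : open U -> measurable U.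
Proof.
move=> oU.
pose B (q : 'rV[rat]_m) (k : nat) : set 'rV[R]_m :=
  [set y | forall j, ball (ratr (q ord0 j) : R) k.+1%:R^-1 (y ord0 j)].
have mB q k : measurable (B q k).
  by apply: (measurable_forall_coord (A := fun j => ball (ratr (q ord0 j) : R) k.+1%:R^-1)) => j; exact: measurable_ball.
pose F (i : 'rV[rat]_m * nat) := if pselect (B i.1 i.2 `<=` U) then B i.1 i.2
   else set0.
have -> : U = \bigcup_i F i.
  apply/seteqP; split => [x Ux|x [[q k]] _]; last first.
    by rewrite /F; case: pselect => // BU; exact: BU.
  have /nbhs_ballP[e /= e0 xeU] := oU _ Ux.
  (* A box of radius less than e/2 containing x lies in the ball of radius e around x. *)
  have [k ke] : exists k : nat, (k.+1%:R^-1 : R) < e / 2.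
    have e20 : 0 < e / 2 by rewrite divr_gt0.
    exists (Num.bound (e / 2)^-1).
    rewrite invf_plt ?posrE//; apply: lt_le_trans (archi_boundP _) _.
      by rewrite invr_ge0 ltW.
    by rewrite ler_nat.
  have qP j : exists q : rat, `|ratr q - x ord0 j| < k.+1%:R^-1.
    have [|q] := @rat_in_itvoo R (x ord0 j - k.+1%:R^-1) (x ord0 j + k.+1%:R^-1).
      by rewrite ltrD2l (@lt_trans _ _ 0)// ?oppr_lt0 invr_gt0.
    rewrite in_itv/= => /andP[q1 q2]; exists q.
    by rewrite ltr_distl q1 q2.
  pose q := \row_j projT1 (cid (qP j)).
  have qx j : `|ratr (q ord0 j) - x ord0 j| < k.+1%:R^-1.
    by rewrite mxE; case: cid.
  exists (q, k) => //; rewrite /F /=; case: pselect => [_ j /=|].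
    exact: qx.
  case=> y By; apply: xeU; split => // i j; rewrite !(ord1 i).
  rewrite /ball/= -(subrK (ratr (q ord0 j)) (x ord0 j)) -addrA.
  apply: le_lt_trans (ler_normD _ _) _; rewrite (splitr e) ltrD//.
    by rewrite distrC (lt_trans (qx j)).
  by apply: lt_trans ke; exact: By.
apply: countable_bigcupT_measurable => [|i]; first exact: countableP.
by rewrite /F; case: ifP.
Qed.

Lemma measurable_fun_open_rV m (O : set 'rV[R]_m) (f : 'rV[R]_m -> R) :
  open O -> (forall x, O x -> {for x, continuous f}) -> measurable_fun O f.
Proof.
move=> oO cf; apply: (measurability _ (RGenOpens.measurableE R)).
move=> _ [_ [a [b ->]] <-]; apply: open_measurable_rV.
rewrite openE => x [Ox fx]; apply: filterI; first by apply: open_nbhs_nbhs.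
by apply: (cf _ Ox); apply: open_nbhs_nbhs; split => //; exact: interval_open.
Qed.

Lemma continuous_measurable_rV m (f : 'rV[R]_m -> R) :
  continuous f -> measurable_fun setT f.
Proof. by move=> cf; apply: measurable_fun_open_rV => [|x _]; [exact: openT|exact: cf]. Qed.

End rV_borel.

Section lebesgue_rV_box.
Context {R : realType}.

Lemma lebesgue_rV_box m (A : set R) (r : R) : measurable A ->
  lebesgue_measure A = r%:E ->
  lebesgue_rV m [set y : 'rV[R]_m | forall j, A (y ord0 j)] = (r ^+ m)%:E.
Proof.
move=> mA Ar; elim: m => [|m IH] /=.
  rewrite expr0 diracE mem_set//= => -[//].
rewrite /cons_measure /image_measure /pushforward /=.
rewrite (_ : _ @^-1` _ = A `*` [set y : 'rV[R]_m | forall j, A (y ord0 j)]).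
  rewrite product_measure1E//; last exact: (measurable_forall_coord (A := fun=> A)).
  by rewrite [X in (X * _)%E]Ar IH -EFinM exprS.
apply/seteqP; split => [[a y] /= H|[a y] /= [Aa Ay] j].
  split; first by have := H ord0; rewrite cons_rV0.
  by move=> j; have := H (lift ord0 j); rewrite cons_rVS.
by case: (unliftP ord0 j) => [k|] ->; rewrite ?cons_rVS ?cons_rV0.
Qed.

End lebesgue_rV_box.

Lemma ge0_integral_mrestr d (T : measurableType d) (R : realType)
    (mu : {measure set T -> \bar R}) (D E : set T) (mD : measurable D)
    (f : T -> \bar R) :
  measurable E -> measurable_fun E f -> (forall x, E x -> 0 <= f x)%E ->
  (\int[mrestr mu mD]_(x in E) f x = \int[mu]_(x in E `&` D) f x)%E.
Proof.
move=> mE mf f0.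
rewrite [LHS](ge0_negligible_integral (measurableC mD))//=; last first.
  by rewrite /mrestr setICl measure0.
rewrite setDE setCK.
apply: eq_measure_integral => A mA AD; rewrite /= /mrestr setIidl//.
by apply: subset_trans AD _; exact: subIsetr.
Qed.

Section sphere_basics.
Context {R : realType}.
Implicit Types n m : nat.

Lemma dotvC m (x y : 'rV[R]_m) : dotv x y = dotv y x.
Proof. by apply: eq_bigr => i _; rewrite mulrC. Qed.

Lemma dotvDl m (x y z : 'rV[R]_m) : dotv (x + y) z = dotv x z + dotv y z.
Proof. by rewrite -big_split; apply: eq_bigr => i _; rewrite mxE mulrDl. Qed.

Lemma dotvZl m a (x y : 'rV[R]_m) : dotv (a *: x) y = a * dotv x y.
Proof. by rewrite /dotv mulr_sumr; apply: eq_bigr => i _; rewrite mxE mulrA. Qed.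

Lemma dotvDr m (x y z : 'rV[R]_m) : dotv x (y + z) = dotv x y + dotv x z.
Proof. by rewrite dotvC dotvDl !(dotvC x). Qed.

Lemma dotvZr m a (x y : 'rV[R]_m) : dotv x (a *: y) = a * dotv x y.
Proof. by rewrite dotvC dotvZl dotvC. Qed.

Lemma dotvNr m (x y : 'rV[R]_m) : dotv x (- y) = - dotv x y.
Proof. by rewrite -scaleN1r dotvZr mulN1r. Qed.

Lemma dotvNl m (x y : 'rV[R]_m) : dotv (- x) y = - dotv x y.
Proof. by rewrite dotvC dotvNr dotvC. Qed.

Lemma dotv_ge0 m (x : 'rV[R]_m) : 0 <= dotv x x.
Proof. by apply: sumr_ge0 => i _; rewrite -expr2 sqr_ge0. Qed.

Lemma enorm_ge0 m (x : 'rV[R]_m) : 0 <= enorm x.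
Proof. exact: sqrtr_ge0. Qed.

Lemma enorm_sqr m (x : 'rV[R]_m) : enorm x ^+ 2 = dotv x x.
Proof. by rewrite sqr_sqrtr// dotv_ge0. Qed.

Lemma enormZ m a (x : 'rV[R]_m) : enorm (a *: x) = `|a| * enorm x.
Proof.
by rewrite /enorm dotvZl dotvZr mulrA -expr2 sqrtrM ?sqr_ge0// sqrtr_sqr.
Qed.

Lemma coord_le_enorm m (x : 'rV[R]_m) i : `|x ord0 i| <= enorm x.
Proof.
rewrite -sqrtr_sqr ler_sqrt ?dotv_ge0// /dotv (bigD1 i)//= -expr2 lerDl.
by apply: sumr_ge0 => j _; rewrite -expr2 sqr_ge0.
Qed.

Lemma enorm_eq0 m (x : 'rV[R]_m) : (enorm x == 0) = (x == 0).
Proof.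
apply/eqP/eqP => [x0|->]; last first.
  by rewrite /enorm /dotv big1 ?sqrtr0// => i _; rewrite mxE mul0r.
apply/rowP => i; rewrite mxE; apply/eqP; rewrite -normr_le0.
by rewrite -x0 coord_le_enorm.
Qed.

Lemma enorm_gt0 m (x : 'rV[R]_m) : (0 < enorm x) = (x != 0).
Proof. by rewrite lt_def enorm_ge0 andbT enorm_eq0. Qed.

Lemma dotv_cauchy m (x y : 'rV[R]_m) : `|dotv x y| <= enorm x * enorm y.
Proof.
have [->|y0] := eqVneq y 0.
  rewrite (_ : dotv x 0 = 0) ?normr0 ?mulr_ge0 ?enorm_ge0//.
  by rewrite /dotv big1// => i _; rewrite mxE mulr0.
rewrite -ler_sqr ?nnegrE ?mulr_ge0 ?enorm_ge0// exprMn real_normK ?num_real//.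
rewrite !enorm_sqr.
have yy0 : 0 < dotv y y by rewrite -enorm_sqr exprn_gt0// enorm_gt0.
have := dotv_ge0 (x - (dotv x y / dotv y y) *: y).
rewrite dotvDl !dotvDr !dotvNl !dotvNr !dotvZl !dotvZr (dotvC y x).
rewrite divfK ?gt_eqF// opprK addNr addr0 subr_ge0 mulrAC -expr2.
by rewrite ler_pdivrMr.
Qed.

Lemma sphereE n (x : 'rV[R]_n.+1) : sphere n x <-> dotv x x = 1.
Proof.
split => [|xx]; first by rewrite /sphere/= -enorm_sqr => ->; rewrite expr1n.
by rewrite /sphere/= /enorm xx sqrtr1.
Qed.

Lemma unit_dir_sphere n (x : 'rV[R]_n.+1) : x != 0 -> sphere n (unit_dir x).
Proof.
rewrite -enorm_gt0 => x0.
rewrite /sphere/= /unit_dir enormZ ger0_norm ?invr_ge0 ?enorm_ge0// mulVf//.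
by rewrite gt_eqF.
Qed.

Lemma unit_dir_id n (x : 'rV[R]_n.+1) : sphere n x -> unit_dir x = x.
Proof. by rewrite /sphere/= /unit_dir => ->; rewrite invr1 scale1r. Qed.

Lemma sphere_neq0 n (x : 'rV[R]_n.+1) : sphere n x -> x != 0.
Proof. by rewrite /sphere/= -enorm_gt0 => ->. Qed.

Lemma measurable_sphere n : measurable (sphere (R := R) n).
Proof.
rewrite -[X in measurable X]setTI; apply: (@measurable_enorm R n.+1 measurableT [set 1]).
exact: measurable_set1.
Qed.

Lemma lebesgue_punctured_ball_lty m :
  (lebesgue_rV m (punctured_ball (R := R) m) < +oo)%E.
Proof.
apply: (@le_lt_trans _ _ (lebesgue_rV m
    [set y : 'rV[R]_m | forall j, `[-1, 1]%classic (y ord0 j)])).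
  apply: le_measure; rewrite ?inE.
  - exact: measurable_punctured_ball.
  - exact: (measurable_forall_coord (A := fun=> `[-1, 1]%classic)).
  - move=> x /andP[_ x1] j /=.
    by rewrite in_itv/= -ler_norml (le_trans (coord_le_enorm _ _)).
rewrite (@lebesgue_rV_box _ _ _ 2) ?ltry// lebesgue_measure_itv/= lte_fin.
by rewrite ifT -?EFinD ?opprK// (@lt_trans _ _ 0) ?ltrN10.
Qed.

Lemma lebesgue_punctured_ball_gt0 n :
  (0 < lebesgue_rV n.+1 (punctured_ball (R := R) n.+1))%E.
Proof.
(* With this side the cube of all x with coordinates in ]0, c] lies in the ball: each squared
   coordinate is at most c, and there are n + 1 of them. *)
pose c : R := n.+1%:R^-1.
have c0 : 0 < c by rewrite invr_gt0.
apply: (@lt_le_trans _ _ (lebesgue_rV n.+1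
    [set y : 'rV[R]_n.+1 | forall j, `]0, c]%classic (y ord0 j)])).
  rewrite (@lebesgue_rV_box _ _ _ c) ?lte_fin ?exprn_gt0//.
  by rewrite lebesgue_measure_itv/= lte_fin c0 oppr0 adde0.
apply: le_measure; rewrite ?inE.
- exact: (measurable_forall_coord (A := fun=> `]0, c]%classic)).
- exact: measurable_punctured_ball.
- move=> x xc; apply/andP; split.
    rewrite enorm_gt0; apply/eqP => x0.
    by have := xc ord0; rewrite /= x0 mxE in_itv/= ltxx.
  rewrite -(@ler_sqr _ (enorm x)) ?nnegrE ?enorm_ge0// enorm_sqr expr1n.
  apply: (@le_trans _ _ (\sum_(i < n.+1) c)); last first.
    by rewrite sumr_const card_ord -[leLHS]mulr_natr mulVf.
  apply: ler_sum => i _; have := xc i; rewrite /= in_itv/= => /andP[x0 x1].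
  apply: le_trans x1; rewrite ger_pMr//.
  apply: (@le_trans _ _ c); last by rewrite invf_le1// ler1n.
  by have := xc i; rewrite /= in_itv/= => /andP[].
Qed.

Lemma punctured_ball_unit_dir n : (@unit_dir R n.+1) @^-1` sphere n `&`
  punctured_ball n.+1 = punctured_ball n.+1.
Proof.
apply/seteqP; split => [x []//|x /[dup] x1 /andP[x0 _]]; split => //=.
by apply: unit_dir_sphere; rewrite -enorm_gt0.
Qed.

Lemma surface_measure_sphere n : surface_measure n (sphere (R := R) n) =
  (n.+1%:R%:E * lebesgue_rV n.+1 (punctured_ball n.+1))%E.
Proof. by rewrite /surface_measure punctured_ball_unit_dir. Qed.

Lemma surface_measure_sphere_lty n :
  (surface_measure n (sphere (R := R) n) < +oo)%E.
Proof.
rewrite surface_measure_sphere lte_mul_pinfty ?lee_fin//.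
exact: lebesgue_punctured_ball_lty.
Qed.

Lemma surface_measure_sphere_gt0 n :
  (0 < surface_measure n (sphere (R := R) n))%E.
Proof.
by rewrite surface_measure_sphere mule_gt0 ?lte_fin// lebesgue_punctured_ball_gt0.
Qed.

Lemma surface_measure_setC_sphere n :
  surface_measure n (~` sphere (R := R) n) = 0%E.
Proof.
rewrite /surface_measure (_ : _ `&` _ = set0) ?measure0 ?mule0//.
apply/seteqP; split => // x [xs /andP[x0 _]]; apply: xs.
by apply: unit_dir_sphere; rewrite -enorm_gt0.
Qed.

(** The definition as a cone measure is a scaled image of a restricted Lebesgue measure; undoing the
    three operations turns a surface integral into the integral over the ball of the extension of f
    constant along rays. *)
Lemma ge0_surface_integral n (f : 'rV[R]_n.+1 -> \bar R) :
  measurable_fun (sphere n) f -> (forall x, sphere n x -> 0 <= f x)%E ->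
  (\int[surface_measure n]_(x in sphere n) f x =
   n.+1%:R%:E * \int[lebesgue_rV n.+1]_(x in punctured_ball n.+1) f (unit_dir x))%E.
Proof.
move=> mf f0.
pose mpb := @measurable_punctured_ball R n.+1.
pose nu := mrestr (lebesgue_rV n.+1) mpb.
transitivity (\int[mscale ((n.+1)%:R : R)%:nng%R
    (image_measure nu (@unit_dir R n.+1))]_(x in sphere n) f x)%E.
  by apply: eq_measure_integral.
rewrite (@ge0_integral_mscale _ _ _ (image_measure nu (@unit_dir R n.+1)) _
  (@measurable_sphere n) _ _ mf f0).
congr (_ * _)%E.
have mS : measurable (@unit_dir R n.+1 @^-1` sphere n).
  rewrite -[X in measurable X]setTI; apply: measurable_unit_dir => //.
  exact: (@measurable_sphere n).
have mfu : measurable_fun (@unit_dir R n.+1 @^-1` sphere n) (f \o @unit_dir R n.+1).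
  apply: (measurable_comp (F := sphere n)).
  - exact: (@measurable_sphere n).
  - by move=> _ [x + <-].
  - exact: mf.
  - by apply: measurable_funTS; exact: measurable_unit_dir.
have f0' : {in sphere n, forall x, 0 <= f x}%E.
  by move=> x /[!inE]; exact: f0.
transitivity (\int[nu]_(x in @unit_dir R n.+1 @^-1` sphere n) f (unit_dir x))%E.
  etransitivity; last exact: (ge0_integral_pushforward
    (@measurable_unit_dir R n.+1) nu (@measurable_sphere n) mf f0').
  exact: eq_measure_integral.
have f0u x : (@unit_dir R n.+1 @^-1` sphere n) x -> (0 <= f (unit_dir x))%E.
  exact: f0.
by rewrite (ge0_integral_mrestr _ _ mS mfu f0u) punctured_ball_unit_dir.
Qed.

End sphere_basics.

(** * The divergence theorem on the sphere *)

Section derive_facts.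
Context {R : realType}.

Lemma is_derive_line (V W : normedModType R) (f : V -> W) (y v : V) (s : R) (d : W) :
  is_derive (s *: v + y) v f d -> is_derive s (1 : R) (fun r => f (r *: v + y)) d.
Proof.
have E : (fun h : R => h^-1 *: (((fun r => f (r *: v + y)) \o shift s) (h *: (1 : R)) -
    f (s *: v + y))) =
  (fun h => h^-1 *: ((f \o shift (s *: v + y)) (h *: v) - f (s *: v + y))).
  apply/funext => h /=; congr (_ *: (f _ - _)).
  by rewrite -[h *: 1]/(h * 1) mulr1 scalerDl addrA.
by case=> dv dd; split; rewrite /derivable /derive E.
Qed.

Lemma cvg_sumr (T I : Type) {F : set_system T} {FF : Filter F} (r : seq I)
    (P : pred I) (f : I -> T -> R) (l : I -> R) :
  (forall i, P i -> f i x @[x --> F] --> l i) ->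
  \sum_(i <- r | P i) f i x @[x --> F] --> \sum_(i <- r | P i) l i.
Proof.
move=> fl; elim: r => [|i r IH].
  under eq_fun do rewrite big_nil.
  by rewrite big_nil; exact: cvg_cst.
under eq_fun do rewrite big_cons.
rewrite big_cons; case: ifPn => // Pi.
by apply: cvgD => //; exact: fl.
Qed.

Lemma is_diff_intro (V W : normedModType R) (f : V -> W) (df : {linear V -> W}) (x : V) :
  continuous df ->
  (forall e, 0 < e -> \forall h \near (0 : V), `|f (h + x) - (f x + df h)| <= e * `|h|) ->
  is_diff x f df.
Proof.
move=> cdf dfx.
have dxf : f \o shift x = cst (f x) + df +o_ 0 id.
  by apply/eqaddoP => e e0; have := dfx e e0.
have dfE := diff_unique cdf dxf.
by split => //; apply/diff_locallyP; rewrite dfE.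
Qed.

Lemma increment_le (f df : R -> R) (b c e : R) :
  (forall s : R, is_derive s (1 : R) f (df s)) ->
  (forall s, `|s| <= `|b| -> `|df s - c| <= e) ->
  `|f b - f 0 - b * c| <= e * `|b|.
Proof.
move=> dfE dfc.
have cf a a' : {within `[a, a'], continuous f}.
  apply: derivable_within_continuous => s _; exact: ex_derive.
have [b0|b0] := leP 0 b.
  have [s] := MVT_segment b0 (fun s _ => dfE s) (cf 0 b).
  rewrite in_itv/= => /andP[s0 sb] ->; rewrite subr0 (mulrC b) -mulrBl normrM.
  by rewrite ler_wpM2r// dfc// !ger0_norm.
have [s] := MVT_segment (ltW b0) (fun s _ => dfE s) (cf b 0).
rewrite in_itv/= => /andP[s0 sb] fE.
have -> : f b - f 0 - b * c = b * (df s - c).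
  by rewrite -(opprB (f 0)) fE; ring.
rewrite normrM mulrC.
by rewrite ler_wpM2r// dfc// !ler0_norm ?lerN2// ltW.
Qed.

End derive_facts.

(** * Differentiability of functions with continuous partial derivatives *)

Section partial_derivatives.
Context {R : realType}.
Implicit Types m : nat.

Lemma coord_le_norm m (v : 'rV[R]_m) i : `|v ord0 i| <= `|v|.
Proof.
by rewrite [leRHS]/Num.Def.normr/= mx_normrE; apply: (le_bigmax _ _ (ord0, i)).
Qed.

Lemma norm_le_coord m (v : 'rV[R]_m) c : 0 <= c ->
  (forall i, `|v ord0 i| <= c) -> `|v| <= c.
Proof.
move=> c0 vc; rewrite [leLHS]/Num.Def.normr/= mx_normrE (bigmax_le _ c0)// => -[i j] _.
by rewrite (ord1 i).
Qed.

Lemma continuous_coord m (i : 'I_m) : continuous (fun x : 'rV[R]_m => x ord0 i).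
Proof. by move=> x; exact: coord_continuous. Qed.

Lemma delta_mx_coord m (i j : 'I_m) : (delta_mx ord0 i : 'rV[R]_m) ord0 j = (j == i)%:R.
Proof. by rewrite mxE eqxx. Qed.

Lemma partial_linear m (c : 'I_m -> R) :
  linear (fun h : 'rV[R]_m => \sum_i h ord0 i * c i).
Proof.
move=> a u v; rewrite scaler_sumr -big_split; apply: eq_bigr => i _.
by rewrite /= !mxE mulrDl -[a *: _]/(a * _) mulrA.
Qed.

(** The increment h is reached by switching on its coordinates one at a time ([hk]); each of the m
    increments lies along a coordinate axis and is estimated by the mean value theorem. *)
Lemma differentiable_continuous_partial m (f : 'rV[R]_m -> R) (x : 'rV[R]_m) :
  (forall i y, derivable f y (delta_mx ord0 i)) ->
  (forall i, {for x, continuous (partial i f)}) -> differentiable f x.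
Proof.
move=> df cf.
pose lin := GRing.isLinear.Build R 'rV[R]_m R _ _ (partial_linear (fun i => partial i f x)).
pose L : {linear 'rV[R]_m -> R} := HB.pack (fun h : 'rV[R]_m => \sum_i h ord0 i * partial i f x) lin.
suff : is_diff x f L by case.
apply: is_diff_intro.
  move=> z; apply: (@cvg_sumr _ _ _ (nbhs z) _ _ xpredT
    (fun i (h : 'rV[R]_m) => h ord0 i * partial i f x)
    (fun i => z ord0 i * partial i f x)) => i _.
  by apply: cvgMr_tmp; exact: continuous_coord.
move=> e e0.
(* There are m increments, each with error e' |h|; dividing by m + 1 also covers m = 0. *)
pose e' := e / m.+1%:R.
have e'0 : 0 < e' by rewrite divr_gt0.
have : \forall z \near x, forall i, `|partial i f z - partial i f x| <= e'.
  apply: (@filter_forall _ _ (fun i z => `|partial i f z - partial i f x| <= e')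
    _ (nbhs_filter x)) => i.
  have /cvgrPdist_le/(_ _ e'0) := cf i; apply: filterS => z.
  by rewrite distrC.
move=> /nbhs_normP[r /= r0 xr].
apply/nbhs_normP; exists r => //= h; rewrite /ball_/= sub0r normrN => hr.
pose hk (k : nat) : 'rV[R]_m := \row_j (if (j < k)%N then h ord0 j else 0).
have h0 : hk 0 = 0 by apply/rowP => j; rewrite !mxE ltn0.
have hm : hk m = h by apply/rowP => j; rewrite !mxE ltn_ord.
have hS (k : 'I_m) : hk k.+1 = h ord0 k *: delta_mx ord0 k + hk k.
  apply/rowP => j; rewrite !mxE eqxx/= ltnS leq_eqVlt.
  have [->|jk] := eqVneq j k; first by rewrite eqxx ltnn mulr1 addr0.
  by rewrite (negbTE (_ : (j : nat) != k)) ?mulr0 ?add0r//.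
have step (k : 'I_m) :
    `|f (hk k.+1 + x) - f (hk k + x) - h ord0 k * partial k f x| <= e' * `|h|.
  pose g s := f (s *: delta_mx ord0 k + (hk k + x)).
  have gE (s : R) : is_derive s (1 : R) g (partial k f (s *: delta_mx ord0 k + (hk k + x))).
    by apply: is_derive_line; apply: derivableP; exact: df.
  have := @increment_le _ g _ (h ord0 k) (partial k f x) e' gE.
  rewrite {2}/g scale0r add0r {1}/g addrA -hS => H.
  apply: le_trans (H _) _; last by rewrite ler_wpM2l ?coord_le_norm// ltW.
  move=> s sh; apply: xr; rewrite /ball_/= distrC addrA addrK.
  apply: le_lt_trans hr.
  apply: norm_le_coord => // j; rewrite !mxE eqxx/=.
  have [->|jk] := eqVneq j k.
    by rewrite ltnn mulr1 addr0 (le_trans sh)// coord_le_norm.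
  by rewrite mulr0 add0r; case: ifPn; rewrite ?normr0// coord_le_norm.
have -> : f (h + x) - (f x + L h) =
    \sum_(k < m) (f (hk k.+1 + x) - f (hk k + x) - h ord0 k * partial k f x).
  rewrite sumrB/= opprD addrA; congr (_ - _).
  rewrite -(big_mkord xpredT (fun k => f (hk k.+1 + x) - f (hk k + x))).
  by rewrite (telescope_sumr (fun k => f (hk k + x)))// h0 hm add0r.
apply: le_trans (ler_norm_sum _ _ _) _.
apply: (@le_trans _ _ (\sum_(k < m) e' * `|h|)); first exact: ler_sum.
rewrite sumr_const card_ord -mulr_natr mulrAC ler_wpM2r// /e'.
by rewrite mulrAC ler_pdivrMr// ler_wpM2l ?ler_nat// ltW.
Qed.

Lemma derive_partial m (f : 'rV[R]_m -> R) x v : differentiable f x ->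
  'D_v f x = \sum_i v ord0 i * partial i f x.
Proof.
move=> df; rewrite deriveE// [in LHS](row_sum_delta v) linear_sum.
by apply: eq_bigr => i _; rewrite linearZ/= /partial deriveE.
Qed.

End partial_derivatives.

Lemma bounded_integrable d (T : measurableType d) (R : realType)
    (mu : {measure set T -> \bar R}) (D : set T) (f : T -> R) (M : R) :
  measurable D -> (mu D < +oo)%E -> measurable_fun D f ->
  (forall x, D x -> `|f x| <= M) -> mu.-integrable D (EFin \o f).
Proof.
move=> mD muD mf fM; apply: measurable_bounded_integrable => //.
exists M; split; first exact: num_real.
by move=> r Mr x Dx /=; rewrite (le_trans (fM _ Dx))// ltW.
Qed.

Lemma integral_out0 d (T : measurableType d) (R : realType)
    (mu : {measure set T -> \bar R}) (D : set T) (f : T -> \bar R) :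
  (forall x, ~ D x -> f x = 0%E) ->
  (\int[mu]_x f x = \int[mu]_(x in D) f x)%E.
Proof.
move=> f0; rewrite [RHS]integral_mkcond; apply: eq_integral => x _.
by rewrite patchE; case: ifPn => // /negP Dx; rewrite f0// => /mem_set.
Qed.

Lemma integrable_out0 d (T : measurableType d) (R : realType)
    (mu : {measure set T -> \bar R}) (D : set T) (f : T -> \bar R) :
  measurable D -> (forall x, ~ D x -> f x = 0%E) ->
  mu.-integrable D f -> mu.-integrable setT f.
Proof.
move=> mD f0 intf.
rewrite (_ : f = f \_ D).
  by apply/(integrable_restrict mu mD measurableT f); rewrite setTI.
apply/funext => x; rewrite patchE; case: ifPn => // /negP Dx.
by rewrite f0// => /mem_set.
Qed.

(** * Vanishing integrals of partial derivatives *)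

Section integral_partial.
Context {R : realType}.

Lemma derive_line_eq (V V' W : normedModType R) (f : V -> W) (g : V' -> W)
    (x v : V) (x' v' : V') : (forall h : R, f (h *: v + x) = g (h *: v' + x')) ->
  'D_v f x = 'D_v' g x' /\ (derivable f x v = derivable g x' v').
Proof.
move=> fg.
have E : (fun h : R => h^-1 *: ((f \o shift x) (h *: v) - f x)) =
         (fun h : R => h^-1 *: ((g \o shift x') (h *: v') - g x')).
  apply/funext => h /=; rewrite fg.
  by have := fg 0; rewrite !scale0r !add0r => ->.
by rewrite /derive /derivable E.
Qed.

Implicit Types m : nat.

Lemma compact_continuous_bounded m (A : set 'rV[R]_m) (f : 'rV[R]_m -> R) :
  compact A -> (forall x, A x -> {for x, continuous f}) ->
  exists M, forall x, A x -> `|f x| <= M.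
Proof.
move=> cA cf.
have cfA : compact (f @` A).
  apply: continuous_compact => //; apply: continuous_in_subspaceT => x.
  by rewrite inE; exact: cf.
have [M [Mr MP]] := compact_bounded cfA.
exists (M + 1) => x Ax; apply: MP; first by rewrite ltrDl.
by exists x.
Qed.

Lemma compact_box m (c : R) :
  compact [set x : 'rV[R]_m | forall j, `[- c, c]%classic (x ord0 j)].
Proof.
by apply: (@rV_compact _ _ (fun=> `[- c, c]%classic)) => _; exact: segment_compact.
Qed.

Lemma cons_rV_line n (a : R) (y : 'rV[R]_n) (h : R) (j : 'I_n) :
  cons_rV (a, h *: delta_mx ord0 j + y) =
  h *: delta_mx ord0 (lift ord0 j) + cons_rV (a, y).
Proof.
apply/rowP => k; rewrite !mxE /=; case: unliftP => [l ->|->] /=.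
  by rewrite !mxE !eqxx/= (inj_eq lift_inj).
by rewrite mulr0 add0r.
Qed.

Lemma cons_rV_line0 n (a : R) (y : 'rV[R]_n) (h : R) :
  cons_rV (h + a, y) = h *: delta_mx ord0 ord0 + cons_rV (a, y).
Proof.
apply/rowP => k; rewrite !mxE /=; case: unliftP => [l ->|->] /=.
  by rewrite mulr0 add0r.
by rewrite mulr1.
Qed.

Lemma norm_cons_rV n (a : R) (y : 'rV[R]_n) : `|y| <= `|cons_rV (a, y)|.
Proof.
apply: norm_le_coord => // i.
by rewrite -(cons_rVS (a, y)) coord_le_norm.
Qed.

Lemma norm_cons_rV0 n (a : R) (y : 'rV[R]_n) : `|a| <= `|cons_rV (a, y)|.
Proof. by rewrite -[leLHS]/`|(a, y).1| -cons_rV0 coord_le_norm. Qed.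

Lemma contracting_continuous (V W : normedModType R) (f : V -> W) :
  (forall x z, `|f x - f z| <= `|x - z|) -> continuous f.
Proof.
move=> fxz x; apply/cvgrPdist_le => e e0.
apply/nbhs_normP; exists e => // z; rewrite /ball_/= => /ltW.
exact: le_trans.
Qed.

Lemma continuous_cons_rVr n (a : R) :
  continuous (fun y : 'rV[R]_n => cons_rV (a, y)).
Proof.
apply: contracting_continuous => y z; apply: norm_le_coord => // i.
rewrite !mxE; case: unliftP => [j _|_] /=; last by rewrite subrr normr0.
by have := coord_le_norm (y - z) j; rewrite !mxE.
Qed.

Lemma continuous_cons_rVl n (y : 'rV[R]_n) :
  continuous (fun a : R => cons_rV (a, y)).
Proof.
apply: contracting_continuous => a b; apply: norm_le_coord => // i.
by rewrite !mxE; case: unliftP => [j _|_] //=; rewrite subrr normr0.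
Qed.

Lemma partial_out0 m (i : 'I_m) (G : 'rV[R]_m -> R) (c : R) :
  (forall x, c <= `|x| -> G x = 0) -> forall x, c < `|x| -> partial i G x = 0.
Proof.
move=> G0 x cx; rewrite /partial.
rewrite (@near_eq_derive _ _ _ G (cst 0) x); first by rewrite derive_cst.
have : \forall z \near x, c < `|z|.
  have := @norm_continuous _ _ x; move/cvgrPdist_lt.
  move=> /(_ (`|x| - c)); rewrite subr_gt0 => /(_ cx); apply: filterS => z.
  move=> /(le_lt_trans (ler_norm _)); lra.
by apply: filterS => z /ltW; exact: G0.
Qed.

Lemma integrable_partial m (i : 'I_m) (G : 'rV[R]_m -> R) (c : R) :
  continuous (partial i G) -> (forall x, c <= `|x| -> G x = 0) ->
  (lebesgue_rV m).-integrable setT (EFin \o partial i G).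
Proof.
move=> cG G0.
pose B : set 'rV[R]_m := [set x | forall j, `[- `|c|, `|c|]%classic (x ord0 j)].
have mB : measurable B := measurable_forall_coord (A := fun=> `[- `|c|, `|c|]%classic) (fun=> measurable_itv _).
have [M MP] := compact_continuous_bounded (@compact_box m `|c|) (fun x _ => cG x).
apply: (integrable_out0 mB).
  move=> x Bx /=; congr EFin; apply: partial_out0 G0 _ _.
  rewrite ltNge; apply/negP => xc; apply: Bx => j /=.
  rewrite in_itv/= -ler_norml (le_trans (coord_le_norm _ _))//.
  by rewrite (le_trans xc)// ler_norm.
apply: (bounded_integrable mB _ _ MP).
  rewrite [ltLHS](_ : _ = ((`|c| + `|c|) ^+ m)%:E) ?ltry//.
  apply: lebesgue_rV_box => //.
  rewrite lebesgue_measure_itv/=; case: ifPn; rewrite lte_fin.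
    by rewrite -EFinD opprK.
  rewrite -leNgt => cc; have -> : `|c| = 0 by have := normr_ge0 c; lra.
  by rewrite addr0.
by apply: measurable_funTS; exact: continuous_measurable_rV.
Qed.

Lemma integral_deriv_supp (g dg : R -> R) (c : R) :
  (forall x : R, is_derive x (1 : R) g (dg x)) -> continuous dg ->
  (forall x, c <= `|x| -> g x = 0) -> (forall x, c < `|x| -> dg x = 0) ->
  (\int[lebesgue_measure]_x (dg x)%:E = 0)%E.
Proof.
move=> gE cdg g0 dg0.
pose a := `|c| + 1.
have a0 : 0 < a by rewrite ltr_pwDr.
have ca : c < a by rewrite (le_lt_trans (ler_norm _))// ltrDl.
pose I : set R := `[- a, a]%classic.
transitivity (\int[lebesgue_measure]_(x in I) (dg x)%:E)%E.
  apply: integral_out0 => x; rewrite /I /=.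
  rewrite in_itv/= -ler_norml => /negP; rewrite -ltNge => ax.
  by rewrite dg0// (lt_trans ca).
have aa : - a < a by rewrite (lt_trans _ a0)// oppr_lt0.
have cg (x : R) : {for x, continuous g}.
  apply: differentiable_continuous; apply/derivable1_diffP.
  exact: ex_derive.
rewrite (continuous_FTC2 (F := g) aa).
- by rewrite !g0 ?normrN ?gtr0_norm ?subee// ltW.
- exact: continuous_subspaceT.
- split.
  + by move=> x _; exact: ex_derive.
  + by apply: cvg_at_right_filter; exact: cg.
  + by apply: cvg_at_left_filter; exact: cg.
- by move=> x _; rewrite derive1E derive_val.
Qed.

(** Induction on the dimension, splitting off the first coordinate by Fubini. If i is the first
    coordinate, the inner integral is one-dimensional and vanishes by the fundamental theorem of
    calculus; otherwise each slice at a fixed first coordinate falls under the induction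
    hypothesis. *)
Lemma integral_partial_eq0 m (i : 'I_m) (G : 'rV[R]_m -> R) (c : R) :
  (forall x, derivable G x (delta_mx ord0 i)) -> continuous (partial i G) ->
  (forall x, c <= `|x| -> G x = 0) ->
  (\int[lebesgue_rV m]_x (partial i G x)%:E = 0)%E.
Proof.
elim: m i G => [[]//|n IH] i G dG cG G0.
have iG := integrable_partial cG G0.
pose F (p : measurableTypeR R * 'rV[R]_n) : \bar R := (partial i G (cons_rV p))%:E.
have mcons := @measurable_cons_rV R n.
have mG : measurable_fun [set: 'rV[R]_n.+1] (EFin \o partial i G).
  by apply/measurable_EFinP; exact: continuous_measurable_rV.
have mF : measurable_fun setT F by exact: measurableT_comp mG mcons.
have iF : (lebesgue_measure \x lebesgue_rV n)%E.-integrable setT F.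
  apply/integrableP; split => //.
  have /integrableP[_] := iG.
  rewrite (_ : (\int[_]_x _)%E = (\int[pushforward (lebesgue_measure \x lebesgue_rV n)%E (@cons_rV R n)]_(x in setT) `|(EFin \o partial i G) x|)%E); last exact: eq_measure_integral.
  rewrite (ge0_integral_pushforward mcons)//.
  exact: measurableT_comp.
transitivity (\int[(lebesgue_measure \x lebesgue_rV n)%E]_p F p)%E.
  etransitivity; last exact: (integral_pushforward mcons (D := setT) mG iF measurableT).
  exact: eq_measure_integral.
case: (unliftP ord0 i) => [j|] iE; subst i.
  rewrite -(integral12_prod_meas1 iF) /fubini_F.
  rewrite integral0_eq// => a _; rewrite /F.
  have pE (y : 'rV[R]_n) :
      'D_(delta_mx ord0 j) (fun y => G (cons_rV (a, y))) y =
        partial (lift ord0 j) G (cons_rV (a, y)) /\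
      derivable (fun y => G (cons_rV (a, y))) y (delta_mx ord0 j) =
        derivable G (cons_rV (a, y)) (delta_mx ord0 (lift ord0 j)).
    by apply: derive_line_eq => h; rewrite cons_rV_line.
  rewrite (eq_integral (fun y => (partial j (fun y => G (cons_rV (a, y))) y)%:E)); last first.
    by move=> y _; rewrite /partial (pE y).1.
  apply: IH.
  - by move=> y; rewrite (pE y).2.
  - move=> y.
    rewrite (_ : partial j _ = (partial (lift ord0 j) G) \o (fun y => cons_rV (a, y))).
      by apply: continuous_comp; [exact: continuous_cons_rVr|exact: cG].
    by apply/funext => z /=; rewrite /partial (pE z).1.
  - by move=> y cy; apply: G0; rewrite (le_trans cy)// norm_cons_rV.
rewrite -(integral21_prod_meas1 iF) /fubini_G.
rewrite integral0_eq// => y _; rewrite /F.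
have pE (a : R) : 'D_(1 : R) (fun a : R => G (cons_rV (a, y))) a = partial ord0 G (cons_rV (a, y)) /\
  derivable (fun a : R => G (cons_rV (a, y))) a (1 : R) = derivable G (cons_rV (a, y)) (delta_mx ord0 ord0).
  apply: derive_line_eq => h.
  by rewrite -[h *: 1]/(h * 1) mulr1 cons_rV_line0.
apply: (@integral_deriv_supp (fun a => G (cons_rV (a, y))) _ c).
- by move=> a; split; rewrite ?(pE a).2 ?(pE a).1.
- move=> a; apply: (@continuous_comp _ _ _ (fun a : R => cons_rV (a, y)) (partial ord0 G)).
    exact: continuous_cons_rVl.
  exact: cG.
- by move=> a ca; apply: G0; rewrite (le_trans ca)// norm_cons_rV0.
- move=> a ca; apply: partial_out0 G0 _ _.
  by rewrite (lt_le_trans ca)// norm_cons_rV0.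
Qed.

End integral_partial.

Section chain_rules.
Context {R : realType}.
Implicit Types V : normedModType R.

Lemma differentiable_comp1 V (f : V -> R) (g : R -> R) (x : V) (d : R) :
  differentiable f x -> is_derive (f x) (1 : R) g d ->
  differentiable (fun z => g (f z)) x.
Proof.
move=> df dg; apply: differentiable_comp => //.
by apply/derivable1_diffP; exact: ex_derive.
Qed.

Lemma derive_comp1 V (f : V -> R) (g : R -> R) (x v : V) (d : R) :
  differentiable f x -> is_derive (f x) (1 : R) g d ->
  'D_v (fun z => g (f z)) x = d * 'D_v f x.
Proof.
move=> df dg.
have dgx : differentiable g (f x) by apply/derivable1_diffP; exact: ex_derive.
rewrite deriveE; last exact: differentiable_comp1 df dg.
rewrite (@diff_comp _ _ _ _ f g x)//= -(deriveE v df).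
rewrite -[in LHS](mulr1 ('D_v f x)) -[X in 'd g _ X]/('D_v f x *: (1 : R)) linearZ/=.
by rewrite -deriveE// derive_val mulrC.
Qed.

Lemma row_sum_delta_fun V m (h : 'I_m -> V -> R) :
  (fun z => \row_l h l z) = (fun z => \sum_l h l z *: (delta_mx ord0 l : 'rV[R]_m)).
Proof.
apply/funext => z; rewrite [LHS]row_sum_delta; apply: eq_bigr => l _.
by rewrite mxE.
Qed.

Lemma differentiable_row V m (h : 'I_m -> V -> R) (x : V) :
  (forall l, differentiable (h l) x) -> differentiable (fun z => \row_l h l z) x.
Proof.
move=> dh; rewrite row_sum_delta_fun.
have -> : (fun z => \sum_l h l z *: delta_mx ord0 l) =
    (\sum_l (fun z => h l z *: (delta_mx ord0 l : 'rV[R]_m)) : V -> 'rV[R]_m).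
  by apply/funext => z; rewrite fct_sumE.
by apply: differentiable_sum => l; exact: differentiableZl.
Qed.

Lemma derive_row_comp V m (h : 'I_m -> V -> R) (f : 'rV[R]_m -> R) (x v : V) :
  (forall l, differentiable (h l) x) -> differentiable f (\row_l h l x) ->
  differentiable (fun z => f (\row_l h l z)) x /\
  'D_v (fun z => f (\row_l h l z)) x =
    \sum_l 'D_v (h l) x * partial l f (\row_l h l x).
Proof.
move=> dh df.
have dr := differentiable_row dh.
have dfr : differentiable (fun z => f (\row_l h l z)) x.
  exact: (@differentiable_comp _ _ _ _ (fun z => \row_l h l z) f).
split => //.
rewrite deriveE// (@diff_comp _ _ _ _ (fun z => \row_l h l z) f x)//= -deriveE//.
rewrite derive_partial//; apply: eq_bigr => l _; congr (_ * _).
rewrite -deriveE// derive_mx; first by rewrite mxE; congr ('D_v _ x); apply/funext => z; rewrite mxE.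
exact: diff_derivable.
Qed.

Lemma differentiable_dotvl m (x y : 'rV[R]_m) :
  differentiable (fun z => dotv z y) x.
Proof.
rewrite (_ : (fun z => _) =
    (\sum_i (fun z : 'rV[R]_m => z ord0 i * y ord0 i) : 'rV[R]_m -> R)).
  apply: differentiable_sum => i; apply: differentiableM => //.
  exact: differentiable_coord.
by apply/funext => z; rewrite fct_sumE.
Qed.

Lemma differentiable_dotvv m (x : 'rV[R]_m) :
  differentiable (fun z => dotv z z) x.
Proof.
rewrite (_ : (fun z => _) =
    (\sum_i (fun z : 'rV[R]_m => z ord0 i * z ord0 i) : 'rV[R]_m -> R)).
  apply: differentiable_sum => i; apply: differentiableM;
  exact: differentiable_coord.
by apply/funext => z; rewrite fct_sumE.
Qed.

Lemma derive_affine V (f : V -> R) (x v : V) (d : R) :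
  (forall h : R, f (h *: v + x) = f x + h * d) -> 'D_v f x = d.
Proof.
move=> fE; rewrite /derive; apply: cvg_lim => //.
have : d @[_ --> (0 : R)^'] --> d by exact: cvg_cst.
apply: cvg_trans; apply: near_eq_cvg.
near=> h => /=; rewrite fE addrC addKr /GRing.scale/= mulKf//.
near: h; exact: nbhs_dnbhs_neq.
Unshelve. all: by end_near. Qed.

Lemma derive_dotvl m (x y v : 'rV[R]_m) : 'D_v (fun z => dotv z y) x = dotv v y.
Proof. by apply: derive_affine => h; rewrite dotvDl dotvZl addrC. Qed.

Lemma derive_coord m (x v : 'rV[R]_m) l : 'D_v (fun z : 'rV[R]_m => z ord0 l) x = v ord0 l.
Proof. by apply: derive_affine => h; rewrite !mxE addrC. Qed.

Lemma derive_dotvv m (x v : 'rV[R]_m) :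
  'D_v (fun z => dotv z z) x = 2 * dotv x v.
Proof.
rewrite /derive; apply: cvg_lim => //.
have : (2 * dotv x v + h * dotv v v) @[h --> (0 : R)^'] --> 2 * dotv x v + 0 * dotv v v.
  apply: cvgD; first exact: cvg_cst.
  apply: cvgMr_tmp; apply: cvg_within_filter; exact: cvg_id.
rewrite mul0r addr0; apply: cvg_trans; apply: near_eq_cvg.
near=> h => /=.
have h0 : h != 0 by near: h; exact: nbhs_dnbhs_neq.
rewrite !dotvDl !dotvDr !dotvZl !dotvZr (dotvC v x) /GRing.scale/=.
by field.
Unshelve. all: by end_near. Qed.

Lemma is_derive_sqrt (x : R) : 0 < x ->
  is_derive x (1 : R) Num.sqrt (2 * Num.sqrt x)^-1.
Proof. exact: is_derive1_sqrt. Qed.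

Lemma differentiable_enorm m (x : 'rV[R]_m) : x != 0 -> differentiable (@enorm R m) x.
Proof.
rewrite -enorm_gt0 => x0.
apply: (differentiable_comp1 (differentiable_dotvv x) (is_derive_sqrt _)).
by rewrite -enorm_sqr exprn_gt0.
Qed.

Lemma derive_enorm m (x v : 'rV[R]_m) : x != 0 ->
  'D_v (@enorm R m) x = dotv x v / enorm x.
Proof.
rewrite -enorm_gt0 => x0.
have xx : 0 < dotv x x by rewrite -enorm_sqr exprn_gt0.
rewrite [LHS](derive_comp1 _ (differentiable_dotvv x) (is_derive_sqrt xx)).
transitivity ((2 * enorm x)^-1 * (2 * dotv x v)); first by rewrite -derive_dotvv.
by field; rewrite gt_eqF.
Qed.

End chain_rules.

Section derive_lambda.
Context {R : realType}.
Implicit Types (f g : R -> R) (x df dg : R).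

Lemma der_eq f x df dg : is_derive x (1 : R) f df -> df = dg ->
  is_derive x (1 : R) f dg.
Proof. by move=> fd <-. Qed.

Lemma derD f g x df dg : is_derive x (1 : R) f df -> is_derive x (1 : R) g dg ->
  is_derive x (1 : R) (fun z => f z + g z) (df + dg).
Proof. exact: is_deriveD. Qed.

Lemma derB f g x df dg : is_derive x (1 : R) f df -> is_derive x (1 : R) g dg ->
  is_derive x (1 : R) (fun z => f z - g z) (df - dg).
Proof. exact: is_deriveB. Qed.

Lemma derM f g x df dg : is_derive x (1 : R) f df -> is_derive x (1 : R) g dg ->
  is_derive x (1 : R) (fun z => f z * g z) (df * g x + f x * dg).
Proof.
move=> fd gd; have := is_deriveM fd gd; rewrite /GRing.scale/= => H.
by rewrite addrC [df * _]mulrC.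
Qed.

Lemma der_comp f g x df dg : is_derive x (1 : R) f df ->
  is_derive (f x) (1 : R) g dg ->
  is_derive x (1 : R) (fun z => g (f z)) (df * dg).
Proof. by move=> fd gd; have := @is_derive1_comp _ g f x _ _ gd fd; rewrite mulrC. Qed.

Lemma der_cst x (c : R) : is_derive x (1 : R) (fun _ : R => c) (0 : R).
Proof. exact: is_derive_cst. Qed.

Lemma der_id x : is_derive x (1 : R) (fun z => z) 1.
Proof. exact: is_derive_id. Qed.

Lemma derX f n x df : is_derive x (1 : R) f df ->
  is_derive x (1 : R) (fun z => f z ^+ n) (n%:R * f x ^+ n.-1 * df).
Proof.
move=> fd; elim: n => [|n IH]; first by rewrite !mul0r; exact: der_cst.
have := derM fd IH.
have -> : (fun z => f z * f z ^+ n) = (fun z => f z ^+ n.+1).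
  by apply/funext => z; rewrite exprS.
move=> H; apply: (der_eq H); case: n {IH H} => [|n] /=.
  by rewrite !expr0; ring.
by rewrite -!natr1 !exprS; ring.
Qed.

Lemma derV f x df : f x != 0 -> is_derive x (1 : R) f df ->
  is_derive x (1 : R) (fun z => (f z)^-1) (- df / f x ^+ 2).
Proof.
move=> fx0 [fd <-].
have gd : derivable (fun z => (f z)^-1) x (1 : R) by exact: derivableV.
split => //; have := deriveV fx0 fd.
rewrite /GRing.inv/= => ->; rewrite /GRing.scale/=.
by rewrite !mulNr mulrC.
Qed.

Lemma derdiv f g x df dg : g x != 0 ->
  is_derive x (1 : R) f df -> is_derive x (1 : R) g dg ->
  is_derive x (1 : R) (fun z => f z / g z) ((df * g x - f x * dg) / g x ^+ 2).
Proof.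
move=> gx0 fd gd; have := derM fd (derV gx0 gd).
by congr is_derive; field.
Qed.

(** Serves functions defined by cases, such as [possq] and |z| z: a quadratic error bound is a
    finite case analysis and involves no one-sided limits. *)
Lemma der_quadratic f x d C :
  (forall h, `|f (h + x) - f x - h * d| <= C * h ^+ 2) ->
  is_derive x (1 : R) f d.
Proof.
move=> fC.
have C0 : 0 <= C by have := fC 1; rewrite expr1n mulr1; apply: le_trans.
have H : h^-1 *: ((f \o shift x) (h *: (1 : R)) - f x) @[h --> (0 : R)^'] --> d.
  apply/cvgrPdist_le => e e0.
  near=> h.
  have h0 : h != 0 by near: h; exact: nbhs_dnbhs_neq.
  rewrite /= -[h *: 1]/(h * 1) mulr1 /GRing.scale/=.
  rewrite (_ : _ - _ = - (h^-1 * (f (h + x) - f x - h * d))); last by field.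
  rewrite normrN normrM (le_trans (ler_wpM2l _ (fC h)))//.
  rewrite -(real_normK (num_real h)) expr2 mulrCA mulrA normfV mulrA.
  rewrite mulrAC -mulrA mulVf ?normr_eq0// mulr1.
  apply: (@le_trans _ _ (C * (e / (C + 1)))).
    rewrite ler_wpM2l//; near: h; apply: dnbhs0_le.
    by rewrite divr_gt0// ltr_wpDl.
  rewrite mulrCA ger_pMr// ler_pdivrMr ?mul1r ?lerDl// ltr_wpDl//.
split; first by apply/cvg_ex; exists d.
exact: (cvg_lim _ H).
Unshelve. all: by end_near. Qed.

End derive_lambda.

Lemma continuous_compose (T U V : topologicalType) (f : T -> U) (g : U -> V) :
  continuous f -> continuous g -> continuous (fun x => g (f x)).
Proof. by move=> cf cg x; apply: continuous_comp; [exact: cf|exact: cg]. Qed.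

(** * C^1 cut-off functions of one variable *)

Section cutoff.
Context {R : realType}.

(** The square makes the positive part C^1, which is all the regularity that the divergence theorem
    below asks for. *)
Definition possq (z : R) : R := Num.max z 0 ^+ 2.

Lemma der_possq (z : R) : is_derive z (1 : R) possq (2 * Num.max z 0).
Proof.
apply: (@der_quadratic _ _ _ _ 1) => h; rewrite mul1r /possq ler_norml.
by case: (lerP z 0) => z0; case: (lerP (h + z) 0) => hz; apply/andP; split; nra.
Qed.

Lemma continuous_max0 : continuous (fun z : R => Num.max z 0).
Proof.
apply: contracting_continuous => x z.
rewrite ler_norml.
by case: (lerP x 0) => x0; case: (lerP z 0) => z0; case: (ler0P (x - z)) => xz;
  apply/andP; split; lra.
Qed.

(** A C^1 transition from 0 on z <= 0 to 1 on z >= 1. The denominator never vanishes since z and 1 -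
    z are not both nonpositive. *)
Definition step (z : R) : R := possq z / (possq z + possq (1 - z)).

Definition dstep (z : R) : R :=
  ((2 * Num.max z 0) * (possq z + possq (1 - z)) -
   possq z * (2 * Num.max z 0 - 2 * Num.max (1 - z) 0)) /
  (possq z + possq (1 - z)) ^+ 2.

Lemma possq_ge0 z : 0 <= possq z. Proof. exact: sqr_ge0. Qed.

Lemma step_den_gt0 z : 0 < possq z + possq (1 - z).
Proof.
rewrite /possq; case: (lerP z 0) => z0; case: (lerP (1 - z) 0) => z1; nra.
Qed.

Lemma der_step z : is_derive z (1 : R) step (dstep z).
Proof.
have d1 := der_possq z.
have d2 : is_derive z (1 : R) (fun w => possq (1 - w)) (- (2 * Num.max (1 - z) 0)).
  apply: der_eq; first exact: (der_comp (derB (der_cst z 1) (der_id z)) (der_possq _)).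
  by rewrite sub0r mulN1r.
have := derdiv _ d1 (derD d1 d2); apply.
by rewrite gt_eqF// step_den_gt0.
Qed.

Lemma step_ge0 z : 0 <= step z.
Proof. by rewrite divr_ge0 ?possq_ge0// ltW// step_den_gt0. Qed.

Lemma step_le1 z : step z <= 1.
Proof. by rewrite ler_pdivrMr ?step_den_gt0// mul1r lerDl possq_ge0. Qed.

Lemma step_eq0 z : z <= 0 -> step z = 0.
Proof. by move=> z0; rewrite /step /possq max_r// expr0n mul0r. Qed.

Lemma step_eq1 z : 1 <= z -> step z = 1.
Proof.
move=> z1; rewrite /step; have -> : possq (1 - z) = 0.
  by rewrite /possq max_r ?expr0n// subr_le0.
by rewrite addr0 divff// /possq max_l ?expf_neq0 ?gt_eqF ?(lt_le_trans _ z1)// (le_trans _ z1).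
Qed.

Lemma continuous_dstep : continuous dstep.
Proof.
have c1 : continuous (fun z : R => Num.max z 0) := continuous_max0.
have cs : continuous (fun z : R => 1 - z).
  by move=> z; apply: cvgB; [exact: cvg_cst|exact: cvg_id].
have c2 : continuous (fun z : R => Num.max (1 - z) 0).
  exact: continuous_compose cs c1.
have cp1 : continuous possq by move=> z; apply: cvgM; exact: c1.
have cp2 : continuous (fun z : R => possq (1 - z)).
  by move=> z; apply: cvgM; exact: c2.
have cD : continuous (fun z : R => possq z + possq (1 - z)).
  by move=> z; apply: cvgD; [exact: cp1|exact: cp2].
move=> z; apply: cvgM.
  apply: cvgB.
    by apply: cvgM; [apply: cvgMl_tmp; exact: c1|exact: cD].
  apply: cvgM; first exact: cp1.
  by apply: cvgB; apply: cvgMl_tmp; [exact: c1|exact: c2].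
apply: cvgV; first by rewrite expf_neq0// gt_eqF// step_den_gt0.
by apply: cvgM; exact: cD.
Qed.

(* [zcut j] vanishes on ]-oo, 1/(j+1)] and on [1 + 1/(j+1), +oo[, and tends to
   the indicator function of ]0, 1]. *)
Definition zcut (j : nat) (q : R) : R :=
  step (j.+1%:R * q - 1) * step (j.+2%:R - j.+1%:R * q).

Definition dzcut (j : nat) (q : R) : R :=
  (j.+1%:R * dstep (j.+1%:R * q - 1)) * step (j.+2%:R - j.+1%:R * q) +
  step (j.+1%:R * q - 1) * (- j.+1%:R * dstep (j.+2%:R - j.+1%:R * q)).

Lemma der_zcut j q : is_derive q (1 : R) (zcut j) (dzcut j q).
Proof.
have l c : is_derive q (1 : R) (fun w => c * w) c.
  by have := derM (der_cst q c) (der_id q); rewrite mul0r mulr1 add0r.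
apply: derM; apply: der_comp (der_step _).
  by have := derB (l j.+1%:R) (der_cst q 1); rewrite subr0.
by have := derB (der_cst q j.+2%:R) (l j.+1%:R); rewrite sub0r.
Qed.

Lemma continuous_dzcut j : continuous (dzcut j).
Proof.
have cst : continuous step.
  move=> z; apply: differentiable_continuous; apply/derivable1_diffP.
  by have := der_step z => -[].
have c1 : continuous (fun q : R => j.+1%:R * q - 1).
  by move=> q; apply: cvgB; [apply: cvgMl_tmp; exact: cvg_id|exact: cvg_cst].
have c2 : continuous (fun q : R => j.+2%:R - j.+1%:R * q).
  by move=> q; apply: cvgB; [exact: cvg_cst|apply: cvgMl_tmp; exact: cvg_id].
move=> q; apply: cvgD; apply: cvgM.
- by apply: cvgMl_tmp; exact: (continuous_compose c1 continuous_dstep).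
- exact: (continuous_compose c2 cst).
- exact: (continuous_compose c1 cst).
- by apply: cvgMl_tmp; exact: (continuous_compose c2 continuous_dstep).
Qed.

Lemma zcut_ge0 j q : 0 <= zcut j q.
Proof. by rewrite mulr_ge0 ?step_ge0. Qed.

Lemma zcut_le1 j q : zcut j q <= 1.
Proof. by rewrite -[leRHS]mulr1 ler_pM ?step_ge0 ?step_le1. Qed.

Lemma zcut_small j q : q <= j.+1%:R^-1 -> zcut j q = 0.
Proof.
move=> qj; rewrite /zcut step_eq0 ?mul0r// subr_le0.
by rewrite -ler_pdivlMl// mulr1.
Qed.

Lemma zcut_large j q : 1 + j.+1%:R^-1 <= q -> zcut j q = 0.
Proof.
move=> qj; rewrite /zcut [X in _ * X]step_eq0 ?mulr0// subr_le0.
have : j.+1%:R * (1 + j.+1%:R^-1) <= j.+1%:R * q by rewrite ler_wpM2l.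
by rewrite mulrDr mulr1 divff// natr1.
Qed.

Lemma cvg_zcut q : zcut j q @[j --> \oo] --> (if 0 < q <= 1 then 1 else 0 : R).
Proof.
have [q0|q0] := leP q 0.
  rewrite (_ : zcut^~ q = cst 0); first exact: cvg_cst.
  apply/funext => j; rewrite zcut_small// (le_trans q0)//.
have nearinv (e : R) : 0 < e -> \forall j \near \oo, j.+1%:R^-1 <= e.
  move=> e0; near=> j.
  rewrite invf_ple ?posrE// ltW// (lt_le_trans (archi_boundP _))//.
    by rewrite invr_ge0 ltW.
  rewrite ler_nat leqW//; near: j; exact: nbhs_infty_ge.
have [q1|q1] := leP q 1; rewrite /=.
  have : (1 : R) @[_ --> \oo] --> (1 : R) by exact: cvg_cst.
  apply: cvg_trans; apply: near_eq_cvg; near=> j.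
  rewrite /zcut !step_eq1 ?mulr1//.
    rewrite -[X in X - _]natr1 addrAC lerDr subr_ge0 ger_pMr//.
  rewrite lerBrDr -[1 + 1]/2%:R -ler_pdivrMr//.
  have : j.+1%:R^-1 <= q / 2 by near: j; apply: nearinv; rewrite divr_gt0.
  by rewrite invf_ple ?posrE ?divr_gt0// invf_div.
have : (0 : R) @[_ --> \oo] --> (0 : R) by exact: cvg_cst.
apply: cvg_trans; apply: near_eq_cvg; near=> j.
rewrite zcut_large// -lerBrDl; near: j; apply: nearinv.
by rewrite subr_gt0.
Unshelve. all: by end_near. Qed.

End cutoff.

Lemma scaleRE (R : realType) (a b : R) : a *: b = a * b.
Proof. by []. Qed.

Lemma locally_cst_continuous (T U : topologicalType) (f : T -> U) (x : T) :
  (\forall y \near x, f y = f x) -> {for x, continuous f}.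
Proof. by move=> fx; exact: cvg_near_cst. Qed.

Section continuous_at.
Context {R : realType} {T : topologicalType}.
Implicit Types (f g : T -> R) (x : T).

Lemma cat_cst (c : R) x : {for x, continuous (fun=> c)}.
Proof. exact: cvg_cst. Qed.

Lemma catD f g x : {for x, continuous f} -> {for x, continuous g} ->
  {for x, continuous (fun y => f y + g y)}.
Proof. by move=> cf cg; exact: cvgD. Qed.

Lemma catN f x : {for x, continuous f} -> {for x, continuous (fun y => - f y)}.
Proof. by move=> cf; exact: cvgN. Qed.

Lemma catM f g x : {for x, continuous f} -> {for x, continuous g} ->
  {for x, continuous (fun y => f y * g y)}.
Proof. by move=> cf cg; exact: cvgM. Qed.

Lemma catV f x : f x != 0 -> {for x, continuous f} ->
  {for x, continuous (fun y => (f y)^-1)}.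
Proof. by move=> fx cf; exact: cvgV. Qed.

Lemma catX f x k : {for x, continuous f} -> {for x, continuous (fun y => f y ^+ k)}.
Proof.
move=> cf; elim: k => [|k IH]; first exact: cvg_cst.
rewrite (_ : (fun y => _) = (fun y => f y * f y ^+ k)); first exact: catM.
by apply/funext => y; rewrite exprS.
Qed.

Lemma cat_sum (I : Type) (r : seq I) (f : I -> T -> R) x :
  (forall i, {for x, continuous (f i)}) ->
  {for x, continuous (fun y => \sum_(i <- r) f i y)}.
Proof. by move=> cf; apply: cvg_sumr => i _; exact: cf. Qed.

Lemma cat_comp (f : T -> R) (g : R -> R) x : {for x, continuous f} ->
  {for f x, continuous g} -> {for x, continuous (fun y => g (f y))}.
Proof. exact: continuous_comp. Qed.

End continuous_at.

(** * Tangent fields extended along rays *)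

Section divergence_theorem.
Context {R : realType}.
Implicit Types n m : nat.

(** Weaker than [smooth]: the radial fields to which the divergence theorem is applied contain
    [possq] and powers of |t|, and are only C^1. *)
Definition C1_sphere n (f : 'rV[R]_n.+1 -> R) : Prop := forall x, sphere n x ->
  differentiable f x /\ forall i, {for x, continuous (partial i f)}.

Definition sphere_continuous n (h : 'rV[R]_n.+1 -> R) : Prop :=
  forall x, sphere n x -> {for x, continuous h}.

Lemma continuous_dotvv m : continuous (fun x : 'rV[R]_m => dotv x x).
Proof. by move=> x; apply: differentiable_continuous; exact: differentiable_dotvv. Qed.

Lemma continuous_dotvl m (y : 'rV[R]_m) : continuous (fun x : 'rV[R]_m => dotv x y).
Proof. by move=> x; apply: differentiable_continuous; exact: differentiable_dotvl. Qed.

Lemma dotvv_gt0 m (x : 'rV[R]_m) : (0 < dotv x x) = (x != 0).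
Proof. by rewrite -enorm_sqr exprn_even_gt0//= enorm_eq0. Qed.

Lemma open_neq0_rV m : open [set x : 'rV[R]_m | x != 0].
Proof.
rewrite (_ : mkset _ = (fun x : 'rV[R]_m => dotv x x) @^-1` [set q | 0 < q]).
  apply: open_comp; last exact: open_gt.
  by move=> x _; exact: continuous_dotvv.
by apply/seteqP; split => x /=; rewrite dotvv_gt0.
Qed.

Lemma compact_sphere n : compact (sphere (R := R) n).
Proof.
apply: bounded_closed_compact.
  exists 1; split; first exact: num_real.
  move=> M M1 x sx; rewrite /= (le_trans _ (ltW M1))//.
  by apply: norm_le_coord => // i; rewrite -[leRHS]sx coord_le_enorm.
rewrite (_ : sphere n = (fun x : 'rV[R]_n.+1 => dotv x x) @^-1` [set 1]).
  apply: closed_comp; last exact: closed_eq.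
  by move=> x _; exact: continuous_dotvv.
by apply/seteqP; split => x /= /sphereE.
Qed.

Lemma sphere_continuous_bounded n (h : 'rV[R]_n.+1 -> R) :
  sphere_continuous h -> exists M, forall x, sphere n x -> `|h x| <= M.
Proof. by move=> ch; apply: compact_continuous_bounded (@compact_sphere n) ch. Qed.

Lemma unit_dir_row m (x : 'rV[R]_m) : unit_dir x = \row_l (x ord0 l / enorm x).
Proof. by apply/rowP => l; rewrite !mxE mulrC. Qed.

Lemma differentiable_unit_coord m (x : 'rV[R]_m) l : x != 0 ->
  differentiable (fun z : 'rV[R]_m => z ord0 l / enorm z) x.
Proof.
move=> x0; apply: differentiableM; first exact: differentiable_coord.
by apply: differentiableV; [exact: differentiable_enorm|rewrite enorm_eq0].
Qed.

Lemma derive_unit_coord m (x v : 'rV[R]_m) l : x != 0 ->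
  'D_v (fun z : 'rV[R]_m => z ord0 l / enorm z) x =
  v ord0 l / enorm x - x ord0 l * dotv x v / enorm x ^+ 3.
Proof.
move=> x0.
have N0 : enorm x != 0 by rewrite enorm_eq0.
have dN : derivable (@enorm R m) x v := diff_derivable (differentiable_enorm x0).
have dc : derivable (fun z : 'rV[R]_m => z ord0 l) x v.
  by apply: diff_derivable; exact: differentiable_coord.
have -> : (fun z : 'rV[R]_m => z ord0 l / enorm z) =
   (fun z : 'rV[R]_m => z ord0 l) * (fun z => (enorm z)^-1) by [].
rewrite (deriveM dc (derivableV N0 dN)).
have -> : 'D_v (fun z : 'rV[R]_m => (enorm z)^-1) x = _ := deriveV N0 dN.
rewrite derive_coord derive_enorm// !scaleRE.
by field.
Qed.

Lemma continuous_unit_dir m (x : 'rV[R]_m) : x != 0 -> {for x, continuous (@unit_dir R m)}.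
Proof.
move=> x0; apply: differentiable_continuous.
rewrite (_ : @unit_dir R m = fun z => \row_l (z ord0 l / enorm z)).
  by apply: differentiable_row => l; exact: differentiable_unit_coord.
by apply/funext => z; exact: unit_dir_row.
Qed.

(** Continuity is given only at points of the sphere, which is not open. Composition with [unit_dir]
    gives a function continuous on the open set of nonzero vectors that agrees with h on the
    sphere. *)
Lemma sphere_continuous_measurable n (h : 'rV[R]_n.+1 -> R) :
  sphere_continuous h -> measurable_fun (sphere n) h.
Proof.
move=> ch.
apply: (@eq_measurable_fun _ _ _ _ _ (h \o @unit_dir R n.+1)).
  by move=> x; rewrite inE => sx /=; rewrite unit_dir_id.
apply: (@measurable_funS _ _ _ _ [set x : 'rV[R]_n.+1 | x != 0]).
- by apply: open_measurable_rV; exact: open_neq0_rV.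
- by move=> x /sphere_neq0.
- apply: measurable_fun_open_rV; first exact: open_neq0_rV.
  move=> x /= x0; apply: continuous_comp; first exact: continuous_unit_dir.
  by apply: ch; exact: unit_dir_sphere.
Qed.

Lemma sphere_continuous_integrable n (h : 'rV[R]_n.+1 -> R) :
  sphere_continuous h -> (surface_measure n).-integrable (sphere n) (EFin \o h).
Proof.
move=> ch; have [M hM] := sphere_continuous_bounded ch.
apply: bounded_integrable hM.
- exact: measurable_sphere.
- exact: surface_measure_sphere_lty.
- exact: sphere_continuous_measurable.
Qed.

Lemma surface_div_continuous n (V : 'rV[R]_n.+1 -> 'rV[R]_n.+1) :
  (forall i, C1_sphere (fun x => V x ord0 i)) ->
  sphere_continuous (surface_div V).
Proof.
move=> CV x sx; apply: catD.
  by apply: cat_sum => i; have [_] := CV i x sx; apply.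
apply: catN; apply: cat_sum => i; apply: cat_sum => j; apply: catM.
  by apply: catM; exact: continuous_coord.
by have [_] := CV i x sx; apply.
Qed.

Section radial_cutoff.
Variables (n : nat) (V : 'rV[R]_n.+1 -> 'rV[R]_n.+1).
Hypothesis CV : forall i, C1_sphere (fun x => V x ord0 i).
Hypothesis tV : forall x, sphere n x -> dotv (V x) x = 0.
Variables (z dz : R -> R) (a c : R).
Hypothesis dzE : forall q : R, is_derive q (1 : R) z (dz q).
Hypothesis cdz : continuous dz.
Hypothesis a0 : 0 < a.
Hypothesis za : forall q, q <= a -> z q = 0.
Hypothesis zc : forall q, c <= q -> z q = 0.

(** The extension of V homogeneous of degree 1, so that its divergence is of degree 0 and thus
    constant along rays, multiplied by a cut-off in |x|^2 that removes the origin and makes the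
    support compact. [P i] is the derivative of [G i] in direction i. *)
Let G i (x : 'rV[R]_n.+1) : R := V (unit_dir x) ord0 i * (enorm x * z (dotv x x)).

Let P i (x : 'rV[R]_n.+1) : R :=
  (\sum_l ((l == i)%:R / enorm x - x ord0 l * x ord0 i / enorm x ^+ 3) *
     partial l (fun y => V y ord0 i) (unit_dir x)) * (enorm x * z (dotv x x)) +
  V (unit_dir x) ord0 i *
    (x ord0 i / enorm x * z (dotv x x) + enorm x * (dz (dotv x x) * (2 * x ord0 i))).

Let dz0 q : q < a -> dz q = 0.
Proof.
move=> qa; rewrite -(@derive_val _ _ _ _ _ _ _ (dzE q)).
rewrite (@near_eq_derive _ _ _ z (cst 0) q); first by rewrite derive_cst.
by near=> w; apply: za; apply: ltW; near: w; exact: lt_nbhsl.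
Unshelve. all: by end_near. Qed.

Let G0 i x : dotv x x <= a -> G i x = 0.
Proof. by move=> xa; rewrite /G za// !mulr0. Qed.

Let P0 i x : dotv x x < a -> P i x = 0.
Proof. by move=> xa; rewrite /P za ?ltW// dz0// mul0r !mulr0 addr0 mulr0 addr0. Qed.

Let near_small (x : 'rV[R]_n.+1) : dotv x x < a -> \forall y \near x, dotv y y < a.
Proof.
move=> xa; have := @continuous_dotvv _ x; move/cvgrPdist_lt.
move=> /(_ (a - dotv x x)); rewrite subr_gt0 => /(_ xa); apply: filterS => y.
rewrite distrC => /(le_lt_trans (ler_norm _)); lra.
Qed.

Let dotv_delta (x : 'rV[R]_n.+1) i : dotv x (delta_mx ord0 i) = x ord0 i.
Proof.
rewrite /dotv (bigD1 i)//= delta_mx_coord eqxx mulr1 big1 ?addr0// => j ji.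
by rewrite delta_mx_coord (negbTE ji) mulr0.
Qed.

Let dG i x : derivable (G i) x (delta_mx ord0 i) /\ partial i (G i) x = P i x.
Proof.
have [xa|ax] := ltP (dotv x x) a.
  have Gx : \forall y \near x, cst 0 y = G i y.
    by apply: filterS (near_small xa) => y ya; rewrite G0// ltW.
  split.
    by apply: near_eq_derivable Gx _; exact: derivable_cst.
  rewrite P0// /partial -(near_eq_derive _ Gx) derive_cst//.
have x0 : x != 0 by rewrite -dotvv_gt0 (lt_le_trans a0).
have N0 : enorm x != 0 by rewrite enorm_eq0.
have su : sphere n (\row_l (x ord0 l / enorm x)).
  by rewrite -unit_dir_row; exact: unit_dir_sphere.
have [dV _] := CV i su.
have [dVu DVu] := derive_row_comp (delta_mx ord0 i)
  (fun l => differentiable_unit_coord l x0) dV.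
have VuE : (fun y => V (unit_dir y) ord0 i) =
    (fun y => V (\row_l (y ord0 l / enorm y)) ord0 i).
  by apply/funext => y; rewrite unit_dir_row.
have dzx := differentiable_comp1 (differentiable_dotvv x) (dzE (dotv x x)).
have dN := differentiable_enorm x0.
have GE : G i = (fun y => V (unit_dir y) ord0 i) *
   ((@enorm R n.+1) * (fun y => z (dotv y y))) by [].
have d1 : derivable (fun y => V (unit_dir y) ord0 i) x (delta_mx ord0 i).
  by rewrite VuE; exact: diff_derivable.
have d2 : derivable (fun y : 'rV[R]_n.+1 => z (dotv y y)) x (delta_mx ord0 i).
  exact: diff_derivable.
have d3 : derivable (@enorm R n.+1) x (delta_mx ord0 i) by exact: diff_derivable.
split; first by rewrite GE; exact: (derivableM d1 (derivableM d3 d2)).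
rewrite /partial GE (deriveM d1 (derivableM d3 d2)) (deriveM d3 d2) VuE DVu !scaleRE.
rewrite (derive_comp1 _ (differentiable_dotvv x) (dzE (dotv x x))).
rewrite derive_enorm// derive_dotvv dotv_delta /P -unit_dir_row.
rewrite addrC; congr (_ + _).
  rewrite [LHS]mulrC; congr (_ * _); apply: eq_bigr => l _; congr (_ * _).
  by rewrite derive_unit_coord// delta_mx_coord dotv_delta.
by congr (_ * _); rewrite addrC; congr (_ + _); rewrite mulrC.
Qed.

Let cPx i x : {for x, continuous (P i)}.
Proof.
have [xa|ax] := ltP (dotv x x) a.
  apply: locally_cst_continuous; apply: filterS (near_small xa) => y ya.
  by rewrite !P0.
have x0 : x != 0 by rewrite -dotvv_gt0 (lt_le_trans a0).
have N0 : enorm x != 0 by rewrite enorm_eq0.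
have su := unit_dir_sphere x0.
have cN : {for x, continuous (@enorm R n.+1)}.
  by apply: differentiable_continuous; exact: differentiable_enorm.
have cq := @continuous_dotvv n.+1 x.
have cNV : {for x, continuous (fun y : 'rV[R]_n.+1 => (enorm y)^-1)} by exact: catV.
have cc l := @continuous_coord R n.+1 l x.
have cz : {for x, continuous (fun y : 'rV[R]_n.+1 => z (dotv y y))}.
  apply: (@continuous_comp _ _ _ _ z) => //.
  apply: differentiable_continuous; apply/derivable1_diffP.
  by have := dzE (dotv x x) => -[].
have cdzx : {for x, continuous (fun y : 'rV[R]_n.+1 => dz (dotv y y))}.
  by apply: (@continuous_comp _ _ _ _ dz) => //; exact: cdz.
have cu := continuous_unit_dir x0.
have cV : {for x, continuous (fun y => V (unit_dir y) ord0 i)}.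
  apply: (@continuous_comp _ _ _ _ (fun y => V y ord0 i)) => //.
  by apply: differentiable_continuous; exact: (CV i su).1.
have cpV l : {for x, continuous (fun y => partial l (fun y => V y ord0 i) (unit_dir y))}.
  by apply: (@continuous_comp _ _ _ _ (partial l (fun y => V y ord0 i))) => //; exact: (CV i su).2.
apply: (@catD _ _ (fun x => (\sum_l _) * (enorm x * z (dotv x x)))); apply: catM.
- apply: cat_sum => l; apply: catM; last exact: cpV.
  apply: catD; first by apply: catM => //; exact: cat_cst.
  apply: catN; apply: catM; first by apply: catM; exact: cc.
  by apply: catV; [rewrite expf_neq0|exact: catX].
- exact: catM.
- exact: cV.
- apply: catD; first by apply: catM => //; apply: catM => //; exact: cc.
  apply: catM => //; apply: catM => //.
  by apply: catM; [exact: cat_cst|exact: cc].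
Qed.

Let cP i : continuous (P i). Proof. by move=> x; exact: cPx. Qed.

Let partialG i : partial i (G i) = P i.
Proof. by apply/funext => x; rewrite (dG i x).2. Qed.

Let Gc i x : Num.max 1 c <= `|x| -> G i x = 0.
Proof.
rewrite ge_max => /andP[x1 cx]; rewrite /G zc ?mulr0//.
apply: (le_trans cx); rewrite -enorm_sqr.
have xN : `|x| <= enorm x.
  by apply: norm_le_coord => [|i']; rewrite ?enorm_ge0 ?coord_le_enorm.
by rewrite (le_trans xN)// expr2 ler_peMr ?enorm_ge0// (le_trans x1).
Qed.

(** All derivatives that fall on the radial factor |x| z(|x|^2) are multiples of V . x, which is 0
    by tangency. What remains is the trace of DV composed with the tangential projection:
    differentiating the unit direction costs 1/|x|, which the factor |x| compensates. *)
Lemma radial_cutoff_divE x :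
  \sum_i P i x = z (dotv x x) * surface_div V (unit_dir x).
Proof.
have [xa|ax] := ltP (dotv x x) a.
  by rewrite za ?ltW// mul0r big1// => i _; exact: P0.
have x0 : x != 0 by rewrite -dotvv_gt0 (lt_le_trans a0).
have N0 : enorm x != 0 by rewrite enorm_eq0.
have su := unit_dir_sphere x0.
rewrite big_split/= [X in _ + X](_ : _ = 0) ?addr0; last first.
  rewrite (eq_bigr (fun i => (z (dotv x x) + enorm x ^+ 2 * dz (dotv x x) * 2) *
     (V (unit_dir x) ord0 i * unit_dir x ord0 i))); last first.
    by move=> i _; rewrite mxE; field.
  by rewrite -mulr_sumr -/(dotv (V (unit_dir x)) (unit_dir x)) tV// mulr0.
rewrite /surface_div -sumrB mulr_sumr; apply: eq_bigr => i _.
rewrite mulr_suml (bigD1 i)//= [in RHS](bigD1 i)//= opprD addrA mulrDr.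
congr (_ + _).
  have -> : (i == i)%:R = 1 :> R by rewrite eqxx.
  by rewrite !mxE; field.
rewrite -sumrN mulr_sumr; apply: eq_bigr => l li.
have -> : (l == i)%:R = 0 :> R by rewrite (negbTE li).
by rewrite !mxE; field.
Qed.

Lemma radial_cutoff_div_continuous :
  continuous (fun x => z (dotv x x) * surface_div V (unit_dir x)).
Proof.
move=> x; rewrite (_ : (fun _ => _) = (fun x => \sum_i P i x)).
  by apply: cat_sum => i; exact: cP.
by apply/funext => y; rewrite radial_cutoff_divE.
Qed.

Lemma integral_radial_cutoff_div :
  (\int[lebesgue_rV n.+1]_x (z (dotv x x) * surface_div V (unit_dir x))%:E = 0)%E.
Proof.
have iP i : (lebesgue_rV n.+1).-integrable setT (EFin \o P i).
  rewrite -partialG; apply: integrable_partial (@Gc i).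
  by rewrite partialG; exact: cP.
under eq_integral do rewrite -radial_cutoff_divE -sumEFin.
rewrite integral_sum//= big1// => i _.
rewrite -partialG; apply: integral_partial_eq0 (@Gc i).
- by move=> x; exact: (dG i x).1.
- by rewrite partialG; exact: cP.
Qed.

End radial_cutoff.

End divergence_theorem.

(** * From the ball to the sphere *)

Section divergence_theorem_sphere.
Context {R : realType}.
Implicit Types n : nat.

Lemma punctured_ballE m (x : 'rV[R]_m) : punctured_ball m x <-> 0 < dotv x x <= 1.
Proof.
rewrite /punctured_ball/= enorm_gt0 dotvv_gt0 -enorm_sqr.
by rewrite expr_le1// enorm_ge0.
Qed.

(** The cut-offs [zcut j] of |x|^2 converge to the indicator function of the punctured ball; every
    cut-off integral is 0 and dominated convergence applies. *)
Lemma integral_cone_surface_div n (V : 'rV[R]_n.+1 -> 'rV[R]_n.+1) :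
  (forall i, C1_sphere (fun x => V x ord0 i)) ->
  (forall x, sphere n x -> dotv (V x) x = 0) ->
  (\int[lebesgue_rV n.+1]_(x in punctured_ball n.+1)
    (surface_div V (unit_dir x))%:E = 0)%E.
Proof.
move=> CV tV; set h := surface_div V.
have [M0 hM0] := sphere_continuous_bounded (surface_div_continuous CV).
pose M := Num.max 0 M0.
have M0' : 0 <= M by rewrite le_max lexx.
have hM x : sphere n x -> `|h x| <= M.
  by move=> sx; rewrite le_max hM0// orbT.
(* A set of finite measure containing all supports: outside it |x|^2 >= 4, whereas [zcut j] vanishes
   from 1 + 1/(j+1) on. *)
pose K : set 'rV[R]_n.+1 := [set x | forall j, `[- 2, 2]%classic (x ord0 j)].
have mK : measurable K by exact: (measurable_forall_coord (A := fun=> `[- 2, 2]%classic)).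
pose f_ j (x : 'rV[R]_n.+1) : \bar R := (zcut j (dotv x x) * h (unit_dir x))%:E.
pose f : 'rV[R]_n.+1 -> \bar R :=
  (fun x => (h (unit_dir x))%:E) \_ (punctured_ball n.+1).
have jpos j : 0 < (j.+1%:R : R)^-1 by rewrite invr_gt0.
have f_K j x : ~ K x -> f_ j x = 0%E.
  move=> Kx; rewrite /f_ zcut_large ?mul0r//.
  have [i xi] : exists i, 2 < `|x ord0 i|.
    apply: contrapT => xi; apply: Kx => i /=.
    rewrite in_itv/= -ler_norml leNgt; apply/negP => xi2; apply: xi.
    by exists i.
  apply: (@le_trans _ _ (2 * 2)).
    apply: (@le_trans _ _ (1 + 1)); last by lra.
    by rewrite lerD2l invf_le1// ler1n.
  have x2 : 2 <= enorm x by rewrite (le_trans (ltW xi))// coord_le_enorm.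
  by rewrite -enorm_sqr expr2 ler_pM.
have muK : (lebesgue_rV n.+1 K < +oo)%E.
  rewrite [ltLHS](_ : _ = ((2 + 2) ^+ n.+1)%:E) ?ltry//.
  apply: lebesgue_rV_box => //.
  have H22 : (- 2 : R) < 2 by lra.
  by rewrite lebesgue_measure_itv/= lte_fin H22 -EFinD opprK.
have mf_ j : measurable_fun K (f_ j).
  apply: measurable_funTS; apply/measurable_EFinP.
  apply: continuous_measurable_rV.
  exact: (radial_cutoff_div_continuous CV tV (der_zcut j)
    (@continuous_dzcut R j) (jpos j) (@zcut_small R j)).
have f_f x : K x -> f_ ^~ x @ \oo --> f x.
  move=> _.
  have H : zcut j (dotv x x) * h (unit_dir x) @[j --> \oo] -->
      (if 0 < dotv x x <= 1 then 1 else 0) * h (unit_dir x).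
    by apply: cvgMr_tmp; exact: cvg_zcut.
  rewrite (_ : f x = ((if 0 < dotv x x <= 1 then 1 else 0) * h (unit_dir x))%:E).
    by apply: cvg_EFin => //; exact: nearW.
  rewrite /f patchE; case: ifPn => [/set_mem /punctured_ballE ->|].
    by rewrite mul1r.
  by rewrite notin_setE => /punctured_ballE /negP/negbTE ->; rewrite mul0r.
have f_M j x : K x -> (`|f_ j x| <= M%:E)%E.
  move=> _; rewrite /f_ lee_fin normrM ger0_norm ?zcut_ge0//.
  have [->|x0] := eqVneq x 0.
    by rewrite zcut_small ?mul0r// -enorm_sqr (_ : enorm _ = 0) ?expr0n ?ltW//; apply/eqP; rewrite enorm_eq0.
  by rewrite -[leRHS]mul1r ler_pM ?zcut_ge0 ?zcut_le1// hM//; exact: unit_dir_sphere.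
have iM : (lebesgue_rV n.+1).-integrable K (cst M%:E).
  apply: (bounded_integrable (M := M) mK muK) => //.
  by move=> x _; rewrite ger0_norm.
have finM x : K x -> cst M%:E x \is a fin_num by [].
have /= cvgf := dominated_cvg mK mf_ f_f finM iM f_M.
have f_0 j : (\int[lebesgue_rV n.+1]_(x in K) f_ j x = 0)%E.
  rewrite -(integral_out0 _ (f_K j)).
  exact: (integral_radial_cutoff_div CV tV (der_zcut j)
    (@continuous_dzcut R j) (jpos j) (@zcut_small R j) (@zcut_large R j)).
have f0 : (\int[lebesgue_rV n.+1]_(x in K) f x = 0)%E.
  have H0 : (fun j => \int[lebesgue_rV n.+1]_(x in K) f_ j x)%E @ \oo --> (0 : \bar R)%E.
    by rewrite (_ : (fun j => _) = cst 0%E); [exact: cvg_cst|apply/funext => j].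
  exact: (cvg_unique _ cvgf H0).
rewrite -f0 /f -integral_mkcondr; congr (integral _ _ _).
apply/seteqP; split => [x /[dup] pbx /andP[_ x1]|x []//]; split => // j /=.
rewrite in_itv/= -ler_norml (le_trans (coord_le_enorm _ _))// (le_trans x1)//.
by rewrite ler1n.
Qed.

(** The passage to the ball is available for nonnegative integrands, so it is applied to the
    positive and the negative part of the divergence, whose integrals over the ball are finite and
    equal. *)
Lemma divergence_theorem n (V : 'rV[R]_n.+1 -> 'rV[R]_n.+1) :
  (forall i, C1_sphere (fun x => V x ord0 i)) ->
  (forall x, sphere n x -> dotv (V x) x = 0) ->
  (\int[surface_measure n]_(x in sphere n) (surface_div V x)%:E = 0)%E.
Proof.
move=> CV tV; have := integral_cone_surface_div CV tV.
set h := fun x => (surface_div V x)%:E => h0.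
have ch := surface_div_continuous CV.
have mh : measurable_fun (sphere n) h.
  by apply/measurable_EFinP; exact: sphere_continuous_measurable.
have [M hM] := sphere_continuous_bounded ch.
have mpb := @measurable_punctured_ball R n.+1.
have sub x : punctured_ball n.+1 x -> sphere n (@unit_dir R n.+1 x).
  by move=> /andP[x0 _]; apply: unit_dir_sphere; rewrite -enorm_gt0.
have ih : (lebesgue_rV n.+1).-integrable (punctured_ball n.+1) (h \o @unit_dir R n.+1).
  apply: (bounded_integrable (M := M) mpb) => //.
  - exact: lebesgue_punctured_ball_lty.
  - apply: (measurable_comp (F := sphere n)).
    + exact: measurable_sphere.
    + by move=> _ [x /sub + <-].
    + exact: sphere_continuous_measurable.
    + by apply: measurable_funTS; exact: measurable_unit_dir.
  - by move=> x /sub; exact: hM.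
have Ep := ge0_surface_integral (measurable_funepos mh) (fun x _ => funepos_ge0 h x).
have En := ge0_surface_integral (measurable_funeneg mh) (fun x _ => funeneg_ge0 h x).
have fn : (\int[lebesgue_rV n.+1]_(x in punctured_ball n.+1) h^\- (unit_dir x))%E \is a fin_num.
  have := integrable_fin_num mpb (integrable_funeneg mpb ih).
  by rewrite funeneg_comp.
rewrite integralE Ep En.
have fp : (\int[lebesgue_rV n.+1]_(x in punctured_ball n.+1) h^\+ (unit_dir x))%E \is a fin_num.
  have := integrable_fin_num mpb (integrable_funepos mpb ih).
  by rewrite funepos_comp.
have := integralE (lebesgue_rV n.+1) (punctured_ball n.+1) (h \o @unit_dir R n.+1).
rewrite [X in X = _ -> _]h0 funepos_comp funeneg_comp => /esym/eqP.
rewrite sube_eq ?fin_num_adde_defl//.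
rewrite add0e => /eqP /= ->.
by rewrite subee// fin_numM.
Qed.

End divergence_theorem_sphere.

Section derive_diff.
Context {R : realType} {V : normedModType R}.
Implicit Types (f g : V -> R) (x v : V).

Lemma differentiable_D f g x : differentiable f x -> differentiable g x ->
  differentiable (fun z => f z + g z) x.
Proof. exact: differentiableD. Qed.

Lemma differentiable_M f g x : differentiable f x -> differentiable g x ->
  differentiable (fun z => f z * g z) x.
Proof. exact: differentiableM. Qed.

Lemma derive_D f g x v : differentiable f x -> differentiable g x ->
  'D_v (fun z => f z + g z) x = 'D_v f x + 'D_v g x.
Proof. by move=> df dg; exact: (deriveD (diff_derivable df) (diff_derivable dg)). Qed.

Lemma derive_M f g x v : differentiable f x -> differentiable g x ->
  'D_v (fun z => f z * g z) x = 'D_v f x * g x + f x * 'D_v g x.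
Proof.
move=> df dg.
have -> : 'D_v (fun z => f z * g z) x = _ := deriveM (diff_derivable df) (diff_derivable dg).
by rewrite !scaleRE addrC mulrC.
Qed.

Lemma derive_cst_fun (c : R) x v : 'D_v (fun _ : V => c) x = 0.
Proof. exact: derive_cst. Qed.

Lemma derive_Ml (c : R) f x v : differentiable f x ->
  'D_v (fun z => c * f z) x = c * 'D_v f x.
Proof.
move=> df; rewrite derive_M//.
by rewrite derive_cst_fun mul0r add0r.
Qed.

End derive_diff.

Lemma near_eq_continuous_at (T U : topologicalType) (f g : T -> U) (x : T) :
  (\forall y \near x, f y = g y) -> {for x, continuous f} -> {for x, continuous g}.
Proof.
move=> fg cf.
suff : g y @[y --> x] --> g x by [].
rewrite -(nbhs_singleton fg); apply: cvg_trans cf.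
by apply: near_eq_cvg; apply: filterS fg => y ->.
Qed.

(** * A class of smooth functions; the meridian field *)

Section smooth_functions.
Context {R : realType}.
Implicit Types m n : nat.

Lemma smooth_differentiable m (f : 'rV[R]_m -> R) x : smooth f -> differentiable f x.
Proof.
move=> sf; apply: differentiable_continuous_partial.
  by move=> i y; have [_ /(_ i y)] := sf [::].
by move=> i; have [cf _] := sf [:: i]; exact: cf.
Qed.

(** Iterated partial derivatives never leave a class closed under partial derivatives, so smoothness
    reduces to first-order differentiability of its members. *)
Lemma smooth_class m (C : set ('rV[R]_m -> R)) :
  (forall f, C f -> (forall x, differentiable f x) /\ forall i, C (partial i f)) ->
  forall f, C f -> smooth f.
Proof.
move=> CP f Cf s; have : C (foldr (@partial R m) f s).
  by elim: s => [|i s IH] //=; exact: (CP _ IH).2.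
move=> /CP[dg _]; split => [x|i x]; first exact: differentiable_continuous.
exact: diff_derivable.
Qed.

(** Closed under partial derivatives and rich enough for all test functions and fields below:
    coordinates give the meridian field, real powers the normalising factor of the flow,
    exponentials the approximate indicator functions. *)
Inductive elem m : ('rV[R]_m -> R) -> Prop :=
| elem_cst (c : R) : elem (fun=> c)
| elem_coord i : elem (fun x => x ord0 i)
| elem_add f g : elem f -> elem g -> elem (fun x => f x + g x)
| elem_mul f g : elem f -> elem g -> elem (fun x => f x * g x)
| elem_exp f : elem f -> elem (fun x => expR (f x))
| elem_powR f p : (forall x, 0 < f x) -> elem f -> elem (fun x => f x `^ p).

Lemma elem_differentiable m (f : 'rV[R]_m -> R) : elem f ->
  (forall x, differentiable f x) /\ forall i, elem (partial i f).
Proof.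
elim => {f} [c|i|f g _ [df pf] _ [dg pg]|f g ef [df pf] eg [dg pg]|f ef [df pf]|f p f0 ef [df pf]].
- split => [x|i]; first exact: differentiable_cst.
  rewrite (_ : partial i _ = fun=> 0); first exact: elem_cst.
  by apply/funext => x; rewrite /partial derive_cst_fun.
- split => [x|j]; first exact: differentiable_coord.
  rewrite (_ : partial j _ = fun=> (delta_mx ord0 j : 'rV[R]_m) ord0 i); first exact: elem_cst.
  by apply/funext => x; rewrite /partial derive_coord.
- split => [x|i]; first exact: differentiable_D.
  rewrite (_ : partial i _ = fun x => partial i f x + partial i g x).
    exact: elem_add.
  by apply/funext => x; rewrite /partial derive_D.
- split => [x|i]; first exact: differentiable_M.
  rewrite (_ : partial i _ = fun x => partial i f x * g x + f x * partial i g x).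
    by apply: elem_add; exact: elem_mul.
  by apply/funext => x; rewrite /partial derive_M.
- have dE x := is_derive_expR (f x).
  split => [x|i]; first exact: differentiable_comp1 (df x) (dE x).
  rewrite (_ : partial i _ = fun x => expR (f x) * partial i f x).
    by apply: elem_mul => //; exact: elem_exp.
  by apply/funext => x; rewrite /partial (derive_comp1 _ (df x) (dE x)).
- have dE x := is_derive1_powR p (f0 x).
  split => [x|i]; first exact: differentiable_comp1 (df x) (dE x).
  rewrite (_ : partial i _ = fun x => p * f x `^ (p - 1) * partial i f x).
    apply: elem_mul => //; apply: elem_mul; first exact: elem_cst.
    exact: elem_powR.
  by apply/funext => x; rewrite /partial (derive_comp1 _ (df x) (dE x)).
Qed.

Lemma elem_smooth m (f : 'rV[R]_m -> R) : elem f -> smooth f.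
Proof. by apply: smooth_class => g /elem_differentiable. Qed.

Lemma elem_sum m (I : Type) (r : seq I) (f : I -> 'rV[R]_m -> R) :
  (forall i, elem (f i)) -> elem (fun x => \sum_(i <- r) f i x).
Proof.
move=> ef; elim: r => [|i r IH].
  by rewrite (_ : (fun x => _) = fun=> 0); [exact: elem_cst|apply/funext => x; rewrite big_nil].
rewrite (_ : (fun x => _) = fun x => f i x + \sum_(j <- r) f j x); first exact: elem_add.
by apply/funext => x; rewrite big_cons.
Qed.

Lemma elem_prod m (I : Type) (r : seq I) (f : I -> 'rV[R]_m -> R) :
  (forall i, elem (f i)) -> elem (fun x => \prod_(i <- r) f i x).
Proof.
move=> ef; elim: r => [|i r IH].
  by rewrite (_ : (fun x => _) = fun=> 1); [exact: elem_cst|apply/funext => x; rewrite big_nil].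
rewrite (_ : (fun x => _) = fun x => f i x * \prod_(j <- r) f j x); first exact: elem_mul.
by apply/funext => x; rewrite big_cons.
Qed.

Lemma elem_dotvl m (y : 'rV[R]_m) : elem (fun x => dotv x y).
Proof.
apply: elem_sum => i; apply: elem_mul; [exact: elem_coord|exact: elem_cst].
Qed.

Lemma elem_comp m (f : 'rV[R]_m -> R) (h : 'I_m -> 'rV[R]_m -> R) :
  elem f -> (forall i, elem (h i)) -> elem (fun x => f (\row_i h i x)).
Proof.
move=> ef eh; elim: ef => {f} [c|i|f g _ IHf _ IHg|f g _ IHf _ IHg|f _ IH|f p f0 _ IH].
- exact: elem_cst.
- by rewrite (_ : (fun x => _) = h i)//; apply/funext => x; rewrite mxE.
- exact: elem_add.
- exact: elem_mul.
- exact: elem_exp.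
- by apply: elem_powR.
Qed.

(** Differentiability around each point makes the notion stable under products: the product rule
    must hold near the point before the partial derivatives of a product can be seen to be
    continuous there. *)
Definition C1_near_sphere n (f : 'rV[R]_n.+1 -> R) : Prop := forall x, sphere n x ->
  (\forall y \near x, differentiable f y) /\ forall i, {for x, continuous (partial i f)}.

Lemma C1_near_C1 n (f : 'rV[R]_n.+1 -> R) : C1_near_sphere f -> C1_sphere f.
Proof. by move=> Cf x /Cf[/nbhs_singleton]. Qed.

Lemma smooth_C1 n (f : 'rV[R]_n.+1 -> R) : smooth f -> C1_near_sphere f.
Proof.
move=> sf x sx; split.
  exact: (@filterE _ (nbhs x) _ _ (fun y => smooth_differentiable y sf)).
by move=> i; have [cf _] := sf [:: i]; exact: cf.
Qed.

Lemma C1_nearM n (f g : 'rV[R]_n.+1 -> R) : C1_near_sphere f -> C1_near_sphere g ->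
  C1_near_sphere (fun x => f x * g x).
Proof.
move=> Cf Cg x sx; have [df cf] := Cf x sx; have [dg cg] := Cg x sx.
split.
  by apply: filterS2 df dg => y; exact: differentiable_M.
have cfx := differentiable_continuous (nbhs_singleton df).
have cgx := differentiable_continuous (nbhs_singleton dg).
move=> i.
have E : \forall y \near x, partial i f y * g y + f y * partial i g y =
    partial i (fun x => f x * g x) y.
  by apply: filterS2 df dg => y dfy dgy; rewrite /partial derive_M.
have c : {for x, continuous (fun y => partial i f y * g y + f y * partial i g y)}.
  by apply: catD; apply: catM => //.
exact: near_eq_continuous_at E c.
Qed.

(** On the sphere |t| <= 1 with equality at the poles, and nearby ambient points have slightly
    larger |t|; hence the interval of radius r > 1. *)
Lemma C1_near_dotv n (Phi : 'rV[R]_n.+1) (g dg : R -> R) (r : R) : sphere n Phi -> 1 < r ->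
  (forall s : R, `|s| < r -> is_derive s (1 : R) g (dg s)) ->
  (forall s, `|s| < r -> {for s, continuous dg}) ->
  C1_near_sphere (fun x => g (dotv x Phi)).
Proof.
move=> sPhi r1 gE cdg x sx.
have xr : `|dotv x Phi| < r.
  by rewrite (le_lt_trans (dotv_cauchy _ _))// sx sPhi mulr1.
have near_r : \forall y \near x, `|dotv y Phi| < r.
  have := @continuous_dotvl R n.+1 Phi x; move/cvgrPdist_lt.
  move=> /(_ (r - `|dotv x Phi|)); rewrite subr_gt0 => /(_ xr); apply: filterS => y.
  move=> xy; rewrite -(subrK (dotv x Phi) (dotv y Phi)).
  by rewrite (le_lt_trans (ler_normD _ _))// distrC -ltrBrDr.
split.
  apply: filterS near_r => y yr.
  exact: (differentiable_comp1 (differentiable_dotvl y Phi) (gE _ yr)).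
move=> i.
have E : \forall y \near x, dg (dotv y Phi) * dotv (delta_mx ord0 i) Phi =
    partial i (fun x => g (dotv x Phi)) y.
  apply: filterS near_r => y yr.
  by rewrite /partial (derive_comp1 _ (differentiable_dotvl y Phi) (gE _ yr)) derive_dotvl.
have c : {for x, continuous (fun y => dg (dotv y Phi) * dotv (delta_mx ord0 i) Phi)}.
  apply: catM; last exact: cat_cst.
  apply: (@cat_comp _ _ (fun y => dotv y Phi) dg); first exact: continuous_dotvl.
  exact: cdg.
exact: near_eq_continuous_at E c.
Qed.

(** In the projected trace the derivatives of f appear multiplied by V x . x = 0, so only the full
    derivative of f along V survives. *)
Lemma surface_divM n (f : 'rV[R]_n.+1 -> R) (V : 'rV[R]_n.+1 -> 'rV[R]_n.+1) x :
  dotv (V x) x = 0 -> differentiable f x ->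
  (forall i, differentiable (fun y => V y ord0 i) x) ->
  surface_div (fun y => f y *: V y) x = 'D_(V x) f x + f x * surface_div V x.
Proof.
move=> Vx df dV; rewrite /surface_div.
have pE i j : partial j (fun y => (f y *: V y) ord0 i) x =
    partial j f x * V x ord0 i + f x * partial j (fun y => V y ord0 i) x.
  rewrite (_ : (fun y => (f y *: V y) ord0 i) = (fun y => f y * V y ord0 i)).
    by rewrite /partial derive_M.
  by apply/funext => y; rewrite mxE.
under eq_bigr do rewrite pE.
under [X in _ - X]eq_bigr do under eq_bigr do rewrite pE mulrDr.
under [X in _ - X]eq_bigr do rewrite big_split.
rewrite /= !big_split/= derive_partial// mulrBr !mulr_sumr.
under [in RHS]eq_bigr do rewrite mulrC.
have -> : \sum_(i < n.+1) \sum_(j < n.+1)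
    x ord0 i * x ord0 j * (partial j f x * V x ord0 i) = 0.
  rewrite exchange_big/= big1// => j _.
  rewrite (eq_bigr (fun i => (x ord0 j * partial j f x) * (V x ord0 i * x ord0 i))).
    by rewrite -mulr_sumr -/(dotv (V x) x) Vx mulr0.
  by move=> i _; ring.
rewrite add0r -!addrA; congr (_ + (_ - _)).
apply: eq_bigr => i _; rewrite mulr_sumr; apply: eq_bigr => j _.
by rewrite mulrCA.
Qed.

(** On the sphere this is the tangential projection of [Phi], that is, the surface gradient of t =
    [dotv x Phi]. *)
Definition meridian n (Phi x : 'rV[R]_n.+1) : 'rV[R]_n.+1 := Phi - dotv x Phi *: x.

Section meridian.
Variables (n : nat) (Phi : 'rV[R]_n.+1).
Hypothesis sPhi : sphere n Phi.
Local Notation X0 := (meridian Phi).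
Implicit Type x : 'rV[R]_n.+1.

Lemma meridian_tangent x : sphere n x -> dotv (X0 x) x = 0.
Proof.
move=> /sphereE sx.
by rewrite /meridian dotvDl dotvNl dotvZl sx mulr1 dotvC subrr.
Qed.

Lemma dotv_meridian (V x : 'rV[R]_n.+1) : dotv V x = 0 -> dotv V (X0 x) = dotv V Phi.
Proof. by move=> Vx; rewrite /meridian dotvDr dotvNr dotvZr Vx mulr0 oppr0 addr0. Qed.

Lemma dotv_meridian_Phi x : dotv (X0 x) Phi = 1 - dotv x Phi ^+ 2.
Proof.
by rewrite /meridian dotvDl dotvNl dotvZl (sphereE Phi).1// expr2.
Qed.

Lemma enorm_meridian x : sphere n x -> enorm (X0 x) ^+ 2 = 1 - dotv x Phi ^+ 2.
Proof.
move=> sx; rewrite enorm_sqr dotv_meridian ?meridian_tangent//.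
exact: dotv_meridian_Phi.
Qed.

Lemma elem_meridian i : elem (fun x => X0 x ord0 i).
Proof.
rewrite (_ : (fun x => _) = (fun x => Phi ord0 i + (-1) * (dotv x Phi * x ord0 i))).
  apply: elem_add; first exact: elem_cst.
  apply: elem_mul; first exact: elem_cst.
  by apply: elem_mul; [exact: elem_dotvl|exact: elem_coord].
by apply/funext => x; rewrite !mxE mulN1r.
Qed.

(** Equivalently, t is an eigenfunction of the Laplacian of the sphere, with eigenvalue -n. *)
Lemma surface_div_meridian x : sphere n x ->
  surface_div X0 x = - (n%:R * dotv x Phi).
Proof.
move=> sx.
have pE i j : partial j (fun y => X0 y ord0 i) x =
    - (Phi ord0 j * x ord0 i + dotv x Phi * (i == j)%:R).
  rewrite (_ : (fun y => _) = (fun y => Phi ord0 i + (-1) * (dotv y Phi * y ord0 i))).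
    have dt := differentiable_dotvl x Phi.
    have dc : differentiable (fun y : 'rV[R]_n.+1 => y ord0 i) x by exact: differentiable_coord.
    rewrite /partial derive_D; last 2 first.
      exact: differentiable_cst.
      by apply: differentiable_M; [exact: differentiable_cst|exact: differentiable_M].
    rewrite derive_cst_fun add0r derive_Ml; last exact: differentiable_M.
    rewrite derive_M// derive_dotvl derive_coord mulN1r delta_mx_coord.
    rewrite (_ : dotv (delta_mx _ _) _ = Phi ord0 j)//.
    rewrite /dotv (bigD1 j)//= delta_mx_coord eqxx mul1r big1 ?addr0// => l lj.
    by rewrite delta_mx_coord (negbTE lj) mul0r.
  by apply/funext => y; rewrite !mxE mulN1r.
rewrite /surface_div.
under eq_bigr do rewrite pE eqxx mulr1.
under [X in _ - X]eq_bigr do under eq_bigr do rewrite pE.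
rewrite sumrN big_split/= sumr_const card_ord.
rewrite (_ : \sum_i Phi ord0 i * x ord0 i = dotv x Phi); last by rewrite dotvC.
set S := (X in _ - X).
have -> : S = - (dotv x Phi + dotv x Phi).
  rewrite /S.
  have inner i : \sum_(j < n.+1) x ord0 i * x ord0 j *
      - (Phi ord0 j * x ord0 i + dotv x Phi * (i == j)%:R) =
      - (dotv x Phi * (x ord0 i * x ord0 i) + dotv x Phi * (x ord0 i * x ord0 i)).
    rewrite (eq_bigr (fun j => - ((x ord0 i * x ord0 i) * (x ord0 j * Phi ord0 j) +
        dotv x Phi * (x ord0 i * x ord0 j * (i == j)%:R)))); last by move=> j _; ring.
    rewrite sumrN big_split/= -!mulr_sumr -/(dotv x Phi); congr (- (_ + _ * _)).
      by rewrite mulrC.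
    rewrite (bigD1 i)//= eqxx mulr1 big1 ?addr0// => j ji.
    by rewrite eq_sym (negbTE ji) mulr0.
  under eq_bigr do rewrite inner.
  by rewrite sumrN big_split/= -mulr_sumr -/(dotv x x) (sphereE x).1// mulr1.
by rewrite mulrS -mulr_natl; ring.
Qed.

End meridian.
End smooth_functions.

Lemma cvg_eq_lim (R : realType) (u v : nat -> \bar R) (l l' : \bar R) :
  u @ \oo --> l -> v @ \oo --> l' -> (forall k, u k = v k) -> l = l'.
Proof.
move=> ul vl /funext uv; rewrite -uv in vl.
by rewrite -(cvg_lim (@ereal_hausdorff R) ul) -(cvg_lim (@ereal_hausdorff R) vl).
Qed.

(** * Uniqueness of the weak gradient *)

Section elementary_separation.
Context {R : realType}.

Definition upper_cell m (a : 'I_m -> R) : set 'rV[R]_m := [set x | forall i, a i < x ord0 i].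

Lemma measurable_upper_cell m (a : 'I_m -> R) : measurable (upper_cell a).
Proof.
rewrite (_ : upper_cell a = [set x | forall j, `]a j, +oo[%classic (x ord0 j)]).
  have := @measurable_forall_coord R m (fun j => `]a j, +oo[%classic); apply.
  by move=> j; exact: measurable_itv.
by apply/seteqP; split => x /= xa j; have := xa j; rewrite /= in_itv/= andbT.
Qed.

(** The cells form a generating system stable under intersection, which is what a Dynkin argument
    requires. *)
Lemma measurable_rVE m :
  @measurable _ 'rV[R]_m = <<s [set A | exists a, A = @upper_cell m a] >>.
Proof.
set G := [set A | _].
apply/seteqP; split => A; last first.
  apply: smallest_sub; first exact: sigma_algebra_measurable.
  by move=> _ [a ->]; exact: measurable_upper_cell.
suff mid : @measurable_fun _ _ (g_sigma_algebraType G) 'rV[R]_m setT id.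
  by move=> mA; have := mid measurableT A mA; rewrite setTI preimage_id.
apply: measurable_fun_rV => i.
suff : @measurable_fun _ _ (g_sigma_algebraType G) (measurableTypeR R) setT
    (fun t : 'rV[R]_m => t ord0 i) by [].
apply: (measurability _ (RGenOInfty.measurableE R)).
move=> _ [_ [r ->] <-]; rewrite setTI.
(* A half-space is exhausted by cells whose bounds in all other coordinates tend to -oo. *)
rewrite (_ : _ @^-1` _ = \bigcup_k
    upper_cell (fun j => if j == i then r else - k%:R)); last first.
  apply/seteqP; split => x /=; rewrite in_itv/= andbT.
    move=> rx; exists (Num.bound (\sum_j `|x ord0 j|)) => // j /=.
    case: eqP => [->//|_]; rewrite ltrNl.
    have := archi_boundP (sumr_ge0 (index_enum 'I_m) (P := xpredT) (fun j _ => normr_ge0 (x ord0 j))).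
    apply: le_lt_trans; rewrite (bigD1 j)//=.
    by rewrite (le_trans (ler_norm _))// normrN lerDl sumr_ge0.
  by move=> [k _ /(_ i)]; rewrite eqxx.
apply: bigcupT_measurable => k; apply: sub_sigma_algebra.
by exists (fun j => if j == i then r else - k%:R).
Qed.

(* As k tends to infinity, k - k^2 c tends to -oo when c > 0 and to +oo when
   c <= 0, so the [soft_step]s are smooth approximations of the indicator
   function of ]0, +oo[; this avoids bump functions. *)
Definition soft_step (c : R) (k : nat) : R := expR (- expR (k%:R - k%:R ^+ 2 * c)).

Lemma cvg_soft_step (c : R) : soft_step c @ \oo --> ((0 < c)%R%:R : R).
Proof.
have [c0|c0] := ltrP 0 c.
  (* As soon as k c >= 2, the inner exponential is at most exp(-k) <= 1/(k+1), and exp(-y) >= 1 -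
     y. *)
  apply: (@squeeze_cvgr _ _ _ _ (fun k => 1 - harmonic k) (fun=> 1)); last exact: cvg_cst.
    near=> k; rewrite expR_le1 oppr_le0 expR_ge0 andbT.
    rewrite (le_trans _ (expR_ge1Dx _))// lerD2l lerN2.
    have kc : 2 <= k%:R * c.
      rewrite -ler_pdivrMr//; near: k; exact: nbhs_infty_ger.
    rewrite (@le_trans _ _ (expR (- k%:R)))//.
      rewrite ler_expR -subr_ge0.
      rewrite (_ : _ - _ = k%:R * (k%:R * c - 2)); last ring.
      by rewrite mulr_ge0// subr_ge0.
    rewrite expRN /harmonic/= lef_pV2 ?posrE ?expR_gt0//.
    by rewrite (le_trans _ (expR_ge1Dx _))// -natr1 addrC.
  rewrite -[X in _ --> X]subr0; apply: cvgB; [exact: cvg_cst|exact: cvg_harmonic].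
apply: (@squeeze_cvgr _ _ _ _ (fun=> 0) harmonic); [|exact: cvg_cst|exact: cvg_harmonic].
near=> k; rewrite expR_ge0/= /soft_step expRN /harmonic/= lef_pV2 ?posrE ?expR_gt0//.
rewrite (le_trans _ (expR_ge1Dx _))// -natr1 addrC lerD2l.
rewrite (le_trans _ (expR_ge1Dx _))//.
have : 0 <= k%:R ^+ 2 * - c by rewrite mulr_ge0 ?sqr_ge0// oppr_ge0.
by rewrite mulrN; have := ler0n R k; lra.
Unshelve. all: by end_near. Qed.

Lemma cvg_prodr (I : Type) (r : seq I) (u : I -> nat -> R) (l : I -> R) :
  (forall i, u i @ \oo --> l i) ->
  (fun k => \prod_(i <- r) u i k) @ \oo --> \prod_(i <- r) l i.
Proof.
move=> ul; elim: r => [|i r IH].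
  by under eq_fun do rewrite big_nil; rewrite big_nil; exact: cvg_cst.
by under eq_fun do rewrite big_cons; rewrite big_cons; exact: cvgM.
Qed.

Definition soft_cell m (a : 'I_m -> R) (k : nat) (x : 'rV[R]_m) : R :=
  \prod_(i < m) soft_step (x ord0 i - a i) k.

Lemma elem_soft_cell m (a : 'I_m -> R) k : elem (soft_cell a k).
Proof.
apply: elem_prod => i; apply: elem_exp.
rewrite (_ : (fun x : 'rV[R]_m => - _) = (fun x : 'rV[R]_m => (-1) *
    expR (k%:R + - k%:R ^+ 2 * (x ord0 i + - a i)))); last first.
  by apply/funext => x; rewrite mulN1r mulNr.
apply: elem_mul; first exact: elem_cst.
apply/elem_exp/elem_add; first exact: elem_cst.
apply: elem_mul; first exact: elem_cst.
by apply: elem_add; [exact: elem_coord|exact: elem_cst].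
Qed.

Lemma soft_cell01 m (a : 'I_m -> R) k x : 0 <= soft_cell a k x <= 1.
Proof.
rewrite prodr_ge0/= => [|i _]; last exact: expR_ge0.
rewrite -[leRHS](@big1 _ _ *%R _ (index_enum 'I_m) xpredT (fun=> 1))//.
by apply: ler_prod => i _; rewrite expR_ge0 expR_le1 oppr_le0 expR_ge0.
Qed.

Lemma cvg_soft_cell m (a : 'I_m -> R) x :
  soft_cell a ^~ x @ \oo --> (\1_(upper_cell a) x : R).
Proof.
rewrite (_ : \1_ _ x = \prod_(i < m) ((0 < x ord0 i - a i)%R%:R : R)).
  by apply: cvg_prodr => i; exact: cvg_soft_step.
rewrite indicE; have [/set_mem xa|/negP xa] := boolP (x \in upper_cell a).
  by rewrite big1// => i _; rewrite subr_gt0 xa.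
have [i xai] : exists i, ~~ (a i < x ord0 i).
  apply/not_existsP => h; apply: xa; rewrite inE => i.
  by apply/negPn/negP; exact: h.
by rewrite (bigD1 i)//= subr_gt0 (negbTE xai) mul0r.
Qed.

Section separation.
Context {d : measure_display} {W : measurableType d} (mu : {measure set W -> \bar R}).
Variables (D : set W) (m : nat).
Hypothesis mD : measurable D.

Let cell_cvg (T : W -> 'rV[R]_m) (f : W -> R) a : measurable_fun setT T ->
  mu.-integrable D (EFin \o f) ->
  (\int[mu]_(x in D) (f x * soft_cell a k (T x))%:E)%E @[k --> \oo] -->
  (\int[mu]_(x in D `&` T @^-1` (upper_cell a)) (f x)%:E)%E.
Proof.
move=> mT fi.
have mc k : measurable_fun D (fun x => soft_cell a k (T x)).
  apply: measurable_funTS; apply: measurableT_comp => //.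
  apply: continuous_measurable_rV => x.
  by apply: differentiable_continuous; have [h _] := elem_differentiable (elem_soft_cell a k).
have mf : measurable_fun D f by apply/measurable_EFinP; case/integrableP : fi.
have mTa : measurable (T @^-1` (upper_cell a)).
  by rewrite -[X in measurable X]setTI; apply: mT => //; exact: measurable_upper_cell.
rewrite (_ : \int[mu]_(x in D `&` _) _ = \int[mu]_(x in D) (f x * \1_(upper_cell a) (T x))%:E)%E.
  apply: (@dominated_cvg _ _ _ mu D mD _ _ (fun x => `|(f x)%:E|%E)).
  - by move=> k; apply/measurable_EFinP; exact: measurable_funM.
  - move=> x _; apply: cvg_EFin; first by near=> k.
    by apply: cvgMr; exact: cvg_soft_cell.
  - by move=> x _; rewrite abse_fin_num.
  - exact: integrable_abse.
  - move=> k x _; have /andP[h0 h1] := soft_cell01 a k (T x).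
    by rewrite abse_EFin lee_fin normrM (ger0_norm h0) ler_piMr.
rewrite integral_mkcondr; apply: eq_integral => x _.
rewrite patchE indicE (_ : (x \in _) = (T x \in upper_cell a)); last first.
  by apply/idP/idP; rewrite !inE.
by case: ifP => _; rewrite ?mulr1 ?mulr0.
Unshelve. all: by end_near. Qed.

(** The functions [soft_cell] are in [elem] and converge to indicator functions of cells, so the
    hypothesis yields the equality on cells by dominated convergence; a Dynkin argument extends it
    to all measurable sets. With T1 = T2 = id this separates densities, with T1 a flow map and T2 =
    id it gives a change of variables. *)
Lemma elem_separation (T1 T2 : W -> 'rV[R]_m) (f1 f2 : W -> R) :
  measurable_fun setT T1 -> measurable_fun setT T2 ->
  mu.-integrable D (EFin \o f1) -> mu.-integrable D (EFin \o f2) ->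
  (forall phi, elem phi -> (forall x, (0 <= phi x <= 1)%R) ->
     \int[mu]_(x in D) (f1 x * phi (T1 x))%:E =
     \int[mu]_(x in D) (f2 x * phi (T2 x))%:E)%E ->
  forall A, measurable A ->
    (\int[mu]_(x in D `&` T1 @^-1` A) (f1 x)%:E =
     \int[mu]_(x in D `&` T2 @^-1` A) (f2 x)%:E)%E.
Proof.
move=> mT1 mT2 i1 i2 E.
have mpre (T : W -> 'rV[R]_m) A : measurable_fun setT T -> measurable A ->
    measurable (D `&` T @^-1` A).
  by move=> mT mA; apply: measurableI => //; rewrite -[X in measurable X]setTI; exact: mT.
pose P A := (\int[mu]_(x in D `&` T1 @^-1` A) (f1 x)%:E =
     \int[mu]_(x in D `&` T2 @^-1` A) (f2 x)%:E)%E.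
have PT : P setT.
  rewrite /P !preimage_setT !setIT.
  have := E (fun=> 1) (elem_cst m 1) (fun=> introT andP (conj ler01 (lexx 1))).
  by under eq_integral do rewrite mulr1; under [X in _ = X -> _]eq_integral do rewrite mulr1.
suff : forall A, <<s [set A | exists a, A = @upper_cell m a] >> A -> P A.
  by rewrite -measurable_rVE.
apply: (@dynkin_induction _ 'rV[R]_m [set A | exists a, A = @upper_cell m a] P) => //.
- exact: measurable_rVE.
- move=> _ _ [a ->] [b ->]; exists (fun i => Num.max (a i) (b i)).
  apply/seteqP; split => x /=.
    by move=> [xa xb] i; rewrite gt_max xa xb.
  by move=> x_ab; split => i; have := x_ab i; rewrite gt_max => /andP[].
- move=> _ [a ->]; rewrite /P.
  apply: (cvg_eq_lim (@cell_cvg T1 f1 a mT1 i1) (@cell_cvg T2 f2 a mT2 i2)) => k.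
  by apply: E; [exact: elem_soft_cell|exact: soft_cell01].
- move=> A mA PA; rewrite /P.
  have split_compl (T : W -> 'rV[R]_m) (f : W -> R) : measurable_fun setT T ->
      mu.-integrable D (EFin \o f) ->
      (\int[mu]_(x in D `&` T @^-1` (~` A)) (f x)%:E =
       \int[mu]_(x in D `&` T @^-1` setT) (f x)%:E -
       \int[mu]_(x in D `&` T @^-1` A) (f x)%:E)%E.
    move=> mT fi.
    have mf : measurable_fun D (EFin \o f) by case/integrableP : fi.
    have iA : mu.-integrable (D `&` T @^-1` A) (EFin \o f).
      by apply: (integrableS mD) => //; exact: mpre.
    rewrite preimage_setT setIT.
    rewrite -{2}[D](setIT D) -(setUv (T @^-1` A)) setIUr integral_setU; last 4 first.
    - exact: mpre.
    - exact: (mpre T (~` A) mT (measurableC mA)).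
    - by rewrite -setIUr setUv setIT.
    - by apply/disj_setPS => x [[_ ?] [_]].
    rewrite addeAC subee ?add0e//.
    exact: (integrable_fin_num (mpre T A mT mA) iA).
  by rewrite (split_compl T1)// (split_compl T2)// PA PT.
- move=> F mF tF PF; rewrite /P.
  have bigc (T : W -> 'rV[R]_m) (f : W -> R) : measurable_fun setT T ->
      mu.-integrable D (EFin \o f) ->
      (\int[mu]_(x in D `&` T @^-1` (\bigcup_k F k)) (f x)%:E =
      \sum_(0 <= k <oo) \int[mu]_(x in D `&` T @^-1` F k) (f x)%:E)%E.
    move=> mT fi; rewrite preimage_bigcup setI_bigcupr integral_bigcup//.
    - move=> i j _ _ [x [[_ xi] [_ xj]]]; apply: tF => //; by exists (T x).
    - by move=> k; exact: mpre.
    - apply: (integrableS mD) => //.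
        by apply: bigcupT_measurable => k; exact: mpre.
      by move=> x [k _ []].
  rewrite (bigc T1)// (bigc T2)//; congr (limn _).
  by apply/funext => k; apply: eq_bigr => i _; exact: PF.
Qed.

End separation.

End elementary_separation.

(** * Fubini's theorem over an interval of parameters *)

Section fubini_itv.
Context {R : realType} {d : measure_display} {W : measurableType d}.
Variables (mu : {sigma_finite_measure set W -> \bar R}) (D : set W) (a b : R) (f : W -> R -> R).
Hypothesis mD : measurable D.
Hypothesis mf : measurable_fun setT (fun p : W * measurableTypeR R => f p.1 p.2).
Let I : set (measurableTypeR R) := `[a, b]%classic.
(** Extension by 0 turns iterated integrals over D and [a, b] into iterated integrals over the whole
    spaces. *)
Let F : W * measurableTypeR R -> \bar R := (fun p => (f p.1 p.2)%:E) \_ (D `*` I).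

Let mI : measurable I. Proof. exact: measurable_itv. Qed.

Let mF : measurable_fun setT F.
Proof.
apply/(measurable_restrictT _ (measurableX mD mI)); apply: measurable_funTS.
exact/measurable_EFinP.
Qed.

Let FE x r : F (x, r) = ((fun x => ((fun r => (f x r)%:E) \_ I) r) \_ D) x.
Proof.
rewrite /F !patchE/=.
have -> : ((x, r) \in D `*` I) = (x \in D) && (r \in I).
  by apply/idP/andP; rewrite !inE.
by case: (x \in D).
Qed.

Let F1 x : (\int[lebesgue_measure]_r F (x, r) =
  ((fun x => \int[lebesgue_measure]_(r in I) (f x r)%:E) \_ D) x)%E.
Proof.
rewrite patchE; under eq_integral do rewrite FE patchE.
case: ifP => _; first by rewrite -integral_mkcond.
exact: integral0.
Qed.

Let F2 r : (\int[mu]_x F (x, r) =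
  ((fun r => \int[mu]_(x in D) (f x r)%:E) \_ I) r)%E.
Proof.
rewrite patchE; under eq_integral do rewrite FE.
rewrite -integral_mkcond; under eq_integral do rewrite patchE.
by case: ifP => // _; exact: integral0.
Qed.

Lemma ge0_fubini_itv : (forall x r, 0 <= f x r) ->
  (\int[mu]_(x in D) \int[lebesgue_measure]_(r in `[a, b]) (f x r)%:E =
   \int[lebesgue_measure]_(r in `[a, b]) \int[mu]_(x in D) (f x r)%:E)%E.
Proof.
move=> f0; rewrite integral_mkcond [RHS]integral_mkcond.
transitivity (\int[mu]_x \int[lebesgue_measure]_r F (x, r))%E.
  by apply: eq_integral => x _; rewrite F1.
transitivity (\int[lebesgue_measure]_r \int[mu]_x F (x, r))%E.
  apply: fubini_tonelli => // p; rewrite /F patchE; case: ifP => // _.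
  by rewrite lee_fin.
by apply: eq_integral => r _; rewrite F2.
Qed.

Lemma measurable_integral_itv : (forall x r, 0 <= f x r) ->
  measurable_fun D (fun x => \int[lebesgue_measure]_(r in `[a, b]) (f x r)%:E)%E /\
  measurable_fun `[a, b] (fun r : measurableTypeR R => \int[mu]_(x in D) (f x r)%:E)%E.
Proof.
move=> f0; have F0 q : (0 <= F q)%E.
  by rewrite /F patchE; case: ifP => // _; rewrite lee_fin.
have m1 := @measurable_fun_fubini_tonelli_F _ _ _ _ _ lebesgue_measure F mF F0.
have m2 := @measurable_fun_fubini_tonelli_G _ _ _ _ _ mu F mF F0.
split.
  apply/(measurable_restrictT _ mD); apply: eq_measurable_fun m1 => x _.
  exact: F1.
apply/(measurable_restrictT _ mI); apply: eq_measurable_fun m2 => r _.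
exact: F2.
Qed.

Variable C : R.
Hypothesis fC : forall r, a <= r <= b -> (\int[mu]_(x in D) (`|f x r|)%:E <= C%:E)%E.

Let iF : ((mu \x lebesgue_measure)%E).-integrable setT F.
Proof.
apply/integrable12ltyP => //.
have mabsF : measurable_fun setT (fun p => `|F p|%E) by exact: measurableT_comp.
rewrite (fubini_tonelli _ mabsF (fun p => abse_ge0 _)).
apply: (@le_lt_trans _ _ (\int[lebesgue_measure]_(r in I) C%:E)%E).
  rewrite [leRHS]integral_mkcond; apply: ge0_le_integral => //.
  - by move=> r _; apply: integral_ge0.
  - exact: (@measurable_fun_fubini_tonelli_G _ _ _ _ _ mu (fun p => `|F p|%E)).
  - by apply/(measurable_restrictT _ mI).
  - move=> r _; under eq_integral do rewrite FE.
    rewrite patchE; case: ifPn => [/set_mem rI|rI].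
      apply: (le_trans _ (fC (r := r) _)); last by have := rI; rewrite /I/= in_itv.
      rewrite [leRHS]integral_mkcond.
      rewrite le_eqVlt; apply/orP; left; apply/eqP; apply: eq_integral => x _.
      by rewrite !patchE (mem_set rI); case: (x \in D) => //; exact: abse0.
    rewrite integral0_eq// => x _.
    by rewrite !patchE (negbTE rI); case: ifP => _; rewrite abse0.
have fI : lebesgue_measure (`[a, b]%classic : set R) \is a fin_num.
  by rewrite lebesgue_measure_itv/=; case: ifP.
by rewrite integral_cst//= ltey_eq; apply/orP; left; exact: (fin_numM _ fI).
Qed.

Lemma fubini_itv :
  (\int[mu]_(x in D) \int[lebesgue_measure]_(r in `[a, b]) (f x r)%:E =
   \int[lebesgue_measure]_(r in `[a, b]) \int[mu]_(x in D) (f x r)%:E)%E.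
Proof.
rewrite integral_mkcond [RHS]integral_mkcond.
transitivity (\int[mu]_x \int[lebesgue_measure]_r F (x, r))%E.
  by apply: eq_integral => x _; rewrite F1.
transitivity (\int[lebesgue_measure]_r \int[mu]_x F (x, r))%E; first exact: (Fubini iF).
by apply: eq_integral => r _; rewrite F2.
Qed.

Lemma integrable_fubini_itv :
  mu.-integrable D (fun x => \int[lebesgue_measure]_(r in `[a, b]) (f x r)%:E)%E.
Proof.
have := integrable_fubini_F iF; rewrite /fubini_F.
by under eq_fun do rewrite F1; move/(integrable_mkcond _ mD).
Qed.

Lemma ae_integrable_itv :
  {ae mu, forall x, D x -> lebesgue_measure.-integrable `[a, b] (EFin \o f x)}.
Proof.
apply: filterS (ae_integrable1 iF) => x /= ix Dx.
apply/(integrable_mkcond _ mI); move: ix.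
by under eq_fun do rewrite FE patchE mem_set//.
Qed.

End fubini_itv.

Section sphere_finite.
Context {R : realType} (n : nat).

(** Makes the surface measure sigma-finite, so that Fubini's theorem can be used on the sphere times
    an interval. *)
Let surface_measure_fin : fin_num_fun (@surface_measure R n).
Proof.
move=> A mA; rewrite ge0_fin_numE//.
apply: (@le_lt_trans _ _ (surface_measure n (sphere (R := R) n))); last exact: surface_measure_sphere_lty.
have mS := @measurable_sphere R n.
have -> : A = (A `&` sphere n) `|` (A `&` ~` sphere n) by rewrite -setIUr setUv setIT.
apply: (le_trans (measureU2 _ _ _)).
- exact: measurableI.
- by apply: measurableI => //; exact: measurableC.
have h0 : surface_measure n (A `&` ~` sphere n) = 0%E.
  apply/eqP; rewrite eq_le measure_ge0 andbT -(@surface_measure_setC_sphere R n).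
  have mSC : measurable (~` sphere (R := R) n) by exact: measurableC.
  by apply: le_measure; [rewrite inE; exact: measurableI|rewrite inE|move=> x []].
apply: (@le_trans _ _ (surface_measure n (A `&` sphere n) + 0)%E); first by rewrite -h0.
rewrite adde0.
by apply: le_measure; [rewrite inE; exact: measurableI|rewrite inE|move=> x []].
Qed.

HB.instance Definition _ := Measure_isFinite.Build _ _ _ (@surface_measure R n)
  surface_measure_fin.

End sphere_finite.

Section weak_gradient.
Context {R : realType}.
Implicit Types n : nat.

Lemma ge0_integral_sphere n (f : 'rV[R]_n.+1 -> \bar R) : measurable_fun setT f ->
  (forall x, 0 <= f x)%E ->
  (\int[surface_measure n]_x f x = \int[surface_measure n]_(x in sphere n) f x)%E.
Proof.
move=> mf f0.
have mS := @measurable_sphere R n.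
rewrite -[in RHS](setCK (sphere n)) -setTD -ge0_negligible_integral//.
- exact: measurableC.
- exact: surface_measure_setC_sphere.
Qed.

Lemma Lfun_natP d (T : measurableType d) (mu : {measure set T -> \bar R}) (p : nat) (f : T -> R) :
  (0 < p)%N -> f \in Lfun mu p%:R%:E <->
  measurable_fun setT f /\ (\int[mu]_x (`|f x| ^+ p)%:E < +oo)%E.
Proof.
move=> p0; have pr0 : p%:R != 0 :> R by rewrite pnatr_eq0 -lt0n.
have E : ('N[mu]_p%:R%:E[EFin \o f] `^ p%:R = \int[mu]_x (`|f x| ^+ p)%:E)%E.
  by rewrite poweR_Lnorm//; apply: eq_integral => x _; rewrite /= powR_mulrn.
split => [/andP[]|[mf fi]].
  rewrite !inE/= => mf; rewrite /finite_norm => fi; split => //.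
  by rewrite -E poweR_lty.
apply/andP; split; rewrite inE//= /finite_norm.
rewrite -E in fi; move: fi.
rewrite lt_neqAle leey andbT ltey => h; apply: contra h => /eqP ->.
by rewrite poweRyr.
Qed.

Lemma Lfun1_sphere_integrable n (f : 'rV[R]_n.+1 -> R) : f \in Lfun (surface_measure n) 1%:E ->
  measurable_fun setT f /\ (surface_measure n).-integrable (sphere n) (EFin \o f).
Proof.
rewrite -[1%:E]/(1%:R%:E) => /(Lfun_natP _ _ (ltn0Sn 0))[mf fi]; split => //.
apply: (@integrableS _ _ _ _ setT) => //; first exact: measurable_sphere.
apply/integrableP; split; first exact/measurable_EFinP.
by under eq_integral do rewrite abse_EFin -[`|_|%R]expr1.
Qed.

Lemma Lfun_sphere_integrable n p (f : 'rV[R]_n.+1 -> R) : (0 < p)%N ->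
  f \in Lfun (surface_measure n) p%:R%:E ->
  [/\ measurable_fun setT f, (surface_measure n).-integrable (sphere n) (EFin \o f)
   & (surface_measure n).-integrable (sphere n) (fun x => (`|f x| ^+ p)%:E)].
Proof.
move=> p0 /(Lfun_natP _ _ p0)[mf fi].
have mS := @measurable_sphere R n.
have ip : (surface_measure n).-integrable (sphere n) (fun x => (`|f x| ^+ p)%:E).
  apply: (@integrableS _ _ _ _ setT) => //.
  apply/integrableP; split.
    by apply/measurable_EFinP; apply: measurable_funX; exact: measurableT_comp.
  by under eq_integral do rewrite abse_EFin ger0_norm ?exprn_ge0//.
split => //.
have i1 : (surface_measure n).-integrable (sphere n) (EFin \o (fun=> 1 : R)).
  apply: sphere_continuous_integrable => x _; exact: cst_continuous.
apply: (le_integrable mS _ _ (integrableD mS i1 ip)).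
  by apply/measurable_EFinP; exact: measurable_funTS.
move=> x _ /=; rewrite lee_fin [leRHS]ger0_norm ?addr_ge0 ?exprn_ge0//.
have [f1|f1] := leP `|f x| 1; first by rewrite (le_trans f1)// lerDl exprn_ge0.
by rewrite (@le_trans _ _ (`|f x| ^+ p))// ?lerDr//; apply: ler_eXnr => //; exact: ltW.
Qed.

Lemma integrable_bdM n (f g : 'rV[R]_n.+1 -> R) (M : R) :
  (surface_measure n).-integrable (sphere n) (EFin \o f) ->
  measurable_fun (sphere n) g -> (forall x, sphere n x -> `|g x| <= M) ->
  (surface_measure n).-integrable (sphere n) (fun x => (f x * g x)%:E).
Proof.
move=> fi mg gM; have mS := @measurable_sphere R n.
have mf : measurable_fun (sphere n) f by apply/measurable_EFinP; case/integrableP : fi.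
apply: (le_integrable mS _ _ (integrableZl mS M fi)).
  by apply/measurable_EFinP; exact: measurable_funM.
move=> x Sx /=; rewrite lee_fin !normrM mulrC ler_wpM2r//.
exact: (le_trans (gM x Sx) (ler_norm _)).
Qed.

Lemma integrable_continuousM n (f g : 'rV[R]_n.+1 -> R) :
  (surface_measure n).-integrable (sphere n) (EFin \o f) -> sphere_continuous g ->
  (surface_measure n).-integrable (sphere n) (fun x => (f x * g x)%:E).
Proof.
move=> fi cg; have [M gM] := sphere_continuous_bounded cg.
by apply: (integrable_bdM fi _ gM); exact: sphere_continuous_measurable.
Qed.

Lemma elem_continuous m (phi : 'rV[R]_m -> R) : elem phi -> continuous phi.
Proof. by move=> /elem_differentiable[dphi _] x; exact: differentiable_continuous. Qed.

Lemma elem_measurable m (phi : 'rV[R]_m -> R) : elem phi -> measurable_fun setT phi.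
Proof. by move=> /elem_continuous; exact: continuous_measurable_rV. Qed.

(** The fundamental lemma of the calculus of variations, obtained from [elem_separation] with both
    maps equal to the identity and second density 0. The bound on phi keeps the later estimates
    uniform. *)
Lemma sphere_ae_eq0 n (f : 'rV[R]_n.+1 -> R) :
  (surface_measure n).-integrable (sphere n) (EFin \o f) ->
  (forall phi, elem phi -> (forall x, 0 <= phi x <= 1) ->
    (\int[surface_measure n]_(x in sphere n) (f x * phi x)%:E = 0)%E) ->
  {ae surface_measure n, forall x, sphere n x -> f x = 0}.
Proof.
move=> fi f0; have mS := @measurable_sphere R n.
have ae0 : ae_eq (surface_measure n) (sphere n) (EFin \o f) (EFin \o (fun=> 0)).
  apply: (integral_ae_eq mS fi); first by apply/measurable_EFinP; exact: measurable_cst.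
  move=> E ES mE.
  have := @elem_separation R _ _ (surface_measure n) (sphere n) n.+1 mS id id f (fun=> 0).
  rewrite /= => /(_ (@measurable_id _ _ _) (@measurable_id _ _ _) fi).
  have i0 : (surface_measure n).-integrable (sphere n) (EFin \o (fun=> 0 : R)).
    exact: integrable0.
  move=> /(_ i0) H.
  have {}H := H (fun phi ephi phi01 => etrans (f0 phi ephi phi01) _).
  have : (\int[surface_measure n]_(x in sphere n `&` E) (f x)%:E =
          \int[surface_measure n]_(x in sphere n `&` E) 0%:E)%E.
    apply: H => // phi.
    by under eq_integral do rewrite mul0r; rewrite integral0.
  by rewrite (_ : sphere n `&` E = E)//; apply/seteqP; split => [x []|x Ex]//; split => //; exact: ES.
by apply: filterS ae0 => x /= h Sx; case: (h Sx).
Qed.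

(** The definition of the weak gradient compares real-valued integrals, which send infinite values
    to 0. Integrability of both sides upgrades it to an identity of extended reals. *)
Lemma weak_surface_gradientE n (u : 'rV[R]_n.+1 -> R) Psi V :
  (surface_measure n).-integrable (sphere n) (EFin \o u) ->
  weak_surface_gradient u Psi -> smooth_tangent_field V ->
  [/\ (surface_measure n).-integrable (sphere n) (fun x => (dotv (Psi x) (V x))%:E),
      (surface_measure n).-integrable (sphere n) (fun x => (u x * surface_div V x)%:E) &
  (\int[surface_measure n]_(x in sphere n) (dotv (Psi x) (V x))%:E =
   - \int[surface_measure n]_(x in sphere n) (u x * surface_div V x)%:E)%E].
Proof.
move=> ui [_ Psi1 PsiV] sV; have mS := @measurable_sphere R n.
have CV i : C1_sphere (fun x => V x ord0 i).
  exact/C1_near_C1/smooth_C1/sV.1.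
have i1 : (surface_measure n).-integrable (sphere n) (fun x => (dotv (Psi x) (V x))%:E).
  rewrite /dotv.
  under eq_fun do rewrite -sumEFin.
  apply: integrable_sum => // i _.
  apply: integrable_continuousM; first by have [] := Lfun1_sphere_integrable (Psi1 i).
  by move=> x Sx; apply: differentiable_continuous; have [] := CV i x Sx.
have i2 : (surface_measure n).-integrable (sphere n) (fun x => (u x * surface_div V x)%:E).
  by apply: integrable_continuousM => //; exact: surface_div_continuous.
split => //.
have := congr1 EFin (PsiV V sV); rewrite /Rintegral.
by rewrite EFinN !fineK//; exact: integrable_fin_num.
Qed.

(** The projection of phi e_i to the tangent space: pairing it with a tangent vector reads off the
    i-th coordinate times phi. *)
Definition tangent_projection n (phi : 'rV[R]_n.+1 -> R) (i : 'I_n.+1) (x : 'rV[R]_n.+1) : 'rV[R]_n.+1 :=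
  phi x *: (delta_mx ord0 i - x ord0 i *: x).

Lemma smooth_tangent_projection n (phi : 'rV[R]_n.+1 -> R) (i : 'I_n.+1) :
  elem phi -> smooth_tangent_field (tangent_projection phi i).
Proof.
move=> ephi; split => [j|x /sphereE xx].
  apply: elem_smooth.
  rewrite (_ : (fun x => _) = (fun x : 'rV[R]_n.+1 => phi x *
    ((delta_mx ord0 i : 'rV[R]_n.+1) ord0 j + (-1) * (x ord0 i * x ord0 j)))); last first.
    by apply/funext => x; rewrite !mxE mulN1r.
  apply: elem_mul => //; apply: elem_add; first exact: elem_cst.
  apply: elem_mul; first exact: elem_cst.
  by apply: elem_mul; exact: elem_coord.
rewrite /tangent_projection dotvZl dotvDl dotvNl dotvZl xx mulr1.
rewrite (_ : dotv (delta_mx _ _) _ = x ord0 i) ?subrr ?mulr0//.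
rewrite /dotv (bigD1 i)//= delta_mx_coord eqxx mul1r big1 ?addr0// => l li.
by rewrite delta_mx_coord (negbTE li) mul0r.
Qed.

Lemma dotv_tangent_projection n (phi : 'rV[R]_n.+1 -> R) (i : 'I_n.+1) (w x : 'rV[R]_n.+1) :
  dotv w x = 0 -> dotv w (tangent_projection phi i x) = w ord0 i * phi x.
Proof.
move=> wx; rewrite /tangent_projection dotvZr dotvDr dotvNr dotvZr wx mulr0 subr0.
rewrite mulrC; congr (_ * _).
rewrite /dotv (bigD1 i)//= delta_mx_coord eqxx mulr1 big1 ?addr0// => l li.
by rewrite delta_mx_coord (negbTE li) mulr0.
Qed.

(** [surface_grad] is an arbitrary choice among weak gradients; this identifies it almost everywhere
    with an explicit one. Testing with [tangent_projection] reduces the claim to each coordinate. *)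
Lemma weak_gradient_unique n (u : 'rV[R]_n.+1 -> R) Psi Psi' :
  (surface_measure n).-integrable (sphere n) (EFin \o u) ->
  weak_surface_gradient u Psi -> weak_surface_gradient u Psi' ->
  {ae surface_measure n, forall x, sphere n x -> Psi x = Psi' x}.
Proof.
move=> ui wP wP'; have mS := @measurable_sphere R n.
have ae_i i : {ae surface_measure n, forall x, sphere n x -> Psi x ord0 i - Psi' x ord0 i = 0}.
  have [t1 /(_ i)/Lfun1_sphere_integrable[_ i1] _] := wP.
  have [t2 /(_ i)/Lfun1_sphere_integrable[_ i2] _] := wP'.
  apply: sphere_ae_eq0; first exact: (integrableB mS i1 i2).
  move=> phi ephi _.
  have sV := smooth_tangent_projection i ephi.
  have [j1 _ E1] := weak_surface_gradientE ui wP sV.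
  have [j2 _ E2] := weak_surface_gradientE ui wP' sV.
  rewrite (eq_integral (fun x => (dotv (Psi x) (tangent_projection phi i x))%:E -
      (dotv (Psi' x) (tangent_projection phi i x))%:E)%E); last first.
    move=> x /set_mem Sx.
    by rewrite !dotv_tangent_projection ?t1 ?t2// -EFinB mulrBl.
  by rewrite integralB// E1 E2 subee// fin_numN integrable_fin_num//; case: (weak_surface_gradientE ui wP sV).
have : {ae surface_measure n, forall x i, sphere n x -> Psi x ord0 i - Psi' x ord0 i = 0}.
  exact: filter_forall.
by apply: filterS => x h Sx; apply/rowP => i; apply/eqP; rewrite -subr_eq0 h.
Qed.

End weak_gradient.

Lemma elem_expn (R : realType) m (f : 'rV[R]_m -> R) k : elem f -> elem (fun x => f x ^+ k).
Proof.
move=> ef; elim: k => [|k IH]; first exact: elem_cst.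
rewrite (_ : (fun x => _) = fun x => f x * f x ^+ k); first exact: elem_mul.
by apply/funext => z; rewrite exprS.
Qed.

(** * The flow along the meridians *)

Section flow.
Context {R : realType}.
Variables (n : nat) (Phi : 'rV[R]_n.+1).
Hypothesis sPhi : sphere n Phi.
Implicit Types (x y : 'rV[R]_n.+1) (a b r : R).
Local Notation t x := (dotv x Phi).

(* In the coordinates x = t Phi + y with y orthogonal to Phi, [flow a]
   multiplies the ratio t / |y| by a; on the sphere it is the flow of the
   field t * meridian at time ln a, and [flow_jac a] is its Jacobian. *)
Definition flow_den a x : R := 1 + (a ^+ 2 - 1) * t x ^+ 2.
Definition flow_fac a x : R := flow_den a x `^ (- 2^-1).
Definition flow_coord a (l : 'I_n.+1) x : R :=
  (x ord0 l + (a - 1) * (t x * Phi ord0 l)) * flow_fac a x.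
Definition flow a x : 'rV[R]_n.+1 := \row_l flow_coord a l x.
Definition flow_jac a x : R := a * flow_fac a x ^+ n.+1.

Lemma dotv_Phi_sqr_le1 x : sphere n x -> t x ^+ 2 <= 1.
Proof.
move=> sx; have := dotv_cauchy x Phi; rewrite sx sPhi mulr1 => h.
by rewrite -[leRHS](expr1n _ 2) -real_normK ?num_real// ler_pXn2r// nnegrE.
Qed.

Lemma flow_den_ge1 a x : 1 <= a -> 1 <= flow_den a x.
Proof.
move=> a1; rewrite lerDl mulr_ge0 ?sqr_ge0// subr_ge0.
by rewrite exprn_ege1.
Qed.

Lemma flow_den_gt0 a x : 0 < a -> sphere n x -> 0 < flow_den a x.
Proof.
move=> a0 /dotv_Phi_sqr_le1; rewrite /flow_den; set s := t x ^+ 2 => s1.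
have s0 : 0 <= s by exact: sqr_ge0.
have a20 : 0 < a ^+ 2 by rewrite exprn_gt0.
have [->|sn0] := eqVneq s 0; first by rewrite mulr0 addr0.
have sp : 0 < s by rewrite lt_neqAle eq_sym sn0.
have : 0 < a ^+ 2 * s by rewrite mulr_gt0.
lra.
Qed.

Lemma flow_fac_gt0 a x : 0 < flow_den a x -> 0 < flow_fac a x.
Proof. exact: powR_gt0. Qed.

Lemma flow_facK a x : 0 < flow_den a x -> flow_fac a x ^+ 2 * flow_den a x = 1.
Proof.
move=> D0; rewrite -powR_mulrn ?powR_ge0// -powRrM mulNr mulVf// powR_inv1 ?ltW//.
by rewrite mulVf ?gt_eqF.
Qed.

Lemma flow_fac_le1 a x : 1 <= a -> flow_fac a x <= 1.
Proof.
move=> a1; have D1 := flow_den_ge1 x a1.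
have D0 := lt_le_trans ltr01 D1; have := flow_facK D0; have h0 := flow_fac_gt0 D0.
move: (flow_fac a x) h0 => h h0 E; rewrite leNgt; apply/negP => h1.
have : 1 < h ^+ 2 by rewrite exprn_egt1.
by have := sqr_ge0 h; nra.
Qed.

Lemma dotv_flow a x : t (flow a x) = a * t x * flow_fac a x.
Proof.
rewrite {1}/dotv (eq_bigr (fun l => flow_fac a x * (x ord0 l * Phi ord0 l) +
  flow_fac a x * (a - 1) * t x * (Phi ord0 l * Phi ord0 l))); last first.
  by move=> l _; rewrite mxE /flow_coord; ring.
rewrite big_split/= -!mulr_sumr -/(t x) -/(dotv Phi Phi) (sphereE Phi).1//.
by ring.
Qed.

Lemma flow_rowE a x : flow a x = flow_fac a x *: (x + ((a - 1) * t x) *: Phi).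
Proof. by apply/rowP => l; rewrite !mxE /flow_coord; ring. Qed.

Lemma flow_sphere a x : 0 < a -> sphere n x -> sphere n (flow a x).
Proof.
move=> a0 sx; apply/sphereE.
have D0 := flow_den_gt0 a0 sx; rewrite -[RHS](flow_facK D0) flow_rowE.
rewrite !(dotvZl, dotvZr, dotvDl, dotvDr) (dotvC Phi x).
rewrite (sphereE x).1// (sphereE Phi).1// /flow_den; ring.
Qed.

Lemma flow_den_comp a b x : 0 < flow_den a x ->
  flow_den b (flow a x) = flow_den (b * a) x * flow_fac a x ^+ 2.
Proof.
move=> D0; have := flow_facK D0; rewrite /flow_den dotv_flow => E.
by rewrite -{1}E; ring.
Qed.

Lemma flow_comp a b x : 0 < a -> 0 < b -> sphere n x ->
  flow b (flow a x) = flow (b * a) x.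
Proof.
move=> a0 b0 sx.
have D0 := flow_den_gt0 a0 sx; have DD0 := flow_den_gt0 (mulr_gt0 b0 a0) sx.
have h0 := flow_fac_gt0 D0.
have E : flow_fac b (flow a x) * flow_fac a x = flow_fac (b * a) x.
  rewrite {1}/flow_fac flow_den_comp// powRM ?sqr_ge0 ?ltW//.
  rewrite -(powR_mulrn _ (ltW h0)) -powRrM mulrN mulfV// powR_inv1 ?ltW//.
  by rewrite -mulrA mulVf ?mulr1// gt_eqF.
rewrite [LHS]flow_rowE [RHS]flow_rowE -E dotv_flow.
rewrite [in X in _ *: (X + _)]flow_rowE.
apply/rowP => l; rewrite !mxE; ring.
Qed.

Lemma flow1 x : flow 1 x = x.
Proof.
rewrite flow_rowE /flow_fac /flow_den expr1n !subrr !mul0r addr0 powR1 scale1r.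
by rewrite scale0r addr0.
Qed.

Lemma flowVK a x : 0 < a -> sphere n x -> flow a^-1 (flow a x) = x.
Proof. by move=> a0 sx; rewrite flow_comp ?invr_gt0// mulVf ?gt_eqF// flow1. Qed.

Lemma flow_jac1 x : flow_jac 1 x = 1.
Proof.
by rewrite /flow_jac /flow_fac /flow_den expr1n subrr mul0r addr0 powR1 expr1n mulr1.
Qed.

Lemma flow_jac_ge0 a x : 0 <= a -> 0 <= flow_jac a x.
Proof. by move=> a0; rewrite mulr_ge0// exprn_ge0// powR_ge0. Qed.

Lemma flow_jac_le a x : 1 <= a -> flow_jac a x <= a.
Proof.
move=> a1; rewrite ler_piMr ?(le_trans ler01)//.
by rewrite exprn_ile1 ?powR_ge0// flow_fac_le1.
Qed.

Let meas_t (d : measure_display) (T : measurableType d) (f : T -> 'rV[R]_n.+1) :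
  measurable_fun setT f -> measurable_fun setT (fun z => t (f z)).
Proof.
move=> mf; apply: measurable_sum => i; apply: measurable_funM => //.
exact: (measurableT_comp (measurable_coord i) mf).
Qed.

Lemma measurable_flow_joint (d : measure_display) (T : measurableType d)
    (g : T -> R) (f : T -> 'rV[R]_n.+1) :
  measurable_fun setT g -> measurable_fun setT f ->
  measurable_fun setT (fun z => flow_fac (g z) (f z)) /\
  measurable_fun setT (fun z => flow (g z) (f z)).
Proof.
move=> mg mf; have mt := meas_t mf.
have mh : measurable_fun setT (fun z => flow_fac (g z) (f z)).
  apply: (measurableT_comp (f := fun s : R => s `^ (- 2^-1))); first exact: measurable_powR.
  apply: measurable_funD => //; apply: measurable_funM; last exact: measurable_funX.
  by apply: measurable_funB => //; exact: measurable_funX.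
split => //; apply: measurable_fun_rV => i.
under eq_fun do rewrite mxE.
apply: measurable_funM => //; apply: measurable_funD.
  exact: (measurableT_comp (measurable_coord i) mf).
by apply: measurable_funM; [exact: measurable_funB|exact: measurable_funM].
Qed.

Lemma measurable_flow a : measurable_fun setT (flow a).
Proof. by have [] := @measurable_flow_joint _ _ (fun=> a) id (measurable_cst _) (@measurable_id _ _ _). Qed.

Lemma measurable_flow_jac a : measurable_fun setT (flow_jac a).
Proof.
apply: measurable_funM => //; apply: measurable_funX.
by have [] := @measurable_flow_joint _ _ (fun=> a) id (measurable_cst _) (@measurable_id _ _ _).
Qed.

(** For a >= 1 the base of the power is at least 1 on the whole ambient space, whereas for a < 1 it
    becomes negative at large |t|. For this reason test functions are moved by [flow a] with a >= 1,
    and u by [flow a^-1]. *)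
Lemma elem_flow_fac a : 1 <= a -> elem (flow_fac a).
Proof.
move=> a1; apply: elem_powR => [x|]; first exact: (lt_le_trans ltr01 (flow_den_ge1 x a1)).
apply: elem_add; first exact: elem_cst.
apply: elem_mul; first exact: elem_cst.
by apply: elem_mul; exact: elem_dotvl.
Qed.

Lemma elem_flow_coord a l : 1 <= a -> elem (flow_coord a l).
Proof.
move=> a1; apply: elem_mul; last exact: elem_flow_fac.
apply: elem_add; first exact: elem_coord.
apply: elem_mul; first exact: elem_cst.
by apply: elem_mul; [exact: elem_dotvl|exact: elem_cst].
Qed.

Lemma elem_flow_jac a : 1 <= a -> elem (flow_jac a).
Proof.
move=> a1; apply: elem_mul; first exact: elem_cst.
by apply: elem_expn; exact: elem_flow_fac.
Qed.

Lemma elem_comp_flow a phi : 1 <= a -> elem phi -> elem (fun x => phi (flow a x)).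
Proof. by move=> a1 ephi; apply: elem_comp => // l; exact: elem_flow_coord. Qed.

End flow.

(** * The transport equation of the flow *)

Section flow_derivative.
Context {R : realType}.
Variables (n : nat) (Phi : 'rV[R]_n.+1).
Hypothesis sPhi : sphere n Phi.
Implicit Types (x y : 'rV[R]_n.+1) (a b r : R).
Local Notation t x := (dotv x Phi).
Local Notation flow_den := (flow_den Phi).
Local Notation flow_fac := (flow_fac Phi).
Local Notation flow := (flow Phi).
Local Notation flow_coord := (flow_coord Phi).
Local Notation flow_jac := (flow_jac Phi).

Definition dflow_fac a x : R := - (a * t x ^+ 2 * flow_fac a x ^+ 3).
Definition dflow_coord a l x : R :=
  t x * Phi ord0 l * flow_fac a x +
  (x ord0 l + (a - 1) * (t x * Phi ord0 l)) * dflow_fac a x.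
Definition dflow_jac a x : R :=
  flow_fac a x ^+ n.+1 + a * (n.+1%:R * flow_fac a x ^+ n * dflow_fac a x).

Lemma flow_fac3 a x : 0 < flow_den a x ->
  flow_den a x `^ (- 2^-1 - 1) = flow_fac a x ^+ 3.
Proof.
move=> D0; rewrite -powR_mulrn ?powR_ge0// -powRrM; congr (_ `^ _); by field.
Qed.

Lemma der_flow_fac a x : 0 < flow_den a x ->
  is_derive a (1 : R) (fun r => flow_fac r x) (dflow_fac a x).
Proof.
move=> D0.
have dD0 := derD (der_cst a 1) (derM (derB (derX 2 (der_id a)) (der_cst a 1))
  (der_cst a (t x ^+ 2))).
have dp := is_derive1_powR (- 2^-1) D0.
apply: (der_eq (der_comp dD0 dp)).
by rewrite flow_fac3// /dflow_fac /=; field.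
Qed.

Lemma der_flow_coord a l x : 0 < flow_den a x ->
  is_derive a (1 : R) (fun r => flow_coord r l x) (dflow_coord a l x).
Proof.
move=> D0.
have d0 := derM (derD (der_cst a (x ord0 l)) (derM (derB (der_id a) (der_cst a 1))
    (der_cst a (t x * Phi ord0 l)))) (der_flow_fac D0).
by apply: (der_eq d0); rewrite /dflow_coord; ring.
Qed.

Lemma der_flow_jac a x : 0 < flow_den a x ->
  is_derive a (1 : R) (fun r => flow_jac r x) (dflow_jac a x).
Proof.
move=> D0.
have d0 := derM (der_id a) (derX n.+1 (der_flow_fac D0)).
by apply: (der_eq d0); rewrite /dflow_jac mul1r.
Qed.

Variable phi : 'rV[R]_n.+1 -> R.
Hypothesis ephi : elem phi.

(** The density phi pulled back by the flow, including the Jacobian, so that total integrals are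
    preserved; [dtransported] is its derivative in a. *)
Definition transported a x : R := phi (flow a x) * flow_jac a x.
Definition dtransported a x : R :=
  (\sum_(l < n.+1) dflow_coord a l x * partial l phi (flow a x)) * flow_jac a x +
  phi (flow a x) * dflow_jac a x.

Lemma der_transported a x : 0 < flow_den a x ->
  is_derive a (1 : R) (fun r => transported r x) (dtransported a x).
Proof.
move=> D0; apply: derM (der_flow_jac D0).
have dc l : differentiable (fun r => flow_coord r l x) a.
  by apply/derivable1_diffP; have [] := der_flow_coord l D0.
have dphi y : differentiable phi y by have [] := elem_differentiable ephi.
have [d1 d2] := derive_row_comp (1 : R) dc (dphi (\row_l flow_coord a l x)).
split; first exact: diff_derivable.
rewrite d2; apply: eq_bigr => l _; congr (_ * _).
by have [_ ->] := der_flow_coord l D0.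
Qed.

Let X x := t x *: meridian Phi x.

Lemma elem_transported a : 1 <= a -> elem (transported a).
Proof. by move=> a1; apply: elem_mul; [exact: elem_comp_flow|exact: elem_flow_jac]. Qed.

Lemma smooth_transported a : 1 <= a ->
  smooth_tangent_field (fun x => transported a x *: X x).
Proof.
move=> a1; split => [i|x sx]; last first.
  by rewrite !dotvZl meridian_tangent// !mulr0.
apply: elem_smooth.
rewrite (_ : (fun x => _) = fun x => transported a x * (t x * meridian Phi x ord0 i)).
  apply: elem_mul; first exact: elem_transported.
  by apply: elem_mul; [exact: elem_dotvl|exact: elem_meridian].
by apply/funext => x; rewrite !mxE.
Qed.

(** The continuity equation of the flow of X, the factor a being due to a = exp(time). It
    characterises [flow_jac] as the Jacobian without any determinant. *)
Lemma surface_div_transported a x : 1 <= a -> sphere n x ->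
  surface_div (fun x => transported a x *: X x) x = a * dtransported a x.
Proof.
move=> a1 sx.
have D0 : 0 < flow_den a x by exact: lt_le_trans (flow_den_ge1 Phi x a1).
have a0 : 0 < a by exact: lt_le_trans a1.
have dm i : differentiable (fun y => meridian Phi y ord0 i) x.
  by have [] := elem_differentiable (elem_meridian Phi i).
have dt := differentiable_dotvl x Phi.
have dX i : differentiable (fun y => X y ord0 i) x.
  rewrite (_ : (fun y => _) = fun y => t y * meridian Phi y ord0 i).
    exact: differentiable_M.
  by apply/funext => y; rewrite !mxE.
have tX : dotv (X x) x = 0 by rewrite dotvZl meridian_tangent// mulr0.
have dpsi : differentiable (transported a) x.
  by have [] := elem_differentiable (elem_transported a1).
rewrite surface_divM//.
have -> : surface_div X x = 1 - n.+1%:R * t x ^+ 2.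
  rewrite surface_divM//; last exact: meridian_tangent.
  rewrite surface_div_meridian// derive_dotvl dotv_meridian_Phi// -natr1; ring.
have DXt : 'D_(X x) (fun y => t y) x = t x * (1 - t x ^+ 2).
  by rewrite derive_dotvl /X dotvZl dotv_meridian_Phi.
have dt2 : differentiable (fun y => t y ^+ 2) x by exact: differentiable_M.
have dct2 : differentiable (fun y => (a ^+ 2 - 1) * t y ^+ 2) x.
  by apply: differentiable_M; [exact: differentiable_cst|exact: dt2].
have dc1 : differentiable (fun _ : 'rV[R]_n.+1 => 1 : R) x by exact: differentiable_cst.
have dD : differentiable (flow_den a) x by exact: (differentiable_D dc1 dct2).
have DXD : 'D_(X x) (flow_den a) x = (a ^+ 2 - 1) * (2 * t x * (t x * (1 - t x ^+ 2))).
  rewrite (derive_D _ dc1 dct2) derive_cst_fun add0r (derive_Ml _ _ dt2).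
  by rewrite [X in _ * X = _](derive_M _ dt dt) DXt; congr (_ * _); ring.
have dp := is_derive1_powR (- 2^-1) D0.
have dh : differentiable (flow_fac a) x by exact: (differentiable_comp1 dD dp).
set h := flow_fac a x.
have DXh : 'D_(X x) (flow_fac a) x = - ((a ^+ 2 - 1) * t x ^+ 2 * (1 - t x ^+ 2) * h ^+ 3).
  rewrite (derive_comp1 _ dD dp) DXD flow_fac3// -/h; by field.
have hD : h ^+ 2 * flow_den a x = 1 by exact: flow_facK.
have dxl l : differentiable (fun y : 'rV[R]_n.+1 => y ord0 l) x by exact: differentiable_coord.
have dc0 l : differentiable (fun y => y ord0 l + (a - 1) * (t y * Phi ord0 l)) x.
  apply: differentiable_D => //; apply: differentiable_M; first exact: differentiable_cst.
  by apply: differentiable_M => //; exact: differentiable_cst.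
have dc l : differentiable (flow_coord a l) x by exact: differentiable_M.
(* A flow carries its generator to itself: differentiating the flow map along X at the starting
   point is the same as differentiating in time. *)
have DXc l : 'D_(X x) (flow_coord a l) x = a * dflow_coord a l x.
  rewrite derive_M// DXh derive_D//; last first.
    apply: differentiable_M; first exact: differentiable_cst.
    by apply: differentiable_M => //; exact: differentiable_cst.
  rewrite derive_coord derive_Ml; last first.
    by apply: differentiable_M => //; exact: differentiable_cst.
  rewrite derive_M//.
  rewrite DXt derive_cst_fun mulr0 addr0.
  have -> : X x ord0 l = t x * (Phi ord0 l - t x * x ord0 l) by rewrite !mxE.
  rewrite /dflow_coord /dflow_fac -/h.
  move: hD; rewrite /flow_den => hD.
  have -> : h ^+ 3 = h * h ^+ 2 by rewrite exprS.
  (* The factor h^2 [flow_den] = 1 is inserted so that both sides become polynomials in h divisible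
     by h^3; the remaining identity is then algebraic. *)
  transitivity (h * ((t x * (Phi ord0 l - t x * x ord0 l) +
     (a - 1) * (t x * (1 - t x ^+ 2) * Phi ord0 l)) * (h ^+ 2 * (1 + (a ^+ 2 - 1) * t x ^+ 2))
   - (x ord0 l + (a - 1) * (t x * Phi ord0 l)) * ((a ^+ 2 - 1) * t x ^+ 2 * (1 - t x ^+ 2)) * h ^+ 2)).
    by rewrite hD; ring.
  transitivity (h * (a * (t x * Phi ord0 l) * (h ^+ 2 * (1 + (a ^+ 2 - 1) * t x ^+ 2)) -
     (x ord0 l + (a - 1) * (t x * Phi ord0 l)) * (a ^+ 2 * t x ^+ 2) * h ^+ 2)).
    ring.
  by rewrite hD; ring.
have hm : differentiable (fun y => flow_fac a y ^+ n.+1) x.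
  exact: (differentiable_comp1 dh (derX n.+1 (der_id h))).
(* The case phi = 1 of the continuity equation, with 1 - (n+1) t^2 = div X. *)
have DXJ : 'D_(X x) (flow_jac a) x + flow_jac a x * (1 - n.+1%:R * t x ^+ 2) = a * dflow_jac a x.
  rewrite derive_Ml// (derive_comp1 _ dh (derX n.+1 (der_id h))) DXh.
  rewrite /flow_jac /dflow_jac /dflow_fac -/h /=.
  move: hD; rewrite /flow_den => hD.
  have -> : h ^+ n.+1 = h ^+ n * h by rewrite exprSr.
  have -> : h ^+ 3 = h * h ^+ 2 by rewrite exprS.
  transitivity (a * h ^+ n * h * (1 - n.+1%:R * (t x ^+ 2 * (h ^+ 2 * (1 + (a ^+ 2 - 1) * t x ^+ 2)) +
    (a ^+ 2 - 1) * t x ^+ 2 * (1 - t x ^+ 2) * h ^+ 2))).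
    by rewrite hD; ring.
  by ring.
have dphi y : differentiable phi y by have [] := elem_differentiable ephi.
have [d1 d2] := derive_row_comp (X x) dc (dphi (flow a x)).
rewrite derive_M//; last by have [] := elem_differentiable (elem_flow_jac Phi a1).
rewrite d2 /transported /dtransported -addrA -[_ * _ * (1 - _)]mulrA -mulrDr DXJ.
rewrite (eq_bigr (fun l => a * (dflow_coord a l x * partial l phi (flow a x)))).
  by rewrite -mulr_sumr; ring.
by move=> l _; rewrite DXc mulrA.
Qed.

End flow_derivative.

(** * Change of variables for nonnegative functions *)

Section ge0_change_of_variables.
Import HBNNSimple.
Context {R : realType} {d d' : measure_display} {W : measurableType d} {Y : measurableType d'}.
Variables (mu : {measure set W -> \bar R}) (D : set W).
Hypothesis mD : measurable D.

Let integral_approx (T : W -> Y) (f : W -> R) (h : {nnsfun Y >-> R}) :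
  measurable_fun setT T -> measurable_fun D f -> (forall x, D x -> 0 <= f x) ->
  (\int[mu]_(x in D) (f x * h (T x))%:E =
   \sum_(r \in range h) (r%:E * \int[mu]_(x in D `&` T @^-1` (h @^-1` [set r])) (f x)%:E))%E.
Proof.
move=> mT mf f0.
have mi r : measurable_fun D (fun x => f x * \1_(h @^-1` [set r]) (T x)).
  apply: measurable_funM => //; apply: measurable_funTS.
  exact: measurableT_comp.
have E x : (f x * h (T x))%:E =
    (\sum_(r \in range h) (r * (f x * \1_(h @^-1` [set r]) (T x)))%:E)%E.
  rewrite [in LHS]fimfunE fsumEFin//; congr EFin.
  rewrite [in LHS]mulrC mulr_fsuml//.
  by apply: eq_fsbigr => r _; ring.
under eq_integral do rewrite E.
rewrite ge0_integral_fsum//; last 2 first.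
- by move=> r; apply/measurable_EFinP; exact: measurable_funM.
- move=> r x Dx; rewrite lee_fin; have [r0|r0] := ltP r 0.
    by rewrite preimage_nnfun0// indic0 !mulr0.
  by rewrite !mulr_ge0// f0.
apply: eq_fsbigr => r /set_mem [y _ <-].
under eq_integral do rewrite EFinM.
rewrite ge0_integralZl//; last 3 first.
- exact/measurable_EFinP.
- by move=> x Dx; rewrite lee_fin mulr_ge0// f0.
- by rewrite lee_fin.
congr (_ * _)%E; rewrite integral_mkcondr; apply: eq_integral => x _.
rewrite patchE indicE (_ : (x \in _) = (T x \in h @^-1` [set h y])); last first.
  by apply/idP/idP; rewrite !inE.
by case: ifP => _; rewrite ?mulr1 ?mulr0.
Qed.

(** An equality on measurable sets passes to simple functions through their level sets, and to
    nonnegative functions by monotone convergence. *)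
Lemma ge0_change_of_variables (T1 T2 : W -> Y) (f1 f2 : W -> R) :
  measurable_fun setT T1 -> measurable_fun setT T2 ->
  measurable_fun D f1 -> measurable_fun D f2 ->
  (forall x, D x -> 0 <= f1 x) -> (forall x, D x -> 0 <= f2 x) ->
  (forall A, measurable A ->
    (\int[mu]_(x in D `&` T1 @^-1` A) (f1 x)%:E =
     \int[mu]_(x in D `&` T2 @^-1` A) (f2 x)%:E)%E) ->
  forall g : Y -> R, measurable_fun setT g -> (forall y, 0 <= g y) ->
    (\int[mu]_(x in D) (f1 x * g (T1 x))%:E =
     \int[mu]_(x in D) (f2 x * g (T2 x))%:E)%E.
Proof.
move=> mT1 mT2 mf1 mf2 f10 f20 E g mg g0.
have mEg : measurable_fun setT (EFin \o g) by exact/measurable_EFinP.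
pose h := nnsfun_approx measurableT mEg.
have cvg_h (T : W -> Y) (f : W -> R) : measurable_fun setT T -> measurable_fun D f ->
    (forall x, D x -> 0 <= f x) ->
    (\int[mu]_(x in D) (f x * h k (T x))%:E)%E @[k --> \oo] -->
    (\int[mu]_(x in D) (f x * g (T x))%:E)%E.
  move=> mT mf f0.
  have := @cvg_monotone_convergence _ _ _ mu D mD (fun k x => (f x * h k (T x))%:E).
  rewrite (eq_integral (fun x => (f x * g (T x))%:E)).
    apply.
    - move=> k; apply/measurable_EFinP; apply: measurable_funM => //.
      by apply: measurable_funTS; exact: measurableT_comp.
    - by move=> k x Dx; rewrite lee_fin mulr_ge0// f0.
    - move=> x Dx k l kl; rewrite lee_fin ler_wpM2l ?f0//.
      exact/lefP/nd_nnsfun_approx.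
  move=> x /set_mem Dx; apply: cvg_lim => //.
  apply: cvg_EFin; first by near=> k.
  apply: cvgMr; have := @cvg_nnsfun_approx _ _ _ _ measurableT _ mEg (fun y _ => g0 y) (T x) I.
  by move/fine_cvgP => [].
apply: (cvg_eq_lim (cvg_h T1 f1 mT1 mf1 f10) (cvg_h T2 f2 mT2 mf2 f20)) => k.
rewrite !integral_approx//; apply: eq_fsbigr => r _; congr (_ * _)%E.
by apply: E; rewrite -[X in measurable X]setTI; exact: measurable_funP.
Unshelve. all: by end_near. Qed.

End ge0_change_of_variables.

(** * Weak gradients along the flow *)

Section flow_identity.
Context {R : realType}.
Variables (n : nat) (Phi : 'rV[R]_n.+1).
Hypothesis sPhi : sphere n Phi.
Implicit Types (x y : 'rV[R]_n.+1) (a b r : R).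
Local Notation t x := (dotv x Phi).
Local Notation flow := (flow Phi).
Local Notation flow_fac := (flow_fac Phi).
Local Notation flow_jac := (flow_jac Phi).
Local Notation transported := (transported Phi).
Local Notation dtransported := (dtransported Phi).

Local Notation itv1 a := ([set` `[1, a]] : set R).

Lemma coord_le1 x l : sphere n x -> `|x ord0 l| <= 1.
Proof. by move=> sx; have := coord_le_enorm x l; rewrite sx. Qed.

Lemma dotv_Phi_le1 x : sphere n x -> `|t x| <= 1.
Proof. by move=> sx; have := dotv_cauchy x Phi; rewrite sx sPhi mulr1. Qed.

Lemma elem_bounded phi : elem phi -> exists2 M, 0 <= M & forall x, sphere n x -> `|phi x| <= M.
Proof.
move=> ephi; have [|M hM] := @sphere_continuous_bounded R n phi.
  by move=> x _; exact: elem_continuous.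
by exists M => //; exact: (le_trans (normr_ge0 _) (hM _ sPhi)).
Qed.

(** The bound is uniform in the parameter r, which makes u times this derivative integrable on the
    sphere times [1, a]. *)
Lemma dtransported_bounded phi a : elem phi ->
  exists2 C, 0 <= C & forall r x, 1 <= r <= a -> sphere n x -> `|dtransported phi r x| <= C.
Proof.
move=> ephi; have [M0 M00 hM0] := elem_bounded ephi.
have /fin_all_exists2[M M_ge0 hM] : forall l : 'I_n.+1, exists2 M, 0 <= M &
    forall x, sphere n x -> `|partial l phi x| <= M.
  by move=> l; apply: elem_bounded; have [_] := elem_differentiable ephi; exact.
have [a0|a0] := ltP a 1.
  by exists 0 => // r x /andP[r1 ra]; have := lt_le_trans a0 (le_trans r1 ra); rewrite ltxx.
have a_ge0 : 0 <= a by exact: le_trans a0.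
exists ((\sum_l (1 + a ^+ 2) * M l) * a + M0 * (1 + a * (n.+1%:R * a))).
  rewrite addr_ge0// mulr_ge0// ?sumr_ge0// => [l _|].
    by rewrite mulr_ge0// addr_ge0 ?sqr_ge0.
  by rewrite addr_ge0// !mulr_ge0.
move=> r x /andP[r1 ra] sx.
have r0 : 0 <= r by exact: le_trans r1.
have h0 : 0 <= flow_fac r x by exact: powR_ge0.
have h1 : flow_fac r x <= 1 by exact: flow_fac_le1.
have hk k : `|flow_fac r x ^+ k| <= 1 by rewrite ger0_norm ?exprn_ge0// exprn_ile1.
have t1 := dotv_Phi_le1 sx.
have dh : `|dflow_fac Phi r x| <= a.
  rewrite /dflow_fac normrN normrM normrM (ger0_norm r0) (ger0_norm (sqr_ge0 _)).
  rewrite -[leRHS]mulr1; apply: ler_pM => //; first by rewrite mulr_ge0// sqr_ge0.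
  rewrite -[leRHS]mulr1; apply: ler_pM => //; first exact: sqr_ge0.
  exact: dotv_Phi_sqr_le1.
have sf := flow_sphere sPhi (lt_le_trans ltr01 r1) sx.
have jr : `|flow_jac r x| <= a.
  by rewrite ger0_norm ?flow_jac_ge0// (le_trans (flow_jac_le _ _ r1)).
rewrite /dtransported (le_trans (ler_normD _ _))// lerD// normrM ler_pM//.
- rewrite (le_trans (ler_norm_sum _ _ _))// ler_sum// => l _; rewrite normrM ler_pM ?hM//.
  have xl := coord_le1 l sx; have pl := coord_le1 l sPhi.
  have tp : `|t x * Phi ord0 l| <= 1.
    by rewrite normrM -[leRHS]mulr1 ler_pM.
  rewrite (le_trans (ler_normD _ _))// lerD//.
    by rewrite normrM -[leRHS]mulr1 ler_pM// (ger0_norm h0).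
  rewrite normrM expr2 ler_pM// (le_trans (ler_normD _ _))// normrM.
  rewrite (@le_trans _ _ (1 + `|r - 1| * 1))//; first by rewrite lerD// ler_wpM2l.
  by rewrite mulr1 ger0_norm ?subr_ge0// addrC subrK.
- exact: hM0.
- rewrite (le_trans (ler_normD _ _))// lerD// normrM (ger0_norm r0) ler_pM//.
  rewrite 2!normrM -[leRHS]mulr1 mulrAC ler_pM ?mulr_ge0//.
  by rewrite ger0_norm// ler_wpM2l.
Qed.

Lemma measurable_dtransported phi : elem phi ->
  measurable_fun setT (fun p : 'rV[R]_n.+1 * measurableTypeR R => dtransported phi p.2 p.1).
Proof.
move=> ephi.
have m2 : measurable_fun setT (fun p : 'rV[R]_n.+1 * measurableTypeR R => p.2 : R).
  exact: measurable_snd.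
have m1 : measurable_fun setT (fun p : 'rV[R]_n.+1 * measurableTypeR R => p.1).
  exact: measurable_fst.
have [mh mfl] := measurable_flow_joint Phi m2 m1.
have mt : measurable_fun setT (fun p : 'rV[R]_n.+1 * measurableTypeR R => t p.1).
  exact: (measurableT_comp (continuous_measurable_rV (@continuous_dotvl R n.+1 Phi)) m1).
have mx l : measurable_fun setT (fun p : 'rV[R]_n.+1 * measurableTypeR R => p.1 ord0 l).
  exact: (measurableT_comp (measurable_coord l) m1).
have mdh : measurable_fun setT (fun p : 'rV[R]_n.+1 * measurableTypeR R => dflow_fac Phi p.2 p.1).
  apply: measurable_funN; apply: measurable_funM; last exact: measurable_funX.
  by apply: measurable_funM => //; exact: measurable_funX.
have mphi psi : elem psi ->
    measurable_fun setT (fun p : 'rV[R]_n.+1 * measurableTypeR R => psi (flow p.2 p.1)).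
  by move=> epsi; exact: (measurableT_comp (elem_measurable epsi) mfl).
apply: measurable_funD; apply: measurable_funM.
- apply: measurable_sum => l; apply: measurable_funM.
    apply: measurable_funD; first by apply: measurable_funM => //; exact: measurable_funM.
    apply: measurable_funM => //; apply: measurable_funD => //.
    by apply: measurable_funM; [exact: measurable_funB|exact: measurable_funM].
  by apply: mphi; have [_] := elem_differentiable ephi; exact.
- by apply: measurable_funM => //; exact: measurable_funX.
- exact: mphi.
- apply: measurable_funD; first exact: measurable_funX.
  apply: measurable_funM => //; apply: measurable_funM => //.
  by apply: measurable_funM => //; exact: measurable_funX.
Qed.

Lemma continuous_dtransported phi x r : elem phi -> 0 < r -> sphere n x ->
  {for r, continuous (fun r => dtransported phi r x)}.
Proof.
move=> ephi r0 sx; have D0 := flow_den_gt0 sPhi r0 sx.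
have ch : {for r, continuous (fun r => flow_fac r x)}.
  by apply: differentiable_continuous; apply/derivable1_diffP; have [] := der_flow_fac D0.
have cid : {for r, continuous (fun r : R => r)} by exact: cvg_id.
have cdh : {for r, continuous (fun r => dflow_fac Phi r x)}.
  apply: catN; apply: catM; last exact: catX.
  by apply: catM => //; exact: cat_cst.
have cphi psi : elem psi -> {for r, continuous (fun r => psi (flow r x))}.
  move=> epsi; apply: differentiable_continuous.
  have dc l : differentiable (fun r => flow_coord Phi r l x) r.
    by apply/derivable1_diffP; have [] := der_flow_coord l D0.
  have dpsi y : differentiable psi y by have [] := elem_differentiable epsi.
  by have [] := derive_row_comp (1 : R) dc (dpsi (flow r x)).
have cj : {for r, continuous (fun r => flow_jac r x)}.
  by apply: catM => //; exact: catX.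
apply: catD; apply: catM => //.
- apply: cat_sum => l; apply: catM; last first.
    by apply: cphi; have [_] := elem_differentiable ephi; exact.
  apply: catD; first by apply: catM => //; exact: cat_cst.
  apply: catM => //; apply: catD; first exact: cat_cst.
  apply: catM; last exact: cat_cst.
  by apply: catD => //; exact: cat_cst.
- exact: cphi.
- apply: catD; first exact: catX.
  apply: catM => //; apply: catM => //.
  by apply: catM; [exact: cat_cst|exact: catX].
Qed.

Lemma integral_dtransported phi (c : R) a x : elem phi -> 1 < a -> sphere n x ->
  (\int[lebesgue_measure]_(r in itv1 a) (c * dtransported phi r x)%:E =
   (c * transported phi a x - c * phi x)%:E)%E.
Proof.
move=> ephi a1 sx.
have dT r : 1 <= r -> is_derive r (1 : R) (fun r => c * transported phi r x) (c * dtransported phi r x).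
  move=> r1; have D0 : 0 < flow_den Phi r x by exact: (lt_le_trans ltr01 (flow_den_ge1 Phi x r1)).
  apply: (der_eq (derM (der_cst r c) (der_transported ephi D0))).
  by rewrite mul0r add0r.
have cd r : 1 <= r -> {for r, continuous (fun r => c * dtransported phi r x)}.
  move=> r1; apply: catM; first exact: cat_cst.
  exact: continuous_dtransported ephi (lt_le_trans ltr01 r1) sx.
have cT r : 1 <= r -> {for r, continuous (fun r => c * transported phi r x)}.
  by move=> r1; apply: differentiable_continuous; apply/derivable1_diffP; have [] := dT r r1.
have := @continuous_FTC2 R (fun r => c * dtransported phi r x) (fun r => c * transported phi r x) 1 a a1.
rewrite /transported flow1 flow_jac1 mulr1 -EFinB; apply.
- apply: continuous_in_subspaceT => r; rewrite inE/= in_itv/= => /andP[r1 _].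
  exact: (cd r r1).
- split.
  + by move=> r; rewrite in_itv/= => /andP[r1 _]; have [] := dT r (ltW r1).
  + apply: cvg_at_right_filter; exact: (cT 1 (lexx 1)).
  + apply: cvg_at_left_filter; exact: (cT a (ltW a1)).
- move=> r; rewrite in_itv/= => /andP[r1 _]; rewrite derive1E.
  by have [] := dT r (ltW r1).
Qed.

(** The increment of the transported test function is the integral of its r-derivative. By the
    continuity equation this derivative is 1/r times the divergence of a smooth tangent field,
    against which the weak gradient may be used once Fubini has exchanged the integrals. No
    derivative ever falls on u. *)
Lemma flow_identity phi (u : 'rV[R]_n.+1 -> R) Psi a : elem phi -> 1 < a ->
  measurable_fun setT u ->
  (surface_measure n).-integrable (sphere n) (EFin \o u) -> weak_surface_gradient u Psi ->
  (\int[surface_measure n]_(x in sphere n) (u x * transported phi a x - u x * phi x)%:E =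
   \int[lebesgue_measure]_(r in itv1 a) \int[surface_measure n]_(x in sphere n)
     (- (r^-1 * (t x * dotv (Psi x) Phi * transported phi r x)))%:E)%E.
Proof.
move=> ephi a1 mu ui wP; have mS := @measurable_sphere R n.
have [C C0 hC] := dtransported_bounded a ephi.
transitivity (\int[surface_measure n]_(x in sphere n) \int[lebesgue_measure]_(r in itv1 a)
    (u x * dtransported phi r x)%:E)%E.
  by apply: eq_integral => x /set_mem sx; rewrite integral_dtransported.
have mf : measurable_fun setT (fun p : 'rV[R]_n.+1 * measurableTypeR R =>
    u p.1 * dtransported phi p.2 p.1).
  apply: measurable_funM; last exact: measurable_dtransported.
  by apply: (measurableT_comp mu); exact: measurable_fst.
have ifin : (\int[surface_measure n]_(x in sphere n) (`|u x|%:E) < +oo)%E.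
  by case/integrableP : ui => _; under eq_integral do rewrite /=.
pose I := fine (\int[surface_measure n]_(x in sphere n) (`|u x|%:E))%E.
have mau : measurable_fun (sphere n) (fun x => (`|u x|)%:E).
  by apply/measurable_EFinP; apply: measurable_funTS; exact: measurableT_comp.
rewrite (@fubini_itv _ _ _ (surface_measure n) _ 1 a (fun x r => u x * dtransported phi r x) mS mf (C * I)).
  apply: eq_integral => r /set_mem; rewrite /= in_itv/= => /andP[r1 _].
  have r0 : 0 < r by exact: lt_le_trans r1.
  have sV := smooth_transported Phi ephi r1.
  have [j1 j2 E] := weak_surface_gradientE ui wP sV.
  transitivity (\int[surface_measure n]_(x in sphere n) ((r^-1)%:E *
      (u x * surface_div (fun x => transported phi r x *: (t x *: meridian Phi x)) x)%:E))%E.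
    apply: eq_integral => x /set_mem sx.
    by rewrite surface_div_transported// -EFinM; congr EFin; field; rewrite gt_eqF.
  rewrite integralZl// -[X in (_ * X)%E]oppeK -E muleN -mulNe -EFinN -integralZl//.
  apply: eq_integral => x /set_mem sx.
  rewrite -EFinM !dotvZr dotv_meridian; last by case: wP => t0 _ _; exact: t0.
  by congr EFin; ring.
move=> r r1a; apply: (@le_trans _ _ (\int[surface_measure n]_(x in sphere n) (C%:E * (`|u x|)%:E))%E).
  apply: ge0_le_integral => //.
  - apply/measurable_EFinP; apply: measurable_funTS; apply: measurableT_comp => //.
    have m2 : measurable_fun setT (fun x : 'rV[R]_n.+1 => (x, r : measurableTypeR R)).
      by apply/measurable_fun_pairP; split; [exact: measurable_id|exact: measurable_cst].
    exact: (measurableT_comp mf m2).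
  - exact: measurable_funeM.
  - by move=> x sx; rewrite lee_fin normrM mulrC ler_wpM2r// hC.
rewrite ge0_integralZl//.
by rewrite /I EFinM fineK// ge0_fin_numE//; exact: integral_ge0.
Qed.

End flow_identity.

Lemma measurable_invr (R : realType) : measurable_fun setT (fun r : measurableTypeR R => r^-1 : R).
Proof.
have mN : measurable (~` [set 0 : R]) by exact: measurableC.
have -> : (fun r : R => r^-1) = (fun r => r^-1) \_ (~` [set 0 : R]).
  apply/funext => r; rewrite patchE; case: ifPn => // /negP; rewrite inE/= => r0.
  have -> : r = 0 by apply: contrapT => /r0.
  by rewrite invr0.
apply/(measurable_restrictT _ mN).
apply: open_continuous_measurable_fun.
  by rewrite openC; exact: closed_eq.
by move=> x; rewrite inE/= => /eqP x0; exact: inv_continuous.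
Qed.

Section flow_change_of_variables.
Context {R : realType}.
Variables (n : nat) (Phi : 'rV[R]_n.+1).
Hypothesis sPhi : sphere n Phi.
Implicit Types (x y : 'rV[R]_n.+1) (a b r : R).
Local Notation flow := (flow Phi).
Local Notation flow_jac := (flow_jac Phi).
Local Notation transported := (transported Phi).
Local Notation sigma := (@surface_measure R n).

Let mS := @measurable_sphere R n.

(** This is the divergence theorem for smooth tangent fields; fed into [flow_identity], it shows
    that transport preserves integrals. *)
Lemma weak_surface_gradient_cst (c : R) :
  weak_surface_gradient (fun _ : 'rV[R]_n.+1 => c) (fun=> 0).
Proof.
split => [x _|i|V sV].
- by rewrite /dotv big1// => i _; rewrite mxE mul0r.
- rewrite (_ : (fun x => _) = fun=> 0); last by apply/funext => x; rewrite mxE.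
  rewrite -[1%:E]/(1%:R%:E); apply/Lfun_natP => //; split; first exact: measurable_cst.
  by under eq_integral do rewrite normr0 expr1; rewrite integral0.
- rewrite /Rintegral integral0_eq; last first.
    by move=> x _; rewrite /dotv big1// => i _; rewrite mxE mul0r.
  have CV i : C1_sphere (fun x => V x ord0 i) by exact/C1_near_C1/smooth_C1/sV.1.
  have ci := sphere_continuous_integrable (surface_div_continuous CV).
  have := integralZl mS ci c; under eq_integral do rewrite /= -EFinM.
  by move=> ->; rewrite divergence_theorem ?mule0 ?oppr0//; case: sV.
Qed.

Lemma integrable_elem phi : elem phi -> sigma.-integrable (sphere n) (EFin \o phi).
Proof.
move=> ephi; apply: sphere_continuous_integrable => x _; exact: elem_continuous.
Qed.

Lemma integral_transported phi a : elem phi -> 1 <= a ->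
  (\int[sigma]_(x in sphere n) (transported phi a x)%:E =
   \int[sigma]_(x in sphere n) (phi x)%:E)%E.
Proof.
move=> ephi; rewrite le_eqVlt => /orP[/eqP <-|a1].
  by apply: eq_integral => x _; rewrite /transported flow1 flow_jac1 mulr1.
have i1 : sigma.-integrable (sphere n) (EFin \o (fun=> 1)).
  by apply: integrable_elem; exact: elem_cst.
have := flow_identity sPhi ephi a1 (@measurable_cst _ _ _ _ _ (1 : R)) i1 (weak_surface_gradient_cst 1).
rewrite [RHS]integral0_eq; last first.
  move=> r _; rewrite integral0_eq// => x _.
  by rewrite (_ : dotv 0 Phi = 0) ?(mulr0, mul0r, oppr0)// /dotv big1// => i _; rewrite mxE mul0r.
under eq_integral do rewrite !mul1r EFinB.
have ip := integrable_elem ephi.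
have iT := integrable_elem (elem_transported Phi ephi (ltW a1)).
rewrite integralB// => /eqP; rewrite sube_eq ?add0e.
- by move/eqP.
- exact: integrable_fin_num.
- by rewrite fin_num_adde_defl// integrable_fin_num.
Qed.

(** For g in [elem] this is the conservation of mass [integral_transported]; [elem_separation] and
    [ge0_change_of_variables] extend it to all nonnegative measurable g. *)
Lemma ge0_integral_flow a (g : 'rV[R]_n.+1 -> R) : 1 <= a ->
  measurable_fun setT g -> (forall x, 0 <= g x) ->
  (\int[sigma]_(x in sphere n) (flow_jac a x * g (flow a x))%:E =
   \int[sigma]_(x in sphere n) (g x)%:E)%E.
Proof.
move=> a1 mg g0.
have mfl := measurable_flow Phi a; have mj := measurable_flow_jac Phi a.
rewrite [RHS](eq_integral (fun x => (1 * g x)%:E)); last by move=> x _; rewrite mul1r.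
have ij := integrable_elem (elem_flow_jac Phi a1).
have i1 : sigma.-integrable (sphere n) (EFin \o (fun=> 1)).
  by apply: integrable_elem; exact: elem_cst.
apply: (@ge0_change_of_variables _ _ _ _ _ sigma (sphere n) mS (flow a) id _ (fun=> 1)) => //.
- exact: measurable_funTS.
- by move=> x _; rewrite flow_jac_ge0// (le_trans ler01).
apply: (elem_separation mS mfl (@measurable_id _ _ _) ij i1) => phi ephi _.
under [RHS]eq_integral do rewrite mul1r.
rewrite -(integral_transported ephi a1); apply: eq_integral => x _.
by rewrite /transported mulrC.
Qed.

Lemma integral_flow a (g : 'rV[R]_n.+1 -> R) : 1 <= a ->
  measurable_fun setT g -> sigma.-integrable (sphere n) (EFin \o g) ->
  (\int[sigma]_(x in sphere n) (flow_jac a x * g (flow a x))%:E =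
   \int[sigma]_(x in sphere n) (g x)%:E)%E.
Proof.
move=> a1 mg ig; have mj := measurable_flow_jac Phi a.
have mfl := measurable_flow Phi a.
have part (h : 'rV[R]_n.+1 -> R) : measurable_fun setT h -> (forall x, 0 <= h x <= `|g x|) ->
    [/\ sigma.-integrable (sphere n) (EFin \o h),
        sigma.-integrable (sphere n) (fun x => (flow_jac a x * h (flow a x))%:E) &
  (\int[sigma]_(x in sphere n) (flow_jac a x * h (flow a x))%:E =
   \int[sigma]_(x in sphere n) (h x)%:E)%E].
  move=> mh hg; have h0 x : 0 <= h x by have /andP[] := hg x.
  have E := ge0_integral_flow a1 mh h0.
  have ih : sigma.-integrable (sphere n) (EFin \o h).
    apply: (le_integrable mS _ _ ig); first by apply/measurable_EFinP; exact: measurable_funTS.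
    by move=> x _ /=; rewrite lee_fin (ger0_norm (h0 x)); have /andP[] := hg x.
  split => //; apply/integrableP; split.
    apply/measurable_EFinP; apply: measurable_funTS; apply: measurable_funM => //.
    exact: measurableT_comp.
  rewrite (eq_integral (fun x => (flow_jac a x * h (flow a x))%:E)); last first.
    by move=> x _; rewrite abse_EFin ger0_norm// mulr_ge0// flow_jac_ge0// (le_trans ler01).
  rewrite E; case/integrableP : ih => _; congr (_ < _)%E.
  by apply: eq_integral => x _; rewrite /= ger0_norm.
have [p1 p2 p3] : [/\ sigma.-integrable (sphere n) (EFin \o (fun x => Num.max (g x) 0)),
    sigma.-integrable (sphere n) (fun x => (flow_jac a x * Num.max (g (flow a x)) 0)%:E) &
  (\int[sigma]_(x in sphere n) (flow_jac a x * Num.max (g (flow a x)) 0)%:E =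
   \int[sigma]_(x in sphere n) (Num.max (g x) 0)%:E)%E].
  apply: (part (fun x => Num.max (g x) 0)); first exact: measurable_maxr.
  by move=> x; rewrite le_max lexx orbT/= ge_max normr_ge0 ler_norm.
have [q1 q2 q3] : [/\ sigma.-integrable (sphere n) (EFin \o (fun x => Num.max (- g x) 0)),
    sigma.-integrable (sphere n) (fun x => (flow_jac a x * Num.max (- g (flow a x)) 0)%:E) &
  (\int[sigma]_(x in sphere n) (flow_jac a x * Num.max (- g (flow a x)) 0)%:E =
   \int[sigma]_(x in sphere n) (Num.max (- g x) 0)%:E)%E].
  apply: (part (fun x => Num.max (- g x) 0)).
    by apply: measurable_maxr => //; exact: measurable_funN.
  by move=> x; rewrite le_max lexx orbT/= ge_max normr_ge0 -normrN ler_norm.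
have gE x : g x = Num.max (g x) 0 - Num.max (- g x) 0.
  by case: (lerP (g x) 0) => gx; case: (lerP (- g x) 0) => gx'; lra.
rewrite (eq_integral (fun x => (flow_jac a x * Num.max (g (flow a x)) 0)%:E -
    (flow_jac a x * Num.max (- g (flow a x)) 0)%:E)%E); last first.
  by move=> x _; rewrite -EFinB -mulrBr -gE.
rewrite [RHS](eq_integral (fun x => (Num.max (g x) 0)%:E - (Num.max (- g x) 0)%:E)%E); last first.
  by move=> x _; rewrite -EFinB -gE.
by rewrite !integralB// p3 q3.
Qed.

End flow_change_of_variables.

Lemma integralZl_fine d (T : measurableType d) (R : realType) (mu : {measure set T -> \bar R})
    (D : set T) (f : T -> R) (c : R) : measurable D -> mu.-integrable D (EFin \o f) ->
  (\int[mu]_(x in D) (c * f x)%:E)%E = (c * fine (\int[mu]_(x in D) (f x)%:E)%E)%:E.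
Proof.
move=> mD fi; under eq_integral do rewrite EFinM.
by rewrite (integralZl mD fi) EFinM fineK//; exact: integrable_fin_num.
Qed.

Lemma abse_fine_le (R : realType) (z : \bar R) : (`|fine z|%:E <= `|z|)%E.
Proof. by case: z => [z| |] //=; rewrite normr0 leey. Qed.

Lemma abse_fine_integral_le d (T : measurableType d) (R : realType)
    (mu : {measure set T -> \bar R}) (D : set T) (f : T -> R) :
  measurable D -> measurable_fun D f ->
  ((`|fine (\int[mu]_(x in D) (f x)%:E)|)%:E <= \int[mu]_(x in D) (`|f x|)%:E)%E.
Proof.
move=> mD mf; apply: (le_trans (abse_fine_le _)).
by apply: le_trans (le_abse_integral _ mD _) _ => //; exact/measurable_EFinP.
Qed.

(** * Almost everywhere increments along orbits *)

Section flow_ae.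
Context {R : realType}.
Variables (n : nat) (Phi : 'rV[R]_n.+1).
Hypothesis sPhi : sphere n Phi.
Implicit Types (x y : 'rV[R]_n.+1) (a b r : R).
Local Notation t x := (dotv x Phi).
Local Notation flow := (flow Phi).
Local Notation flow_jac := (flow_jac Phi).
Local Notation transported := (transported Phi).
Local Notation sigma := (@surface_measure R n).
Local Notation itv1 a := ([set` `[1, a]] : set R).

Let mS := @measurable_sphere R n.

Variables (u : 'rV[R]_n.+1 -> R) (Psi : 'rV[R]_n.+1 -> 'rV[R]_n.+1).
Hypothesis mu : measurable_fun setT u.
Hypothesis ui : sigma.-integrable (sphere n) (EFin \o u).
Hypothesis wP : weak_surface_gradient u Psi.

(** The derivative of u along X = t [meridian]: for tangent [Psi] the pairing with the meridian
    field equals the pairing with [Phi]. *)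
Definition meridian_slope x : R := t x * dotv (Psi x) Phi.
Local Notation v := meridian_slope.

Lemma measurable_meridian_slope : measurable_fun setT v.
Proof.
have mt : measurable_fun setT (fun x => t x).
  by apply: continuous_measurable_rV; exact: continuous_dotvl.
apply: measurable_funM => //; apply: measurable_sum => i; apply: measurable_funM => //.
by have [_ /(_ i)/Lfun1_sphere_integrable[]] := wP.
Qed.

Lemma integrable_meridian_slope : sigma.-integrable (sphere n) (EFin \o v).
Proof.
have sV := smooth_transported Phi (elem_cst n.+1 1) (lexx 1).
have [i1 _ _] := weak_surface_gradientE ui wP sV.
apply: eq_integrable i1 => // x /set_mem sx /=.
rewrite !dotvZr dotv_meridian; last by case: wP => t0 _ _; exact: t0.
by rewrite /transported flow_jac1 !mul1r.
Qed.

(** Formally minus the r-derivative of u along the backward orbit r -> [flow r^-1 y]. *)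
Let f y r := r^-1 * v (flow r^-1 y).

Let mf : measurable_fun setT (fun p : 'rV[R]_n.+1 * measurableTypeR R => f p.1 p.2).
Proof.
have m2 : measurable_fun setT (fun p : 'rV[R]_n.+1 * measurableTypeR R => p.2^-1 : R).
  exact: (measurableT_comp (@measurable_invr R) (@measurable_snd _ _ _ _)).
have m1 : measurable_fun setT (fun p : 'rV[R]_n.+1 * measurableTypeR R => p.1).
  exact: measurable_fst.
have [_ mfl] := measurable_flow_joint Phi m2 m1.
by apply: measurable_funM => //; exact: (measurableT_comp measurable_meridian_slope mfl).
Qed.

Let mfr r : measurable_fun setT (f ^~ r).
Proof.
apply: measurable_funM => //.
exact: (measurableT_comp measurable_meridian_slope (measurable_flow Phi r^-1)).
Qed.

Let C : R := fine (\int[sigma]_(x in sphere n) (`|v x|)%:E)%E.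

(** After the change of variables x = [flow r y] the Jacobian, at most r, absorbs the factor 1/r;
    the bound is therefore independent of r. *)
Let fC r : 1 <= r -> (\int[sigma]_(x in sphere n) (`|f x r|)%:E <= C%:E)%E.
Proof.
move=> r1; have r0 : 0 < r by exact: lt_le_trans r1.
have mav : measurable_fun setT (fun x => `|v x|).
  by apply: measurableT_comp => //; exact: measurable_meridian_slope.
rewrite /C fineK; last first.
  rewrite ge0_fin_numE; last by apply: integral_ge0 => x _; rewrite lee_fin.
  by case/integrableP : integrable_meridian_slope.
rewrite -(ge0_integral_flow sPhi (g := fun x => `|f x r|) r1)//; last first.
  by apply: measurableT_comp => //; exact: mfr.
apply: ge0_le_integral => //.
- by move=> x _; rewrite lee_fin mulr_ge0// flow_jac_ge0// ltW.
- apply/measurable_EFinP; apply: measurable_funTS; apply: measurable_funM.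
    exact: measurable_flow_jac.
  apply: measurableT_comp => //.
  exact: (measurableT_comp (mfr r) (measurable_flow Phi r)).
- by apply/measurable_EFinP; exact: measurable_funTS.
- move=> x sx; rewrite lee_fin /f flowVK// normrM mulrA ler_piMl//.
  rewrite (ger0_norm (ltW _)) ?invr_gt0// -/(flow_jac r x / r) ler_pdivrMr// mul1r.
  exact: flow_jac_le.
Qed.

(** Tested against phi and rewritten by change of variables and Fubini, [flow_identity] says that
    u([flow a^-1 y]) - u(y) plus the integral of f over [1, a] has zero integral against every phi,
    hence vanishes almost everywhere. *)
Lemma ae_flow a : 1 < a -> {ae sigma, forall y, sphere n y ->
  ((`|u (flow a^-1 y) - u y|)%:E <=
   \int[lebesgue_measure]_(r in itv1 a) (`|r^-1 * v (flow r^-1 y)|)%:E)%E}.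
Proof.
move=> a1; have a0 : 0 < a by exact: lt_trans a1.
have fC' r : 1 <= r <= a -> (\int[sigma]_(x in sphere n) (`|f x r|)%:E <= C%:E)%E.
  by move=> /andP[r1 _]; exact: fC.
pose I y : \bar R := (\int[lebesgue_measure]_(r in itv1 a) (f y r)%:E)%E.
have iI : sigma.-integrable (sphere n) I := integrable_fubini_itv mS mf fC'.
have aeI := ae_integrable_itv mS mf fC'.
(* I is integrable, hence finite almost everywhere; w is a real-valued representative. *)
pose w y : R := fine (I y).
have iw : sigma.-integrable (sphere n) (EFin \o w).
  apply: (le_integrable mS _ _ iI).
    apply/measurable_EFinP; apply: (measurableT_comp (f := fine)); first exact: fine_measurable.
    by case/integrableP : iI.
  by move=> x _; exact: abse_fine_le.
pose ua y := u (flow a^-1 y).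
have mua : measurable_fun setT ua by exact: (measurableT_comp mu (measurable_flow Phi a^-1)).
have iua : sigma.-integrable (sphere n) (EFin \o ua).
  apply/integrableP; split; first by apply/measurable_EFinP; exact: measurable_funTS.
  rewrite (eq_integral (fun x => (`|ua x|)%:E))//.
  rewrite -(ge0_integral_flow sPhi (g := fun x => `|ua x|) (ltW a1))//; last exact: measurableT_comp.
  apply: (@le_lt_trans _ _ (\int[sigma]_(x in sphere n) (a%:E * (`|u x|)%:E))%E).
    apply: ge0_le_integral => //.
    - by move=> x _; rewrite lee_fin mulr_ge0// flow_jac_ge0// ltW.
    - apply/measurable_EFinP; apply: measurable_funTS; apply: measurable_funM.
        exact: measurable_flow_jac.
      apply: measurableT_comp => //.
      exact: (measurableT_comp mua (measurable_flow Phi a)).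
    - apply: measurable_funeM; apply/measurable_EFinP.
      by apply: measurable_funTS; exact: measurableT_comp.
    - move=> x sx; rewrite -EFinM lee_fin /ua flowVK// ler_wpM2r//.
      exact/flow_jac_le/ltW.
  rewrite ge0_integralZl//; last 2 first.
  - by apply/measurable_EFinP; apply: measurable_funTS; exact: measurableT_comp.
  - by rewrite lee_fin ltW.
  by rewrite lte_mul_pinfty ?lee_fin ?(ltW a0)//; case/integrableP : ui.
have key : {ae sigma, forall y, sphere n y -> ua y - u y + w y = 0}.
  apply: sphere_ae_eq0.
    exact: (integrableD mS (integrableB mS iua ui) iw).
  move=> phi ephi phi01.
  have cphi : sphere_continuous phi by move=> x _; exact: elem_continuous.
  have mphi := elem_measurable ephi.
  have i1 := integrable_continuousM iua cphi.
  have i2 := integrable_continuousM ui cphi.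
  have i3 := integrable_continuousM iw cphi.
  have FI := flow_identity sPhi ephi a1 mu ui wP.
  have iT : sigma.-integrable (sphere n) (fun x => (u x * transported phi a x)%:E).
    apply: integrable_continuousM => // x _.
    by apply: elem_continuous; apply: elem_transported => //; exact: ltW.
  have E1 : (\int[sigma]_(x in sphere n) (u x * transported phi a x)%:E =
             \int[sigma]_(x in sphere n) (ua x * phi x)%:E)%E.
    rewrite -(integral_flow sPhi (g := fun x => ua x * phi x) (ltW a1))//; last exact: measurable_funM.
    by apply: eq_integral => x /set_mem sx; rewrite /ua flowVK// /transported; congr EFin; ring.
  (* The inner integral is moved by [flow r]: the transported test function becomes phi and the
     slope is evaluated on the backward orbit. Integrating in r first then produces w. *)
  have E2 : (\int[lebesgue_measure]_(r in itv1 a) \int[sigma]_(x in sphere n)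
      (- (r^-1 * (t x * dotv (Psi x) Phi * transported phi r x)))%:E =
    - \int[sigma]_(x in sphere n) (w x * phi x)%:E)%E.
    have mg : measurable_fun setT
        (fun p : 'rV[R]_n.+1 * measurableTypeR R => - phi p.1 * f p.1 p.2).
      apply: measurable_funM => //; apply: measurable_funN.
      exact: (measurableT_comp mphi (@measurable_fst _ _ _ _)).
    have gC r : 1 <= r <= a -> (\int[sigma]_(x in sphere n) (`|- phi x * f x r|)%:E <= C%:E)%E.
      move=> r1a; apply: le_trans (fC' _ r1a); apply: ge0_le_integral => //.
      - apply/measurable_EFinP; apply: measurable_funTS; apply: measurableT_comp => //.
        by apply: measurable_funM; [exact: measurable_funN|exact: mfr].
      - by apply/measurable_EFinP; apply: measurable_funTS; apply: measurableT_comp => //; exact: mfr.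
      - move=> x _; have /andP[p0 p1] := phi01 x.
        by rewrite lee_fin normrM normrN ler_piMl// ger0_norm.
    have E3 : (\int[lebesgue_measure]_(r in itv1 a) \int[sigma]_(x in sphere n)
      (- (r^-1 * (t x * dotv (Psi x) Phi * transported phi r x)))%:E =
      \int[lebesgue_measure]_(r in itv1 a) \int[sigma]_(x in sphere n) (- phi x * f x r)%:E)%E.
      apply: eq_integral => r /set_mem; rewrite /= in_itv/= => /andP[r1 ra].
      have r0 : 0 < r by exact: lt_le_trans r1.
      have ifr : sigma.-integrable (sphere n) (EFin \o f ^~ r).
        apply/integrableP; split; first by apply/measurable_EFinP; apply: measurable_funTS; exact: mfr.
        by apply: le_lt_trans (fC r1) _; rewrite ltry.
      have mphi' : measurable_fun setT (fun x => - phi x) by exact: measurable_funN.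
      rewrite -(integral_flow sPhi (g := fun x => - phi x * f x r) r1); last 2 first.
      - by apply: measurable_funM => //; exact: mfr.
      - have cphiN : sphere_continuous (fun x => - phi x) by move=> x sx; apply: catN; exact: cphi.
        by apply: eq_integrable (integrable_continuousM ifr cphiN) => // x _ /=; rewrite mulrC.
      apply: eq_integral => x /set_mem sx.
      by rewrite /f flowVK// /v /transported; congr EFin; ring.
    rewrite E3 -(fubini_itv mS mg gC).
    have mIphi : measurable_fun (sphere n) (fun x => \int[lebesgue_measure]_(r in itv1 a) (- phi x * f x r)%:E)%E.
      by case/integrableP : (integrable_fubini_itv mS mg gC).
    rewrite -[RHS]mulN1e -[(- 1)%E]/((-1)%:E) -integralZl//.
    apply: ae_eq_integral => //.
      by apply: measurable_funeM; case/integrableP : i3.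
    apply: filterS aeI => x ix sx.
    transitivity ((- phi x * w x)%:E); last by rewrite -EFinM; congr EFin; ring.
    by apply: integralZl_fine (ix sx); exact: measurable_itv.
  under eq_integral do rewrite mulrDl mulrBl EFinD.
  rewrite integralD//; last exact: (integrableB mS i1 i2).
  under eq_integral do rewrite EFinB.
  rewrite integralB// -E1 -integralB//.
  under eq_integral do rewrite -EFinB.
  by rewrite FI E2 addeC subee// integrable_fin_num.
apply: filterS key => y ky sy; have {ky}ky := ky sy.
have -> : u (flow a^-1 y) - u y = - w y by apply/eqP; rewrite -addr_eq0; apply/eqP.
rewrite normrN.
apply: abse_fine_integral_le; first exact: measurable_itv.
apply: measurable_funTS.
have m2 : measurable_fun setT (fun r : measurableTypeR R => (y, r)).
  by apply/measurable_fun_pairP; split; [exact: measurable_cst|exact: measurable_id].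
exact: (measurableT_comp mf m2).
Qed.

End flow_ae.

Lemma der_seq (R : realType) (f : R -> R) (x d : R) : is_derive x (1 : R) f d ->
  (fun j => (f (x + harmonic j) - f x) / harmonic j) @ \oo --> d.
Proof.
move=> [df fd].
have h0 : (harmonic : nat -> R) @ \oo --> (0 : R)^'.
  have /cvgrPdist_lt h := @cvg_harmonic R.
  move=> A [e /= e0 eA]; have := h e e0; apply: filterS => j hj.
  by apply: eA => //=; rewrite gt_eqF// harmonic_gt0.
rewrite -fd; apply: cvg_trans (cvg_comp _ _ h0 df).
apply: near_eq_cvg; near=> j => /=.
by rewrite scaleRE [_%:A]scaleRE mulr1 mulrC (addrC x).
Unshelve. all: by end_near. Qed.

Lemma measurable_sqrt (R : realType) : measurable_fun setT (@Num.sqrt R).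
Proof. by apply: continuous_measurable_fun; exact: sqrt_continuous. Qed.

(** * The regularised weight and its divergence *)

Section weight.
Context {R : realType}.
Implicit Types (z r a delta : R).

Definition sn z : R := Num.sqrt (1 - z ^+ 2).
Definition lg z : R := 1 - ln (sn z).
(* [reg delta] regularises s^2 log(e/s) at the poles; at delta = 0 one has
   sn z / reg 0 z = 1 / (s log(e/s)), again with value 0 at the poles. *)
Definition reg delta z : R := sn z ^+ 2 * lg z + delta.
Definition weight p k delta z : R := `|z| ^+ k * sn z ^+ p * (reg delta z)^-1 ^+ p.+1.

Lemma sn_ge0 z : 0 <= sn z. Proof. exact: sqrtr_ge0. Qed.

Lemma sn_sqr z : z ^+ 2 <= 1 -> sn z ^+ 2 = 1 - z ^+ 2.
Proof. by move=> z1; rewrite sqr_sqrtr// subr_ge0. Qed.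

Lemma sn_le1 z : sn z <= 1.
Proof. by rewrite -sqrtr1 ler_sqrt// gerBl sqr_ge0. Qed.

Lemma lg_ge1 z : 1 <= lg z.
Proof. by rewrite lerBrDl gerDr ln_le0// sn_le1. Qed.

Lemma reg_ge delta z : delta <= reg delta z.
Proof. by rewrite lerDr mulr_ge0 ?sqr_ge0// (le_trans ler01 (lg_ge1 _)). Qed.

Lemma reg_gt0 delta z : 0 < delta -> 0 < reg delta z.
Proof. by move=> d0; exact: lt_le_trans (reg_ge _ _). Qed.

Lemma sn_sqr_le_reg delta z : 0 <= delta -> sn z ^+ 2 <= reg delta z.
Proof.
move=> d0; rewrite -[leLHS]addr0 lerD// ler_peMr ?sqr_ge0//.
exact: lg_ge1.
Qed.

Lemma measurable_sn : measurable_fun setT sn.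
Proof.
apply: (measurableT_comp (@measurable_sqrt R)).
by apply: measurable_funB => //; exact: measurable_funX.
Qed.

Lemma measurable_lg : measurable_fun setT lg.
Proof.
by apply: measurable_funB => //; apply: (measurableT_comp _ measurable_sn); exact: measurable_ln.
Qed.

Lemma measurable_reg delta : measurable_fun setT (reg delta).
Proof.
apply: measurable_funD => //; apply: measurable_funM; last exact: measurable_lg.
by apply: measurable_funX; exact: measurable_sn.
Qed.

Lemma measurable_weight p k delta : measurable_fun setT (weight p k delta).
Proof.
apply: measurable_funM; first apply: measurable_funM.
- by apply: measurable_funX; exact: normr_measurable.
- by apply: measurable_funX; exact: measurable_sn.
- apply: measurable_funX; apply: (measurableT_comp (@measurable_invr R)).
  exact: measurable_reg.
Qed.

Lemma weight_ge0 p k delta z : 0 < delta -> 0 <= weight p k delta z.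
Proof.
by move=> d0; rewrite !mulr_ge0 ?exprn_ge0 ?sn_ge0// invr_ge0 ltW// reg_gt0.
Qed.

Lemma weight_le p k delta z : 0 < delta -> z ^+ 2 <= 1 -> weight p k delta z <= delta^-1 ^+ p.+1.
Proof.
move=> d0 z1; have B0 := reg_gt0 z d0.
have az1 : `|z| <= 1 by rewrite -(@ler_pXn2r _ 2)// ?nnegrE// expr1n real_normK ?num_real.
rewrite -[leRHS]mul1r ler_pM ?mulr_ge0 ?exprn_ge0 ?sn_ge0 ?invr_ge0 ?(ltW B0)//.
  by rewrite mulr_ile1 ?exprn_ge0 ?sn_ge0// ?exprn_ile1 ?sn_ge0 ?sn_le1.
by rewrite lerXn2r ?nnegrE ?invr_ge0 ?(ltW B0) ?(ltW d0)// lef_pV2// ?posrE// reg_ge.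
Qed.

End weight.

Section flow_weight.
Context {R : realType}.
Variables (p k : nat) (Phi : 'rV[R]_p.+3) (delta : R).
Hypotheses (sPhi : sphere p.+2 Phi) (delta0 : 0 < delta).
Implicit Types (x : 'rV[R]_p.+3) (a r : R).
Local Notation t x := (dotv x Phi).
Local Notation flow := (flow Phi).
Local Notation flow_fac := (flow_fac Phi).
Local Notation flow_jac := (flow_jac Phi).

Lemma sn_flow a x : 0 < a -> sphere p.+2 x -> sn (t (flow a x)) = sn (t x) * flow_fac a x.
Proof.
move=> a0 sx; have D0 := flow_den_gt0 sPhi a0 sx.
have h0 := flow_fac_gt0 D0; have := flow_facK D0; rewrite /flow_den => E.
rewrite /sn dotv_flow// (_ : 1 - _ = (1 - t x ^+ 2) * flow_fac a x ^+ 2); last first.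
  by rewrite -{1}E; ring.
by rewrite sqrtrM ?subr_ge0 ?dotv_Phi_sqr_le1// sqrtr_sqr gtr0_norm.
Qed.

Lemma reg_flow a x : 0 < a -> sphere p.+2 x -> reg delta (t (flow a x)) =
  sn (t x) ^+ 2 * (flow_fac a x ^+ 2 * (lg (t x) - ln (flow_fac a x))) + delta.
Proof.
move=> a0 sx; have D0 := flow_den_gt0 sPhi a0 sx; have h0 := flow_fac_gt0 D0.
rewrite /reg /lg sn_flow//; congr (_ + _).
have [s0|s0] := eqVneq (sn (t x)) 0; first by rewrite s0; ring.
have sp : 0 < sn (t x) by rewrite lt_neqAle eq_sym s0 sn_ge0.
by rewrite lnM ?posrE//; ring.
Qed.

Let B a x := sn (t x) ^+ 2 * (flow_fac a x ^+ 2 * (lg (t x) - ln (flow_fac a x))) + delta.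

(** Isolates the dependence on a: the first factor, possibly singular or zero, is constant along the
    orbit, and the second is differentiable in a because delta > 0. *)
Lemma weight_flowE a x : 0 < a -> sphere p.+2 x ->
  weight p k delta (t (flow a x)) * flow_jac a x =
  (`|t x| ^+ k * sn (t x) ^+ p) *
    (a ^+ k.+1 * flow_fac a x ^+ (k + p + p.+3) * (B a x)^-1 ^+ p.+1).
Proof.
move=> a0 sx; have D0 := flow_den_gt0 sPhi a0 sx; have h0 := flow_fac_gt0 D0.
rewrite /weight reg_flow// sn_flow// dotv_flow// !normrM (gtr0_norm a0) (gtr0_norm h0).
rewrite -/(B a x) /flow_jac !exprMn !exprD [a ^+ k.+1]exprS; ring.
Qed.

(** Bounds the upward difference quotients of the weight by a multiple of the weight itself, which
    provides the nonnegativity that Fatou's lemma will require. *)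
Lemma weight_flow_le a x : 1 <= a -> sphere p.+2 x ->
  weight p k delta (t (flow a x)) * flow_jac a x <= a ^+ k.+1 * weight p k delta (t x).
Proof.
move=> a1 sx; have a0 : 0 < a by exact: lt_le_trans a1.
have D0 := flow_den_gt0 sPhi a0 sx; have h0 := flow_fac_gt0 D0.
have h1 : flow_fac a x <= 1 by exact: flow_fac_le1.
rewrite weight_flowE//; set h := flow_fac a x in h0 h1 *.
have B0 := reg_gt0 (t x) delta0.
have Bh : h ^+ 2 * reg delta (t x) <= B a x.
  rewrite /B /reg mulrDr lerD//; last by rewrite ler_piMl ?(ltW delta0)// exprn_ile1// ltW.
  rewrite mulrCA ler_wpM2l ?sqr_ge0// ler_wpM2l ?sqr_ge0// lerDl oppr_ge0.
  exact: ln_le0.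
have Bp : 0 < h ^+ 2 * reg delta (t x) by rewrite mulr_gt0// exprn_gt0.
rewrite (_ : a ^+ k.+1 * weight p k delta (t x) = (`|t x| ^+ k * sn (t x) ^+ p) *
  (a ^+ k.+1 * (reg delta (t x))^-1 ^+ p.+1)); last by rewrite /weight; ring.
rewrite ler_wpM2l ?mulr_ge0 ?exprn_ge0 ?sn_ge0// -mulrA ler_wpM2l ?exprn_ge0 ?(ltW a0)//.
apply: (@le_trans _ _ (h ^+ (k + p + p.+3) * (h ^+ 2 * reg delta (t x))^-1 ^+ p.+1)).
  rewrite ler_wpM2l ?exprn_ge0 ?(ltW h0)// lerXn2r ?nnegrE ?invr_ge0 ?(ltW Bp)//.
    exact: ltW (lt_le_trans Bp Bh).
  by rewrite lef_pV2// posrE// (lt_le_trans Bp).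
rewrite invfM exprMn mulrA ler_piMl ?exprn_ge0 ?invr_ge0 ?(ltW B0)//.
(* 2 (p+1) of the factors h cancel those of the regularised denominator; the k + 1 others are at
   most 1. *)
rewrite (_ : (k + p + p.+3 = 2 * p.+1 + k.+1)%N); last by ring.
rewrite exprD exprM mulrAC -exprMn mulfV ?gt_eqF ?exprn_gt0// expr1n mul1r.
by rewrite exprn_ile1// ltW.
Qed.

(* The divergence of the field [weight * t * meridian]. *)
Definition dweight x : R := weight p k delta (t x) *
  (k.+1%:R * (1 - t x ^+ 2) - p.+1%:R * t x ^+ 2 * (sn (t x) ^+ 2 + 2 * delta) / reg delta (t x)).

(** The continuity equation at a = 1 for the density [weight], which lies outside [elem], so the
    derivative is computed from the formula of [weight_flowE]. *)
Lemma der_weight_flow x : sphere p.+2 x ->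
  (fun j => (weight p k delta (t (flow (1 + harmonic j) x)) * flow_jac (1 + harmonic j) x
     - weight p k delta (t x)) / harmonic j) @ \oo --> dweight x.
Proof.
move=> sx.
have D1 : 0 < flow_den Phi 1 x by exact: flow_den_gt0.
have dh := der_flow_fac D1.
have h1 : flow_fac 1 x = 1.
  by rewrite /flow_fac /flow_den expr1n subrr mul0r addr0 powR1.
have B1 : B 1 x = reg delta (t x) by rewrite /B h1 ln1 subr0 expr1n mul1r.
have B10 : B 1 x != 0 by rewrite B1 gt_eqF// reg_gt0.
have h10 : 0 < flow_fac 1 x by rewrite h1.
have dB := derD (derM (der_cst (1 : R) (sn (t x) ^+ 2))
  (derM (derX 2 dh) (derB (der_cst (1 : R) (lg (t x))) (der_comp dh (is_derive1_ln h10)))))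
  (der_cst (1 : R) delta).
have dE := derM (der_cst (1 : R) (`|t x| ^+ k * sn (t x) ^+ p))
  (derM (derM (derX k.+1 (der_id (1 : R))) (derX (k + p + p.+3) dh)) (derX p.+1 (@derV _ (fun z => B z x) _ _ B10 dB))).
have := der_seq dE.
rewrite (_ : (fun j => _) = (fun j => (weight p k delta (t (flow (1 + harmonic j) x)) *
  flow_jac (1 + harmonic j) x - weight p k delta (t x)) / harmonic j)); last first.
  apply/funext => j; rewrite -weight_flowE//; last by rewrite addr_gt0// harmonic_gt0.
  by rewrite -(weight_flowE ltr01 sx) flow1 flow_jac1 mulr1.
set d := (X in _ --> X -> _); suff -> : d = dweight x by [].
rewrite /d /dweight /weight /dflow_fac -/(B 1 x) h1 !expr1n ln1 subr0 invr1.
rewrite B1.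
have := erefl (reg delta (t x)); rewrite {1}/reg.
move: (gt_eqF (reg_gt0 (t x) delta0)); set b := reg delta (t x) => /negbT b0 bE.
(* Eliminates the logarithm, leaving only [reg] in the derivative; this is the origin of the term 2
   delta in [dweight]. *)
have sE : sn (t x) ^+ 2 * lg (t x) = b - delta by rewrite -bE addrK.
rewrite exprS /=; set P := b^-1 ^+ p.
set T := `|t x| ^+ k * sn (t x) ^+ p.
transitivity (T * P * b^-1 * (k.+1%:R - (k + p + p.+3)%:R * t x ^+ 2 -
  p.+1%:R * (t x ^+ 2 * sn (t x) ^+ 2 - 2 * t x ^+ 2 * (sn (t x) ^+ 2 * lg (t x))) / b)).
  by field.
rewrite sE !natrD -[p.+3%:R]/((2 + p.+1)%:R) natrD -![_.+1%:R]natr1.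
by field.
Qed.

End flow_weight.

(** * Young's inequality and comparison along orbits *)

Section elementary_inequalities.
Context {R : realType}.
Implicit Types A B z : R.

(** Young's inequality for integer exponents, by induction: multiply by z and add (n+1) A^n (z -
    A)^2 >= 0. *)
Lemma young_exp A z n : 0 <= A -> 0 <= z ->
  n.+1%:R * A ^+ n * z <= n%:R * A ^+ n.+1 + z ^+ n.+1.
Proof.
move=> A0 z0; elim: n => [|n IH]; first by rewrite mulr1n expr0 mul0r add0r !mul1r.
have h := ler_wpM2r z0 IH; rewrite -subr_ge0 in h.
have h2 := mulr_ge0 (mulr_ge0 (ler0n R n.+1) (exprn_ge0 n A0)) (sqr_ge0 (z - A)).
have := addr_ge0 h h2; rewrite -[in X in _ -> X]subr_ge0.
by congr (0 <= _); rewrite -[n.+2%:R]natr1 -[n.+1%:R]natr1 !exprS; ring.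
Qed.

Lemma subr_exp_le A B n : 0 <= A -> 0 <= B ->
  A ^+ n.+1 - B ^+ n.+1 <= n.+1%:R * A ^+ n * `|A - B|.
Proof.
move=> A0 B0; have := young_exp n A0 B0; rewrite -natr1 => h.
have : (n%:R + 1) * A ^+ n * (A - B) <= (n%:R + 1) * A ^+ n * `|A - B|.
  by rewrite ler_wpM2l ?ler_norm// mulr_ge0 ?exprn_ge0// natr1.
apply: le_trans; rewrite mulrBr -mulrA -exprSr; lra.
Qed.

End elementary_inequalities.

Section flow_geometry.
Context {R : realType}.
Variables (n : nat) (Phi : 'rV[R]_n.+1).
Hypothesis sPhi : sphere n Phi.
Implicit Types (x y : 'rV[R]_n.+1) (a r : R).
Local Notation t x := (dotv x Phi).
Local Notation flow := (flow Phi).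

Lemma meridian_slope_le (Psi : 'rV[R]_n.+1 -> 'rV[R]_n.+1) x :
  sphere n x -> dotv (Psi x) x = 0 ->
  `|meridian_slope Phi Psi x| <= `|t x| * sn (t x) * enorm (Psi x).
Proof.
move=> sx Px; rewrite /meridian_slope normrM -mulrA ler_wpM2l//.
rewrite -(dotv_meridian _ Px) (le_trans (dotv_cauchy _ _))// mulrC ler_wpM2r ?enorm_ge0//.
rewrite le_eqVlt; apply/orP; left; apply/eqP.
rewrite -[LHS]ger0_norm ?enorm_ge0// -sqrtr_sqr enorm_meridian//.
Qed.

(** Compares |t| and |X| = |t| s at the two ends of an orbit; the factors r tend to 1 and disappear
    in the limit. *)
Lemma flow_dotv_le r x : 1 <= r -> sphere n x ->
  `|t (flow r x)| <= r * `|t x| /\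
  `|t x| * sn (t x) <= r * (`|t (flow r x)| * sn (t (flow r x))).
Proof.
move=> r1 sx; have r0 : 0 < r by exact: lt_le_trans r1.
have D0 := flow_den_gt0 sPhi r0 sx; have h0 := flow_fac_gt0 D0.
have h1 := flow_fac_le1 Phi x r1; have E := flow_facK D0.
have sE : sn (t (flow r x)) = sn (t x) * flow_fac Phi r x.
  rewrite /sn dotv_flow// (_ : 1 - _ = (1 - t x ^+ 2) * flow_fac Phi r x ^+ 2); last first.
    by rewrite -{1}E /flow_den; ring.
  by rewrite sqrtrM ?subr_ge0 ?dotv_Phi_sqr_le1// sqrtr_sqr gtr0_norm.
have tE : `|t (flow r x)| = r * `|t x| * flow_fac Phi r x.
  by rewrite dotv_flow// !normrM (gtr0_norm r0) (gtr0_norm h0).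
rewrite sE tE; split; first by rewrite ler_piMr// mulr_ge0// ltW.
have Dr : flow_den Phi r x <= r ^+ 2.
  have := dotv_Phi_sqr_le1 sPhi sx; rewrite /flow_den => t1.
  have : (r ^+ 2 - 1) * t x ^+ 2 <= (r ^+ 2 - 1) * 1.
    by rewrite ler_wpM2l// subr_ge0 exprn_ege1.
  lra.
have : 1 <= flow_fac Phi r x ^+ 2 * r ^+ 2 by rewrite -[leLHS]E ler_wpM2l ?sqr_ge0.
have := mulr_ge0 (normr_ge0 (t x)) (sn_ge0 (t x)).
set q := `|t x| * sn (t x) => q0 /(ler_wpM2l q0); rewrite mulr1 => /le_trans; apply.
by rewrite /q le_eqVlt; apply/orP; left; apply/eqP; ring.
Qed.

End flow_geometry.

(** Fatou's lemma for a pointwise limit with convergent bounds on the integrals. Infinite bounds are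
    allowed, so nothing has to be known to be integrable. *)
Lemma fatou_cvg d (T : measurableType d) (R : realType) (mu : {measure set T -> \bar R})
    (D : set T) (f_ : nat -> T -> \bar R) (f : T -> \bar R) (c_ : nat -> \bar R) (c : \bar R) :
  measurable D -> (forall j, measurable_fun D (f_ j)) ->
  (forall j x, D x -> 0 <= f_ j x)%E -> (forall x, D x -> f_ ^~ x @ \oo --> f x) ->
  (forall j, \int[mu]_(x in D) f_ j x <= c_ j)%E -> c_ @ \oo --> c ->
  (\int[mu]_(x in D) f x <= c)%E.
Proof.
move=> mD mf f0 ff fc cc.
rewrite (eq_integral (fun x => limn_einf (f_ ^~ x))); last first.
  move=> x /set_mem Dx; rewrite is_cvg_limn_einfE; last by apply/cvg_ex; exists (f x); exact: ff.
  by apply/esym/cvg_lim => //; exact: ff.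
apply: (le_trans (fatou _ mD mf f0)).
rewrite limn_einf_lim -(cvg_lim _ cc)//; apply: lee_lim.
- exact: is_cvg_einfs.
- by apply/cvg_ex; exists c.
- near=> j; apply: le_trans (fc j); apply: ereal_inf_lbound.
  by exists j => /=.
Unshelve. all: by end_near. Qed.

(** * The Hardy inequalities *)

Section hardy.
Context {R : realType}.
Variables (p k : nat) (Phi : 'rV[R]_p.+3).
Hypothesis sPhi : sphere p.+2 Phi.
Implicit Types (x y : 'rV[R]_p.+3) (a r : R).
Local Notation n := p.+2.
Local Notation t x := (dotv x Phi).
Local Notation flow := (flow Phi).
Local Notation flow_jac := (flow_jac Phi).
Local Notation sigma := (@surface_measure R n).
Local Notation S := (sphere n).
Let mS := @measurable_sphere R n.
Let g : R := p.+1%:R / n%:R.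

Variables (u : 'rV[R]_p.+3 -> R) (Psi : 'rV[R]_p.+3 -> 'rV[R]_p.+3).
Hypothesis mu : measurable_fun setT u.
Hypothesis ui : sigma.-integrable S (EFin \o u).
Hypothesis un : sigma.-integrable S (fun x => (`|u x| ^+ n)%:E).
Hypothesis wP : weak_surface_gradient u Psi.

(** Common frame of the two inequalities: al = 1, th = |z|, k = 0, c = n for U_n and Q_n, and al =
    |z|, th = 1, k = p, c = n - 1 for V_n and H_n. Condition [al_th] distributes the power |t|^(k+1)
    of weight times |X| between u and its gradient, which sit at different points of an orbit, at
    the price of a factor r. *)
Variables (al th : R -> R) (c : R).
Hypothesis (mal : measurable_fun setT al) (mth : measurable_fun setT th).
Hypothesis (al0 : forall z, 0 <= al z) (al1 : forall z, z ^+ 2 <= 1 -> al z <= 1).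
Hypothesis (th0 : forall z, 0 <= th z).
Hypothesis al_th : forall z z' r, 1 <= r -> z ^+ 2 <= 1 -> z' ^+ 2 <= 1 ->
  `|z| <= r * `|z'| -> `|z| ^+ k.+1 <= r * (al z ^+ p.+1 * th z').

Variable delta : R.
Hypothesis delta0 : 0 < delta.
Local Notation W x := (weight p k delta (t x)).
Local Notation om x := (sn (t x) / reg delta (t x)).
Let A x := al (t x) * `|u x| * om x.
Let E x := th (t x) * enorm (Psi x).

Hypothesis c0 : 0 <= c.
Hypothesis dweight_le : forall x, S x ->
  p.+1%:R * (al (t x) * om x) ^+ n -
    c * (`|t x| ^+ k * sn (t x) ^+ n * (reg delta (t x))^-1 ^+ p.+1) <=
  - dweight k Phi delta x.

Let mt : measurable_fun setT (fun x => t x).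
Proof. by apply: continuous_measurable_rV; exact: continuous_dotvl. Qed.

Let mPsi : measurable_fun setT Psi.
Proof.
apply: measurable_fun_rV => i.
by have [_ /(_ i)/Lfun1_sphere_integrable[]] := wP.
Qed.

Let mW : measurable_fun setT (fun x => W x).
Proof. exact: (measurableT_comp (measurable_weight p k delta) mt). Qed.

Let mom : measurable_fun setT (fun x => om x).
Proof.
apply: measurable_funM; first exact: (measurableT_comp (@measurable_sn R) mt).
apply: (measurableT_comp (@measurable_invr R)).
exact: (measurableT_comp (measurable_reg delta) mt).
Qed.

Let mau : measurable_fun setT (fun x => `|u x|).
Proof. exact: (measurableT_comp (@normr_measurable R setT) mu). Qed.

Let mA : measurable_fun setT A.
Proof.
apply: measurable_funM => //; apply: measurable_funM => //.
exact: (measurableT_comp mal mt).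
Qed.

Let mE : measurable_fun setT E.
Proof.
apply: measurable_funM; first exact: (measurableT_comp mth mt).
exact: (measurableT_comp (@measurable_enorm R _) mPsi).
Qed.

Let om_ge0 x : 0 <= om x.
Proof. by rewrite divr_ge0 ?sn_ge0// ltW// reg_gt0. Qed.

Let A0 x : 0 <= A x. Proof. by rewrite /A mulr_ge0 ?om_ge0// mulr_ge0. Qed.
Let E0 x : 0 <= E x. Proof. by rewrite mulr_ge0// enorm_ge0. Qed.

Let g0 : 0 < g. Proof. by rewrite divr_gt0. Qed.

(* Young's inequality applied to n A^(n-1) (E / g). *)
Lemma hardy_pointwise r y : 1 <= r -> S y ->
  n%:R * `|u y| ^+ p.+1 * W y * `|r^-1 * meridian_slope Phi Psi (flow r^-1 y)| <=
  r * (p.+1%:R * g * A y ^+ n + g^-1 ^+ p.+1 * E (flow r^-1 y) ^+ n).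
Proof.
move=> r1 sy; have r0 : 0 < r by exact: lt_le_trans r1.
set x := flow r^-1 y.
have sx : S x by apply: flow_sphere => //; rewrite invr_gt0.
have yE : y = flow r x by rewrite /x flow_comp ?invr_gt0// mulfV ?gt_eqF// flow1.
have [tr ts] := flow_dotv_le sPhi r1 sx.
rewrite -yE in tr ts.
have Px : dotv (Psi x) x = 0 by case: wP => tP _ _; exact: tP.
have vle := meridian_slope_le sPhi sx Px.
have t1 := dotv_Phi_sqr_le1 sPhi sy; have t1' := dotv_Phi_sqr_le1 sPhi sx.
have ale := al_th r1 t1 t1' tr.
have B0 := reg_gt0 (t y) delta0.
have e0 := enorm_ge0 (Psi x).
have s0 := sn_ge0 (t y).
have vle2 : `|meridian_slope Phi Psi x| <= r * (`|t y| * sn (t y)) * enorm (Psi x).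
  by apply: le_trans vle _; rewrite ler_wpM2r.
have young := young_exp p.+1 (A0 y) (divr_ge0 (E0 x) (ltW g0)).
have step : n%:R * `|u y| ^+ p.+1 * W y * `|r^-1 * meridian_slope Phi Psi x| <=
    r * (g * (n%:R * A y ^+ p.+1 * (E x / g))).
  rewrite (_ : r * _ = n%:R * (`|u y| * om y) ^+ p.+1 * (r * (al (t y) ^+ p.+1 * th (t x))) * enorm (Psi x)); last first.
    by rewrite /A /E !exprMn; field; rewrite gt_eqF.
  apply: (@le_trans _ _ (n%:R * (`|u y| * om y) ^+ p.+1 * (`|t y| ^+ k.+1) * enorm (Psi x))).
    rewrite normrM gtr0_norm ?invr_gt0//.
    apply: (@le_trans _ _ (n%:R * `|u y| ^+ p.+1 * W y * (r^-1 * (r * (`|t y| * sn (t y)) * enorm (Psi x))))).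
      rewrite ler_wpM2l//; last by rewrite ler_wpM2l// invr_ge0 ltW.
      by apply: mulr_ge0; [rewrite mulr_ge0// exprn_ge0|exact: weight_ge0].
    rewrite le_eqVlt; apply/orP; left; apply/eqP.
    rewrite /weight [(_ * om y) ^+ _]exprMn [om y ^+ _]exprMn [`|t y| ^+ k.+1]exprS [sn (t y) ^+ p.+1]exprS.
    by field; rewrite gt_eqF.
  rewrite ler_wpM2r// ler_wpM2l// mulr_ge0// exprn_ge0// mulr_ge0//.
apply: (le_trans step); rewrite ler_wpM2l ?(ltW r0)//.
apply: le_trans (ler_wpM2l (ltW g0) young) _.
rewrite le_eqVlt; apply/orP; left; apply/eqP.
rewrite mulrDr; congr (_ + _); first by ring.
by rewrite exprMn [g^-1 ^+ n]exprS mulrCA (mulrA g) mulfV ?gt_eqF// mul1r mulrC.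
Qed.

Local Notation X := (\int[sigma]_(x in S) (A x ^+ n)%:E)%E.
Local Notation Y := (\int[sigma]_(x in S) (E x ^+ n)%:E)%E.
Local Notation M := ((p.+1%:R * g)%:E * X + (g^-1 ^+ p.+1)%:E * Y)%E.
Let N x := `|u x| ^+ n.

Let mN : measurable_fun setT N. Proof. exact: measurable_funX. Qed.

Lemma integrable_hardy_A : sigma.-integrable S (fun x => (A x ^+ n)%:E).
Proof.
have omb x : S x -> `|(al (t x) * om x) ^+ n| <= delta^-1 ^+ n.
  move=> sx; have q0 : 0 <= al (t x) * om x by exact: mulr_ge0.
  rewrite ger0_norm ?exprn_ge0// lerXn2r ?nnegrE ?invr_ge0 ?(ltW delta0)//.
  rewrite -[leRHS]mul1r; apply: ler_pM => //; first by rewrite al1// dotv_Phi_sqr_le1.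
  rewrite -[leRHS]mul1r; apply: ler_pM; rewrite ?sn_ge0 ?sn_le1//.
    by rewrite invr_ge0 ltW// reg_gt0.
  by rewrite lef_pV2 ?posrE ?reg_gt0// reg_ge.
have mo : measurable_fun S (fun x => (al (t x) * om x) ^+ n).
  apply: measurable_funTS; apply: measurable_funX; apply: measurable_funM => //.
  exact: (measurableT_comp mal mt).
apply: eq_integrable (integrable_bdM un mo omb) => // x _.
by congr EFin; rewrite -exprMn /A; congr (_ ^+ _); ring.
Qed.

Hypothesis iY : sigma.-integrable S (fun x => (E x ^+ n)%:E).
Let m : R := p.+1%:R * g * fine X + g^-1 ^+ p.+1 * fine Y.

Let fX0 : 0 <= fine X.
Proof. by apply: fine_ge0; apply: integral_ge0 => x _; rewrite lee_fin exprn_ge0. Qed.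

Let fY0 : 0 <= fine Y.
Proof. by apply: fine_ge0; apply: integral_ge0 => x _; rewrite lee_fin exprn_ge0. Qed.

(** A change of variables shifts the flow from the weight to u. Then |u|^n - |u_a|^n <= n |u|^(n-1)
    |u_a - u| keeps the power n-1 at the unmoved point, [ae_flow] bounds the increment by an
    integral over r, and after Tonelli [hardy_pointwise] is integrated for each r. *)
Lemma hardy_step a : 1 < a ->
  (\int[sigma]_(x in S) (N x * W x)%:E <=
   \int[sigma]_(x in S) (N x * (W (flow a x) * flow_jac a x))%:E +
   (a ^+ 2 * m * (a - 1))%:E)%E.
Proof.
move=> a1; have a0 : 0 < a by exact: lt_trans a1.
pose ua y := u (flow a^-1 y).
have mua : measurable_fun setT ua by exact: (measurableT_comp mu (measurable_flow Phi a^-1)).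
have mNa : measurable_fun setT (fun y => `|ua y| ^+ n).
  by apply: measurable_funX; exact: measurableT_comp.
have W0 x : 0 <= W x by exact: weight_ge0.
have E1 : (\int[sigma]_(x in S) (N x * (W (flow a x) * flow_jac a x))%:E =
    \int[sigma]_(x in S) (`|ua x| ^+ n * W x)%:E)%E.
  rewrite -(ge0_integral_flow sPhi (g := fun x => `|ua x| ^+ n * W x) (ltW a1)); last 2 first.
  - exact: measurable_funM.
  - by move=> x; rewrite mulr_ge0 ?exprn_ge0.
  by apply: eq_integral => x /set_mem sx; rewrite /ua flowVK//; congr EFin; rewrite /N; ring.
rewrite E1.
pose f y r := n%:R * `|u y| ^+ p.+1 * W y * `|r^-1 * meridian_slope Phi Psi (flow r^-1 y)|.
have c0' y : 0 <= n%:R * `|u y| ^+ p.+1 * W y.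
  by apply: mulr_ge0 => //; rewrite mulr_ge0// exprn_ge0.
have f0 y r : 0 <= f y r by apply: mulr_ge0.
have mc : measurable_fun setT (fun y => n%:R * `|u y| ^+ p.+1 * W y).
  by apply: measurable_funM => //; apply: measurable_funM => //; exact: measurable_funX.
have mms := measurable_meridian_slope Phi wP.
have mf : measurable_fun setT (fun q : 'rV[R]_p.+3 * measurableTypeR R => f q.1 q.2).
  have m2 : measurable_fun setT (fun q : 'rV[R]_p.+3 * measurableTypeR R => q.2^-1 : R).
    exact: (measurableT_comp (@measurable_invr R) (@measurable_snd _ _ _ _)).
  have m1 : measurable_fun setT (fun q : 'rV[R]_p.+3 * measurableTypeR R => q.1).
    exact: measurable_fst.
  have [_ mfl] := measurable_flow_joint Phi m2 m1.
  apply: measurable_funM; first exact: (measurableT_comp mc m1).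
  apply: measurableT_comp => //; apply: measurable_funM => //.
  exact: (measurableT_comp mms mfl).
have mX : measurable_fun S (fun x => (A x ^+ n)%:E).
  by apply/measurable_EFinP; apply: measurable_funTS; exact: measurable_funX.
have mY : measurable_fun setT (fun x => E x ^+ n) by exact: measurable_funX.
have mdiff : measurable_fun setT (fun x => n%:R * `|u x| ^+ p.+1 * W x * `|ua x - u x|).
  by apply: measurable_funM => //; apply: measurableT_comp => //; exact: measurable_funB.
have s1 : (\int[sigma]_(x in S) (N x * W x)%:E <= \int[sigma]_(x in S) (`|ua x| ^+ n * W x)%:E +
    \int[sigma]_(x in S) (n%:R * `|u x| ^+ p.+1 * W x * `|ua x - u x|)%:E)%E.
  rewrite -ge0_integralD//; last 4 first.
  - by move=> x _; rewrite lee_fin; apply: mulr_ge0 => //; exact: exprn_ge0.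
  - by apply/measurable_EFinP; apply: measurable_funTS; exact: measurable_funM.
  - by move=> x _; rewrite lee_fin; apply: mulr_ge0.
  - by apply/measurable_EFinP; exact: measurable_funTS.
  apply: ge0_le_integral => //.
  - by move=> x _; rewrite lee_fin; apply: mulr_ge0 => //; exact: exprn_ge0.
  - by apply/measurable_EFinP; apply: measurable_funTS; exact: measurable_funM.
  - apply/measurable_EFinP; apply: measurable_funTS; apply: measurable_funD => //.
    exact: measurable_funM.
  - move=> x _; rewrite -EFinD lee_fin.
    have := subr_exp_le p.+1 (normr_ge0 (u x)) (normr_ge0 (ua x)) => h.
    have h2 : `| `|u x| - `|ua x| | <= `|ua x - u x|.
      by rewrite (distrC (ua x)); exact: ler_dist_dist.
    have := ler_wpM2l (mulr_ge0 (ler0n R n) (exprn_ge0 p.+1 (normr_ge0 (u x)))) h2.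
    move=> /(le_trans h) /(ler_wpM2r (W0 x)); rewrite mulrBl lerBlDl /N => /le_trans; apply.
    by rewrite lerD2l le_eqVlt; apply/orP; left; apply/eqP; ring.
apply: (le_trans s1); rewrite leeD2l//.
apply: (@le_trans _ _ (\int[sigma]_(x in S) \int[lebesgue_measure]_(r in ([set` `[1%R, a]] : set R)) (f x r)%:E)%E).
  apply: ae_ge0_le_integral => //.
  - by move=> x _; rewrite lee_fin; apply: mulr_ge0.
  - by apply/measurable_EFinP; exact: measurable_funTS.
  - by move=> x _; apply: integral_ge0 => r _; rewrite lee_fin.
  - by have [] := measurable_integral_itv sigma 1 a mS mf f0.
  - apply: filterS (ae_flow sPhi mu ui wP a1) => x ax sx.
    rewrite EFinM; apply: le_trans (lee_wpmul2l _ (ax sx)) _; first by rewrite lee_fin.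
    rewrite -ge0_integralZl//; last 2 first.
    + apply/measurable_EFinP; apply: measurable_funTS; apply: measurableT_comp => //.
      have m2 : measurable_fun setT (fun r : measurableTypeR R => r^-1 : R) by exact: measurable_invr.
      have [_ mfl] := measurable_flow_joint Phi m2 (@measurable_cst _ _ (measurableTypeR R) _ setT x).
      by apply: measurable_funM => //; exact: (measurableT_comp mms mfl).
    + by rewrite lee_fin.
rewrite (ge0_fubini_itv _ _ _ mS mf f0).
(* One factor r <= a comes from the pointwise bound, another from moving the gradient term back by
   the flow. *)
apply: (@le_trans _ _ (\int[lebesgue_measure]_(r in ([set` `[1%R, a]] : set R)) (a ^+ 2 * m)%:E)%E).
  apply: ge0_le_integral => //.
  - by move=> r _; apply: integral_ge0 => x _; rewrite lee_fin.
  - by have [] := measurable_integral_itv sigma 1 a mS mf f0.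
  - move=> r; rewrite /= in_itv/= => /andP[r1 ra].
    have r0 : 0 < r by exact: lt_le_trans r1.
    have mEr : measurable_fun setT (fun y => E (flow r^-1 y) ^+ n).
      exact: (measurableT_comp mY (measurable_flow Phi r^-1)).
    have c1 : 0 <= r * (p.+1%:R * g) by rewrite mulr_ge0 ?(ltW r0)// mulr_ge0// ltW.
    have c2 : 0 <= r * g^-1 ^+ p.+1 by rewrite mulr_ge0 ?(ltW r0)// exprn_ge0// invr_ge0 ltW.
    have Er : (\int[sigma]_(y in S) (E (flow r^-1 y) ^+ n)%:E <= (r * fine Y)%:E)%E.
      rewrite -(ge0_integral_flow sPhi (g := fun y => E (flow r^-1 y) ^+ n) r1)//; last first.
        by move=> y; rewrite exprn_ge0.
      rewrite EFinM fineK; last exact: integrable_fin_num.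
      rewrite -ge0_integralZl//; last 3 first.
      - by apply/measurable_EFinP; exact: measurable_funTS.
      - by move=> y _; rewrite lee_fin exprn_ge0.
      - by rewrite lee_fin ltW.
      apply: ge0_le_integral => //.
      - by move=> y _; rewrite lee_fin mulr_ge0 ?exprn_ge0// flow_jac_ge0// ltW.
      - apply/measurable_EFinP; apply: measurable_funTS; apply: measurable_funM.
          exact: measurable_flow_jac.
        exact: (measurableT_comp mEr (measurable_flow Phi r)).
      - by apply: measurable_funeM; apply/measurable_EFinP; exact: measurable_funTS.
      - move=> y sy; rewrite flowVK// -EFinM lee_fin ler_wpM2r ?exprn_ge0//.
        exact: flow_jac_le.
    apply: (@le_trans _ _ (\int[sigma]_(y in S) ((r * (p.+1%:R * g))%:E * (A y ^+ n)%:E +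
        (r * g^-1 ^+ p.+1)%:E * (E (flow r^-1 y) ^+ n)%:E))%E).
      apply: ge0_le_integral => //.
      - by move=> y _; rewrite lee_fin.
      - by apply/measurable_EFinP; apply: measurable_funTS; apply: measurable_funM => //;
          apply: measurableT_comp => //; apply: measurable_funM => //;
          exact: (measurableT_comp mms (measurable_flow Phi r^-1)).
      - by apply: emeasurable_funD; apply: measurable_funeM => //;
          apply/measurable_EFinP; exact: measurable_funTS.
      - move=> y sy; rewrite -!EFinM -EFinD lee_fin.
        by apply: le_trans (hardy_pointwise r1 sy) _; rewrite mulrDr !mulrA.
    rewrite ge0_integralD//; last 4 first.
    - by move=> y _; rewrite -EFinM lee_fin mulr_ge0// exprn_ge0.
    - by apply: measurable_funeM.
    - by move=> y _; rewrite -EFinM lee_fin mulr_ge0// exprn_ge0.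
    - by apply: measurable_funeM; apply/measurable_EFinP; exact: measurable_funTS.
    rewrite !ge0_integralZl//;
      try (by apply/measurable_EFinP; exact: measurable_funTS);
      try (by move=> y _; rewrite lee_fin exprn_ge0).
    apply: (@le_trans _ _ ((r * (p.+1%:R * g) * fine X)%:E + (r * g^-1 ^+ p.+1 * (r * fine Y))%:E)%E).
      apply: leeD.
        by rewrite [leRHS]EFinM fineK//; apply: integrable_fin_num => //; exact: integrable_hardy_A.
      by rewrite [leRHS]EFinM; apply: lee_wpmul2l => //; rewrite lee_fin.
    rewrite -EFinD lee_fin.
    have ra2 : r <= a ^+ 2 by rewrite (le_trans ra)// expr2 ler_peMl// ?ltW// (le_trans r1).
    have ra3 : r * r <= a ^+ 2 by rewrite expr2 ler_pM// ltW.
    rewrite /m mulrDr lerD//.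
      by rewrite -(mulrA r) ler_wpM2r// mulr_ge0// mulr_ge0// ltW.
    rewrite (_ : r * _ * _ = r * r * (g^-1 ^+ p.+1 * fine Y)); last by ring.
    by rewrite ler_wpM2r// mulr_ge0// exprn_ge0// invr_ge0 ltW.
have I1 : lebesgue_measure ([set` `[1%R, a]] : set R) = (a - 1)%:E.
  by rewrite lebesgue_measure_itv/= lte_fin a1.
by rewrite integral_cst//= I1 -EFinM.
Qed.

Let Zw x := `|t x| ^+ k * sn (t x) ^+ n * (reg delta (t x))^-1 ^+ p.+1.
Local Notation Z := (\int[sigma]_(x in S) (N x * Zw x)%:E)%E.

Let t_le1 x : S x -> `|t x| <= 1. Proof. exact: dotv_Phi_le1. Qed.

Let mZw : measurable_fun setT Zw.
Proof.
apply: measurable_funM; first apply: measurable_funM.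
- by apply: measurable_funX; exact: (measurableT_comp (@normr_measurable R setT) mt).
- by apply: measurable_funX; exact: (measurableT_comp (@measurable_sn R) mt).
- apply: measurable_funX; apply: (measurableT_comp (@measurable_invr R)).
  exact: (measurableT_comp (measurable_reg delta) mt).
Qed.

Let Zw_ge0 x : 0 <= Zw x.
Proof.
have B0 := reg_gt0 (t x) delta0.
apply: mulr_ge0; last by rewrite exprn_ge0// invr_ge0 ltW.
by apply: mulr_ge0; rewrite exprn_ge0// sn_ge0.
Qed.

Lemma integrable_hardy_Z : sigma.-integrable S (fun x => (N x * Zw x)%:E).
Proof.
apply: (integrable_bdM un (measurable_funTS mZw) (M := delta^-1 ^+ p.+1)) => x sx.
have B0 := reg_gt0 (t x) delta0.
rewrite ger0_norm// /Zw -[leRHS]mul1r; apply: ler_pM.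
- by rewrite mulr_ge0 ?exprn_ge0 ?sn_ge0.
- by rewrite exprn_ge0// invr_ge0 ltW.
- by rewrite mulr_ile1 ?exprn_ge0 ?sn_ge0 ?exprn_ile1 ?sn_ge0 ?sn_le1// t_le1.
- by rewrite lerXn2r ?nnegrE ?invr_ge0 ?(ltW B0) ?(ltW delta0)// lef_pV2 ?posrE// reg_ge.
Qed.

(** Dividing [hardy_step] by a - 1 and letting a tend to 1 along 1 + 1/(j+1) replaces the difference
    quotient of the weight by -[dweight]. All integrals are finite here, so terms may be
    cancelled. *)
Lemma hardy_delta : g * fine X <= c * fine Z + g^-1 ^+ p.+1 * fine Y.
Proof.
pose Wf a x := W (flow a x) * flow_jac a x.
pose h (j : nat) : R := harmonic j.
have h0 j : 0 < h j by exact: harmonic_gt0.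
have h1 j : h j <= 1 by rewrite invf_le1// ler1n.
(* Bounds ((1 + h)^(k+1) - 1)/h for 0 < h <= 1. Adding C times the weight makes the difference
   quotients nonnegative, as Fatou's lemma demands; the added finite integral is subtracted again at
   the end. *)
pose C : R := k.+1%:R * 2 ^+ k.
have hC j : (1 + h j) ^+ k.+1 - 1 <= C * h j.
  have := subr_exp_le k (addr_ge0 ler01 (ltW (h0 j))) ler01.
  rewrite expr1n => /le_trans; apply; rewrite addrAC subrr add0r (gtr0_norm (h0 j)).
  rewrite ler_wpM2r ?(ltW (h0 j))// ler_wpM2l// lerXn2r ?nnegrE ?addr_ge0 ?(ltW (h0 j))//.
  by rewrite -[2]/(1 + 1) lerD2l.
have W0 x : 0 <= W x by exact: weight_ge0.
have Wb x : S x -> `|W x| <= delta^-1 ^+ p.+1.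
  by move=> sx; rewrite ger0_norm// weight_le// dotv_Phi_sqr_le1.
have iW : sigma.-integrable S (fun x => (N x * W x)%:E).
  exact: (integrable_bdM un (measurable_funTS mW) Wb).
have a1 j : 1 <= 1 + h j by rewrite lerDl ltW.
have a0 j : 0 < 1 + h j by exact: lt_le_trans (a1 j).
have Wf0 j x : 0 <= Wf (1 + h j) x.
  by rewrite mulr_ge0 ?flow_jac_ge0 ?(ltW (a0 j))//; exact: weight_ge0.
have mWf j : measurable_fun setT (Wf (1 + h j)).
  apply: measurable_funM; last exact: measurable_flow_jac.
  exact: (measurableT_comp mW (measurable_flow Phi _)).
have Wfb j x : S x -> `|Wf (1 + h j) x| <= (1 + h j) ^+ k.+1 * delta^-1 ^+ p.+1.
  move=> sx; rewrite ger0_norm//; apply: le_trans (weight_flow_le k sPhi delta0 (a1 j) sx) _.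
  rewrite ler_wpM2l ?exprn_ge0 ?(ltW (a0 j))//.
  by rewrite weight_le// dotv_Phi_sqr_le1.
have iWf j : sigma.-integrable S (fun x => (N x * Wf (1 + h j) x)%:E).
  exact: (integrable_bdM un (measurable_funTS (mWf j)) (Wfb j)).
pose F j x : R := N x * ((W x - Wf (1 + h j) x) / h j + C * W x).
have N0 x : 0 <= N x by exact: exprn_ge0.
have C0 : 0 <= C by rewrite mulr_ge0// exprn_ge0.
have F0 j x : S x -> 0 <= F j x.
  move=> sx; rewrite mulr_ge0//.
  have := weight_flow_le k sPhi delta0 (a1 j) sx => wle.
  rewrite -lerBlDr sub0r ler_pdivlMr// mulNr -[C * W x * h j]mulrAC.
  have := ler_wpM2r (W0 x) (hC j); rewrite mulrBl mul1r /Wf; lra.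
pose I1 := fine (\int[sigma]_(x in S) (N x * W x)%:E)%E.
have key : (\int[sigma]_(x in S) (N x * (- dweight k Phi delta x + C * W x))%:E <= (m + C * I1)%:E)%E.
  apply: (@fatou_cvg _ _ _ sigma S (fun j x => (F j x)%:E) _
    (fun j => ((1 + h j) ^+ 2 * m + C * I1)%:E)) => //.
  - move=> j; apply/measurable_EFinP; apply: measurable_funTS; apply: measurable_funM => //.
    apply: measurable_funD; last exact: measurable_funM.
    by apply: measurable_funM => //; exact: measurable_funB.
  - move=> x sx; apply: cvg_EFin; first by near=> j.
    rewrite /F /=; apply: cvgMr; apply: cvgD; last exact: cvg_cst.
    have hw := der_weight_flow (k := k) sPhi delta0 sx.
    rewrite (_ : (fun j => _) = (fun j => - ((Wf (1 + h j) x - W x) / h j))).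
      exact: (cvgN hw).
    by apply/funext => j; rewrite -[RHS]mulNr [- (_ - W x)]opprB.
  - move=> j.
    rewrite (eq_integral (fun x => ((h j)^-1 + C)%:E * (N x * W x)%:E - ((h j)^-1)%:E * (N x * Wf (1 + h j) x)%:E)%E); last first.
      by move=> x _; rewrite -!EFinM -EFinB; congr EFin; rewrite /F; ring.
    rewrite integralB//; last 2 first.
    + exact: integrableZl.
    + exact: integrableZl.
    rewrite !integralZl//.
    have a1' : 1 < 1 + h j by rewrite ltrDl.
    have := hardy_step a1'; rewrite -/(Wf _ _).
    have f1 : (\int[sigma]_(x in S) (N x * W x)%:E)%E \is a fin_num by exact: integrable_fin_num.
    have f2 : (\int[sigma]_(x in S) (N x * Wf (1 + h j) x)%:E)%E \is a fin_num by exact: integrable_fin_num.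
    rewrite -(fineK f1) -(fineK f2) -/I1 -EFinD lee_fin -!EFinM -EFinB lee_fin.
    rewrite [1 + h j - 1]addrAC subrr add0r.
    set I2 := fine _ => st.
    have : (I1 - I2) / h j <= (1 + h j) ^+ 2 * m by rewrite ler_pdivrMr// lerBlDl.
    rewrite (_ : ((h j)^-1 + C) * I1 - _ = (I1 - I2) / h j + C * I1); last by ring.
    by rewrite lerD2r.
  - apply: cvg_EFin; first by near=> j.
    rewrite /=; apply: cvgD; last exact: cvg_cst.
    rewrite -[X in _ --> X]mul1r; apply: cvgMl.
    have c1 : (fun j => 1 + h j) @ \oo --> (1 : R).
      rewrite -[X in _ --> X]addr0; apply: cvgD; [exact: cvg_cst|exact: cvg_harmonic].
    rewrite -[X in _ --> X]mulr1 (_ : (fun j => _) = (fun j => (1 + h j) * (1 + h j))).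
      exact: (cvgM c1 c1).
    by apply/funext => j; rewrite expr2.
have fX : X \is a fin_num by apply: integrable_fin_num => //; exact: integrable_hardy_A.
have fZ : Z \is a fin_num by apply: integrable_fin_num => //; exact: integrable_hardy_Z.
have fI1 : (\int[sigma]_(x in S) (N x * W x)%:E)%E \is a fin_num by exact: integrable_fin_num.
have mdw : measurable_fun setT (dweight k Phi delta).
  apply: measurable_funM => //; apply: measurable_funB.
    by apply: measurable_funM => //; apply: measurable_funB => //; exact: measurable_funX.
  apply: measurable_funM; last first.
    apply: (measurableT_comp (@measurable_invr R)).
    exact: (measurableT_comp (measurable_reg delta) mt).
  apply: measurable_funM; first by apply: measurable_funM => //; exact: measurable_funX.
  by apply: measurable_funD => //; apply: measurable_funX; exact: (measurableT_comp (@measurable_sn R) mt).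
have dw0 x : S x -> 0 <= - dweight k Phi delta x + C * W x.
  move=> sx; have B0 := reg_gt0 (t x) delta0; have t1 := dotv_Phi_sqr_le1 sPhi sx.
  have kC : k.+1%:R <= C by rewrite ler_peMr// exprn_ege1// ler1n.
  rewrite /dweight -mulrN opprB mulrBr [C * _]mulrC -addrA [- _ + _]addrC -mulrBr.
  rewrite addr_ge0// mulr_ge0//.
    have e1 : 0 <= sn (t x) ^+ 2 + 2 * delta by rewrite addr_ge0 ?sqr_ge0// mulr_ge0// ltW.
    have e2 : 0 <= p.+1%:R * t x ^+ 2 by rewrite mulr_ge0 ?sqr_ge0.
    by apply: divr_ge0; [exact: mulr_ge0|exact: ltW].
  by rewrite subr_ge0 (le_trans _ kC)// ler_piMr// gerBl sqr_ge0.
have mAn : measurable_fun S (fun x => (A x ^+ n)%:E).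
  by apply/measurable_EFinP; apply: measurable_funTS; exact: measurable_funX.
have mNW : measurable_fun S (fun x => (N x * W x)%:E).
  by apply/measurable_EFinP; apply: measurable_funTS; exact: measurable_funM.
have mNZ : measurable_fun S (fun x => (N x * Zw x)%:E).
  by apply/measurable_EFinP; apply: measurable_funTS; exact: measurable_funM.
have mNd : measurable_fun S (fun x => (N x * (- dweight k Phi delta x + C * W x))%:E).
  apply/measurable_EFinP; apply: measurable_funTS; apply: measurable_funM => //.
  by apply: measurable_funD; [exact: measurable_funN|exact: measurable_funM].
have : (\int[sigma]_(x in S) (p.+1%:R%:E * (A x ^+ n)%:E + C%:E * (N x * W x)%:E) <=
    \int[sigma]_(x in S) ((N x * (- dweight k Phi delta x + C * W x))%:E + c%:E * (N x * Zw x)%:E))%E.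
  apply: ge0_le_integral => //.
  - move=> x _; rewrite -!EFinM -EFinD lee_fin addr_ge0// mulr_ge0 ?exprn_ge0//.
    exact: mulr_ge0.
  - by apply: emeasurable_funD; exact: measurable_funeM.
  - by apply: emeasurable_funD => //; exact: measurable_funeM.
  - move=> x sx; rewrite -!EFinM -!EFinD lee_fin.
    have -> : A x ^+ n = N x * (al (t x) * om x) ^+ n.
      by rewrite /A /N -exprMn; congr (_ ^+ _); ring.
    have := ler_wpM2l (N0 x) (dweight_le sx); rewrite -/(Zw x).
    set q := (_ * om x) ^+ n; set e := dweight _ _ _ _; set z := Zw x; set w := W x.
    by nra.
rewrite ge0_integralD//; last 4 first.
- by move=> x _; rewrite -EFinM lee_fin mulr_ge0// exprn_ge0.
- exact: measurable_funeM.
- by move=> x _; rewrite -EFinM lee_fin mulr_ge0//; apply: mulr_ge0.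
- exact: measurable_funeM.
rewrite ge0_integralZl//; last by move=> x _; rewrite lee_fin exprn_ge0.
rewrite ge0_integralZl//; last by move=> x _; rewrite lee_fin; exact: mulr_ge0.
rewrite ge0_integralD//; last 3 first.
- by move=> x sx; rewrite lee_fin mulr_ge0// dw0.
- by move=> x _; rewrite -EFinM lee_fin mulr_ge0//; apply: mulr_ge0.
- exact: measurable_funeM.
rewrite [in X in (_ <= _ + X)%E -> _]ge0_integralZl//; last by move=> x _; rewrite lee_fin; exact: mulr_ge0.
move=> /le_trans /(_ (leeD2r _ key)).
rewrite -(fineK fX) -(fineK fZ) -(fineK fI1) -/I1 -!EFinM -!EFinD lee_fin.
(* The divergence supplies n-1 copies of the main integral, and Young's inequality takes back (n-1)
   g of them. *)
have gE : p.+1%:R - p.+1%:R * g = g.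
  have n0 : p.+1%:R + 1 != 0 :> R by rewrite natr1 pnatr_eq0.
  by rewrite /g -[n%:R]natr1; move: n0; set q := p.+1%:R => n0; field.
have := congr1 (fun z => z * fine X) gE; rewrite mulrBl /m => e; lra.
Unshelve. all: by end_near. Qed.

End hardy.

(** * Removing the regularisation *)

Section hardy_limit.
Context {R : realType}.
Variables (p k : nat) (Phi : 'rV[R]_p.+3).
Hypothesis sPhi : sphere p.+2 Phi.
Local Notation n := p.+2.
Local Notation t x := (dotv x Phi).
Local Notation sigma := (@surface_measure R n).
Local Notation S := (sphere n).
Let mS := @measurable_sphere R n.
Let g : R := p.+1%:R / n%:R.

Variables (u : 'rV[R]_p.+3 -> R) (Psi : 'rV[R]_p.+3 -> 'rV[R]_p.+3).
Hypothesis mu : measurable_fun setT u.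
Hypothesis ui : sigma.-integrable S (EFin \o u).
Hypothesis un : sigma.-integrable S (fun x => (`|u x| ^+ n)%:E).
Hypothesis wP : weak_surface_gradient u Psi.

Variables (al th : R -> R) (c : R).
Hypothesis (mal : measurable_fun setT al) (mth : measurable_fun setT th).
Hypothesis (al0 : forall z, 0 <= al z) (al1 : forall z, z ^+ 2 <= 1 -> al z <= 1).
Hypothesis (th0 : forall z, 0 <= th z).
Hypothesis al_th : forall z z' r, 1 <= r -> z ^+ 2 <= 1 -> z' ^+ 2 <= 1 ->
  `|z| <= r * `|z'| -> `|z| ^+ k.+1 <= r * (al z ^+ p.+1 * th z').
Hypothesis c0 : 0 <= c.
Local Notation om delta x := (sn (t x) / reg delta (t x)).
Hypothesis dweight_le : forall delta x, 0 < delta -> S x ->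
  p.+1%:R * (al (t x) * om delta x) ^+ n -
    c * (`|t x| ^+ k * sn (t x) ^+ n * (reg delta (t x))^-1 ^+ p.+1) <=
  - dweight k Phi delta x.

Let A delta x := al (t x) * `|u x| * om delta x.
Let E x := th (t x) * enorm (Psi x).
Let Zw delta x := `|u x| ^+ n * (`|t x| ^+ k * sn (t x) ^+ n * (reg delta (t x))^-1 ^+ p.+1).

Let mt : measurable_fun setT (fun x => t x).
Proof. by apply: continuous_measurable_rV; exact: continuous_dotvl. Qed.

Let msn : measurable_fun setT (fun x => sn (t x)).
Proof. exact: (measurableT_comp (@measurable_sn R) mt). Qed.

Let mrV delta : measurable_fun setT (fun x => (reg delta (t x))^-1).
Proof.
apply: (measurableT_comp (@measurable_invr R)).
exact: (measurableT_comp (measurable_reg delta) mt).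
Qed.

Let mau : measurable_fun setT (fun x => `|u x|).
Proof. exact: (measurableT_comp (@normr_measurable R setT) mu). Qed.

Let mA delta : measurable_fun setT (A delta).
Proof.
apply: measurable_funM; last exact: measurable_funM.
by apply: measurable_funM => //; exact: (measurableT_comp mal mt).
Qed.

Let mZw delta : measurable_fun setT (Zw delta).
Proof.
apply: measurable_funM; first exact: measurable_funX.
apply: measurable_funM; last exact: measurable_funX.
apply: measurable_funM; last exact: measurable_funX.
by apply: measurable_funX; exact: (measurableT_comp (@normr_measurable R setT) mt).
Qed.

Let mE : measurable_fun setT E.
Proof.
apply: measurable_funM; first exact: (measurableT_comp mth mt).
apply: (measurableT_comp (@measurable_enorm R _)); apply: measurable_fun_rV => i.
by have [_ /(_ i)/Lfun1_sphere_integrable[]] := wP.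
Qed.

Let reg0 (z : R) : 0 <= reg 0 z. Proof. exact: reg_ge. Qed.

Let reg_eq0 (z : R) : reg 0 z = 0 -> sn z = 0.
Proof.
move=> /eqP; rewrite /reg addr0 mulf_eq0 sqrf_eq0 => /orP[/eqP//|/eqP lz].
by have := lg_ge1 z; rewrite lz ler10.
Qed.

Let Zw_le delta x : 0 < delta -> Zw delta x <= Zw 0 x.
Proof.
move=> d0; rewrite /Zw ler_wpM2l ?exprn_ge0//.
have [s0|s0] := eqVneq (sn (t x)) 0; first by rewrite s0 expr0n !mulr0 !mul0r.
have r0 : 0 < reg 0 (t x).
  rewrite lt_neqAle reg0 andbT eq_sym; apply: contra s0 => /eqP/reg_eq0/eqP; exact.
have q0 := mulr_ge0 (exprn_ge0 k (normr_ge0 (t x))) (exprn_ge0 n (sn_ge0 (t x))).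
rewrite ler_wpM2l// lerXn2r ?nnegrE ?invr_ge0 ?reg0 ?(ltW (reg_gt0 _ d0))//.
rewrite lef_pV2 ?posrE//; first by rewrite /reg addr0 lerDl ltW.
exact: reg_gt0.
Qed.

Let Zw_ge0 delta x : 0 <= delta -> 0 <= Zw delta x.
Proof.
move=> d0; have B0 : 0 <= reg delta (t x) by exact: le_trans (reg_ge _ _).
apply: mulr_ge0; first exact: exprn_ge0.
apply: mulr_ge0; last by rewrite exprn_ge0// invr_ge0.
by apply: mulr_ge0; rewrite exprn_ge0// sn_ge0.
Qed.

Let A_ge0 delta x : 0 <= delta -> 0 <= A delta x.
Proof.
move=> d0; have B0 : 0 <= reg delta (t x) by exact: le_trans (reg_ge _ _).
apply: mulr_ge0; first exact: mulr_ge0.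
by rewrite divr_ge0 ?sn_ge0.
Qed.

Let g0 : 0 < g. Proof. by rewrite divr_gt0. Qed.

(** As delta = 1/(j+1) tends to 0, the left side is handled by Fatou's lemma, while the integral
    with coefficient c is at most its value at delta = 0. The result holds in [0, +oo]. *)
Lemma hardy : (g%:E * \int[sigma]_(x in S) (A 0 x ^+ n)%:E <=
  c%:E * \int[sigma]_(x in S) (Zw 0 x)%:E +
  (g^-1 ^+ p.+1)%:E * \int[sigma]_(x in S) (E x ^+ n)%:E)%E.
Proof.
have mAn delta : measurable_fun S (fun x => (A delta x ^+ n)%:E).
  by apply/measurable_EFinP; apply: measurable_funTS; exact: measurable_funX.
have mEn : measurable_fun S (fun x => (E x ^+ n)%:E).
  by apply/measurable_EFinP; apply: measurable_funTS; exact: measurable_funX.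
have En0 x : 0 <= E x ^+ n by rewrite exprn_ge0// mulr_ge0// enorm_ge0.
have gp : 0 < g^-1 ^+ p.+1 by rewrite exprn_gt0// invr_gt0.
(* If the gradient term is infinite so is the right side; otherwise it is integrable, as
   [hardy_delta] assumes. *)
have [Yoo|Yfin] := eqVneq (\int[sigma]_(x in S) (E x ^+ n)%:E)%E +oo%E.
  rewrite Yoo gt0_muley ?lte_fin// addey ?leey//.
  rewrite -ltNye (@lt_le_trans _ _ 0%E)// mule_ge0 ?lee_fin//.
  by apply: integral_ge0 => x _; rewrite lee_fin Zw_ge0.
have iY : sigma.-integrable S (fun x => (E x ^+ n)%:E).
  apply/integrableP; split => //.
  rewrite (eq_integral (fun x => (E x ^+ n)%:E)); first by rewrite ltey.
  by move=> x _; rewrite abse_EFin ger0_norm.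
rewrite -ge0_integralZl//; last 2 first.
- by move=> x _; rewrite lee_fin exprn_ge0// A_ge0.
- by rewrite lee_fin ltW.
have h0 j : 0 < harmonic j :> R by exact: harmonic_gt0.
apply: (@fatou_cvg _ _ _ sigma S (fun j x => (g%:E * (A (harmonic j) x ^+ n)%:E)%E) _
  (fun=> (c%:E * \int[sigma]_(x in S) (Zw 0 x)%:E +
  (g^-1 ^+ p.+1)%:E * \int[sigma]_(x in S) (E x ^+ n)%:E)%E)) => //.
- by move=> j; exact: measurable_funeM.
- by move=> j x _; rewrite -EFinM lee_fin mulr_ge0 ?(ltW g0)// exprn_ge0// A_ge0// ltW.
- move=> x sx; rewrite -EFinM; under eq_fun do rewrite -EFinM.
  apply: cvg_EFin; first by near=> j.
  apply: cvgMr.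
  have [s0|s0] := eqVneq (sn (t x)) 0.
    have AE delta : A delta x = 0 by rewrite /A s0 mul0r mulr0.
    by rewrite /= AE; under eq_fun do rewrite /= AE; exact: cvg_cst.
  have r0 : reg 0 (t x) != 0 by apply: contra s0 => /eqP/reg_eq0/eqP; exact.
  have cr : (fun j => reg (harmonic j) (t x)) @ \oo --> reg 0 (t x).
    by apply: cvgD; [exact: cvg_cst|exact: cvg_harmonic].
  have cA : (fun j => A (harmonic j) x) @ \oo --> A 0 x.
    apply: cvgMr; apply: cvgMr; exact: cvgV.
  have : forall m, (fun j => A (harmonic j) x ^+ m) @ \oo --> A 0 x ^+ m; last exact.
  elim=> [|m IH]; first exact: cvg_cst.
  rewrite exprS (_ : (fun j => _) = (fun j => A (harmonic j) x * A (harmonic j) x ^+ m)).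
    exact: cvgM.
  by apply/funext => j; rewrite exprS.
- move=> j.
  have hd := @hardy_delta R p k Phi sPhi u Psi mu ui un wP al th c mal mth al0 al1 th0 al_th
    (harmonic j) (h0 j) c0 (fun x sx => dweight_le (h0 j) sx) iY.
  rewrite ge0_integralZl//; last 2 first.
  + by move=> x _; rewrite lee_fin exprn_ge0// A_ge0// ltW.
  + by rewrite lee_fin ltW.
  have fX : (\int[sigma]_(x in S) (A (harmonic j) x ^+ n)%:E)%E \is a fin_num.
    apply: integrable_fin_num => //.
    exact: (@integrable_hardy_A R p Phi sPhi u un al mal al0 al1 _ (h0 j)).
  have fZ : (\int[sigma]_(x in S) (Zw (harmonic j) x)%:E)%E \is a fin_num.
    apply: integrable_fin_num => //.
    exact: (integrable_hardy_Z k sPhi un (h0 j)).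
  apply: (@le_trans _ _ (c%:E * \int[sigma]_(x in S) (Zw (harmonic j) x)%:E +
    (g^-1 ^+ p.+1)%:E * \int[sigma]_(x in S) (E x ^+ n)%:E)%E).
    rewrite -(fineK fX) -(fineK fZ) -(fineK (integrable_fin_num mS iY)).
    by rewrite -!EFinM -EFinD lee_fin.
  rewrite leeD2r//; apply: lee_wpmul2l; first by rewrite lee_fin.
  apply: ge0_le_integral => //.
  + by move=> x _; rewrite lee_fin Zw_ge0// ltW.
  + by apply/measurable_EFinP; exact: measurable_funTS.
  + by apply/measurable_EFinP; exact: measurable_funTS.
  + by move=> x _; rewrite lee_fin Zw_le.
- exact: cvg_cst.
Unshelve. all: by end_near. Qed.

End hardy_limit.

(** * The two inequalities for the functionals *)

Section functional_bounds.
Context {R : realType}.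
Variables (p : nat) (Phi : 'rV[R]_p.+3).
Hypothesis sPhi : sphere p.+2 Phi.
Local Notation n := p.+2.
Local Notation t x := (dotv x Phi).
Local Notation sigma := (@surface_measure R n).
Local Notation S := (sphere n).
Let mS := @measurable_sphere R n.
Let g : R := gamma n.

Lemma gammaE : gamma n = p.+1%:R / n%:R :> R.
Proof. by rewrite /gamma -[n%:R]natr1 addrK. Qed.

Lemma cos_geodist x : S x -> cos (geodist Phi x) = t x.
Proof. by move=> sx; rewrite /geodist acosK// in_itv/= -ler_norml dotv_Phi_le1. Qed.

Lemma sin_geodist x : S x -> sin (geodist Phi x) = sn (t x).
Proof. by move=> sx; rewrite /geodist sin_acos// -ler_norml dotv_Phi_le1. Qed.

Lemma log_sn (z : R) : sn z != 0 -> ln (expR 1 / sn z) = lg z.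
Proof.
move=> s0; have sp : 0 < sn z by rewrite lt_neqAle eq_sym s0 sn_ge0.
by rewrite ln_div ?posrE ?expR_gt0// expRK.
Qed.

Lemma sn_div_reg (z : R) : sn z != 0 -> sn z / reg 0 z = (sn z * lg z)^-1.
Proof.
move=> s0; have l0 : lg z != 0 by rewrite gt_eqF// (lt_le_trans ltr01)// lg_ge1.
by rewrite /reg addr0; field; rewrite s0 l0.
Qed.

Implicit Type u : 'rV[R]_p.+3 -> R.

(** The integrands agree at the poles as well: division by 0 makes both of them 0 there. *)
Lemma functional_UE u : functional_U Phi u =
  (\int[sigma]_(x in S) ((1 * `|u x| * (sn (t x) / reg 0 (t x))) ^+ n)%:E)%E.
Proof.
apply: eq_integral => x /set_mem sx; rewrite sin_geodist//; congr EFin.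
have [s0|s0] := eqVneq (sn (t x)) 0; first by rewrite s0 !mul0r mulr0 !expr0n !mul0r invr0 mulr0.
by rewrite log_sn// sn_div_reg// mul1r [RHS]exprMn exprVn exprMn.
Qed.

Lemma functional_VE u : functional_V Phi u =
  (\int[sigma]_(x in S) ((`|t x| * `|u x| * (sn (t x) / reg 0 (t x))) ^+ n)%:E)%E.
Proof.
apply: eq_integral => x /set_mem sx; rewrite sin_geodist// cos_geodist//; congr EFin.
have [s0|s0] := eqVneq (sn (t x)) 0.
  by rewrite s0 !mul0r mulr0 invr0 mulr0 !expr0n mulr0 mul0r.
rewrite log_sn// sn_div_reg// -exprMn -expr_div_n; congr (_ ^+ _).
have l0 : lg (t x) != 0 by rewrite gt_eqF// (lt_le_trans ltr01)// lg_ge1.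
by field; rewrite s0 l0.
Qed.

Let weightE (z w : R) : sn z != 0 -> w * (sn z ^+ n * (reg 0 z)^-1 ^+ p.+1) =
  w / (sn z ^+ p * lg z ^+ p.+1).
Proof.
move=> s0; have l0 : lg z != 0 by rewrite gt_eqF// (lt_le_trans ltr01)// lg_ge1.
congr (_ * _); rewrite /reg addr0 exprVn exprMn -exprM mulnC.
rewrite (_ : (p.+1 * 2 = n + p)%N); last by rewrite !addSn addnn muln2.
by rewrite exprD; field; rewrite !expf_neq0.
Qed.

Lemma functional_UtildeE u : functional_Utilde Phi u =
  (\int[sigma]_(x in S) (`|u x| ^+ n *
    (`|t x| ^+ 0 * sn (t x) ^+ n * (reg 0 (t x))^-1 ^+ p.+1))%:E)%E.
Proof.
apply: eq_integral => x /set_mem sx; rewrite sin_geodist//; congr EFin.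
rewrite !subSS !subn0.
have [s0|s0] := eqVneq (sn (t x)) 0.
  by rewrite s0 invr0 mulr0 ln0// [0 ^+ p.+1]exprS [0 ^+ n]exprS !(mul0r, mulr0, invr0).
by rewrite log_sn// expr0 mul1r weightE.
Qed.

Lemma functional_VtildeE u : functional_Vtilde Phi u =
  (\int[sigma]_(x in S) (`|u x| ^+ n *
    (`|t x| ^+ p * sn (t x) ^+ n * (reg 0 (t x))^-1 ^+ p.+1))%:E)%E.
Proof.
apply: eq_integral => x /set_mem sx; rewrite sin_geodist// cos_geodist//; congr EFin.
rewrite !subSS !subn0.
have [s0|s0] := eqVneq (sn (t x)) 0.
  by rewrite s0 invr0 !mulr0 ln0// [0 ^+ p.+1]exprS [0 ^+ n]exprS !(mul0r, mulr0, invr0).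
rewrite log_sn// -(mulrA (`|t x| ^+ p)) [RHS]mulrA weightE// exprMn exprVn.
by rewrite invfM !mulrA.
Qed.

Lemma functional_HE u : functional_H u =
  (\int[sigma]_(x in S) ((1 * enorm (surface_grad u x)) ^+ n)%:E)%E.
Proof. by apply: eq_integral => x _; rewrite mul1r. Qed.

Lemma functional_QE u : functional_Q Phi u =
  (\int[sigma]_(x in S) ((`|t x| * enorm (surface_grad u x)) ^+ n)%:E)%E.
Proof.
by apply: eq_integral => x /set_mem sx; rewrite cos_geodist// mulrC -exprMn.
Qed.

Lemma surface_gradP u : sobolev u -> weak_surface_gradient u (surface_grad u).
Proof. by move=> [_ [Psi wP _]]; apply: xgetPex; exists Psi. Qed.

(** The condition [dweight_le] for k = 0 in abstract letters: s2 = s^2, T = t^2, i = 1/[reg], m = n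
    - 1, and q the remaining powers. The difference is a sum of nonnegative terms because s^2 <=
    [reg], a consequence of L >= 1. *)
Let dweight_case (q : R) s2 T i delta (m : R) : 0 <= q -> 0 <= s2 -> 0 <= T -> 0 <= i -> 0 < delta ->
  s2 * i <= 1 -> s2 = 1 - T -> 0 <= m ->
  m * (q * s2 * i) - (m + 1) * (q * s2) <= - (q * (1 * (1 - T) - m * T * (s2 + 2 * delta) * i)).
Proof.
move=> q0 s0 T0 i0 d0 si sT m0.
rewrite -subr_ge0 (_ : _ - _ = q * (m * s2 * (1 - s2 * i) + 2 * m * T * delta * i)).
  apply: mulr_ge0 => //; apply: addr_ge0.
    by rewrite mulr_ge0 ?mulr_ge0// subr_ge0.
  by rewrite !mulr_ge0// ltW.
by rewrite sT; ring.
Qed.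

(** The case k = p. Only the term with delta is lost, so at delta = 0 the divergence is exactly the
    difference of the two weights. *)
Let dweight_case' (q : R) s2 T i delta (m : R) : 0 <= q -> 0 <= T -> 0 <= i -> 0 < delta ->
  s2 = 1 - T -> 0 <= m ->
  m * (q * (T * s2) * i) - m * (q * s2) <= - (q * (m * (1 - T) - m * T * (s2 + 2 * delta) * i)).
Proof.
move=> q0 T0 i0 d0 sT m0.
rewrite -subr_ge0 (_ : _ - _ = q * (2 * m * T * delta * i)).
  by rewrite !mulr_ge0// ltW.
by rewrite sT; ring.
Qed.

Lemma functional_U_bound u : sobolev u ->
  (g%:E * functional_U Phi u <= n%:R%:E * functional_Utilde Phi u +
   (g^-1 ^+ p.+1)%:E * functional_Q Phi u)%E.
Proof.
move=> su; have wP := surface_gradP su; have [un _] := su.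
have [mu ui uni] := Lfun_sphere_integrable (ltn0Sn _) un.
rewrite functional_UE functional_UtildeE functional_QE /g gammaE.
apply: (@hardy R p 0 Phi sPhi u _ mu ui uni wP (fun=> 1) (fun z => `|z|) n%:R) => //.
- by move=> z z' r r1 _ _ zr; rewrite expr1 expr1n mul1r.
- move=> delta x d0 sx.
  have B0 := reg_gt0 (t x) d0; have S2 := sn_sqr (dotv_Phi_sqr_le1 sPhi sx).
  have := @dweight_case (sn (t x) ^+ p * (reg delta (t x))^-1 ^+ p.+1) (sn (t x) ^+ 2) (t x ^+ 2)
    (reg delta (t x))^-1 delta p.+1%:R.
  move=> /(_ _ (sqr_ge0 _) (sqr_ge0 _) _ d0 _ S2 (ler0n _ _)) h.
  have := h _ _ _; rewrite natr1 /dweight /weight expr0 !mul1r => le.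
  apply: le_trans (le _ _ _).
  + rewrite [(sn (t x) / _) ^+ n]exprMn le_eqVlt; apply/orP; left; apply/eqP.
    by rewrite !exprS; ring.
  + by rewrite mulr_ge0// exprn_ge0 ?sn_ge0// invr_ge0 ltW.
  + by rewrite invr_ge0 ltW.
  + by rewrite ler_pdivrMr// mul1r sn_sqr_le_reg// ltW.
Qed.

Lemma functional_V_bound u : sobolev u ->
  (g%:E * functional_V Phi u <= (n%:R - 1)%:E * functional_Vtilde Phi u +
   (g^-1 ^+ p.+1)%:E * functional_H u)%E.
Proof.
move=> su; have wP := surface_gradP su; have [un _] := su.
have [mu ui uni] := Lfun_sphere_integrable (ltn0Sn _) un.
rewrite functional_VE functional_VtildeE functional_HE /g gammaE (_ : n%:R - 1 = p.+1%:R); last by rewrite -[n%:R]natr1 addrK.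
apply: (@hardy R p p Phi sPhi u _ mu ui uni wP (fun z => `|z|) (fun=> 1) p.+1%:R) => //.
- move=> z z1; rewrite -(@ler_pXn2r _ 2)// ?nnegrE//.
  by rewrite expr1n real_normK ?num_real.
- move=> z z' r r1 _ _ zr; rewrite mulr1 ler_peMl// exprn_ge0//.
- move=> delta x d0 sx.
  have B0 := reg_gt0 (t x) d0; have S2 := sn_sqr (dotv_Phi_sqr_le1 sPhi sx).
  have le := @dweight_case' (`|t x| ^+ p * sn (t x) ^+ p * (reg delta (t x))^-1 ^+ p.+1)
    (sn (t x) ^+ 2) (t x ^+ 2) (reg delta (t x))^-1 delta p.+1%:R.
  apply: le_trans (le _ (sqr_ge0 _) _ d0 S2 (ler0n _ _)).
  + rewrite -[t x ^+ 2]real_normK ?num_real// le_eqVlt; apply/orP; left; apply/eqP.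
    by rewrite [(`|t x| * _) ^+ n]exprMn [(sn (t x) / _) ^+ n]exprMn !exprS; ring.
  + by rewrite !mulr_ge0// ?exprn_ge0 ?sn_ge0// invr_ge0 ltW.
  + by rewrite invr_ge0 ltW.
Qed.

End functional_bounds.

(** * Radial test functions *)

Section radial_divergence.
Context {R : realType}.
Variables (n : nat) (Phi : 'rV[R]_n.+1).
Hypothesis sPhi : sphere n Phi.
Local Notation t x := (dotv x Phi).
Local Notation sigma := (@surface_measure R n).
Local Notation S := (sphere n).
Let mS := @measurable_sphere R n.

Variables (h dh : R -> R) (r : R).
Hypothesis r1 : 1 < r.
Hypothesis dhE : forall z : R, `|z| < r -> is_derive z (1 : R) h (dh z).
Hypothesis cdh : forall z, `|z| < r -> {for z, continuous dh}.

Let t_lt x : S x -> `|t x| < r.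
Proof. by move=> sx; apply: le_lt_trans r1; exact: dotv_Phi_le1. Qed.

Let Ch : C1_near_sphere (fun x => h (t x)) := C1_near_dotv sPhi r1 dhE cdh.

Lemma radial_C1 x : S x -> differentiable (fun x => h (t x)) x.
Proof. by move=> /Ch[/nbhs_singleton]. Qed.

Lemma radial_derive x v : S x -> 'D_v (fun x => h (t x)) x = dh (t x) * dotv v Phi.
Proof.
move=> sx; rewrite (derive_comp1 _ (differentiable_dotvl x Phi) (dhE (t_lt sx))).
by rewrite derive_dotvl.
Qed.

Let integral_div_radial (V : 'rV[R]_n.+1 -> 'rV[R]_n.+1) :
  (forall i, smooth (fun x => V x ord0 i)) -> (forall x, S x -> dotv (V x) x = 0) ->
  (\int[sigma]_(x in S) (dh (t x) * dotv (V x) Phi + h (t x) * surface_div V x)%:E = 0)%E.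
Proof.
move=> sV tV.
rewrite -(@divergence_theorem R n (fun x => h (t x) *: V x)); last 2 first.
- move=> i; rewrite (_ : (fun x => _) = fun x => h (t x) * V x ord0 i).
    by apply/C1_near_C1/C1_nearM => //; exact: smooth_C1.
  by apply/funext => x; rewrite mxE.
- by move=> x sx; rewrite dotvZl tV// mulr0.
apply: eq_integral => x /set_mem sx; rewrite surface_divM ?radial_derive//; first exact: tV.
- exact: radial_C1.
- by move=> i; exact: smooth_differentiable.
Qed.

Lemma radial_divergence :
  (\int[sigma]_(x in S) (dh (t x) * (1 - t x ^+ 2) - n%:R * t x * h (t x))%:E = 0)%E.
Proof.
rewrite -[RHS](@integral_div_radial (meridian Phi)).
- apply: eq_integral => x /set_mem sx.
  by rewrite dotv_meridian_Phi// surface_div_meridian//; congr EFin; ring.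
- by move=> i; apply: elem_smooth; exact: elem_meridian.
- exact: meridian_tangent.
Qed.

(** For tangent V the number [dotv (V x) Phi] is the derivative of t along V, so this is the
    integration by parts formula for h(t). *)
Lemma radial_weak_gradient V : smooth_tangent_field V ->
  [/\ sigma.-integrable S (fun x => (dh (t x) * dotv (V x) Phi)%:E),
      sigma.-integrable S (fun x => (h (t x) * surface_div V x)%:E) &
  (\int[sigma]_(x in S) (dh (t x) * dotv (V x) Phi)%:E =
   - \int[sigma]_(x in S) (h (t x) * surface_div V x)%:E)%E].
Proof.
move=> [sV tV].
have ct x : {for x, continuous (fun x => t x)} by exact: continuous_dotvl.
have i1 : sigma.-integrable S (fun x => (dh (t x) * dotv (V x) Phi)%:E).
  apply: sphere_continuous_integrable => x sx.
  apply: catM; first by apply: cat_comp => //; exact: cdh (t_lt sx).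
  apply: cat_sum => i; apply: catM; last exact: cat_cst.
  by apply: differentiable_continuous; exact: smooth_differentiable.
have i2 : sigma.-integrable S (fun x => (h (t x) * surface_div V x)%:E).
  apply: sphere_continuous_integrable => x sx.
  apply: catM; first by apply: differentiable_continuous; exact: radial_C1.
  by apply: surface_div_continuous => // i; exact/C1_near_C1/smooth_C1.
split => //; have := integral_div_radial sV tV.
under eq_integral do rewrite EFinD.
rewrite integralD// -(fineK (integrable_fin_num mS i1)) -(fineK (integrable_fin_num mS i2)).
by move=> [] /eqP; rewrite addr_eq0 => /eqP ->.
Qed.

End radial_divergence.

(** * Radial functions cut off near the poles *)

Section radial_functions.
Context {R : realType}.
Implicit Types z y : R.

Lemma der_continuous (f : R -> R) z d : is_derive z (1 : R) f d -> {for z, continuous f}.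
Proof. by move=> [df _]; apply: differentiable_continuous; exact/derivable1_diffP. Qed.

(** Two consecutive exponents are carried along because the induction multiplies by z^2 = |z|^2,
    which is smooth. The base case |z| z has a quadratic error at every point. *)
Lemma der_normX k z : is_derive z (1 : R) (fun z => `|z| ^+ k * z) (k.+1%:R * `|z| ^+ k) /\
  is_derive z (1 : R) (fun z => `|z| ^+ k.+1 * z) (k.+2%:R * `|z| ^+ k.+1).
Proof.
elim: k => [|k [IH1 IH2]].
  split.
    rewrite (_ : (fun z => _) = id); last by apply/funext => w; rewrite expr0 mul1r.
    by rewrite expr0 mulr1; exact: der_id.
  apply: (@der_quadratic _ _ _ _ 1) => h; rewrite mul1r !expr1 ler_norml.
  by case: (ler0P z) => z0; case: (ler0P (h + z)) => hz; apply/andP; split; nra.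
split=> //.
have d2 := derM (derX 2 (der_id z)) IH1.
rewrite (_ : (fun w => _) = (fun w => w ^+ 2 * (`|w| ^+ k * w))).
  apply: (der_eq d2); rewrite -[_ ^+ 2](real_normK (num_real z)) -[k.+3%:R]natr1 -[k.+2%:R]natr1 !exprS.
  have zz : z * z = `|z| * `|z| by rewrite -!expr2 real_normK ?num_real.
  transitivity (2 * `|z| ^+ k * (z * z) + `|z| * `|z| * (k.+1%:R * `|z| ^+ k)).
    by rewrite expr0 /=; ring.
  by rewrite zz -[k.+1%:R]natr1; ring.
by apply/funext => w; rewrite -[w ^+ 2](real_normK (num_real w)) !exprS; ring.
Qed.

End radial_functions.

Section cutoff.
Context {R : realType}.
Implicit Types z y : R.

Lemma sn_gt0 z : (0 < sn z) = (0 < 1 - z ^+ 2).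
Proof. by rewrite /sn sqrtr_gt0. Qed.

Lemma der_sn z : 0 < sn z -> is_derive z (1 : R) (@sn R) (- z / sn z).
Proof.
move=> s0; have z0 : 0 < 1 - z ^+ 2 by rewrite -sn_gt0.
have ds := is_derive1_sqrt z0.
have dq := derB (der_cst z (1 : R)) (derX 2 (der_id z)).
apply: (der_eq (der_comp dq ds)); rewrite -/(sn z) /=.
by field; rewrite gt_eqF.
Qed.

Lemma der_lg z : 0 < sn z -> is_derive z (1 : R) (@lg R) (z / sn z ^+ 2).
Proof.
move=> s0; have dl := derB (der_cst z (1 : R)) (der_comp (der_sn s0) (is_derive1_ln s0)).
by apply: (der_eq dl); rewrite /=; field; rewrite gt_eqF.
Qed.

(* Since 0^-1 = 0, a cut-off with q = 0 on [L, +oo[ vanishes near the poles and,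
   as a function of the real variable z, everywhere outside ]-1, 1[; it is thus
   of class C^1 on the whole real line. *)
Definition cutoff (q a : R -> R) m z := a z * ((sn z)^-1 ^+ m.+1 * q (lg z)).

(** Since sn' = -z/sn and lg' = z/sn^2, differentiating the power of sn and differentiating chi(lg)
    both produce z sn^(-m-3), so the two terms merge into one cut-off function. *)
Definition dcutoff (chi dchi a da : R -> R) m z := cutoff chi da m z +
  cutoff (fun y => m.+1%:R * chi y + dchi y) (fun z => a z * z) m.+2 z.

Let lg_gt0 z : 0 < lg z. Proof. exact: lt_le_trans ltr01 (lg_ge1 z). Qed.

Lemma sn_continuous : continuous (@sn R).
Proof.
move=> z; apply: (@continuous_comp _ _ _ (fun z => 1 - z ^+ 2) (@Num.sqrt R)); last exact: sqrt_continuous.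
by apply: catD; [exact: cat_cst|apply: catN; apply: catX; exact: cvg_id].
Qed.

(** Either the usual rules of calculus apply at z, or every cut-off function vanishes identically
    near z. *)
Let sn_case (L : R) z : 0 < sn z \/ \forall w \near z, sn w = 0 \/ L <= lg w.
Proof.
have [z0|z0] := eqVneq (sn z) 0; last by left; rewrite lt_neqAle eq_sym z0 sn_ge0.
right; have e0 := expR_gt0 (1 - L).
have : \forall w \near z, sn w < expR (1 - L).
  by apply: (@cvgr_lt _ _ _ _ _ _ (@sn_continuous z)); rewrite z0.
apply: filterS => w we.
have [w0|w0] := eqVneq (sn w) 0; first by left.
right; have wp : 0 < sn w by rewrite lt_neqAle eq_sym w0 sn_ge0.
have : ln (sn w) <= 1 - L by rewrite -[leRHS]expRK ler_ln ?posrE// ltW.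
by rewrite /lg; lra.
Qed.

Let flat (q a : R -> R) L m z : (forall y, L <= y -> q y = 0) ->
  sn z = 0 \/ L <= lg z -> cutoff q a m z = 0.
Proof.
move=> q0; rewrite /cutoff; case=> [->|zL]; last by rewrite q0// !mulr0.
by rewrite invr0 expr0n/= !(mul0r, mulr0).
Qed.

Lemma cutoff_continuous (q a : R -> R) L m :
  (forall y, 0 < y -> {for y, continuous q}) -> (forall y, L <= y -> q y = 0) ->
  continuous a -> forall z, {for z, continuous (cutoff q a m)}.
Proof.
move=> cq q0 ca z; have [s0|nz] := sn_case L z; last first.
  apply: (@near_eq_continuous_at _ _ (fun=> 0)); last exact: cvg_cst.
  by apply: filterS nz => w /(flat _ _ q0) ->.
apply: catM; first exact: ca.
apply: catM; first by apply: catX; apply: catV; [rewrite gt_eqF|exact: sn_continuous].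
apply: continuous_comp; last exact: cq.
exact: der_continuous (der_lg s0).
Qed.

Section derivative.
Variables (chi dchi : R -> R) (L : R).
Hypothesis dchiE : forall y, 0 < y -> is_derive y (1 : R) chi (dchi y).
Hypothesis cdchi : forall y, 0 < y -> {for y, continuous dchi}.
Hypothesis chi0 : forall y, L <= y -> chi y = 0.
Hypothesis dchi0 : forall y, L <= y -> dchi y = 0.
Variables (a da : R -> R) (m : nat).
Hypothesis daE : forall z, is_derive z (1 : R) a (da z).
Hypothesis cda : continuous da.

Let ca : continuous a. Proof. by move=> z; exact: der_continuous (daE z). Qed.
Let cchi y : 0 < y -> {for y, continuous chi}.
Proof. by move=> y0; exact: der_continuous (dchiE y0). Qed.

Lemma cutoff_derive z : is_derive z (1 : R) (cutoff chi a m) (dcutoff chi dchi a da m z).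
Proof.
have [s0|nz] := sn_case L z.
  have sn0 : sn z != 0 by rewrite gt_eqF.
  have d := derM (daE z) (derM (derX m.+1 (derV sn0 (der_sn s0)))
    (der_comp (der_lg s0) (dchiE (lg_gt0 z)))).
  apply: (der_eq d); rewrite /dcutoff /cutoff /= !exprS; field.
  by rewrite sn0.
have zL := nbhs_singleton nz.
rewrite /dcutoff (flat _ _ chi0 zL) (@flat _ _ L _ _ _ zL); last first.
  by move=> y Ly; rewrite chi0// dchi0// mulr0 addr0.
rewrite addr0.
apply: (@near_eq_is_derive _ _ _ (fun=> 0) (cutoff chi a m)).
by apply: filterS nz => w /(flat _ _ chi0) ->.
Qed.

Lemma dcutoff_continuous z : {for z, continuous (dcutoff chi dchi a da m)}.
Proof.
apply: catD; first apply (@cutoff_continuous chi da L m cchi chi0 cda z).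
apply: (@cutoff_continuous _ _ L) => [y y0|y Ly|w].
- by apply: catD; [apply: catM; [exact: cat_cst|exact: cchi]|exact: cdchi].
- by rewrite chi0// dchi0// mulr0 addr0.
- by apply: catM; [exact: ca|exact: cvg_id].
Qed.

End derivative.

End cutoff.

Section cutoff_identity.
Context {R : realType}.
Variables (n : nat) (Phi : 'rV[R]_n.+1).
Hypothesis sPhi : sphere n Phi.
Local Notation t x := (dotv x Phi).
Local Notation sigma := (@surface_measure R n).
Local Notation S := (sphere n).
Let mS := @measurable_sphere R n.

Variables (chi dchi : R -> R) (L : R).
Hypothesis dchiE : forall y : R, 0 < y -> is_derive y (1 : R) chi (dchi y).
Hypothesis cdchi : forall y : R, 0 < y -> {for y, continuous dchi}.
Hypothesis chi0 : forall y : R, L <= y -> chi y = 0.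
Hypothesis dchi0 : forall y : R, L <= y -> dchi y = 0.

Let pw k (z : R) : R := `|z| ^+ k * z.
Let dpw k (z : R) : R := k.+1%:R * `|z| ^+ k.
Let dpwE k z : is_derive z (1 : R) (pw k) (dpw k z). Proof. by have [] := der_normX k z. Qed.
Let cdpw k z : {for z, continuous (dpw k)}.
Proof. by rewrite /dpw; apply: catM; [exact: cat_cst|apply: catX; exact: norm_continuous]. Qed.

Lemma cutoff_integrable (q a : R -> R) m : (forall y : R, 0 < y -> {for y, continuous q}) ->
  (forall y : R, L <= y -> q y = 0) -> continuous a ->
  sigma.-integrable S (fun x => (cutoff q a m (t x))%:E).
Proof.
move=> cq q0 ca; apply: sphere_continuous_integrable => x _.
apply: continuous_comp; first exact: continuous_dotvl.
apply (@cutoff_continuous R q a L m cq q0 ca).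
Qed.

Let cchi y : 0 < y -> {for y, continuous chi}.
Proof. by move=> y0; exact: der_continuous (dchiE y0). Qed.

Let cabs k : continuous (fun z : R => `|z| ^+ k).
Proof. by move=> z; apply: catX; exact: norm_continuous. Qed.

Let cpws k z : {for z, continuous (fun z : R => k.+1%:R * `|z| ^+ k * sn z ^+ 2)}.
Proof.
apply: catM; last by apply: catX; exact: sn_continuous.
by apply: catM; [exact: cat_cst|exact: cabs].
Qed.

(** The divergence theorem for |t|^k t s^(-m-1) chi(L) grad t. If m + 1 < n the first term on the
    right has a positive coefficient and bounds an integral; if m + 1 = n it vanishes and the
    derivative of chi remains alone. *)
Lemma cutoff_integral m k :
  (\int[sigma]_(x in S) (cutoff chi (fun z => k.+1%:R * `|z| ^+ k * sn z ^+ 2) m (t x))%:E =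
   \int[sigma]_(x in S) ((n%:R - m.+1%:R) * cutoff chi (fun z => `|z| ^+ k.+2) m (t x) +
     cutoff (fun y => - dchi y) (fun z => `|z| ^+ k.+2) m (t x))%:E)%E.
Proof.
pose f1 x := cutoff chi (fun z => k.+1%:R * `|z| ^+ k * sn z ^+ 2) m (t x).
pose f2 x := (n%:R - m.+1%:R) * cutoff chi (fun z => `|z| ^+ k.+2) m (t x) +
  cutoff (fun y => - dchi y) (fun z => `|z| ^+ k.+2) m (t x).
have i1 : sigma.-integrable S (fun x => (f1 x)%:E).
  apply: cutoff_integrable => // z; exact: cpws.
have i2 : sigma.-integrable S (fun x => (f2 x)%:E).
  have i3 : sigma.-integrable S (fun x => (cutoff chi (fun z => `|z| ^+ k.+2) m (t x))%:E).
    exact: cutoff_integrable.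
  have i4 : sigma.-integrable S (fun x => (cutoff (fun y => - dchi y) (fun z => `|z| ^+ k.+2) m (t x))%:E).
    apply: cutoff_integrable => //; last by move=> y Ly; rewrite dchi0// oppr0.
    by move=> y y0; apply: catN; exact: cdchi.
  have := integrableD mS (integrableZl mS (n%:R - m.+1%:R) i3) i4.
  by apply: eq_integrable => // x _; rewrite /f2 EFinD EFinM.
suff : (\int[sigma]_(x in S) (f1 x - f2 x)%:E = 0)%E.
  under eq_integral do rewrite EFinB.
  rewrite integralB// -(fineK (integrable_fin_num mS i1)) -(fineK (integrable_fin_num mS i2)).
  by rewrite -EFinB => -[] /eqP; rewrite subr_eq0 => /eqP ->.
rewrite -[RHS](@radial_divergence _ _ _ sPhi (cutoff chi (pw k) m) (dcutoff chi dchi (pw k) (dpw k) m) 2).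
- apply: eq_integral => x /set_mem sx; congr EFin.
  have S2 := sn_sqr (dotv_Phi_sqr_le1 sPhi sx); rewrite -S2.
  have z2 : t x ^+ 2 = `|t x| ^+ 2 by rewrite real_normK ?num_real.
  rewrite /f1 /f2 /dcutoff /cutoff /pw /dpw.
  have [s0|s0] := eqVneq (sn (t x)) 0.
    by rewrite s0 invr0 !expr0n/= !(mul0r, mulr0, addr0, subr0).
  rewrite [`|_| ^+ k.+2]exprS [`|_| ^+ k.+1]exprS mulrA -expr2 -z2.
  rewrite [_^-1 ^+ m.+3]exprS [_^-1 ^+ m.+2]exprS; move: (_^-1 ^+ m.+1) => e.
  by field.
- by rewrite ltrDl.
- by move=> z _; exact: (cutoff_derive dchiE chi0 dchi0 m (dpwE k)).
- by move=> z _; apply (@dcutoff_continuous R chi dchi L dchiE cdchi chi0 dchi0 (pw k) (dpw k) m (dpwE k) (@cdpw k) z).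
Qed.

End cutoff_identity.

(** * A cut-off in the logarithm *)

Section theta.
Context {R : realType}.
Implicit Types y : R.

(** C^1, supported in y <= j + 1, convergent to 1, and with derivative bounded by 2/y independently
    of j. The last property makes the error terms y^c theta' comparable to y^(c-1). *)
Definition theta j y : R := possq (1 - y / j.+1%:R).
Definition dtheta j y : R := - (2 / j.+1%:R * Num.max (1 - y / j.+1%:R) 0).

Lemma der_theta j y : is_derive y (1 : R) (theta j) (dtheta j y).
Proof.
have d := der_comp (derB (der_cst y (1 : R)) (derM (der_id y) (der_cst y (j.+1%:R)^-1)))
  (der_possq (1 - y / j.+1%:R)).
by apply: (der_eq d); rewrite /dtheta; ring.
Qed.

Lemma dtheta_continuous j y : {for y, continuous (dtheta j)}.
Proof.
apply: catN; apply: catM; first exact: cat_cst.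
apply: (@continuous_comp _ _ _ (fun y : R => 1 - y / j.+1%:R) (fun z : R => Num.max z 0)); last exact: continuous_max0.
by apply: catD; [exact: cat_cst|apply: catN; apply: catM; [exact: cvg_id|exact: cat_cst]].
Qed.

Let max0 j y : j.+1%:R <= y -> Num.max (1 - y / j.+1%:R) 0 = 0 :> R.
Proof. by move=> jy; apply/max_idPr; rewrite subr_le0 ler_pdivlMr ?ltr0n// mul1r. Qed.

Lemma theta_eq0 j y : j.+1%:R <= y -> theta j y = 0.
Proof. by move=> jy; rewrite /theta /possq max0// expr0n. Qed.

Lemma dtheta_eq0 j y : j.+1%:R <= y -> dtheta j y = 0.
Proof. by move=> jy; rewrite /dtheta max0// mulr0 oppr0. Qed.

Lemma theta_ge0 j y : 0 <= theta j y.
Proof. exact: possq_ge0. Qed.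

Let max_le1 j y : 0 <= y -> Num.max (1 - y / j.+1%:R) 0 <= 1.
Proof. by move=> y0; rewrite ge_max ler01 andbT gerBl divr_ge0. Qed.

Lemma theta_le1 j y : 0 <= y -> theta j y <= 1.
Proof. by move=> y0; rewrite /theta /possq exprn_ile1 ?max_le1// le_max lexx orbT. Qed.

Lemma dtheta_le0 j y : dtheta j y <= 0.
Proof. by rewrite oppr_le0 mulr_ge0// le_max lexx orbT. Qed.

Lemma dtheta_ge j y : 0 <= y -> - dtheta j y <= 2 / j.+1%:R.
Proof. by move=> y0; rewrite opprK ler_piMr// max_le1. Qed.

Lemma dtheta_geV j y : 0 < y -> - dtheta j y <= 2 / y.
Proof.
move=> y0; have [jy|yj] := leP j.+1%:R y.
  by rewrite dtheta_eq0// oppr0 divr_ge0// ltW.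
apply: le_trans (dtheta_ge j (ltW y0)) _.
by rewrite ler_pM2l// lef_pV2 ?posrE ?ltr0n// ltW.
Qed.

Let cvg_inv y : (fun j => y / j.+1%:R) @ \oo --> (0 : R).
Proof. by rewrite -(mulr0 y); apply: cvgMr; exact: cvg_harmonic. Qed.

Lemma cvg_theta y : theta ^~ y @ \oo --> (1 : R).
Proof.
have -> : 1 = possq (1 - 0) :> R by rewrite subr0 /possq (max_idPl ler01) expr1n.
apply: continuous_cvg; first exact: der_continuous (der_possq _).
by apply: cvgB; [exact: cvg_cst|exact: cvg_inv].
Qed.

Lemma cvg_dtheta y : 0 <= y -> dtheta ^~ y @ \oo --> (0 : R).
Proof.
move=> y0; apply: (@squeeze_cvgr _ _ _ _ (fun j => - (2 / j.+1%:R)) (fun=> 0)).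
- by near=> j; rewrite dtheta_le0 andbT lerNl dtheta_ge.
- by rewrite -oppr0; apply: cvgN; exact: cvg_inv.
- exact: cvg_cst.
Unshelve. all: by end_near. Qed.

End theta.

(** * Integrability of negative powers of s *)

Section inverse_powers.
Context {R : realType}.
Variables (n : nat) (Phi : 'rV[R]_n.+1).
Hypothesis sPhi : sphere n Phi.
Local Notation t x := (dotv x Phi).
Local Notation sigma := (@surface_measure R n).
Local Notation S := (sphere n).
Let mS := @measurable_sphere R n.

Lemma measurable_radial (f : R -> R) : measurable_fun setT f -> measurable_fun S (fun x => (f (t x))%:E).
Proof.
move=> mf; apply/measurable_EFinP; apply: measurable_funTS; apply: (measurableT_comp mf).
by apply: continuous_measurable_rV; exact: continuous_dotvl.
Qed.

Lemma measurable_inv_sn m : measurable_fun setT (fun z : R => (sn z)^-1 ^+ m).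
Proof.
by apply: measurable_funX; apply: (measurableT_comp (@measurable_invr R)); exact: measurable_sn.
Qed.

Lemma measurable_absX k : measurable_fun setT (fun z : R => `|z| ^+ k).
Proof. by apply: measurable_funX; exact: normr_measurable. Qed.

Lemma measurable_absX_sn k : measurable_fun setT (fun z : R => k.+1%:R * `|z| ^+ k * sn z ^+ 2).
Proof.
apply: measurable_funM; last by apply: measurable_funX; exact: measurable_sn.
by apply: measurable_funM; [exact: measurable_cst|exact: measurable_absX].
Qed.

Lemma inv_sn_ge0 m (z : R) : 0 <= (sn z)^-1 ^+ m.
Proof. by rewrite exprn_ge0// invr_ge0 sn_ge0. Qed.

Lemma measurable_theta j : measurable_fun setT (fun z : R => theta j (lg z)).
Proof.
apply: (measurableT_comp _ measurable_lg); apply: continuous_measurable_fun => y.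
exact: der_continuous (der_theta j y).
Qed.

Lemma measurable_dtheta j : measurable_fun setT (fun z : R => - dtheta j (lg z)).
Proof.
apply: measurable_funN; apply: (measurableT_comp _ measurable_lg).
by apply: continuous_measurable_fun => y; exact: dtheta_continuous.
Qed.

Lemma measurable_cutoff (q a : R -> R) m : measurable_fun setT a ->
  measurable_fun setT (fun z => q (lg z)) -> measurable_fun setT (cutoff q a m).
Proof.
by move=> ma mq; apply: measurable_funM => //; apply: measurable_funM => //; exact: measurable_inv_sn.
Qed.

Let step m : (m.+1 < n)%N ->
  (\int[sigma]_(x in S) (`|t x| ^+ 2 * (sn (t x))^-1 ^+ m.+1)%:E <=
   \int[sigma]_(x in S) (sn (t x) ^+ 2 * (sn (t x))^-1 ^+ m.+1)%:E)%E.
Proof.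
move=> mn.
have mf : measurable_fun setT (fun z : R => `|z| ^+ 2 * (sn z)^-1 ^+ m.+1).
  by apply: measurable_funM; [exact: measurable_absX|exact: measurable_inv_sn].
apply: (@fatou_cvg _ _ _ _ _ (fun j x => (`|t x| ^+ 2 * (sn (t x))^-1 ^+ m.+1 * theta j (lg (t x)))%:E) _
  (fun=> \int[sigma]_(x in S) (sn (t x) ^+ 2 * (sn (t x))^-1 ^+ m.+1)%:E)%E) => //.
- by move=> j; apply: (@measurable_radial (fun z => `|z| ^+ 2 * (sn z)^-1 ^+ m.+1 * theta j (lg z))); apply: measurable_funM => //; exact: measurable_theta.
- by move=> j x _; rewrite lee_fin mulr_ge0 ?theta_ge0// mulr_ge0// inv_sn_ge0.
- move=> x _; apply: cvg_EFin; first by near=> j.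
  by rewrite -[X in _ --> X]mulr1; apply: cvgMr; exact: cvg_theta.
- move=> j.
  have E := @cutoff_integral _ _ _ sPhi (theta j) (dtheta j) j.+1%:R (fun y _ => der_theta j y)
    (fun y _ => @dtheta_continuous _ j y) (@theta_eq0 _ j) (@dtheta_eq0 _ j) m 0.
  apply: (@le_trans _ _ (\int[sigma]_(x in S) (cutoff (theta j) (fun z => 1%:R * `|z| ^+ 0 * sn z ^+ 2) m (t x))%:E)%E).
    rewrite E; apply: ge0_le_integral => //.
    + by move=> x _; rewrite lee_fin mulr_ge0 ?theta_ge0// mulr_ge0// inv_sn_ge0.
    + by apply: (@measurable_radial (fun z => `|z| ^+ 2 * (sn z)^-1 ^+ m.+1 * theta j (lg z))); apply: measurable_funM => //; exact: measurable_theta.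
    + apply: (@measurable_radial (fun z => (n%:R - m.+1%:R) * cutoff (theta j) (fun z => `|z| ^+ 2) m z +
        cutoff (fun y => - dtheta j y) (fun z => `|z| ^+ 2) m z)).
      apply: measurable_funD; first apply: measurable_funM => //.
        by apply: measurable_cutoff; [exact: measurable_absX|exact: measurable_theta].
      apply: measurable_cutoff; first exact: measurable_absX.
      exact: measurable_dtheta.
    + move=> x sx; rewrite lee_fin /cutoff -mulrA -[leLHS]addr0 lerD//.
        rewrite ler_peMl//; last by rewrite -natrB ?ler1n ?subn_gt0// ltnW.
        by rewrite mulr_ge0// mulr_ge0 ?inv_sn_ge0// theta_ge0.
      by rewrite mulr_ge0// mulr_ge0 ?inv_sn_ge0// oppr_ge0 dtheta_le0.
  apply: ge0_le_integral => //.
  + by move=> x _; rewrite lee_fin /cutoff expr0 !mul1r; apply: mulr_ge0; [exact: sqr_ge0|exact: mulr_ge0 (inv_sn_ge0 _ _) (theta_ge0 _ _)].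
  + apply: measurable_radial; apply: measurable_cutoff; last exact: measurable_theta.
    exact: (measurable_absX_sn 0).
  + apply: (@measurable_radial (fun z => sn z ^+ 2 * (sn z)^-1 ^+ m.+1)).
    by apply: measurable_funM; [apply: measurable_funX; exact: measurable_sn|exact: measurable_inv_sn].
  + move=> x sx; rewrite lee_fin /cutoff expr0 !mul1r mulrA ler_piMr//.
      by rewrite mulr_ge0 ?sqr_ge0 ?inv_sn_ge0.
    by rewrite theta_le1// (le_trans ler01)// lg_ge1.
- exact: cvg_cst.
Unshelve. all: by end_near. Qed.

Let split_power (z : R) m : z ^+ 2 <= 1 ->
  (sn z)^-1 ^+ m = `|z| ^+ 2 * (sn z)^-1 ^+ m + sn z ^+ 2 * (sn z)^-1 ^+ m.
Proof. by move=> z1; rewrite -mulrDl real_normK ?num_real// sn_sqr// addrC subrK mul1r. Qed.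

(** Writing 1 = t^2 + s^2, [step] bounds the t^2-part by the s^2-part, in which the exponent of 1/s
    is lower by 2. *)
Lemma inv_sn_integral_lty m : (m < n)%N ->
  (\int[sigma]_(x in S) ((sn (t x))^-1 ^+ m)%:E < +oo)%E.
Proof.
have h0 : (\int[sigma]_(x in S) 1%:E < +oo)%E.
  by rewrite integral_cst// mul1e surface_measure_sphere_lty.
have red k : (k.+1 < n)%N -> (\int[sigma]_(x in S) (sn (t x) ^+ 2 * (sn (t x))^-1 ^+ k.+1)%:E < +oo)%E ->
    (\int[sigma]_(x in S) ((sn (t x))^-1 ^+ k.+1)%:E < +oo)%E.
  move=> kn h.
  rewrite (eq_integral (fun x => (`|t x| ^+ 2 * (sn (t x))^-1 ^+ k.+1)%:E +
    (sn (t x) ^+ 2 * (sn (t x))^-1 ^+ k.+1)%:E)%E); last first.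
    by move=> x /set_mem sx; rewrite -EFinD -split_power// dotv_Phi_sqr_le1.
  rewrite ge0_integralD//.
  - by rewrite lte_add_pinfty//; apply: le_lt_trans (step kn) _.
  - by move=> x _; rewrite lee_fin mulr_ge0// inv_sn_ge0.
  - apply: (@measurable_radial (fun z => `|z| ^+ 2 * (sn z)^-1 ^+ k.+1)).
    by apply: measurable_funM; [exact: measurable_absX|exact: measurable_inv_sn].
  - by move=> x _; rewrite lee_fin mulr_ge0 ?sqr_ge0 ?inv_sn_ge0.
  - apply: (@measurable_radial (fun z => sn z ^+ 2 * (sn z)^-1 ^+ k.+1)).
    by apply: measurable_funM; [apply: measurable_funX; exact: measurable_sn|exact: measurable_inv_sn].
have mono k j : (forall z : R, sn z ^+ 2 * (sn z)^-1 ^+ k <= (sn z)^-1 ^+ j) ->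
    (\int[sigma]_(x in S) ((sn (t x))^-1 ^+ j)%:E < +oo)%E ->
    (\int[sigma]_(x in S) (sn (t x) ^+ 2 * (sn (t x))^-1 ^+ k)%:E < +oo)%E.
  move=> le; apply: le_lt_trans; apply: ge0_le_integral => //.
  - by move=> x _; rewrite lee_fin mulr_ge0 ?sqr_ge0 ?inv_sn_ge0.
  - apply: (@measurable_radial (fun z => sn z ^+ 2 * (sn z)^-1 ^+ k)).
    by apply: measurable_funM; [apply: measurable_funX; exact: measurable_sn|exact: measurable_inv_sn].
  - exact: (measurable_radial (measurable_inv_sn j)).
  - by move=> x _; rewrite lee_fin.
(* Exponents drop by 2, so the induction carries two consecutive ones; for exponent 1 the reduced
   integrand s^2/s = s is bounded. *)
suff H : ((m < n)%N -> (\int[sigma]_(x in S) ((sn (t x))^-1 ^+ m)%:E < +oo)%E) /\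
    ((m.+1 < n)%N -> (\int[sigma]_(x in S) ((sn (t x))^-1 ^+ m.+1)%:E < +oo)%E) by case: H.
elim: m => [|m [IH1 IH2]].
  split=> // n1; apply: red => //; apply: (mono 1%N 0%N) => // z.
  have [->|s0] := eqVneq (sn z) 0; first by rewrite invr0 mulr0.
  by rewrite expr2 expr1 -mulrA mulfV// mulr1 expr0 sn_le1.
split=> // mn; apply: red => //; apply: (mono m.+2 m) => [z|]; last by apply: IH1; do 2 apply: ltnW.
have [->|s0] := eqVneq (sn z) 0; first by rewrite expr0n mul0r invr0 expr0n ler0n.
by rewrite -[m.+2]addn2 exprD mulrCA -exprMn mulfV// expr1n mulr1.
Qed.

End inverse_powers.

Section power_cutoff.
Context {R : realType}.
Implicit Types c y : R.

Definition powcut c j y : R := y `^ c * theta j y.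
Definition dpowcut c j y : R := c * y `^ (c - 1) * theta j y + y `^ c * dtheta j y.

Lemma der_powcut c j y : 0 < y -> is_derive y (1 : R) (powcut c j) (dpowcut c j y).
Proof. by move=> y0; exact: der_eq (derM (is_derive1_powR c y0) (der_theta j y)) _. Qed.

Lemma dpowcut_continuous c j y : 0 < y -> {for y, continuous (dpowcut c j)}.
Proof.
move=> y0; have cp e : {for y, continuous (fun y => y `^ e)}.
  exact: der_continuous (is_derive1_powR e y0).
apply: catD; apply: catM; last exact: dtheta_continuous.
- by apply: catM; [exact: cat_cst|exact: cp].
- exact: der_continuous (der_theta j y).
- exact: cp.
Qed.

Lemma powcut_eq0 c j y : j.+1%:R <= y -> powcut c j y = 0.
Proof. by move=> jy; rewrite /powcut theta_eq0// mulr0. Qed.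

Lemma dpowcut_eq0 c j y : j.+1%:R <= y -> dpowcut c j y = 0.
Proof. by move=> jy; rewrite /dpowcut theta_eq0// dtheta_eq0// !mulr0 addr0. Qed.

Lemma powR_pred c y : 0 < y -> y `^ c / y = y `^ (c - 1).
Proof. move=> y0; have yn : y != 0 by rewrite gt_eqF.
by rewrite powRD ?yn ?implybT// powR_inv1// ltW. Qed.

Lemma powcut_ge0 c j y : 0 <= powcut c j y.
Proof. by rewrite mulr_ge0 ?powR_ge0 ?theta_ge0. Qed.

Lemma powcut_le c j y : 0 <= y -> powcut c j y <= y `^ c.
Proof. by move=> y0; rewrite ler_piMr ?powR_ge0 ?theta_le1. Qed.

Lemma cvg_powcut c y : powcut c ^~ y @ \oo --> y `^ c.
Proof. by rewrite -[X in _ --> X]mulr1; apply: cvgMr; exact: cvg_theta. Qed.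

Lemma powdtheta_le c j y : 0 < y -> y `^ c * - dtheta j y <= 2 * y `^ (c - 1).
Proof.
move=> y0; rewrite -powR_pred// mulrCA ler_wpM2l ?powR_ge0//.
exact: dtheta_geV.
Qed.

Lemma norm_dpowcut_le c j y : 0 < y -> `|dpowcut c j y| <= (`|c| + 2) * y `^ (c - 1).
Proof.
move=> y0; rewrite (le_trans (ler_normD _ _))// mulrDl lerD//.
  rewrite 2!normrM (ger0_norm (powR_ge0 _ _)) [`|theta _ _|]ger0_norm ?theta_ge0//.
  by apply: ler_piMr; [rewrite mulr_ge0// powR_ge0|exact: theta_le1 (ltW y0)].
by rewrite normrM (ger0_norm (powR_ge0 _ _)) [`|dtheta _ _|]ler0_norm ?dtheta_le0// powdtheta_le.
Qed.

Lemma cvg_dpowcut c y : 0 < y -> dpowcut c ^~ y @ \oo --> c * y `^ (c - 1).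
Proof.
move=> y0; rewrite -[X in _ --> X]addr0 -(mulr0 (y `^ c)) -[c * _]mulr1.
by apply: cvgD; apply: cvgMr; [exact: cvg_theta|apply: cvg_dtheta; exact: ltW].
Qed.

Lemma powR_lg_le1 c (z : R) : c <= 0 -> lg z `^ c <= 1.
Proof. by move=> c0; rewrite -[leRHS](powRr0 (lg z)) ler_powR// lg_ge1. Qed.

Lemma measurable_powR_lg c : measurable_fun setT (fun z : R => lg z `^ c).
Proof. exact: (measurableT_comp (measurable_powR c) measurable_lg). Qed.

End power_cutoff.

(** * Integrals of powers of the logarithm *)

Section log_integrals.
Context {R : realType}.
Variables (p : nat) (Phi : 'rV[R]_p.+3).
Hypothesis sPhi : sphere p.+2 Phi.
Local Notation n := p.+2.
Local Notation t x := (dotv x Phi).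
Local Notation sigma := (@surface_measure R n).
Local Notation S := (sphere n).
Let mS := @measurable_sphere R n.
Variables (b : R) (k : nat).
Hypothesis b0 : 0 < b.

(** F and G are what [cutoff_integral] with m + 1 = n relates for chi(y) = y^(-b): the derivative
    -chi' is b y^(-b-1), so the integrals of G and b F agree up to the cut-off. *)
Let F (z : R) : R := `|z| ^+ k.+2 * ((sn z)^-1 ^+ n * lg z `^ (- b - 1)).
Let G (z : R) : R := k.+1%:R * `|z| ^+ k * sn z ^+ 2 * ((sn z)^-1 ^+ n * lg z `^ (- b)).

Let lg_gt0 (z : R) : 0 < lg z. Proof. exact: lt_le_trans ltr01 (lg_ge1 z). Qed.

Let F0 z : 0 <= F z. Proof. by rewrite mulr_ge0// mulr_ge0 ?inv_sn_ge0 ?powR_ge0. Qed.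

Let G0 j z : 0 <= G z * theta j (lg z).
Proof.
apply: mulr_ge0; last exact: theta_ge0.
apply: mulr_ge0; first by apply: mulr_ge0; [exact: mulr_ge0|exact: sqr_ge0].
by apply: mulr_ge0; [exact: inv_sn_ge0|exact: powR_ge0].
Qed.

Let mF : measurable_fun setT F.
Proof.
apply: measurable_funM; first exact: measurable_absX.
by apply: measurable_funM; [exact: measurable_inv_sn|exact: measurable_powR_lg].
Qed.

(** The error made by the cut-off: nonnegative, at most 2 F for every j, and tending to 0. *)
Let E j z := cutoff (fun y => y `^ (- b) * - dtheta j y) (fun z => `|z| ^+ k.+2) p.+1 z.

Let E_le j z : E j z <= 2 * F z.
Proof.
rewrite /E /cutoff /F [2 * _]mulrCA; apply: ler_wpM2l; first by rewrite exprn_ge0.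
rewrite [2 * _]mulrCA; apply: ler_wpM2l; first exact: inv_sn_ge0.
exact: powdtheta_le.
Qed.

Let mE j : measurable_fun setT (E j).
Proof.
apply: measurable_cutoff; first exact: measurable_absX.
by apply: measurable_funM; [exact: measurable_powR_lg|exact: measurable_dtheta].
Qed.

Let E0 j z : 0 <= E j z.
Proof.
rewrite mulr_ge0// mulr_ge0 ?inv_sn_ge0//.
by rewrite mulr_ge0 ?powR_ge0// oppr_ge0 dtheta_le0.
Qed.

Let mFt j : measurable_fun setT (fun z => F z * theta j (lg z)).
Proof. by apply: measurable_funM => //; exact: measurable_theta. Qed.

Let mGt j : measurable_fun setT (fun z => G z * theta j (lg z)).
Proof.
apply: measurable_funM; last exact: measurable_theta.
apply: measurable_funM; first exact: measurable_absX_sn.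
by apply: measurable_funM; [exact: measurable_inv_sn|exact: measurable_powR_lg].
Qed.

Let identity j : (\int[sigma]_(x in S) (G (t x) * theta j (lg (t x)))%:E =
  b%:E * \int[sigma]_(x in S) (F (t x) * theta j (lg (t x)))%:E +
  \int[sigma]_(x in S) (E j (t x))%:E)%E.
Proof.
have mr f (mf : measurable_fun setT f) := measurable_radial (n := n) Phi mf.
rewrite -ge0_integralZl//; last 3 first.
- exact: (mr _ (mFt j)).
- by move=> x _; rewrite lee_fin mulr_ge0 ?theta_ge0.
- by rewrite lee_fin ltW.
rewrite -ge0_integralD//; last 4 first.
- by move=> x _; rewrite mule_ge0// lee_fin ?(ltW b0)// mulr_ge0 ?theta_ge0.
- by apply: measurable_funeM; exact: (mr _ (mFt j)).
- by move=> x _; rewrite lee_fin.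
- exact: (mr _ (mE j)).
have := @cutoff_integral _ _ _ sPhi (powcut (- b) j) (dpowcut (- b) j) j.+1%:R (fun y => @der_powcut _ _ j y)
    (fun y => @dpowcut_continuous _ _ j y) (@powcut_eq0 _ _ j) (@dpowcut_eq0 _ _ j) p.+1 k.
rewrite subrr => H.
transitivity (\int[sigma]_(x in S) (cutoff (powcut (- b) j) (fun z => k.+1%:R * `|z| ^+ k * sn z ^+ 2) p.+1 (t x))%:E)%E.
  by apply: eq_integral => x _; rewrite /cutoff /G /powcut; congr EFin; ring.
rewrite H; apply: eq_integral => x _; rewrite -EFinM -EFinD.
by rewrite /cutoff /F /E /cutoff /dpowcut; congr EFin; ring.
Qed.

(** In [identity] the error is nonnegative, so b times the cut-off integral of F is at most that of
    G, and G <= (k+1) s^(-p) with p < n. Fatou's lemma removes the cut-off. *)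
Lemma log_integral_lty : (\int[sigma]_(x in S) (F (t x))%:E < +oo)%E.
Proof.
have C := inv_sn_integral_lty sPhi (ltnW (ltnSn p.+1)).
pose I := (\int[sigma]_(x in S) (k.+1%:R * (sn (t x))^-1 ^+ p)%:E)%E.
have Ioo : (I < +oo)%E.
  rewrite /I; under eq_integral do rewrite EFinM.
  rewrite ge0_integralZl//; first by rewrite lte_mul_pinfty// lee_fin.
  - exact: (measurable_radial _ (measurable_inv_sn p)).
  - by move=> x _; rewrite lee_fin inv_sn_ge0.
have : (b%:E * \int[sigma]_(x in S) (F (t x))%:E <= I)%E.
  rewrite -ge0_integralZl//; last 3 first.
  - exact: (measurable_radial _ mF).
  - by move=> x _; rewrite lee_fin.
  - by rewrite lee_fin ltW.
  apply: (@fatou_cvg _ _ _ _ _ (fun j x => b%:E * (F (t x) * theta j (lg (t x)))%:E)%E _ (fun=> I)) => //.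
  - by move=> j; apply: measurable_funeM; exact: (measurable_radial _ (mFt j)).
  - by move=> j x _; rewrite mule_ge0// lee_fin ?(ltW b0)// mulr_ge0 ?theta_ge0.
  - move=> x _; apply: cvgeZl => //; apply: cvg_EFin; first by near=> j.
    by rewrite -[X in _ --> X]mulr1; apply: cvgMr; exact: cvg_theta.
  - move=> j; rewrite ge0_integralZl//; last 3 first.
    + exact: (measurable_radial _ (mFt j)).
    + by move=> x _; rewrite lee_fin mulr_ge0 ?theta_ge0.
    + by rewrite lee_fin ltW.
    apply: (@le_trans _ _ (\int[sigma]_(x in S) (G (t x) * theta j (lg (t x)))%:E)%E).
      rewrite identity leeDl//; apply: integral_ge0 => x _.
      by rewrite lee_fin.
    apply: ge0_le_integral => //.
    + by move=> x _; rewrite lee_fin.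
    + exact: (measurable_radial _ (mGt j)).
    + apply: (@measurable_radial _ _ _ (fun z => k.+1%:R * (sn z)^-1 ^+ p)).
      by apply: measurable_funM => //; exact: measurable_inv_sn.
    + move=> x sx; rewrite lee_fin /G; set z := t x.
      have z1 : `|z| <= 1 by exact: dotv_Phi_le1.
      apply: (@le_trans _ _ (k.+1%:R * (sn z ^+ 2 * (sn z)^-1 ^+ n))); last first.
        rewrite ler_wpM2l//; have [->|s0] := eqVneq (sn z) 0.
          by rewrite expr0n mul0r exprn_ge0// invr_ge0.
        by rewrite -[n]addn2 exprD mulrCA -exprMn mulfV// expr1n mulr1.
      rewrite (_ : _ * theta j _ = k.+1%:R * (`|z| ^+ k * (sn z ^+ 2 * ((sn z)^-1 ^+ n * (lg z `^ (- b) * theta j (lg z)))))); last by ring.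
      rewrite ler_wpM2l// -[leRHS]mul1r ler_pM ?exprn_ge0 ?exprn_ile1//.
        apply: mulr_ge0; first exact: sqr_ge0.
        by apply: mulr_ge0; [exact: inv_sn_ge0|exact: mulr_ge0 (powR_ge0 _ _) (theta_ge0 _ _)].
      rewrite ler_wpM2l ?sqr_ge0// ler_piMr ?inv_sn_ge0// mulr_ile1 ?powR_ge0 ?theta_ge0//.
        by rewrite powR_lg_le1// oppr_le0 ltW.
      by rewrite theta_le1// ltW.
  - exact: cvg_cst.
move=> bF; rewrite -(@lte_pmul2l _ b%:E)// ?lte_fin//.
by rewrite gt0_muley ?lte_fin//; exact: le_lt_trans bF Ioo.
Unshelve. all: by end_near. Qed.

(** Once F is known to be integrable, 2 F dominates the errors in [identity], whose integrals
    therefore tend to 0. *)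
Lemma log_integral_le : (\int[sigma]_(x in S) (G (t x))%:E <=
  b%:E * \int[sigma]_(x in S) (F (t x))%:E)%E.
Proof.
have iF : sigma.-integrable S (fun x => (2 * F (t x))%:E).
  under eq_fun do rewrite EFinM.
  apply: integrableZl => //; apply/integrableP; split; first exact: (measurable_radial _ mF).
  apply: le_lt_trans log_integral_lty; apply: ge0_le_integral => //.
  - by apply: measurableT_comp => //; exact: (measurable_radial _ mF).
  - exact: (measurable_radial _ mF).
  - by move=> x _; rewrite /= lee_fin ger0_norm.
have cE : (fun j => \int[sigma]_(x in S) (E j (t x))%:E)%E @ \oo --> 0%E.
  have := @dominated_convergence _ _ _ sigma S mS (fun j x => (E j (t x))%:E) (cst 0%E)
    _ (fun j => measurable_radial _ (mE j)) (measurable_cst _) _ iF.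
  rewrite integral0 => -[]//.
  - apply: aeW => x _ /=; apply: cvg_EFin; first by near=> j.
    rewrite -(mulr0 (`|t x| ^+ k.+2)); apply: cvgMr.
    rewrite -(mulr0 ((sn (t x))^-1 ^+ n)); apply: cvgMr.
    rewrite -(mulr0 (lg (t x) `^ (- b))) -oppr0; apply: cvgMr; apply: cvgN.
    exact: cvg_dtheta (ltW _).
  - by apply: aeW => x j _; rewrite /= lee_fin ger0_norm// E_le.
rewrite -[leRHS]adde0.
apply: (@fatou_cvg _ _ _ _ _ (fun j x => (G (t x) * theta j (lg (t x)))%:E) _
  (fun j => b%:E * \int[sigma]_(x in S) (F (t x))%:E + \int[sigma]_(x in S) (E j (t x))%:E)%E) => //.
- by move=> j; exact: (measurable_radial _ (mGt j)).
- by move=> j x _; rewrite lee_fin.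
- move=> x _; apply: cvg_EFin; first by near=> j.
  by rewrite -[X in _ --> X]mulr1; apply: cvgMr; exact: cvg_theta.
- move=> j; rewrite identity leeD2r// lee_wpmul2l ?lee_fin ?(ltW b0)//.
  apply: ge0_le_integral => //.
  + by move=> x _; rewrite lee_fin mulr_ge0 ?theta_ge0.
  + exact: (measurable_radial _ (mFt j)).
  + exact: (measurable_radial _ mF).
  + by move=> x _; rewrite lee_fin ler_piMr// theta_le1// ltW.
- apply: cvgeD _ (cvg_cst _) cE; exact: fin_num_adde_defl.
Unshelve. all: by end_near. Qed.

End log_integrals.

(** * The weak gradient of a power of the logarithm *)

Section logarithmic_power.
Context {R : realType}.
Variables (p : nat) (Phi : 'rV[R]_p.+3) (beta : R).
Hypotheses (sPhi : sphere p.+2 Phi) (beta_gt0 : 0 < beta) (beta_le1 : beta <= 1).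
Local Notation n := p.+2.
Local Notation t x := (dotv x Phi).
Local Notation sigma := (@surface_measure R n).
Local Notation S := (sphere n).
Let mS := @measurable_sphere R n.

(* The factor sn z * (sn z)^-1 only changes the values at the poles, to 0. *)
Definition lgpow (z : R) : R := sn z * (sn z)^-1 * lg z `^ beta.
Definition slope (z : R) : R := beta * lg z `^ (beta - 1) * z * (sn z)^-1 ^+ 2.
Definition lgpow_grad x : 'rV[R]_p.+3 := slope (t x) *: meridian Phi x.

Let lg_gt0 (z : R) : 0 < lg z. Proof. exact: lt_le_trans ltr01 (lg_ge1 z). Qed.

Lemma lg_le (z : R) : sn z != 0 -> lg z <= (sn z)^-1.
Proof.
move=> s0; have sp : 0 < sn z by rewrite lt_neqAle eq_sym s0 sn_ge0.
have i0 : 0 < (sn z)^-1 by rewrite invr_gt0.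
have : ln (1 + ((sn z)^-1 - 1)) <= (sn z)^-1 - 1 by apply: le_ln1Dx; lra.
rewrite addrC subrK lnV ?posrE// /lg; lra.
Qed.

Lemma lgpow_ge0 z : 0 <= lgpow z.
Proof. by rewrite mulr_ge0 ?powR_ge0// mulr_ge0 ?invr_ge0 ?sn_ge0. Qed.

Lemma lgpow_le z : lgpow z <= (sn z)^-1.
Proof.
rewrite /lgpow; have [->|s0] := eqVneq (sn z) 0; first by rewrite invr0 mulr0 mul0r.
rewrite mulfV// mul1r; apply: le_trans (lg_le s0).
by rewrite ler1_powR// lg_ge1.
Qed.

Lemma measurable_lgpow : measurable_fun setT lgpow.
Proof.
apply: measurable_funM; last exact: measurable_powR_lg.
by apply: measurable_funM; [exact: measurable_sn|exact: (measurable_inv_sn 1)].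
Qed.

Lemma measurable_slope : measurable_fun setT slope.
Proof.
apply: measurable_funM; last exact: measurable_inv_sn.
apply: measurable_funM => //; apply: measurable_funM => //; exact: measurable_powR_lg.
Qed.

Let integrable_inv_sn : sigma.-integrable S (fun x => ((sn (t x))^-1)%:E).
Proof.
apply/integrableP; split; first exact: (measurable_radial _ (measurable_inv_sn 1)).
apply: le_lt_trans (@inv_sn_integral_lty _ n _ sPhi 1 isT); apply: ge0_le_integral => //.
- by apply: measurableT_comp => //; exact: (measurable_radial _ (measurable_inv_sn 1)).
- exact: (measurable_radial _ (measurable_inv_sn 1)).
- by move=> x _; rewrite /= lee_fin ger0_norm// invr_ge0 sn_ge0.
Qed.

Let dominated (f_ : nat -> 'rV[R]_p.+3 -> R) (f : 'rV[R]_p.+3 -> R) (C : R) :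
  (forall j, measurable_fun S (f_ j)) -> measurable_fun S f ->
  (forall x, S x -> f_ ^~ x @ \oo --> f x) ->
  (forall j x, S x -> `|f_ j x| <= C * (sn (t x))^-1) ->
  (fun j => \int[sigma]_(x in S) (f_ j x)%:E)%E @ \oo --> (\int[sigma]_(x in S) (f x)%:E)%E.
Proof.
move=> mf_ mf ff fC.
have iC : sigma.-integrable S (fun x => (C * (sn (t x))^-1)%:E).
  by under eq_fun do rewrite EFinM; exact: integrableZl.
have [||_ _ //] := @dominated_convergence _ _ _ sigma S mS (fun j x => (f_ j x)%:E)
  (fun x => (f x)%:E) _ (fun j => (measurable_EFinP _ _).2 (mf_ j)) ((measurable_EFinP _ _).2 mf) _ iC.
- by apply: aeW => x sx; apply: cvg_EFin; [near=> j|exact: ff].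
- by apply: aeW => x j sx; rewrite /= lee_fin fC.
Unshelve. all: by end_near. Qed.

Let sq (z : R) : R := 1 - z ^+ 2.
Let dsq (z : R) : R := - (2 * z).
Let dsqE z : is_derive z (1 : R) sq (dsq z).
Proof.
apply: (der_eq (derB (der_cst z (1 : R)) (derX 2 (der_id z)))).
by rewrite /dsq; ring.
Qed.
Let cdsq z : {for z, continuous dsq}.
Proof. by apply: catN; apply: catM; [exact: cat_cst|exact: cvg_id]. Qed.

(** A [cutoff] always carries a negative power of sn; with m = 1 it is cancelled on the sphere by
    [sq] = sn^2, so that h j is [lgpow] times [theta j] of the logarithm, as a C^1 function of t. *)
Let h j := cutoff (powcut beta j) sq 1.
Let dh j := dcutoff (powcut beta j) (dpowcut beta j) sq dsq 1.

Let hE j x : S x -> h j (t x) = sn (t x) * (sn (t x))^-1 * powcut beta j (lg (t x)).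
Proof.
move=> sx; rewrite /h /cutoff /sq -sn_sqr ?dotv_Phi_sqr_le1//.
have [->|s0] := eqVneq (sn (t x)) 0; first by rewrite invr0 !expr0n !mul0r.
by field.
Qed.

Let dhE j x : S x -> dh j (t x) = t x * (sn (t x))^-1 ^+ 2 * dpowcut beta j (lg (t x)).
Proof.
move=> sx; rewrite /dh /dcutoff /cutoff /sq /dsq -sn_sqr ?dotv_Phi_sqr_le1//.
have [->|s0] := eqVneq (sn (t x)) 0; first by rewrite invr0 !expr0n/= !(mul0r, mulr0, addr0).
by field.
Qed.

Let norm_meridian x v : S x -> dotv v x = 0 -> `|dotv v Phi| <= enorm v * sn (t x).
Proof.
move=> sx vx; rewrite -(dotv_meridian Phi vx) (le_trans (dotv_cauchy _ _))// ler_wpM2l ?enorm_ge0//.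
by rewrite le_eqVlt -(ger0_norm (enorm_ge0 _)) -sqrtr_sqr enorm_meridian// eqxx.
Qed.

Let sn_inv2 (z : R) : sn z * (sn z)^-1 ^+ 2 = (sn z)^-1.
Proof.
have [->|s0] := eqVneq (sn z) 0; first by rewrite invr0 mul0r.
by field.
Qed.

Let abs_t x : S x -> `|t x| <= 1. Proof. exact: dotv_Phi_le1. Qed.

Let measurable_radialR (f : R -> R) : measurable_fun setT f -> measurable_fun S (fun x => f (t x)).
Proof. by move=> mf; apply/measurable_EFinP; exact: measurable_radial. Qed.

(** The formula holds for the C^1 functions h j and passes to the limit: both integrands are bounded
    by a multiple of 1/s independently of j, because the radial derivative of order s^(-2) is paired
    with |V . Phi| <= |V| s. The function 1/s is integrable since n >= 2. *)
Lemma lgpow_gradE (V : 'rV[R]_p.+3 -> 'rV[R]_p.+3) : smooth_tangent_field V ->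
  (\int[sigma]_(x in S) (dotv (lgpow_grad x) (V x))%:E =
   - \int[sigma]_(x in S) (lgpow (t x) * surface_div V x)%:E)%E.
Proof.
move=> sVt; have [sV tV] := sVt.
have cdiv : sphere_continuous (surface_div V).
  by apply: surface_div_continuous => i; exact/C1_near_C1/smooth_C1.
have cdot w : sphere_continuous (fun x => dotv (V x) w).
  move=> x sx; apply: cat_sum => i; apply: catM; last exact: cat_cst.
  by apply: differentiable_continuous; exact: smooth_differentiable.
have cV : sphere_continuous (fun x => enorm (V x)).
  move=> x sx; apply: (@continuous_comp _ _ _ (fun x => dotv (V x) (V x)) (@Num.sqrt R)); last exact: sqrt_continuous.
  by apply: cat_sum => i; apply: catM; apply: differentiable_continuous; exact: smooth_differentiable.
have [Md hMd] := sphere_continuous_bounded cdiv.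
have [Mv hMv] := sphere_continuous_bounded cV.
have mdiv := sphere_continuous_measurable cdiv.
have mdot := sphere_continuous_measurable (cdot Phi).
have Md0 : 0 <= Md := le_trans (normr_ge0 _) (hMd _ sPhi).
have Mv0 : 0 <= Mv := le_trans (normr_ge0 _) (hMv _ sPhi).
pose C := beta + 2; have C0 : 0 <= C by rewrite addr_ge0// ltW.
have c1 : (fun j => \int[sigma]_(x in S) (h j (t x) * surface_div V x)%:E)%E @ \oo -->
    (\int[sigma]_(x in S) (lgpow (t x) * surface_div V x)%:E)%E.
  apply: (@dominated _ _ Md).
  - move=> j; apply: measurable_funM => //; apply: (@measurable_radialR (h j)).
    apply: continuous_measurable_fun => z.
    apply (@cutoff_continuous R (powcut beta j) sq j.+1%:R 1) => //.
      by move=> y y0; exact: der_continuous (der_powcut beta j y0).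
      exact: powcut_eq0.
    by move=> w; exact: der_continuous (dsqE w).
  - apply: measurable_funM => //; apply: measurable_radialR; exact: measurable_lgpow.
  - move=> x sx; apply: cvgMl; rewrite (_ : (fun j => _) = fun j => sn (t x) * (sn (t x))^-1 * powcut beta j (lg (t x))); last first.
      by apply/funext => j; rewrite hE.
    by apply: cvgMr; exact: cvg_powcut.
  - move=> j x sx; rewrite normrM mulrC; apply: ler_pM => //; first exact: hMd.
    rewrite hE// ger0_norm; last first.
      by rewrite mulr_ge0 ?powcut_ge0// mulr_ge0 ?invr_ge0 ?sn_ge0.
    apply: le_trans (lgpow_le _); rewrite /lgpow ler_wpM2l ?mulr_ge0 ?invr_ge0 ?sn_ge0//.
    by rewrite powcut_le// ltW.
have c2 : (fun j => \int[sigma]_(x in S) (dh j (t x) * dotv (V x) Phi)%:E)%E @ \oo -->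
    (\int[sigma]_(x in S) (dotv (lgpow_grad x) (V x))%:E)%E.
  rewrite (eq_integral (fun x => (slope (t x) * dotv (V x) Phi)%:E)); last first.
    by move=> x /set_mem sx; rewrite /lgpow_grad dotvZl [dotv (meridian _ _) _]dotvC dotv_meridian// tV.
  apply: (@dominated _ _ (C * Mv)).
  - move=> j; apply: measurable_funM => //; apply: (@measurable_radialR (dh j)).
    apply: continuous_measurable_fun => z.
    by apply (@dcutoff_continuous R (powcut beta j) (dpowcut beta j) j.+1%:R
      (fun y => @der_powcut _ beta j y) (fun y => @dpowcut_continuous _ beta j y)
      (@powcut_eq0 _ beta j) (@dpowcut_eq0 _ beta j) sq dsq 1 dsqE cdsq z).
  - by apply: measurable_funM => //; apply: measurable_radialR; exact: measurable_slope.
  - move=> x sx; apply: cvgMl; rewrite (_ : slope _ = t x * (sn (t x))^-1 ^+ 2 * (beta * lg (t x) `^ (beta - 1))); last first.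
      by rewrite /slope; ring.
    rewrite (_ : (fun j => _) = fun j => t x * (sn (t x))^-1 ^+ 2 * dpowcut beta j (lg (t x))); last first.
      by apply/funext => j; rewrite dhE.
    by apply: cvgMr; exact: cvg_dpowcut.
  - move=> j x sx; rewrite normrM.
    apply: (@le_trans _ _ ((C * (sn (t x))^-1 ^+ 2) * (Mv * sn (t x)))); last first.
      rewrite (_ : _ * (Mv * _) = C * Mv * (sn (t x) * (sn (t x))^-1 ^+ 2)); last by ring.
      by rewrite sn_inv2.
    apply: ler_pM => //; last first.
      apply: le_trans (norm_meridian sx (tV _ sx)) _; rewrite ler_wpM2r ?sn_ge0//.
      by apply: le_trans (hMv _ sx); exact: ler_norm.
    rewrite dhE// 2!normrM mulrC ler_pM ?mulr_ge0//.
      apply: (le_trans (norm_dpowcut_le _ _ (lg_gt0 _))); rewrite gtr0_norm// ler_piMr//.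
      by rewrite powR_lg_le1// subr_le0.
    by rewrite [`|_ ^+ 2|]ger0_norm ?inv_sn_ge0// ler_piMl ?inv_sn_ge0 ?abs_t.
have c3 : (fun j => - \int[sigma]_(x in S) (h j (t x) * surface_div V x)%:E)%E @ \oo -->
    (- \int[sigma]_(x in S) (lgpow (t x) * surface_div V x)%:E)%E by exact: cvgeN.
apply: (cvg_eq_lim c2 c3) => j.
have r2 : 1 < 2 :> R by rewrite ltr1n.
have d1 z : `|z| < 2 -> is_derive z (1 : R) (h j) (dh j z).
  move=> _; exact: (cutoff_derive (fun y => @der_powcut _ beta j y) (@powcut_eq0 _ beta j)
    (@dpowcut_eq0 _ beta j) 1 dsqE).
have d2 z : `|z| < 2 -> {for z, continuous (dh j)}.
  by move=> _; apply (@dcutoff_continuous R (powcut beta j) (dpowcut beta j) j.+1%:R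
      (fun y => @der_powcut _ beta j y) (fun y => @dpowcut_continuous _ beta j y)
      (@powcut_eq0 _ beta j) (@dpowcut_eq0 _ beta j) sq dsq 1 dsqE cdsq z).
by have [_ _] := radial_weak_gradient sPhi r2 d1 d2 sVt.
Qed.

End logarithmic_power.

(** * Positivity of radial integrals *)

Section radial_positivity.
Context {R : realType}.
Variables (n : nat) (Phi : 'rV[R]_n.+1).
Hypotheses (n_gt0 : (0 < n)%N) (sPhi : sphere n Phi).
Local Notation t x := (dotv x Phi).
Local Notation sigma := (@surface_measure R n).
Local Notation S := (sphere n).
Let mS := @measurable_sphere R n.

(* Tested with h(z) = z - 2 z^3, the radial identity has a positive integrand
   on the set where t = 0 or t^2 = 1, so this set does not have full measure. *)
Lemma radial_integral_gt0 (f : 'rV[R]_n.+1 -> R) : measurable_fun S f ->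
  (forall x, S x -> 0 <= f x) ->
  (forall x, S x -> t x != 0 -> sn (t x) != 0 -> 0 < f x) ->
  (0 < \int[sigma]_(x in S) (f x)%:E)%E.
Proof.
move=> mf f0 fpos; rewrite lt_def integral_ge0 ?andbT//; apply/eqP => If.
have mfE : measurable_fun S (EFin \o f) by exact/measurable_EFinP.
have aef : {ae sigma, forall x, S x -> (f x)%:E = 0%E}.
  apply/(ae_eq_integral_abs sigma mS mfE); rewrite -[RHS]If.
  by apply: eq_integral => x /set_mem sx; rewrite /= ger0_norm ?f0.
pose h (z : R) := z - 2 * z ^+ 3; pose dh (z : R) := 1 - 6 * z ^+ 2.
have dhE z : is_derive z (1 : R) h (dh z).
  apply: (der_eq (derB (der_id z) (derM (der_cst z (2 : R)) (derX 3 (der_id z))))).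
  by rewrite /dh /=; ring.
have cdh z : {for z, continuous dh}.
  by apply: catD; [exact: cat_cst|apply: catN; apply: catM; [exact: cat_cst|apply: catX; exact: cvg_id]].
have ch z : {for z, continuous (fun z : R => dh z * (1 - z ^+ 2) - n%:R * z * h z)}.
  apply: catD.
    by apply: catM; [exact: cdh|apply: catD; [exact: cat_cst|apply: catN; apply: catX; exact: cvg_id]].
  apply: catN; apply: catM; last exact: der_continuous (dhE z).
  by apply: catM; [exact: cat_cst|exact: cvg_id].
have r2 : 1 < 2 :> R by rewrite ltr1n.
have := @radial_divergence _ _ _ sPhi h dh 2 r2 (fun z _ => dhE z) (fun z _ => cdh z).
have mt : measurable_fun setT (fun z : R => 1 + (n%:R - 1) * z ^+ 2).
  by apply: measurable_funD => //; apply: measurable_funM => //; exact: measurable_funX.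
(* If the integral of f were 0, almost every x would have t = 0 or t^2 = 1. At these values the
   integrand of the radial identity is 1 or n, as given by this polynomial, which is at least 1. *)
rewrite (@ae_eq_integral _ _ _ _ _ (fun x => (1 + (n%:R - 1) * t x ^+ 2)%:E))//.
- move=> I0; have := surface_measure_sphere_gt0 (R := R) n; rewrite ltNge => /negP; apply.
  rewrite -I0 -[X in (X <= _)%E]mul1e -(integral_cst sigma mS 1%E).
  apply: ge0_le_integral => //.
    exact: (measurable_radial _ mt).
  move=> x _; rewrite lee_fin lerDl mulr_ge0 ?sqr_ge0// subr_ge0 ler1n//.
- apply: (@measurable_radial _ _ _ (fun z => dh z * (1 - z ^+ 2) - n%:R * z * h z)).
  exact: continuous_measurable_fun.
- exact: (measurable_radial _ mt).
- apply: filterS aef => x fx sx; congr EFin; have {fx}[fx] := fx sx.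
  have [t0|t0] := eqVneq (t x) 0; first by rewrite /dh /h t0; ring.
  have [s0|s0] := eqVneq (sn (t x)) 0; last by have := fpos x sx t0 s0; rewrite fx ltxx.
  have : t x ^+ 2 = 1.
    have := sn_sqr (dotv_Phi_sqr_le1 sPhi sx); rewrite s0 expr0n/= => /eqP.
    by rewrite eq_sym subr_eq0 => /eqP.
  rewrite /dh /h => t2; rewrite (_ : _ - _ = (1 - 6 * t x ^+ 2) * (1 - t x ^+ 2) - n%:R * t x ^+ 2 * (1 - 2 * t x ^+ 2)); last by ring.
  by rewrite t2; ring.
Qed.

End radial_positivity.

(** * The functionals at the test function *)

Section test_function.
Context {R : realType}.
Variables (p : nat) (Phi : 'rV[R]_p.+3) (beta : R).
Local Notation n := p.+2.
Hypotheses (sPhi : sphere n Phi) (beta_gt0 : 0 < beta) (beta_lt : beta < gamma n).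
Local Notation t x := (dotv x Phi).
Local Notation sigma := (@surface_measure R n).
Local Notation S := (sphere n).
Let mS := @measurable_sphere R n.
(** Chosen so that (L^beta / L)^n = L^(-b-1); it is positive and tends to 0 as beta tends to
    gamma. *)
Let b : R := n%:R * (gamma n - beta).
Let u x := lgpow beta (t x).

Let b0 : 0 < b. Proof. by rewrite mulr_gt0// subr_gt0. Qed.

Let beta_le1 : beta <= 1.
Proof.
apply: le_trans (ltW beta_lt) _; rewrite gammaE ler_pdivrMr ?ltr0n// mul1r ler_nat.
exact: leqnSn.
Qed.

Let lg_gt0 (z : R) : 0 < lg z. Proof. exact: lt_le_trans ltr01 (lg_ge1 z). Qed.

Let lgE (z : R) : lg z `^ (beta - 1) ^+ n = lg z `^ (- b - 1).
Proof.
rewrite -powR_mulrn ?powR_ge0// -powRrM; congr (_ `^ _).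
have m0 : n%:R != 0 :> R by rewrite pnatr_eq0.
by rewrite /b /gamma; field.
Qed.

Let powE (z : R) : (lg z `^ beta) ^+ n * (lg z)^-1 ^+ n = lg z `^ (- b - 1).
Proof. by rewrite -lgE -exprMn powR_pred. Qed.

Let w (z : R) : R := (sn z)^-1 ^+ n * lg z `^ (- b - 1).

Let w_ge0 z : 0 <= w z. Proof. by rewrite mulr_ge0 ?inv_sn_ge0 ?powR_ge0. Qed.

Let mw : measurable_fun setT w.
Proof. by apply: measurable_funM; [exact: measurable_inv_sn|exact: measurable_powR_lg]. Qed.

Let mwI k : measurable_fun setT (fun z : R => `|z| ^+ k.+2 * w z).
Proof. by apply: measurable_funM; [exact: measurable_absX|exact: mw]. Qed.

Let UE (a z : R) : (a * `|lgpow beta z| * (sn z / reg 0 z)) ^+ n = a ^+ n * w z.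
Proof.
rewrite ger0_norm ?lgpow_ge0// /w /lgpow; have [->|s0] := eqVneq (sn z) 0.
  by rewrite invr0 !(mul0r, mulr0) !expr0n/= mul0r mulr0.
by rewrite sn_div_reg// mulfV// mul1r -powE invfM !exprMn; ring.
Qed.

Let tildeE k (z : R) : `|lgpow beta z| ^+ n * (`|z| ^+ k * sn z ^+ n * (reg 0 z)^-1 ^+ p.+1) =
  `|z| ^+ k * sn z ^+ 2 * ((sn z)^-1 ^+ n * lg z `^ (- b)).
Proof.
rewrite ger0_norm ?lgpow_ge0// /lgpow; have [->|s0] := eqVneq (sn z) 0.
  by rewrite invr0 !(mul0r, mulr0) !expr0n/= !(mul0r, mulr0).
have -> : lg z `^ (- b) = lg z * lg z `^ (- b - 1).
  by rewrite -powR_pred// mulrC divfK// gt_eqF.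
rewrite mulfV// mul1r -powE /reg addr0 invfM exprMn -exprVn -exprM.
have l0 : lg z != 0 by rewrite gt_eqF.
rewrite (_ : (2 * p.+1 = n + p)%N); last by ring.
have e1 : sn z ^+ n * (sn z)^-1 ^+ n = 1 by rewrite -exprMn mulfV// expr1n.
have e2 : sn z ^+ 2 * (sn z)^-1 ^+ n = (sn z)^-1 ^+ p.
  by rewrite (exprD _ 2 p) mulrA -exprMn mulfV// expr1n mul1r.
rewrite exprD [(lg z)^-1 ^+ n]exprS; move: e2; move: ((lg z)^-1 ^+ p.+1) ((sn z)^-1 ^+ p) => L s e2.
set B := _ ^+ n; transitivity (`|z| ^+ k * (sn z ^+ n * (sn z)^-1 ^+ n) * s * (B * L)).
  by ring.
rewrite e1 -e2; move: ((sn z)^-1 ^+ n) => I.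
by field.
Qed.

Let measurable_radialR (f : R -> R) : measurable_fun setT f -> measurable_fun setT (fun x => f (t x)).
Proof.
move=> mf; apply: (measurableT_comp mf).
by apply: continuous_measurable_rV; exact: continuous_dotvl.
Qed.

Let mu : measurable_fun setT u.
Proof. apply: measurable_radialR; exact: measurable_lgpow. Qed.

Let mslope : measurable_fun setT (fun x => slope beta (t x)).
Proof. apply: measurable_radialR; exact: measurable_slope. Qed.

Let abs_t x : S x -> `|t x| <= 1. Proof. exact: dotv_Phi_le1. Qed.

Let wI (k : nat) := (\int[sigma]_(x in S) (`|t x| ^+ k.+2 * w (t x))%:E)%E.

Let wI_lty k : (wI k < +oo)%E. Proof. exact: log_integral_lty. Qed.

Let UuE : functional_U Phi u = (\int[sigma]_(x in S) (w (t x))%:E)%E.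
Proof. by rewrite functional_UE//; apply: eq_integral => x _; rewrite UE expr1n mul1r. Qed.

Let VuE : functional_V Phi u = wI p.
Proof. by rewrite functional_VE//; apply: eq_integral => x _; rewrite UE. Qed.

Let wI_le k : (wI k <= functional_U Phi u)%E.
Proof.
rewrite UuE; apply: ge0_le_integral => //.
- by move=> x _; rewrite lee_fin mulr_ge0.
- exact: (measurable_radial _ (mwI k)).
- exact: measurable_radial.
- by move=> x sx; rewrite lee_fin ler_piMl// exprn_ile1// abs_t.
Qed.

(** [log_integral_lty] controls t^2 w; the rest (1 - t^2) w = s^2 w is at most s^(-p), which is
    integrable. *)
Lemma functional_U_lty : (functional_U Phi u < +oo)%E.
Proof.
rewrite UuE.
apply: (@le_lt_trans _ _ (\int[sigma]_(x in S) ((`|t x| ^+ 2 * w (t x))%:E + ((sn (t x))^-1 ^+ p)%:E)%E)%E).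
  apply: ge0_le_integral => //.
  - by move=> x _; rewrite lee_fin.
  - exact: measurable_radial.
  - apply: (@measurable_radial _ _ _ (fun z => `|z| ^+ 2 * w z + (sn z)^-1 ^+ p)).
    by apply: measurable_funD; [exact: mwI|exact: measurable_inv_sn].
  - move=> x sx; rewrite -EFinD lee_fin; set z := t x.
    rewrite -[leLHS](subrK (`|z| ^+ 2 * w z)) addrC lerD2l.
    rewrite (_ : w z - _ = sn z ^+ 2 * (sn z)^-1 ^+ n * lg z `^ (- b - 1)); last first.
      by rewrite /w real_normK ?num_real// sn_sqr ?dotv_Phi_sqr_le1//; ring.
    have [->|s0] := eqVneq (sn z) 0; first by rewrite expr0n !mul0r exprn_ge0// invr0.
    rewrite (exprD _ 2 p) mulrA -exprMn mulfV// expr1n mul1r ler_piMr ?inv_sn_ge0//.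
    by apply: powR_lg_le1; have := b0; lra.
rewrite ge0_integralD//.
- by rewrite lte_add_pinfty//; [exact: (wI_lty 0)|exact: inv_sn_integral_lty].
- by move=> x _; rewrite lee_fin mulr_ge0.
- exact: (measurable_radial _ (mwI 0)).
- by move=> x _; rewrite lee_fin inv_sn_ge0.
- exact: (measurable_radial _ (measurable_inv_sn p)).
Qed.

Lemma functional_Utilde_le : (functional_Utilde Phi u <= b%:E * functional_U Phi u)%E.
Proof.
apply: (@le_trans _ _ (b%:E * wI 0)%E); last first.
  by apply: lee_wpmul2l; [rewrite lee_fin ltW|exact: wI_le].
rewrite functional_UtildeE//; apply: le_trans (log_integral_le sPhi 0 b0).
rewrite le_eqVlt; apply/orP; left; apply/eqP; apply: eq_integral => x _.
by congr EFin; rewrite tildeE; ring.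
Qed.

Lemma functional_Vtilde_le :
  ((n%:R - 1)%:E * functional_Vtilde Phi u <= b%:E * functional_V Phi u)%E.
Proof.
rewrite VuE functional_VtildeE// (_ : n%:R - 1 = p.+1%:R :> R); last by rewrite -natr1 addrK.
apply: le_trans (log_integral_le sPhi p b0).
rewrite -ge0_integralZl//.
- rewrite le_eqVlt; apply/orP; left; apply/eqP; apply: eq_integral => x _.
  by rewrite -EFinM tildeE !mulrA.
- under eq_fun do rewrite tildeE.
  apply: (@measurable_radial _ _ _ (fun z => `|z| ^+ p * sn z ^+ 2 * ((sn z)^-1 ^+ n * lg z `^ (- b)))).
  apply: measurable_funM.
    apply: measurable_funM; first exact: measurable_absX.
    by apply: measurable_funX; exact: measurable_sn.
  by apply: measurable_funM; [exact: measurable_inv_sn|exact: measurable_powR_lg].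
- move=> x _; rewrite tildeE lee_fin; apply: mulr_ge0; first by apply: mulr_ge0; [exact: exprn_ge0|exact: sqr_ge0].
  by apply: mulr_ge0; [exact: inv_sn_ge0|exact: powR_ge0].
Qed.

Let gradE x : S x -> enorm (lgpow_grad Phi beta x) ^+ n = beta ^+ n * (`|t x| ^+ n * w (t x)).
Proof.
move=> sx; rewrite /lgpow_grad enormZ.
have -> : enorm (meridian Phi x) = sn (t x).
  by rewrite -[LHS]ger0_norm ?enorm_ge0// -sqrtr_sqr enorm_meridian.
rewrite /slope !normrM (gtr0_norm beta_gt0) (ger0_norm (powR_ge0 _ _)).
rewrite normfV (ger0_norm (sn_ge0 _)).
have -> : forall B L T s : R, B * L * T * (s^-1 * s^-1) * s = B * (T * (s^-1 * L)).
  move=> B L T s; have [->|s0] := eqVneq s 0; first by rewrite invr0 !(mul0r, mulr0).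
  by field.
by rewrite !exprMn lgE.
Qed.

Let grad_le x : S x -> enorm (lgpow_grad Phi beta x) <= (sn (t x))^-1.
Proof.
move=> sx; rewrite -(@ler_pXn2r _ n)// ?nnegrE ?enorm_ge0 ?invr_ge0 ?sn_ge0// gradE//.
rewrite -[leRHS]mul1r; apply: ler_pM.
- by rewrite exprn_ge0// ltW.
- by rewrite mulr_ge0.
- by rewrite exprn_ile1// ltW.
- rewrite -[leRHS]mul1r; apply: ler_pM => //; first by rewrite exprn_ile1// abs_t.
  by rewrite /w ler_piMr ?inv_sn_ge0//; apply: powR_lg_le1; have := b0; lra.
Qed.

Let mgradi i : measurable_fun setT (fun x => lgpow_grad Phi beta x ord0 i).
Proof.
rewrite (_ : (fun x => _) = fun x => slope beta (t x) * meridian Phi x ord0 i).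
  by apply: measurable_funM => //; apply: elem_measurable; exact: elem_meridian.
by apply/funext => x; rewrite mxE.
Qed.

Let mgrad : measurable_fun setT (fun x => enorm (lgpow_grad Phi beta x)).
Proof. exact: (measurableT_comp (@measurable_enorm R n.+1) (measurable_fun_rV mgradi)). Qed.

Let LfunP k (f : 'rV[R]_p.+3 -> R) (F : 'rV[R]_p.+3 -> R) : (0 < k)%N -> measurable_fun setT f ->
  measurable_fun S F -> (forall x, S x -> `|f x| ^+ k <= F x) ->
  (\int[sigma]_(x in S) (F x)%:E < +oo)%E -> f \in Lfun sigma k%:R%:E.
Proof.
move=> k0 mf mF fF Foo; apply/Lfun_natP => //; split=> //.
have mfk : measurable_fun setT (fun x => `|f x| ^+ k) by apply: measurable_funX; exact: measurableT_comp.
have f0 x : (0 <= (`|f x| ^+ k)%:E)%E by rewrite lee_fin exprn_ge0.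
rewrite (ge0_integral_sphere ((measurable_EFinP _ _).2 mfk) f0).
apply: le_lt_trans Foo; apply: ge0_le_integral => //.
- by move=> x _; exact: f0.
- by apply/measurable_EFinP; exact: measurable_funTS.
- exact/measurable_EFinP.
Qed.

Lemma lgpow_weak_gradient : weak_surface_gradient u (lgpow_grad Phi beta).
Proof.
split=> [x sx|i|V sV].
- by rewrite /lgpow_grad dotvZl meridian_tangent// mulr0.
- apply: (LfunP (k := 1) (F := fun x => (sn (t x))^-1 ^+ 1)) => //.
  + by apply: measurable_funTS; exact: (measurable_radialR (measurable_inv_sn 1)).
  + by move=> x sx; apply: le_trans (coord_le_enorm _ _) (grad_le sx).
  + exact: inv_sn_integral_lty.
- by rewrite /Rintegral lgpow_gradE// fineN.
Qed.

Let u_le x : `|u x| ^+ n <= w (t x).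
Proof.
rewrite ger0_norm ?lgpow_ge0// /u /lgpow /w; have [->|s0] := eqVneq (sn (t x)) 0.
  by rewrite invr0 !(mul0r, mulr0) !expr0n/= mul0r.
rewrite mulfV// mul1r -powE mulrCA ler_peMr ?exprn_ge0 ?powR_ge0// -exprMn exprn_ege1//.
have l0 := lg_gt0 (t x); rewrite ler_pdivlMr// mul1r; exact: lg_le.
Qed.

Let mwS : measurable_fun S (fun x => w (t x)).
Proof. by apply: measurable_funTS; exact: measurable_radialR. Qed.

Lemma lgpow_sobolev : sobolev u.
Proof.
split; last exists (lgpow_grad Phi beta); first 2 [exact: lgpow_weak_gradient].
- apply: (LfunP _ _ mwS) => //; by rewrite -UuE functional_U_lty.
- apply: (LfunP (F := fun x => `|t x| ^+ n * w (t x))) => //.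
  + by apply: measurable_funTS; apply: (measurable_radialR (mwI p)).
  + move=> x sx; rewrite ger0_norm ?enorm_ge0// gradE//; apply: ler_piMl; first exact: mulr_ge0.
    by rewrite exprn_ile1// ltW.
  + exact: wI_lty.
Qed.

Let ae_grad : {ae sigma, forall x, S x -> surface_grad u x = lgpow_grad Phi beta x}.
Proof.
have [un _] := lgpow_sobolev; have [_ ui _] := Lfun_sphere_integrable (ltn0Sn _) un.
exact: weak_gradient_unique ui (surface_gradP lgpow_sobolev) lgpow_weak_gradient.
Qed.

Let msgrad : measurable_fun setT (fun x => enorm (surface_grad u x)).
Proof.
have [_ P _] := surface_gradP lgpow_sobolev.
apply: (measurableT_comp (@measurable_enorm R n.+1)); apply: measurable_fun_rV => i.
by have [] := Lfun1_sphere_integrable (P i).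
Qed.

Let mtabs : measurable_fun setT (fun x => `|t x|).
Proof. by apply: (@measurable_radialR (fun z => `|z|)); exact: normr_measurable. Qed.

Lemma functional_H_lgpow : functional_H u = ((beta ^+ n)%:E * functional_V Phi u)%E.
Proof.
rewrite functional_HE VuE /wI -ge0_integralZl//; last 3 first.
- exact: (measurable_radial _ (mwI p)).
- by move=> x _; rewrite lee_fin mulr_ge0.
- by rewrite lee_fin exprn_ge0// ltW.
apply: ae_eq_integral => //.
- apply/measurable_EFinP; apply: measurable_funTS; apply: measurable_funX.
  by apply: measurable_funM => //; exact: msgrad.
- by apply: measurable_funeM; exact: (measurable_radial _ (mwI p)).
- by apply: filterS ae_grad => x gx sx; rewrite gx// mul1r gradE// EFinM.
Qed.

Let QE : functional_Q Phi u = (\int[sigma]_(x in S) (`|t x| ^+ n * (beta ^+ n * (`|t x| ^+ n * w (t x))))%:E)%E.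
Proof.
rewrite functional_QE//; apply: ae_eq_integral => //.
- apply/measurable_EFinP; apply: measurable_funTS; apply: measurable_funX.
  by apply: measurable_funM => //; exact: msgrad.
- apply: (@measurable_radial _ _ _ (fun z => `|z| ^+ n * (beta ^+ n * (`|z| ^+ n * w z)))).
  apply: measurable_funM; first exact: measurable_absX.
  by apply: measurable_funM => //; exact: mwI.
- by apply: filterS ae_grad => x gx sx; rewrite gx// exprMn gradE.
Qed.

Lemma functional_Q_lgpow_le : (functional_Q Phi u <= (beta ^+ n)%:E * functional_U Phi u)%E.
Proof.
apply: (@le_trans _ _ (functional_H u)); last first.
  by rewrite functional_H_lgpow VuE lee_wpmul2l// ?lee_fin ?exprn_ge0// ltW.
rewrite functional_QE// functional_HE; apply: ge0_le_integral => //.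
- by move=> x _; rewrite lee_fin exprn_ge0// mulr_ge0 ?enorm_ge0.
- apply/measurable_EFinP; apply: measurable_funTS; apply: measurable_funX.
  by apply: measurable_funM => //; exact: msgrad.
- apply/measurable_EFinP; apply: measurable_funTS; apply: measurable_funX.
  by apply: measurable_funM => //; exact: msgrad.
- move=> x sx; rewrite lee_fin lerXn2r ?nnegrE ?mulr_ge0 ?enorm_ge0//.
  by rewrite ler_wpM2r ?enorm_ge0// abs_t.
Qed.

Let w_gt0 (z : R) : sn z != 0 -> 0 < w z.
Proof.
move=> s0; rewrite mulr_gt0 ?powR_gt0// exprn_gt0// invr_gt0.
by rewrite lt_neqAle eq_sym s0 sn_ge0.
Qed.

Lemma functional_V_lgpow_gt0 : (0 < functional_V Phi u)%E.
Proof.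
rewrite VuE; apply: (radial_integral_gt0 _ sPhi) => //.
- by apply: measurable_funTS; apply: (measurable_radialR (mwI p)).
- by move=> x _; rewrite mulr_ge0.
- by move=> x _ t0 s0; rewrite mulr_gt0 ?w_gt0// exprn_gt0// normr_gt0.
Qed.

Lemma functional_Q_lgpow_gt0 : (0 < functional_Q Phi u)%E.
Proof.
rewrite QE; apply: (radial_integral_gt0 _ sPhi) => //.
- apply/measurable_EFinP; apply: (@measurable_radial _ _ _ (fun z => `|z| ^+ n * (beta ^+ n * (`|z| ^+ n * w z)))).
  apply: measurable_funM; first exact: measurable_absX.
  by apply: measurable_funM => //; exact: mwI.
- move=> x _; apply: mulr_ge0; first exact: exprn_ge0.
  by apply: mulr_ge0; [exact: exprn_ge0 (ltW beta_gt0)|exact: mulr_ge0].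
- move=> x _ t0 s0; have ? : 0 < `|t x| ^+ n by rewrite exprn_gt0// normr_gt0.
  by rewrite mulr_gt0// mulr_gt0 ?exprn_gt0// mulr_gt0// w_gt0.
Qed.

Lemma functional_Vtilde_lgpow_gt0 : (0 < functional_Vtilde Phi u)%E.
Proof.
rewrite functional_VtildeE//; under eq_integral do rewrite tildeE.
apply: (radial_integral_gt0 _ sPhi) => //.
- apply/measurable_EFinP; apply: (@measurable_radial _ _ _ (fun z => `|z| ^+ p * sn z ^+ 2 * ((sn z)^-1 ^+ n * lg z `^ (- b)))).
  apply: measurable_funM.
    apply: measurable_funM; first exact: measurable_absX.
    by apply: measurable_funX; exact: measurable_sn.
  by apply: measurable_funM; [exact: measurable_inv_sn|exact: measurable_powR_lg].
- move=> x _; apply: mulr_ge0; first by apply: mulr_ge0; [exact: exprn_ge0|exact: sqr_ge0].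
  by apply: mulr_ge0; [exact: inv_sn_ge0|exact: powR_ge0].
- move=> x _ t0 s0; have s1 : 0 < sn (t x) by rewrite lt_neqAle eq_sym s0 sn_ge0.
  apply: mulr_gt0; first by apply: mulr_gt0; apply: exprn_gt0 => //; rewrite normr_gt0.
  by apply: mulr_gt0; [apply: exprn_gt0; rewrite invr_gt0|exact: powR_gt0].
Qed.

Lemma lgpow_nonzero : ~ {ae sigma, forall x, u x = 0}.
Proof.
move=> u0; have := functional_V_lgpow_gt0; rewrite functional_VE//.
rewrite (@ae_eq_integral _ _ _ _ _ (cst 0%E))// ?integral0 ?ltxx//.
- under eq_fun do rewrite UE.
  exact: (measurable_radial _ (mwI p)).
- by apply: filterS u0 => x ux _; rewrite /= ux normr0 mulr0 mul0r expr0n.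
Qed.

Lemma functional_V_le : (functional_V Phi u <= functional_U Phi u)%E.
Proof. by rewrite VuE wI_le. Qed.

End test_function.

(** * The suprema *)

Section ereal_quotients.
Context {R : realType}.

(** An infinite denominator is admissible: its inverse is 0, so the quotient is 0 <= c. *)
Lemma quotient_le (x y : \bar R) (c : R) : (0 <= y)%E -> y != 0%E -> 0 <= c ->
  (x <= c%:E * y)%E -> (x / y <= c%:E)%E.
Proof.
case: y => [y| |]//; last by move=> _ _ c0 _; rewrite invey mule0.
rewrite lee_fin eqe => y0 yn c0 xy.
by rewrite inver (negPf yn) lee_pdivrMr// lt_neqAle eq_sym yn.
Qed.

(** When y = +oo the difference is -oo, even if x is also infinite. *)
Lemma subre_le (x y z : \bar R) : (0 <= y)%E -> (x <= y + z)%E -> (x - y <= z)%E.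
Proof.
case: y => [y| |]// _; last by move=> _; rewrite addeNy leNye.
by rewrite leeBlDl.
Qed.

Lemma EFin_between (x : \bar R) (y : R) : (0 <= x)%E -> (x <= y%:E)%E -> exists2 r, x = r%:E & 0 <= r <= y.
Proof.
case: x => [x| |]//; rewrite !lee_fin => x0 xy.
by exists x => //; rewrite x0.
Qed.

Lemma divEFin (x y : R) : y != 0 -> (x%:E / y%:E)%E = (x / y)%:E.
Proof. by move=> /negPf y0; rewrite inver y0. Qed.

(** Common scheme of the five suprema: the upper bound is given in product form, and the lower bound
    by a function f of the exponent beta that is continuous at g with value c. The number a leaves
    room to restrict to beta close to g. *)
Lemma sup_quotient_eq n (N D : ('rV[R]_n.+1 -> R) -> \bar R) (f : R -> R) (a g c : R) :
  0 <= c -> a < g -> {for g, continuous f} -> f g = c ->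
  (forall u, 0 <= D u)%E -> (forall u, sobolev u -> N u <= c%:E * D u)%E ->
  (forall beta, a < beta -> beta < g -> exists u, [/\ sobolev u,
    ~ {ae surface_measure n, forall x, u x = 0}, D u != 0%E & ((f beta)%:E <= N u / D u)%E]) ->
  sup_quotient N D = c%:E.
Proof.
move=> c0 ag cf fg D0 upper lower; apply/eqP; rewrite eq_le; apply/andP; split.
  apply: ge_ereal_sup => _ [u [su un Du] <-]; apply: quotient_le => //; exact: upper.
(* The shifted index keeps the factor at most 1/2, so that a < beta j < g for every j. *)
pose beta j := g - (g - a) * harmonic j.+1.
have cb : (fun j => (f (beta j))%:E) @ \oo --> c%:E.
  apply: cvg_EFin; first by near=> j.
  rewrite -fg; apply: continuous_cvg => //.
  rewrite -[X in _ --> X]subr0; apply: cvgB; first exact: cvg_cst.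
  rewrite -(mulr0 (g - a)); apply: cvgMr.
  by have := @cvg_harmonic R; rewrite -cvg_shiftS.
rewrite -(cvg_lim _ cb)//; apply: lime_le; first by apply/cvg_ex; exists c%:E.
near=> j.
have h0 : 0 < (harmonic j.+1 : R) by exact: harmonic_gt0.
have h1 : (harmonic j.+1 : R) < 1 by rewrite /harmonic invf_lt1// ltr1n.
have [||u [su un Du le]] := lower (beta j).
- by rewrite /beta; nra.
- by rewrite /beta; nra.
by apply: le_trans le _; apply: ereal_sup_ubound; exists u.
Unshelve. all: by end_near. Qed.

End ereal_quotients.

Section functionals_ge0.
Context {R : realType}.
Variables (p : nat) (Phi : 'rV[R]_p.+3).
Hypothesis sPhi : sphere p.+2 Phi.
Implicit Type u : 'rV[R]_p.+3 -> R.

Let tilde_ge0 k u x : (0 <= (`|u x| ^+ p.+2 * (`|dotv x Phi| ^+ k *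
  sn (dotv x Phi) ^+ p.+2 * (reg 0 (dotv x Phi))^-1 ^+ p.+1))%:E)%E.
Proof.
rewrite lee_fin; apply: mulr_ge0; first exact: exprn_ge0.
apply: mulr_ge0; first by apply: mulr_ge0; apply: exprn_ge0; rewrite ?sn_ge0.
by apply: exprn_ge0; rewrite invr_ge0 reg_ge.
Qed.

Lemma functional_Utilde_ge0 u : (0 <= functional_Utilde Phi u)%E.
Proof. by rewrite functional_UtildeE//; apply: integral_ge0 => x _; exact: tilde_ge0. Qed.

Lemma functional_Vtilde_ge0 u : (0 <= functional_Vtilde Phi u)%E.
Proof. by rewrite functional_VtildeE//; apply: integral_ge0 => x _; exact: tilde_ge0. Qed.

Lemma functional_H_ge0 n (u : 'rV[R]_n.+1 -> R) : (0 <= functional_H u)%E.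
Proof. by apply: integral_ge0 => x _; rewrite lee_fin exprn_ge0// enorm_ge0. Qed.

Lemma functional_Q_ge0 n (Psi : 'rV[R]_n.+1) (v : 'rV[R]_n.+1 -> R) : (0 <= functional_Q Psi v)%E.
Proof. by apply: integral_ge0 => x _; rewrite lee_fin mulr_ge0 ?exprn_ge0// enorm_ge0. Qed.

End functionals_ge0.

Section test_values.
Context {R : realType}.
Variables (p : nat) (Phi : 'rV[R]_p.+3) (beta : R).
Local Notation n := p.+2.
Hypotheses (sPhi : sphere n Phi) (beta_gt0 : 0 < beta) (beta_lt : beta < gamma n).
Let u x := lgpow beta (dotv x Phi).
Let b : R := n%:R * (gamma n - beta).

Lemma test_values_UQ : exists U Ut Q : R,
  [/\ functional_U Phi u = U%:E, functional_Utilde Phi u = Ut%:E, functional_Q Phi u = Q%:E &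
      [/\ 0 < U, 0 <= Ut <= b * U & 0 < Q <= beta ^+ n * U]].
Proof.
have Uoo : (functional_U Phi u < +oo)%E by exact: functional_U_lty.
have V0 : (0 < functional_V Phi u)%E by exact: functional_V_lgpow_gt0.
have VU : (functional_V Phi u <= functional_U Phi u)%E by exact: functional_V_le.
have Ut_le := functional_Utilde_le sPhi beta_lt.
have Q_le := functional_Q_lgpow_le sPhi beta_gt0 beta_lt.
have Q0 := functional_Q_lgpow_gt0 sPhi beta_gt0 beta_lt.
have U0 := lt_le_trans V0 VU.
case: (functional_U Phi u) Uoo U0 Ut_le Q_le {V0 VU} => [U| |]// _ U0.
rewrite -!EFinM => /EFin_between h1 /EFin_between h2.
have [Ut -> Uh] := h1 (functional_Utilde_ge0 sPhi _).
have [Q QE /andP[_ Qh]] := h2 (ltW Q0).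
exists U, Ut, Q; split => //; split => //.
by rewrite Qh andbT -lte_fin -QE.
Qed.

Lemma test_values_VH : exists V Vt : R,
  [/\ functional_V Phi u = V%:E, functional_Vtilde Phi u = Vt%:E,
      functional_H u = (beta ^+ n * V)%:E &
      [/\ 0 < V, 0 < Vt & (n%:R - 1) * Vt <= b * V]].
Proof.
have Uoo : (functional_U Phi u < +oo)%E by exact: functional_U_lty.
have V0 : (0 < functional_V Phi u)%E by exact: functional_V_lgpow_gt0.
have VU : (functional_V Phi u <= functional_U Phi u)%E by exact: functional_V_le.
have Vt_le := functional_Vtilde_le sPhi beta_lt.
have Vt0 : (0 < functional_Vtilde Phi u)%E by exact: functional_Vtilde_lgpow_gt0.
have HV := functional_H_lgpow sPhi beta_gt0 beta_lt.
have Voo := le_lt_trans VU Uoo.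
have n1 : 0 < n%:R - 1 :> R by rewrite subr_gt0 ltr1n.
rewrite -/u in Vt_le Vt0 HV; move: V0 Voo Vt_le Vt0 HV.
case: (functional_V Phi u) => [V| |]// V0 _.
case: (functional_Vtilde Phi u) => [Vt| |]//; last by rewrite gt0_muley.
rewrite -!EFinM !lee_fin !lte_fin => Vh Vt0 HV.
by exists V, Vt.
Qed.

End test_values.

(** * The five suprema *)

Section suprema.
Context {R : realType}.
Variables (p : nat) (Phi : 'rV[R]_p.+3).
Local Notation n := p.+2.
Hypothesis sPhi : sphere n Phi.
Local Notation U := (functional_U Phi).
Local Notation Ut := (functional_Utilde Phi).
Local Notation V := (functional_V Phi).
Local Notation Vt := (functional_Vtilde Phi).
Local Notation H := (@functional_H R n).
Local Notation Q := (functional_Q Phi).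
Let g : R := gamma n.
Let b beta : R := n%:R * (g - beta).

Let n1 : 0 < n%:R - 1 :> R. Proof. by rewrite subr_gt0 ltr1n. Qed.
Let n0 : 0 < n%:R :> R. Proof. by rewrite ltr0n. Qed.
Let g0 : 0 < g. Proof. by rewrite /g /gamma divr_gt0. Qed.
Let gX0 k : 0 < g ^+ k. Proof. by rewrite exprn_gt0. Qed.

Let bg : b g = 0. Proof. by rewrite /b subrr mulr0. Qed.

Let cb : {for g, continuous b}.
Proof.
by apply: catM; [exact: cat_cst|apply: catD; [exact: cat_cst|apply: catN; exact: cvg_id]].
Qed.

Let cX k : {for g, continuous (fun beta : R => beta ^+ k)}.
Proof. by apply: catX; exact: cvg_id. Qed.

Let gV : g ^- p.+1 = g^-1 ^+ p.+1. Proof. by rewrite exprVn. Qed.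

(** Multiplication by g^(n-1) removes the coefficient g^(1-n) of the gradient term, giving the form
    needed for the quotients with a sum in the denominator. *)
Let scale (x y z : \bar R) (c : R) : (0 <= y)%E -> (0 <= z)%E -> 0 <= c ->
  (g%:E * x <= c%:E * y + (g^-1 ^+ p.+1)%:E * z)%E ->
  ((g ^+ n)%:E * x <= z + (c * g ^+ p.+1)%:E * y)%E.
Proof.
move=> y0 z0 c0 /(@lee_wpmul2l _ (g ^+ p.+1)%:E); rewrite lee_fin (ltW (gX0 _)) => /(_ isT).
rewrite ge0_muleDr ?mule_ge0 ?lee_fin// ?exprn_ge0 ?invr_ge0 ?(ltW g0)//.
by rewrite !muleA -!EFinM -exprSr -exprMn mulfV ?gt_eqF// expr1n mul1e addeC [c * _]mulrC.
Qed.

Let boundU u : sobolev u -> ((g ^+ n)%:E * U u <= Q u + (n%:R * g ^+ p.+1)%:E * Ut u)%E.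
Proof.
move=> su; apply: scale; [exact: functional_Utilde_ge0|exact: functional_Q_ge0|exact: ltW|].
exact: functional_U_bound.
Qed.

Let boundV u : sobolev u -> ((g ^+ n)%:E * V u <= H u + ((n%:R - 1) * g ^+ p.+1)%:E * Vt u)%E.
Proof.
move=> su; apply: scale; [exact: functional_Vtilde_ge0|exact: functional_H_ge0|exact: ltW|].
exact: functional_V_bound.
Qed.

Let ler_quot (a d x y : R) : 0 <= a -> 0 < d -> 0 < y -> y <= d * x -> a / d <= a * x / y.
Proof.
move=> a0 d0 y0 yx; rewrite ler_pdivlMr// mulrAC ler_pdivrMr// -mulrA ler_wpM2l//.
by rewrite mulrC.
Qed.

Let b_gt0 beta : beta < g -> 0 < b beta.
Proof. by move=> bg'; rewrite mulr_gt0// subr_gt0. Qed.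

Lemma sup_quotient_UUtilde : sup_quotient (fun u => (g ^+ n)%:E * U u)%E
  (fun u => Q u + (n%:R * g ^+ p.+1)%:E * Ut u)%E = 1%:E.
Proof.
pose c : R := n%:R * g ^+ p.+1; have c0 : 0 < c by exact: mulr_gt0.
have D0 u : (0 <= c%:E * Ut u)%E by rewrite mule_ge0 ?functional_Utilde_ge0// lee_fin ltW.
have gn0 : g ^+ n != 0 by rewrite gt_eqF.
(* At the test function Q <= beta^n U and U~ <= b U, so the denominator is at most (beta^n + c b)
   U. *)
apply: (@sup_quotient_eq _ _ _ _ (fun beta => g ^+ n / (beta ^+ n + c * b beta)) 0 g) => //.
- apply: catM; first exact: cat_cst.
  apply: catV; first by rewrite bg mulr0 addr0.
  by apply: catD; [exact: cX|apply: catM; [exact: cat_cst|exact: cb]].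
- by rewrite bg mulr0 addr0 mulfV.
- by move=> u; rewrite adde_ge0 ?functional_Q_ge0.
- by move=> u su; rewrite mul1e boundU.
move=> beta b0 lt_g; have [U1 [Ut1 [Q1 [UE UtE QE h]]]] := test_values_UQ sPhi b0 lt_g.
have [U0 /andP[Ut0 Uth] /andP[Q0 Qh]] := h.
exists (fun x => lgpow beta (dotv x Phi)); rewrite UE UtE QE -!EFinM -EFinD -/c.
have D1 : 0 < Q1 + c * Ut1 by rewrite ltr_pwDl// mulr_ge0// ltW.
split; [exact: lgpow_sobolev|exact: lgpow_nonzero|by rewrite eqe gt_eqF|].
rewrite divEFin ?gt_eqF// lee_fin; apply: ler_quot => //; first exact: ltW.
  by rewrite ltr_pwDl ?exprn_gt0// mulr_ge0 ?(ltW c0)// ltW// b_gt0.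
by rewrite mulrDl lerD// -mulrA ler_wpM2l// ltW.
Qed.

Lemma sup_quotient_UQ : sup_quotient (fun u => g%:E * U u - n%:R%:E * Ut u)%E Q = (g ^- p.+1)%:E.
Proof.
(* Above this threshold n b = n^2 (g - beta) <= g; the numerator bound is then nonnegative, and
   replacing Q by its upper bound beta^n U decreases the quotient. *)
apply: (@sup_quotient_eq _ _ _ _ (fun beta => (g - n%:R * b beta) / beta ^+ n) (g * (1 - n%:R^-1 ^+ 2)) g) => //.
- by rewrite gV exprn_ge0// invr_ge0 ltW.
- by rewrite gtr_pMr// gtrBl exprn_gt0// invr_gt0.
- apply: catM.
    by apply: catD; [exact: cat_cst|apply: catN; apply: catM; [exact: cat_cst|exact: cb]].
  by apply: catV; [rewrite gt_eqF|exact: cX].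
- by rewrite bg mulr0 subr0 exprS; field; rewrite !gt_eqF.
- by move=> u; exact: functional_Q_ge0.
- move=> u su; apply: subre_le.
    by rewrite mule_ge0 ?functional_Utilde_ge0.
  by rewrite gV; exact: functional_U_bound.
move=> beta ab lt_g.
have nV1 : n%:R^-1 ^+ 2 <= 1 :> R by rewrite exprn_ile1 ?invr_ge0// invf_le1 ?ler1n.
have b0 : 0 < beta by apply: le_lt_trans ab; rewrite mulr_ge0 ?(ltW g0)// subr_ge0.
have bn : n%:R * b beta <= g.
  have : n%:R ^+ 2 * (g * (1 - n%:R^-1 ^+ 2)) <= n%:R ^+ 2 * beta by rewrite ler_pM2l ?exprn_gt0// ltW.
  rewrite (_ : n%:R ^+ 2 * (g * _) = n%:R ^+ 2 * g - g); last by field; rewrite gt_eqF.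
  by rewrite /b expr2; lra.
have [U1 [Ut1 [Q1 [UE UtE QE h]]]] := test_values_UQ sPhi b0 lt_g.
have [U0 /andP[Ut0 Uth] /andP[Q0 Qh]] := h.
exists (fun x => lgpow beta (dotv x Phi)); rewrite UE UtE QE -!EFinM -EFinB.
split; [exact: lgpow_sobolev|exact: lgpow_nonzero|by rewrite eqe gt_eqF|].
rewrite divEFin ?gt_eqF// lee_fin.
apply: (@le_trans _ _ ((g - n%:R * b beta) * U1 / Q1)).
  by apply: ler_quot => //; [rewrite subr_ge0|rewrite exprn_gt0].
rewrite ler_pM2r ?invr_gt0// mulrBl lerD2l lerN2 -mulrA ler_wpM2l// ltW.
Qed.

Lemma sup_quotient_VVtilde : sup_quotient (fun u => (g ^+ n)%:E * V u)%E
  (fun u => H u + ((n%:R - 1) * g ^+ p.+1)%:E * Vt u)%E = 1%:E.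
Proof.
pose c : R := (n%:R - 1) * g ^+ p.+1; have c0 : 0 < c by exact: mulr_gt0.
have D0 u : (0 <= c%:E * Vt u)%E by rewrite mule_ge0 ?functional_Vtilde_ge0// lee_fin ltW.
have gn0 : g ^+ n != 0 by rewrite gt_eqF.
(* The factor n - 1 of c is absorbed by (n-1) V~ <= b V. *)
apply: (@sup_quotient_eq _ _ _ _ (fun beta => g ^+ n / (beta ^+ n + g ^+ p.+1 * b beta)) 0 g) => //.
- apply: catM; first exact: cat_cst.
  apply: catV; first by rewrite bg mulr0 addr0.
  by apply: catD; [exact: cX|apply: catM; [exact: cat_cst|exact: cb]].
- by rewrite bg mulr0 addr0 mulfV.
- by move=> u; rewrite adde_ge0 ?functional_H_ge0.
- by move=> u su; rewrite mul1e boundV.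
move=> beta b0 lt_g; have [V1 [Vt1 [VE VtE HE [V0 Vt0 Vh]]]] := test_values_VH sPhi b0 lt_g.
exists (fun x => lgpow beta (dotv x Phi)); rewrite VE VtE HE -!EFinM -EFinD -/c.
have D1 : 0 < beta ^+ n * V1 + c * Vt1 by rewrite addr_gt0// mulr_gt0// exprn_gt0.
split; [exact: lgpow_sobolev|exact: lgpow_nonzero|by rewrite eqe gt_eqF|].
rewrite divEFin ?gt_eqF// lee_fin; apply: ler_quot => //; first exact: ltW.
  by rewrite ltr_pwDl ?exprn_gt0// mulr_ge0 ?(ltW (gX0 _))// ltW// b_gt0.
by rewrite mulrDl lerD2l /c mulrAC mulrC -mulrA ler_pM2l.
Qed.

Lemma sup_quotient_VH : sup_quotient (fun u => g%:E * V u - (n%:R - 1)%:E * Vt u)%E H = (g ^- p.+1)%:E.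
Proof.
apply: (@sup_quotient_eq _ _ _ _ (fun beta => (g - b beta) / beta ^+ n) 0 g) => //.
- by rewrite gV exprn_ge0// invr_ge0 ltW.
- apply: catM; first by apply: catD; [exact: cat_cst|apply: catN; exact: cb].
  by apply: catV; [rewrite gt_eqF|exact: cX].
- by rewrite bg subr0 exprS; field; rewrite !gt_eqF.
- by move=> u; exact: functional_H_ge0.
- move=> u su; apply: subre_le.
    by rewrite mule_ge0 ?functional_Vtilde_ge0// lee_fin ltW.
  by rewrite gV; exact: functional_V_bound.
move=> beta b0 lt_g; have [V1 [Vt1 [VE VtE HE [V0 Vt0 Vh]]]] := test_values_VH sPhi b0 lt_g.
have D1 : 0 < beta ^+ n * V1 by rewrite mulr_gt0// exprn_gt0.
exists (fun x => lgpow beta (dotv x Phi)); rewrite VE VtE HE -!EFinM -EFinB.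
split; [exact: lgpow_sobolev|exact: lgpow_nonzero|by rewrite eqe gt_eqF|].
rewrite divEFin ?gt_eqF// lee_fin ler_pdivlMr// mulrA divfK ?gt_eqF ?exprn_gt0//.
by rewrite mulrBl lerD2l lerN2.
Qed.

Lemma sup_quotient_VVtildeH : sup_quotient (fun u => (g ^+ n)%:E * V u - H u)%E Vt =
  ((n%:R - 1) * g ^+ p.+1)%:E.
Proof.
(* The bound obtained from H = beta^n V and (n-1) V~ <= b V is (n-1)(g^n - beta^n)/b. The factor g -
   beta, common to numerator and b, is cancelled here so that the expression is continuous at beta =
   g. *)
apply: (@sup_quotient_eq _ _ _ _ (fun beta => (n%:R - 1) / n%:R * \sum_(i < n) g ^+ (p.+1 - i) * beta ^+ i) 0 g) => //.
- by rewrite mulr_ge0 ?ltW.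
- apply: catM; first exact: cat_cst.
  by apply: cat_sum => i; apply: catM; [exact: cat_cst|exact: cX].
- under eq_bigr => i _ do rewrite -exprD subnK -1?ltnS ?ltn_ord//.
  by rewrite sumr_const card_ord -[X in _ * X]mulr_natl mulrA divfK// gt_eqF.
- by move=> u; exact: functional_Vtilde_ge0.
- move=> u su; apply: subre_le; first exact: functional_H_ge0.
  exact: boundV.
move=> beta b0 lt_g; have [V1 [Vt1 [VE VtE HE [V0 Vt0 Vh]]]] := test_values_VH sPhi b0 lt_g.
exists (fun x => lgpow beta (dotv x Phi)); rewrite VE VtE HE -!EFinM -EFinB.
split; [exact: lgpow_sobolev|exact: lgpow_nonzero|by rewrite eqe gt_eqF|].
rewrite divEFin ?gt_eqF// lee_fin -mulrBl.
have gb : g - beta != 0 by rewrite subr_eq0 gt_eqF.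
have -> : (n%:R - 1) / n%:R * (\sum_(i < n) g ^+ (p.+1 - i) * beta ^+ i) =
    (g ^+ n - beta ^+ n) / (b beta / (n%:R - 1)).
  by rewrite subrXX /b; field; rewrite gb !gt_eqF.
apply: ler_quot => //.
- by rewrite subr_ge0 lerXn2r ?nnegrE ?(ltW b0) ?(ltW g0)// ltW.
- by rewrite divr_gt0// b_gt0.
- by rewrite mulrAC ler_pdivlMr// mulrC.
Qed.

End suprema.

Local Open Scope ereal_scope.

Theorem theorem9 (R : realType) (n : nat) (Phi : 'rV[R]_n.+1)
    (n_ge2 : (2 <= n)%N) (Phi_sphere : sphere n Phi) :
  let g : R := gamma n in
  let U := functional_U Phi in
  let Ut := functional_Utilde Phi in
  let V := functional_V Phi in
  let Vt := functional_Vtilde Phi in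
  let H := functional_H (R := R) (n := n) in
  let Q := functional_Q Phi in
  [/\ sup_quotient (fun u => (g ^+ n)%:E * U u)
        (fun u => Q u + (n%:R * g ^+ (n - 1))%:E * Ut u) = 1,
      sup_quotient (fun u => g%:E * U u - n%:R%:E * Ut u) Q =
        (g ^- (n - 1))%:E,
      sup_quotient (fun u => (g ^+ n)%:E * V u)
        (fun u => H u + ((n%:R - 1) * g ^+ (n - 1))%:E * Vt u) = 1,
      sup_quotient (fun u => g%:E * V u - (n%:R - 1)%:E * Vt u) H =
        (g ^- (n - 1))%:E &
      sup_quotient (fun u => (g ^+ n)%:E * V u - H u) Vt =
        ((n%:R - 1) * g ^+ (n - 1))%:E].
Proof.
case: n Phi n_ge2 Phi_sphere => [|[|p]]// Phi _ sPhi g U Ut V Vt H Q.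
rewrite subSS subn0; split.
- exact: sup_quotient_UUtilde.
- exact: sup_quotient_UQ.
- exact: sup_quotient_VVtilde.
- exact: sup_quotient_VH.
- exact: sup_quotient_VVtildeH.
Qed.
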